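(* For every $\tau\in\mathbb H$, $$\Phi\left(-\frac1{31\tau}\right)=\Phi(\tau).$$ The cube $\Phi^3$ is a modular function on $\Gamma_0(31)$ and is the normalized Hauptmodul on $\Gamma_0(31)^+$, with expansion $$\Phi^3=q^{-1}+3q+3q^2+6q^3+9q^4+13q^5+O(q^6).$$
   Context: Here $\mathbb H=\{z\in\mathbb C:\operatorname{Im}z>0\}$, $q=e^{2\pi i\tau}$, $\eta(\tau)=e^{2\pi i\tau/24}\prod_{j\ge1}(1-q^j)$, and $$\Theta_{a,b,c}(\tau)=\sum_{u,v\in\mathbb Z}q^{au^2+buv+cv^2},\quad f_{31}=\frac{\Theta_{1,1,8}-\Theta_{2,1,4}}2,\quad \Phi(\tau)=\frac{f_{31}(\tau)}{\eta(\tau)\eta(31\tau)}.$$ $\Gamma_0(31)^+$ is the group generated by $\Gamma_0(31)$ and the Fricke involution $\tau\mapsto-1/(31\tau)$, acting on $\mathbb H$. The normalized Hauptmodul is a generator of the field of modular functions of the (genus-zero) quotient, holomorphic on $\mathbb H$, with a simple pole at the cusp $\infty$ and expansion $q^{-1}+O(q)$ (zero constant term). *)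

(* Defs.v *)
From HB Require Import structures.
From mathcomp Require Import all_boot all_order all_algebra.
From mathcomp Require Import complex.
From mathcomp Require Import all_classical all_reals all_analysis.
From mathcomp Require Import showcase.summability.

Set Implicit Arguments.
Unset Strict Implicit.
Unset Printing Implicit Defensive.

Import Order.TTheory GRing.Theory Num.Theory numFieldNormedType.Exports.

Local Open Scope classical_set_scope.
Local Open Scope ring_scope.
Local Open Scope complex_scope.

(* The topology and the normed structure used on R[i] are those carried by its
   alias R[i]^o, so that derivability below is complex derivability. *)
Notation Cplx R := ((R[i])%type^o).

Section Functions.
Variable R : realType.
Local Notation C := (Cplx R).

Definition upper : set C := [set z | 0 < complex.Im z].

Definition cexp (z : C) : C :=
  let: x +i* y := z in (expR x * cos y) +i* (expR x * sin y).

Definition e2pi (z : C) : C := cexp ((0 +i* (2%:R * pi)) * z).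

Definition nome (tau : C) : C := e2pi tau.

Definition eta (tau : C) : C :=
  e2pi (tau / 24%:R) *
  lim ((fun n : nat => \prod_(1 <= j < n.+1) (1 - nome tau ^+ j) : C) @ \oo).

(* [summability.sum] is the unordered sum, i.e. the limit of the sums over the
   finite subsets of the index type, here Z x Z. *)
Definition Theta (a b c : int) (tau : C) : C :=
  @summability.sum (int * int)%type R[i] C
    (fun uv => nome tau ^ (a * uv.1 ^+ 2 + b * uv.1 * uv.2 + c * uv.2 ^+ 2)).

Definition f31 (tau : C) : C := (Theta 1 1 8 tau - Theta 2 1 4 tau) / 2%:R.

Definition Phi (tau : C) : C := f31 tau / (eta tau * eta (31%:R * tau)).

End Functions.

Section Meromorphic.
Variable R : realType.
Local Notation C := (Cplx R).

Definition holomorphic_at (f : C -> C) (z0 : C) : Prop :=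
  \forall z \near z0, derivable f z 1.

(* A meromorphic function is represented by a total function whose values on
   the (discrete) set of its poles are irrelevant. *)
Definition meromorphic_at (f : C -> C) (z0 : C) : Prop :=
  exists (n : nat) (g : C -> C),
    holomorphic_at g z0 /\ \forall z \near z0^', f z = g z / (z - z0) ^+ n.

(* Equality as meromorphic functions on the upper half-plane: f and g agree
   off a subset with no accumulation point in the half-plane. *)
Definition meromorphic_eq (f g : C -> C) : Prop :=
  forall z0, upper z0 -> \forall z \near z0^', f z = g z.

End Meromorphic.

Section Groups.
Variable R : realType.
Local Notation C := (Cplx R).

Definition mobius (A : 'M[R]_2) (z : C) : C :=
  ((A 0 0)%:C * z + (A 0 1)%:C) / ((A 1 0)%:C * z + (A 1 1)%:C).

Definition SL2Z : set 'M[R]_2 :=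
  [set map_mx intr A | A in [set A : 'M[int]_2 | \det A = 1]].

Definition Gamma0 (N : nat) : set 'M[R]_2 :=
  [set map_mx intr A | A in
    [set A : 'M[int]_2 | \det A = 1 /\ (N%:Z %| A 1%R 0%R)%Z]].

(* The matrix with rows (0, -1) and (N, 0). *)
Definition fricke_mx (N : nat) : 'M[R]_2 :=
  N%:R *: delta_mx 1 0 - delta_mx 0 1.

Definition GL2pos_subgroup (G : set 'M[R]_2) : Prop :=
  [/\ forall A, G A -> 0 < \det A,
      G 1%:M,
      forall A B, G A -> G B -> G (A *m B) &
      forall A, G A -> G (invmx A)].

(* Taken inside GL_2^+(R) rather than modulo scalars; scalar matrices act
   trivially on the upper half-plane. *)
Definition Gamma0plus (N : nat) : set 'M[R]_2 :=
  smallest GL2pos_subgroup (Gamma0 N `|` [set fricke_mx N]).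

End Groups.

Section ModularFunctions.
Variable R : realType.
Local Notation C := (Cplx R).

(* For every alpha in SL_2(Z), f o alpha is a function of exp(2 i pi tau / h)
   which is meromorphic at 0; as alpha varies, alpha(oo) runs over all cusps
   of a group commensurable with SL_2(Z). *)
Definition meromorphic_at_cusps (f : C -> C) : Prop :=
  forall alpha, SL2Z alpha ->
  exists (h : nat) (g : C -> C) (y : R),
    [/\ (0 < h)%N, meromorphic_at g 0 &
        forall tau : C, 0 < complex.Im tau -> y < complex.Im tau ->
          f (mobius alpha tau) = g (e2pi (tau / h%:R))].

Definition modular_function (G : set 'M[R]_2) (f : C -> C) : Prop :=
  [/\ forall z, upper z -> meromorphic_at f z,
      forall A z, G A -> upper z -> f (mobius A z) = f z &
      meromorphic_at_cusps f].

(* f = p(q) + O(q^n), where O(q^n) is q^n times a convergent power series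
   in q. *)
Definition q_expansion (f p : C -> C) (n : nat) : Prop :=
  exists (g : C -> C) (y : R), holomorphic_at g 0 /\
    forall tau : C, 0 < complex.Im tau -> y < complex.Im tau ->
      f tau = p (nome tau) + nome tau ^+ n * g (nome tau).

Definition rational_function_of (t f : C -> C) : Prop :=
  exists p q : {poly C},
    q != 0 /\ meromorphic_eq f (fun z => p.[t z] / q.[t z]).

Definition normalized_hauptmodul (G : set 'M[R]_2) (t : C -> C) : Prop :=
  [/\ modular_function G t,
      forall f, modular_function G f -> rational_function_of t f,
      forall z, upper z -> holomorphic_at t z &
      q_expansion t (fun q => q^-1) 1].

End ModularFunctions.

(* Main.v *)
(* The theta series in [f31] and the pentagonal series for [eta] are combinations of the functions
   th_N,r(t) = sum over s = r mod 2N of e(t s^2 / 4N), evaluated at t and 31 t. Poisson summation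
   for the one-variable theta function gives their transformation under t -> - 1 / (31 t), and,
   after splitting sums modulo 31, under matrices with lower left entry 31. All multipliers cancel
   in [Phi] except for a sign in the numerator, the quotient of two Gauss sums modulo 31 (26 and 21
   are nonresidues), and a sign in the denominator, the value of the character modulo 12 at 7; both
   signs are -1.
   Only translations multiply [Phi] by a cube root of unity, so the cube is invariant under
   Gamma0(31), by descent on the lower left entry, and under the Fricke involution; the cosets of
   Gamma0(31) in SL2(Z) reduce every cusp to the expansion at infinity.
   Conversely, let f be a modular function for the extended group and t = Phi^3. Finitely many
   factors t - t(z_i) clear the poles of f; subtracting a polynomial in t removes the growth at the
   cusp, and what remains tends to 0 there, hence vanishes by the Schwarz lemma in q, since every
   orbit meets the half-plane Im z >= 1/62. The complex analysis rests on Fourier expansions of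
   periodic holomorphic functions, obtained from Goursat's lemma. *)
Require Import Defs.
From mathcomp Require Import all_boot all_order all_algebra.
From mathcomp Require Import complex.
From mathcomp Require Import all_classical all_reals all_analysis.
From mathcomp Require Import ring lra zify.
From mathcomp Require Import finmap.
Set Implicit Arguments.
Unset Strict Implicit.
Unset Printing Implicit Defensive.
Import Order.TTheory GRing.Theory Num.Theory numFieldNormedType.Exports.
Local Open Scope classical_set_scope.
Local Open Scope ring_scope.
Local Open Scope complex_scope.

(** * Complex differentiability in terms of a real-valued norm *)

Section Norm.
Variable R : realType.
Local Notation C := (Cplx R).
Implicit Types (x y z : C) (u v : nat -> C).

(** The obstacle is the multipliers, and they are handled by comparison. The inversion factor [J] is
    controlled by the law $J(\lambda w)\sqrt\lambda=J(w)$ for real $\lambda>0$ ([J_scale]), so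
    numerator and denominator of [Phi] acquire the same quotient [Jratio]. The rational translations
    in [Phi_A] are multiples of $24/31$: since 24 is a common multiple of the periods $4N$ for
    $N=1,2,6$, the factors at $31\tau$ do not see them, and only the factors at $\tau$ produce a
    Gauss sum, the same one above and below up to sign. One analytic device serves for everything
    local: composing with $x\mapsto z_0+re(x)$ turns a punctured disc into the upper half-plane and
    a function on it into one of period 1, so Taylor remainders, removable singularities and
    isolated zeros are read off Fourier coefficients. Compactness enters by bisection of a square
    ([cousin2]), for uniform continuity, for Goursat and for the truncated strip that meets all
    orbits below the cusp. The norm is real-valued because that of [R[i]] takes its values in [R[i]]
    itself. *)

Definition nrm (z : C) : R := Num.sqrt (complex.Re z ^+ 2 + complex.Im z ^+ 2).

Lemma normr_nrm z : `|z| = (nrm z)%:C.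
Proof. by case: z. Qed.

Lemma nrm_ge0 z : 0 <= nrm z.
Proof. exact: sqrtr_ge0. Qed.

Lemma nrmM x y : nrm (x * y) = nrm x * nrm y.
Proof. by apply: complexI; rewrite rmorphM /= -!normr_nrm normrM. Qed.

Lemma nrmD x y : nrm (x + y) <= nrm x + nrm y.
Proof. by rewrite -lecR rmorphD /= -!normr_nrm ler_normD. Qed.

Lemma nrmN x : nrm (- x) = nrm x.
Proof. by apply: complexI; rewrite -!normr_nrm normrN. Qed.

Lemma nrmB x y : nrm (x - y) <= nrm x + nrm y.
Proof. by rewrite -(nrmN y) nrmD. Qed.

Lemma nrmC x y : nrm (x - y) = nrm (y - x).
Proof. by rewrite -nrmN opprB. Qed.

Lemma nrm0 : nrm 0 = 0.
Proof. by apply: complexI; rewrite -normr_nrm normr0. Qed.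

Lemma nrm1 : nrm 1 = 1.
Proof. by apply: complexI; rewrite -normr_nrm normr1. Qed.

Lemma nrm_eq0 x : (nrm x == 0) = (x == 0).
Proof. by rewrite -(inj_eq (@complexI R)) -normr_nrm normr_eq0. Qed.

Lemma nrm_gt0 x : (0 < nrm x) = (x != 0).
Proof. by rewrite lt_def nrm_eq0 nrm_ge0 andbT. Qed.

Lemma nrmV x : nrm x^-1 = (nrm x)^-1.
Proof. by apply: complexI; rewrite -normr_nrm normfV fmorphV /= normr_nrm. Qed.

Lemma nrmX x n : nrm (x ^+ n) = nrm x ^+ n.
Proof. by elim: n => [|n IH]; rewrite ?expr0 ?nrm1 // !exprS nrmM IH. Qed.

Lemma nrm_real (a : R) : nrm a%:C = `|a|.
Proof. by rewrite /nrm /= expr0n addr0 sqrtr_sqr. Qed.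

Lemma nrm_sum (I : Type) (r : seq I) (P : pred I) (F : I -> C) :
  nrm (\sum_(i <- r | P i) F i) <= \sum_(i <- r | P i) nrm (F i).
Proof.
elim/big_rec2: _ => [|i a b _ h]; first by rewrite nrm0.
by apply: (le_trans (nrmD _ _)); rewrite lerD2l.
Qed.

Lemma ler_Re_nrm z : `|complex.Re z| <= nrm z.
Proof. by rewrite -sqrtr_sqr ler_wsqrtr // lerDl sqr_ge0. Qed.

Lemma ler_Im_nrm z : `|complex.Im z| <= nrm z.
Proof. by rewrite -sqrtr_sqr ler_wsqrtr // lerDr sqr_ge0. Qed.

Lemma ler_nrm_ReIm z : nrm z <= `|complex.Re z| + `|complex.Im z|.
Proof.
case: z => a b; rewrite /nrm /= -[leRHS]ger0_norm ?addr_ge0 // -sqrtr_sqr.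
rewrite ler_wsqrtr // sqrrD !real_normK ?num_real // -addrA addrCA.
by rewrite lerDr mulrn_wge0 // mulr_ge0.
Qed.

Lemma ler_nrmBB x y : nrm x - nrm y <= nrm (x - y).
Proof. by rewrite lerBlDr (le_trans _ (nrmD _ _)) // subrK. Qed.

Lemma eq_nrm x y : (forall e : R, 0 < e -> nrm (x - y) <= e) -> x = y.
Proof.
move=> h; apply/eqP; rewrite -subr_eq0 -nrm_eq0 eq_le nrm_ge0 andbT.
by apply/ler_addgt0Pr => e e0; rewrite add0r h.
Qed.

Lemma nbhsC (z0 : C) (P : set C) :
  nbhs z0 P <-> exists2 r : R, 0 < r & forall z, nrm (z - z0) < r -> P z.
Proof.
split.
  (* The radius lives in [R[i]], where positivity forces a zero imaginary part. *)
  move=> /nbhs_ballP[[e f] /= e0 h]; move: e0; rewrite ltcE /= => /andP[/eqP f0 e0].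
  subst f; exists e => // z hz; apply: h => /=.
  rewrite -ball_normE /ball_ /= normr_nrm ltcR; by rewrite nrmC.
move=> [r r0 h]; apply/nbhs_ballP; exists r%:C; first by rewrite /= ltcR.
by move=> z; rewrite -ball_normE /ball_ /= normr_nrm ltcR nrmC; exact: h.
Qed.

Lemma dnbhsC (z0 : C) (P : set C) :
  z0^' P <-> exists2 r : R, 0 < r & forall z, z != z0 -> nrm (z - z0) < r -> P z.
Proof.
split.
  by move=> /nbhsC[r r0 h]; exists r => // z z1 z2; exact: h.
by move=> [r r0 h]; apply/nbhsC; exists r => // z z1 z2; exact: h.
Qed.

(** The derivative as a linear approximation: the non-strict bound includes [w = z], so the rules
    for products and compositions involve no division and no excluded point. *)
Definition cdiff (f : C -> C) (z l : C) : Prop :=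
  forall e : R, 0 < e -> exists2 d : R, 0 < d &
    forall w, nrm (w - z) < d -> nrm (f w - f z - l * (w - z)) <= e * nrm (w - z).

Definition cdiffb (f : C -> C) (z : C) : Prop := exists l, cdiff f z l.

Lemma derivable_cdiff f z : derivable f z 1 <-> cdiffb f z.
Proof.
rewrite /derivable; split.
  move=> /cvg_ex[l hl]; exists l => e e0.
  have hb : nbhs l (ball l e%:C) by apply/nbhs_ballP; exists e%:C => //=; rewrite ltcR.
  have /nbhs_ballP[[d d'] /= d0 hd] := hl _ hb; move: d0.
  rewrite ltcE /= => /andP[/eqP d'0 d0]; subst d'.
  exists d => // w hw.
  have [->|wz] := eqVneq w z.
    by rewrite !subrr mulr0 subrr nrm0 mulr0.
  have wz0 : w - z != 0 by rewrite subr_eq0.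
  have /(_ _ wz0) := hd (w - z); rewrite /ball /=.
  rewrite sub0r normrN normr_nrm ltcR => /(_ hw).
  rewrite normr_nrm ltcR => hh.
  have -> : f w - f z - l * (w - z) = - ((l - (w - z)^-1 *: (f ((w - z) *: (1 : C) + z) - f z)) * (w - z)).
    have -> : (w - z) *: (1 : C) + z = w.
      by rewrite /GRing.scale /= mulr1 subrK.
    rewrite /GRing.scale /=; field; exact: wz0.
  by rewrite nrmN nrmM ler_wpM2r ?nrm_ge0 // ltW.
move=> [l hl]; apply/cvg_ex; exists l.
move=> P /nbhs_ballP[[e e'] /=]; rewrite ltcE /= => /andP[/eqP e'0 e0] hP.
subst e'.
have e20 : 0 < e / 2 by rewrite divr_gt0.
have [d d0 hd] := hl _ e20.
apply/nbhs_ballP; exists d%:C; first by rewrite /= ltcR.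
move=> h; rewrite -ball_normE /ball_ /= sub0r normrN normr_nrm ltcR => hh h0.
apply: hP; rewrite -ball_normE /ball_ /= normr_nrm ltcR.
have := hd (h + z); rewrite addrK => /(_ hh).
have -> : h *: (1 : C) + z = h + z by rewrite /GRing.scale /= mulr1.
move=> {}hd.
have -> : l - h^-1 *: (f (h + z) - f z) = - ((f (h + z) - f z - l * h) * h^-1).
  rewrite /GRing.scale /=; field; exact: h0.
rewrite nrmN nrmM nrmV.
have h1 : 0 < nrm h by rewrite nrm_gt0.
rewrite ltr_pdivrMr // (le_lt_trans hd) // ltr_pM2r //.
lra.
Qed.

Lemma cdiff_ext (f g : C -> C) z l (r : R) : 0 < r ->
  (forall w, nrm (w - z) < r -> f w = g w) -> cdiff f z l -> cdiff g z l.
Proof.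
move=> r0 fg hf e e0; have [d d0 hd] := hf _ e0.
exists (Num.min d r); first by rewrite lt_min d0.
move=> w; rewrite lt_min => /andP[h1 h2]; rewrite -!fg ?hd // subrr nrm0 //.
Qed.

Lemma cdiffb_ext (f g : C -> C) z (r : R) : 0 < r ->
  (forall w, nrm (w - z) < r -> f w = g w) -> cdiffb f z -> cdiffb g z.
Proof. by move=> r0 fg [l hl]; exists l; exact: (cdiff_ext r0 fg hl). Qed.

Lemma cdiff_lip f z l : cdiff f z l -> exists2 d : R, 0 < d &
   forall w, nrm (w - z) < d -> nrm (f w - f z) <= (nrm l + 1) * nrm (w - z).
Proof.
move=> hf; have [d d0 hd] := hf 1 ltr01; exists d => // w /hd h.
have -> : f w - f z = (f w - f z - l * (w - z)) + l * (w - z) by ring.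
apply: (le_trans (nrmD _ _)); rewrite nrmM; lra.
Qed.

Definition ccont (f : C -> C) (z : C) : Prop :=
  forall e : R, 0 < e -> exists2 d : R, 0 < d &
    forall w, nrm (w - z) < d -> nrm (f w - f z) < e.

Lemma cdiffb_ccont f z : cdiffb f z -> ccont f z.
Proof.
move=> [l /cdiff_lip[d d0 hd]] e e0.
have l0 : 0 < nrm l + 1 by rewrite ltr_wpDl ?nrm_ge0.
exists (Num.min d (e / (nrm l + 1))); first by rewrite lt_min d0 divr_gt0.
move=> w; rewrite lt_min ltr_pdivlMr // => /andP[/hd h1 h2].
by apply: (le_lt_trans h1); rewrite mulrC.
Qed.

Lemma cdiff_cst (c : C) z : cdiff (fun=> c) z 0.
Proof.
move=> e e0; exists 1 => // w _; rewrite subrr mul0r subrr nrm0.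
by rewrite mulr_ge0 ?nrm_ge0 // ltW.
Qed.

Lemma cdiff_id z : cdiff id z 1.
Proof.
move=> e e0; exists 1 => // w _; rewrite mul1r subrr nrm0.
by rewrite mulr_ge0 ?nrm_ge0 // ltW.
Qed.

Lemma cdiffD f g z l m : cdiff f z l -> cdiff g z m ->
  cdiff (fun w => f w + g w) z (l + m).
Proof.
move=> hf hg e e0; have e20 : 0 < e / 2 by lra.
have [d d0 hd] := hf _ e20; have [d' d'0 hd'] := hg _ e20.
exists (Num.min d d'); first by rewrite lt_min d0.
move=> w; rewrite lt_min => /andP[/hd h1 /hd' h2].
have -> : f w + g w - (f z + g z) - (l + m) * (w - z) =
  (f w - f z - l * (w - z)) + (g w - g z - m * (w - z)) by ring.
apply: (le_trans (nrmD _ _)); lra.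
Qed.

Lemma cdiffM f g z l m : cdiff f z l -> cdiff g z m ->
  cdiff (fun w => f w * g w) z (l * g z + f z * m).
Proof.
move=> hf hg e e0.
have [dg dg0 hdg] := cdiff_lip hg.
have [df df0 hdf] := cdiff_lip hf.
(* One multiple of [e / K] for each of the three errors below, with weights [nrm (g z)], [nrm (f z)]
   and the product of the two Lipschitz constants. *)
pose K := nrm (f z) + nrm (g z) + (nrm l + 1) * (nrm m + 1) + 1.
have p1 : 0 <= (nrm l + 1) * (nrm m + 1) by rewrite mulr_ge0 // addr_ge0 ?nrm_ge0.
have nf := nrm_ge0 (f z); have ng := nrm_ge0 (g z).
have K0 : 0 < K by rewrite /K; lra.
have eK : 0 < e / K by rewrite divr_gt0.
have [d1 d10 h1] := hf _ eK; have [d2 d20 h2] := hg _ eK.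
exists (Num.min (Num.min df dg) (Num.min (Num.min d1 d2) (e / K))).
  by rewrite !lt_min df0 dg0 d10 d20 eK.
move=> w; rewrite !lt_min => /andP[/andP[/hdf a1 /hdg a2] /andP[/andP[/h1 a3 /h2 a4] a5]].
have -> : f w * g w - f z * g z - (l * g z + f z * m) * (w - z) =
   (f w - f z - l * (w - z)) * g z + f z * (g w - g z - m * (w - z))
   + (f w - f z) * (g w - g z) by ring.
apply: (le_trans (nrmD _ _)).
apply: (le_trans (lerD (nrmD _ _) (lexx _))).
rewrite !nrmM.
set t := nrm (w - z) in a1 a2 a3 a4 a5 *.
have t0 : 0 <= t := nrm_ge0 _.
have b1 : nrm (f w - f z - l * (w - z)) * nrm (g z) <= (e / K * t) * nrm (g z).
  exact: ler_wpM2r.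
have b2 : nrm (f z) * nrm (g w - g z - m * (w - z)) <= nrm (f z) * (e / K * t).
  exact: ler_wpM2l.
have b3 : nrm (f w - f z) * nrm (g w - g z) <= ((nrm l + 1) * t) * ((nrm m + 1) * t).
  by rewrite ler_pM ?nrm_ge0.
have b4 : ((nrm l + 1) * t) * ((nrm m + 1) * t) <= (nrm l + 1) * (nrm m + 1) * (e / K * t).
  rewrite (_ : _ * _ = (nrm l + 1) * (nrm m + 1) * (t * t)); last by ring.
  by rewrite ler_wpM2l // ler_wpM2r // ltW.
have -> : e * t = K * (e / K * t) by field; rewrite gt_eqF.
have b5 : 0 <= e / K * t by rewrite mulr_ge0 // ltW.
move: (e / K * t) b1 b2 b4 b5 => X b1 b2 b4 b5.
rewrite /K in b1 b2 b4 b5 *; lra.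
Qed.

Lemma cdiff_comp f g z l m : cdiff f z l -> cdiff g (f z) m ->
  cdiff (fun w => g (f w)) z (m * l).
Proof.
move=> hf hg e e0.
have [df df0 hdf] := cdiff_lip hf.
pose K := nrm l + 1; have K0 : 0 < K by rewrite ltr_wpDl ?nrm_ge0.
pose M := nrm m + 1; have M0 : 0 < M by rewrite ltr_wpDl ?nrm_ge0.
have e1 : 0 < e / 2 / M by rewrite !divr_gt0.
have e2 : 0 < e / 2 / K by rewrite !divr_gt0.
have [d1 d10 h1] := hf _ e1; have [d2 d20 h2] := hg _ e2.
exists (Num.min (Num.min df d1) (d2 / K)); first by rewrite !lt_min df0 d10 divr_gt0.
move=> w; rewrite !lt_min ltr_pdivlMr // => /andP[/andP[/hdf a1 /h1 a2] a3].
have {}a3 : nrm (f w - f z) < d2 by apply: (le_lt_trans a1); rewrite mulrC.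
have a4 := h2 _ a3.
have -> : g (f w) - g (f z) - m * l * (w - z) =
  (g (f w) - g (f z) - m * (f w - f z)) + m * (f w - f z - l * (w - z)) by ring.
apply: (le_trans (nrmD _ _)); rewrite nrmM.
set t := nrm (w - z) in a1 a2 *.
have t0 : 0 <= t := nrm_ge0 _.
have b1 : nrm (g (f w) - g (f z) - m * (f w - f z)) <= e / 2 * t.
  apply: (le_trans a4); apply: (@le_trans _ _ (e / 2 / K * (K * t))).
    by rewrite ler_wpM2l // ltW.
  by rewrite mulrA divfK // gt_eqF.
have b2 : nrm m * nrm (f w - f z - l * (w - z)) <= e / 2 * t.
  apply: (@le_trans _ _ (M * (e / 2 / M * t))).
    by apply: ler_pM => //; rewrite ?nrm_ge0 // /M lerDl.
  by rewrite le_eqVlt; apply/orP; left; apply/eqP; field; rewrite gt_eqF.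
lra.
Qed.

Lemma cdiff_inv z : z != 0 -> cdiff (fun w => w^-1) z (- z^-2).
Proof.
move=> z0 e e0; have nz : 0 < nrm z by rewrite nrm_gt0.
exists (Num.min (nrm z / 2) (e * nrm z ^+ 3 / 2)).
  by rewrite lt_min !divr_gt0 // mulr_gt0 // exprn_gt0.
move=> w; rewrite lt_min => /andP[h1 h2].
have nw : nrm z / 2 < nrm w.
  have := ler_nrmBB z w; rewrite nrmC; lra.
have w0 : w != 0 by rewrite -nrm_gt0; lra.
have -> : w^-1 - z^-1 - (- z^-2) * (w - z) = (w - z) ^+ 2 / (w * z ^+ 2).
  by field; rewrite z0 w0.
rewrite nrmM nrmX nrmV nrmM nrmX expr2.
rewrite -mulrA mulrC ler_wpM2r ?nrm_ge0 //.
rewrite ler_pdivrMr ?mulr_gt0 ?exprn_gt0 //; last by lra.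
apply: (le_trans (ltW h2)).
rewrite -!mulrA ler_wpM2l ?(ltW e0) // exprS [_ / 2]mulrC mulrA.
have := ltW nw; nra.
Qed.

Lemma cdiffb_cst (c : C) z : cdiffb (fun=> c) z.
Proof. exists 0; exact: cdiff_cst. Qed.
Lemma cdiffb_id z : cdiffb id z.
Proof. exists 1; exact: cdiff_id. Qed.
Lemma cdiffbD f g z : cdiffb f z -> cdiffb g z -> cdiffb (fun w => f w + g w) z.
Proof. by move=> [l hl] [m hm]; exists (l + m); exact: cdiffD. Qed.
Lemma cdiffbM f g z : cdiffb f z -> cdiffb g z -> cdiffb (fun w => f w * g w) z.
Proof. by move=> [l hl] [m hm]; eexists; apply: cdiffM hl hm. Qed.
Lemma cdiffb_comp f g z : cdiffb f z -> cdiffb g (f z) -> cdiffb (fun w => g (f w)) z.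
Proof. by move=> [l hl] [m hm]; eexists; apply: cdiff_comp hl hm. Qed.
Lemma cdiffbN f z : cdiffb f z -> cdiffb (fun w => - f w) z.
Proof.
move=> h; apply: (@cdiffb_ext (fun w => (-1) * f w) _ _ 1) => //.
  by move=> w _; rewrite mulN1r.
apply: cdiffbM => //; exact: cdiffb_cst.
Qed.
Lemma cdiffbB f g z : cdiffb f z -> cdiffb g z -> cdiffb (fun w => f w - g w) z.
Proof. by move=> h1 h2; apply: cdiffbD => //; exact: cdiffbN. Qed.
Lemma cdiffbV f z : f z != 0 -> cdiffb f z -> cdiffb (fun w => (f w)^-1) z.
Proof.
move=> fz h; apply: (cdiffb_comp h); eexists; exact: cdiff_inv.
Qed.
Lemma cdiffb_div f g z : g z != 0 -> cdiffb f z -> cdiffb g z ->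
  cdiffb (fun w => f w / g w) z.
Proof. by move=> gz h1 h2; apply: cdiffbM => //; exact: cdiffbV. Qed.
Lemma cdiffbX f n z : cdiffb f z -> cdiffb (fun w => f w ^+ n) z.
Proof.
move=> h; elim: n => [|n IH]; first exact: cdiffb_cst.
apply: (@cdiffb_ext (fun w => f w * f w ^+ n) _ _ 1) => //.
  by move=> w _; rewrite exprS.
exact: cdiffbM.
Qed.
Lemma cdiffb_sum (I : Type) (r : seq I) (F : I -> C -> C) z :
  (forall i, cdiffb (F i) z) -> cdiffb (fun w => \sum_(i <- r) F i w) z.
Proof.
move=> h; elim: r => [|i r IH].
  apply: (@cdiffb_ext (fun=> 0) _ _ 1) => //; last exact: cdiffb_cst.
  by move=> w _; rewrite big_nil.
apply: (@cdiffb_ext (fun w => F i w + \sum_(j <- r) F j w) _ _ 1) => //.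
  by move=> w _; rewrite big_cons.
exact: cdiffbD.
Qed.
Lemma cdiffb_horner (p : {poly C}) f z : cdiffb f z -> cdiffb (fun w => p.[f w]) z.
Proof.
move=> h; apply: (@cdiffb_ext (fun w => \sum_(i <- index_enum 'I_(size p)) (p`_i * f w ^+ i)) _ _ 1) => //.
  by move=> w _; rewrite horner_coef.
by apply: cdiffb_sum => i; apply: cdiffbM; [exact: cdiffb_cst|exact: cdiffbX].
Qed.

Definition cvC (u : nat -> C) (l : C) : Prop :=
  forall e : R, 0 < e -> exists N, forall n, (N <= n)%N -> nrm (u n - l) <= e.

Lemma cvC_uniq u l m : cvC u l -> cvC u m -> l = m.
Proof.
move=> hl hm; apply: eq_nrm => e e0; have e2 : 0 < e / 2 by lra.
have [N hN] := hl _ e2; have [M hM] := hm _ e2.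
have := hN _ (leq_maxl N M); have := hM _ (leq_maxr N M).
have -> : l - m = (u (maxn N M) - m) - (u (maxn N M) - l) by ring.
move=> h1 h2; apply: (le_trans (nrmB _ _)); lra.
Qed.

Lemma cvC_ext u v l : (forall n, u n = v n) -> cvC u l -> cvC v l.
Proof. by move=> uv h e /h[N hN]; exists N => n /hN; rewrite uv. Qed.

Lemma cvC_cst l : cvC (fun=> l) l.
Proof. by move=> e e0; exists 0%N => n _; rewrite subrr nrm0 ltW. Qed.

Lemma cvCD u v l m : cvC u l -> cvC v m -> cvC (fun n => u n + v n) (l + m).
Proof.
move=> hl hm e e0; have e2 : 0 < e / 2 by lra.
have [N hN] := hl _ e2; have [M hM] := hm _ e2.
exists (maxn N M) => n; rewrite geq_max => /andP[/hN h1 /hM h2].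
rewrite opprD addrACA; apply: (le_trans (nrmD _ _)); lra.
Qed.

Lemma cvCZ (c : C) u l : cvC u l -> cvC (fun n => c * u n) (c * l).
Proof.
move=> hl e e0; have c0 : 0 < nrm c + 1 by rewrite ltr_wpDl ?nrm_ge0.
have [N hN] := hl (e / (nrm c + 1)) (divr_gt0 e0 c0).
exists N => n /hN; rewrite -mulrBr nrmM ler_pdivlMr // => h.
apply: le_trans h; rewrite mulrC ler_wpM2l ?nrm_ge0 // lerDl //.
Qed.

Lemma cvCN u l : cvC u l -> cvC (fun n => - u n) (- l).
Proof.
move=> h; rewrite -mulN1r; apply: (cvC_ext _ (cvCZ (-1) h)) => n.
by rewrite mulN1r.
Qed.

Lemma cvCB u v l m : cvC u l -> cvC v m -> cvC (fun n => u n - v n) (l - m).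
Proof. by move=> h1 h2; apply: cvCD => //; exact: cvCN. Qed.

Lemma cvC_bound u l (M : R) : cvC u l -> (forall n, nrm (u n) <= M) -> nrm l <= M.
Proof.
move=> hl hM; apply/ler_addgt0Pr => e e0; have [N hN] := hl _ e0.
have := hN _ (leqnn N); have := hM N => h1 h2.
have -> : l = u N - (u N - l) by ring.
apply: (le_trans (nrmB _ _)); lra.
Qed.

Lemma cvC_sub u l (s : nat -> nat) : cvC u l -> (forall n, (n <= s n)%N) ->
  cvC (fun n => u (s n)) l.
Proof. by move=> h hs e /h[N hN]; exists N => n hn; apply: hN; rewrite (leq_trans hn). Qed.

Lemma cvC0_le u (b : nat -> R) : (forall n, nrm (u n) <= b n) ->
  (forall e : R, 0 < e -> exists N, forall n, (N <= n)%N -> b n <= e) -> cvC u 0.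
Proof.
by move=> ub hb e /hb[N hN]; exists N => n hn; rewrite subr0 (le_trans (ub n)) ?hN.
Qed.

Lemma R_complete (u : nat -> R) :
  (forall e : R, 0 < e -> exists N, forall n m, (N <= n)%N -> (N <= m)%N -> `|u n - u m| <= e) ->
  exists l, forall e : R, 0 < e -> exists N, forall n, (N <= n)%N -> `|u n - l| <= e.
Proof.
move=> hu.
have cu : cvg (u @ \oo).
  apply: cauchy_cvg; apply/cauchyP => e e0.
  have [N hN] := hu (e / 2) (divr_gt0 e0 (ltr0Sn _ 1)).
  exists (u N); rewrite /nbhs /=; exists N => // n /= hn.
  rewrite /ball /= (le_lt_trans (hN _ _ (leqnn N) hn)) //; lra.
exists (lim (u @ \oo)) => e e0.
move/cvgrPdist_le: cu => /(_ _ e0)[N _ hN]; exists N => n hn; rewrite distrC.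
exact: hN.
Qed.

Lemma C_complete (u : nat -> C) :
  (forall e : R, 0 < e -> exists N, forall n m, (N <= n)%N -> (N <= m)%N -> nrm (u n - u m) <= e) ->
  exists l, cvC u l.
Proof.
move=> hu.
have [a ha] : exists l, forall e : R, 0 < e -> exists N, forall n, (N <= n)%N -> `|complex.Re (u n) - l| <= e.
  apply: R_complete => e /hu[N hN]; exists N => n m hn hm.
  apply: le_trans (hN n m hn hm); apply: le_trans (ler_Re_nrm _).
  by rewrite raddfB.
have [b hb] : exists l, forall e : R, 0 < e -> exists N, forall n, (N <= n)%N -> `|complex.Im (u n) - l| <= e.
  apply: R_complete => e /hu[N hN]; exists N => n m hn hm.
  apply: le_trans (hN n m hn hm); apply: le_trans (ler_Im_nrm _).
  by rewrite raddfB.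
exists (a +i* b) => e e0; have e2 : 0 < e / 2 by lra.
have [N hN] := ha _ e2; have [M hM] := hb _ e2.
exists (maxn N M) => n; rewrite geq_max => /andP[/hN h1 /hM h2].
apply: (le_trans (ler_nrm_ReIm _)); move: h1 h2.
case: (u n) => x y /=; lra.
Qed.

Lemma cvC_lim u l : cvC u l -> lim (u @ \oo) = l.
Proof.
move=> h; apply: (@cvg_lim C); first exact: norm_hausdorff.
move=> P /nbhsC[r r0 hr]; have [N hN] := h (r / 2) (divr_gt0 r0 (ltr0Sn _ 1)).
by exists N => // n /= /hN hn; apply: hr; apply: (le_lt_trans hn); lra.
Qed.

Lemma Rpow_small (r : R) : 0 <= r -> r < 1 -> forall e : R, 0 < e ->
  exists N, forall n, (N <= n)%N -> r ^+ n <= e.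
Proof.
move=> r0 r1 e e0.
have h : (fun n => r ^+ n) @ \oo --> (0 : R) by apply: cvg_expr; rewrite ger0_norm.
move/cvgrPdist_le: h => /(_ _ e0)[N _ hN]; exists N => n hn.
by have := hN _ hn; rewrite /= sub0r normrN ger0_norm ?exprn_ge0.
Qed.

Lemma Rinv_small (e : R) : 0 < e -> exists N, forall n, (N <= n)%N -> n.+1%:R^-1 <= e.
Proof.
move=> e0; exists (Num.bound e^-1) => n hn.
rewrite -[leRHS]invrK lef_pV2 ?posrE ?ltr0Sn ?invr_gt0 //.
apply: (le_trans (ltW (archi_boundP _))); first by rewrite invr_ge0 ltW.
by rewrite ler_nat leqW.
Qed.

End Norm.

(** * Sums over duplicate-free lists *)

Section UniqSums.
Variable R : realType.

Lemma ler_sum_sub (I : eqType) (A B : seq I) (F : I -> R) :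
  uniq A -> uniq B -> {subset A <= B} -> (forall i, 0 <= F i) ->
  \sum_(i <- A) F i <= \sum_(i <- B) F i.
Proof.
move=> uA uB sAB F0; rewrite [leRHS](bigID (mem A)) /=.
rewrite -[X in _ <= X + _]big_filter.
have -> : \sum_(i <- [seq i <- B | i \in A]) F i = \sum_(i <- A) F i.
  apply: perm_big; apply: uniq_perm; rewrite ?filter_uniq // => i.
  by rewrite mem_filter; case: (boolP (i \in A)) => //= /sAB.
by rewrite lerDl sumr_ge0.
Qed.

Lemma big_uniq_split (V : zmodType) (I : eqType) (A B : seq I) (F : I -> V) :
  uniq A -> uniq B -> {subset A <= B} ->
  \sum_(i <- B) F i = \sum_(i <- A) F i + \sum_(i <- [seq i <- B | i \notin A]) F i.
Proof.
move=> uA uB sAB; rewrite (bigID (mem A)) /= big_filter; congr (_ + _).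
rewrite -big_filter; apply: perm_big; apply: uniq_perm; rewrite ?filter_uniq // => i.
by rewrite mem_filter; case: (boolP (i \in A)) => //= /sAB.
Qed.

End UniqSums.

(** * Unordered sums *)

Section Hasum.
Variable R : realType.
Local Notation C := (Cplx R).

Definition asum (I : eqType) (f : I -> C) (M : R) : Prop :=
  forall B : seq I, uniq B -> \sum_(i <- B) nrm (f i) <= M.

(** Unordered summation along duplicate-free lists instead of finite sets, so that decidable
    equality on the index type is enough; [hasum_summability] links it to the sum in [Theta]. *)
Definition hasum (I : eqType) (f : I -> C) (s : C) : Prop :=
  forall e : R, 0 < e -> exists A : seq I, forall B : seq I, uniq B ->
    {subset A <= B} -> nrm (\sum_(i <- B) f i - s) <= e.

Implicit Types I J : eqType.

Lemma hasum_uniq I (f : I -> C) s t : hasum f s -> hasum f t -> s = t.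
Proof.
move=> hs ht; apply: eq_nrm => e e0; have e2 : 0 < e / 2 by lra.
have [A hA] := hs _ e2; have [B hB] := ht _ e2.
have h1 := hA (undup (A ++ B)) (undup_uniq _).
have h2 := hB (undup (A ++ B)) (undup_uniq _).
have {}h1 : nrm (\sum_(i <- undup (A ++ B)) f i - s) <= e / 2.
  by apply: h1 => i iA; rewrite mem_undup mem_cat iA.
have {}h2 : nrm (\sum_(i <- undup (A ++ B)) f i - t) <= e / 2.
  by apply: h2 => i iA; rewrite mem_undup mem_cat iA orbT.
set S := \sum_(i <- _) _ in h1 h2.
have -> : s - t = (S - t) - (S - s) by ring.
apply: (le_trans (nrmB _ _)); lra.
Qed.

Lemma hasum_ext I (f g : I -> C) s : (forall i, f i = g i) -> hasum f s -> hasum g s.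
Proof.
move=> fg h e /h[A hA]; exists A => B uB sB.
by under eq_bigr do rewrite -fg; exact: hA.
Qed.

Lemma hasum_eq I (f g : I -> C) s t : (forall i, f i = g i) -> hasum f s -> hasum g t -> s = t.
Proof. by move=> fg hs ht; apply: hasum_uniq (hasum_ext fg hs) ht. Qed.

(** A list whose absolute sum comes within [e] of the supremum leaves at most [e] to every disjoint
    list. *)
Lemma asum_tail I (f : I -> C) M : asum f M -> forall e : R, 0 < e ->
  exists2 A : seq I, uniq A & forall B, uniq B -> (forall i, i \in B -> i \notin A) ->
    \sum_(i <- B) nrm (f i) <= e.
Proof.
move=> hM e e0.
pose S := [set x : R | exists2 B : seq I, uniq B & x = \sum_(i <- B) nrm (f i)].
have hS : has_sup S.
  split; first by exists (\sum_(i <- [::]) nrm (f i)); exists [::].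
  by exists M => x [B uB ->]; exact: hM.
have [x [A uA xA] hx] := sup_adherent e0 hS.
exists A => // B uB dAB.
have : \sum_(i <- A ++ B) nrm (f i) <= sup S.
  apply: ub_le_sup; first exact: hS.2.
  exists (A ++ B) => //; rewrite cat_uniq uA uB andbT /=.
  by apply/hasPn => i /dAB.
rewrite big_cat /=; rewrite xA in hx; lra.
Qed.

(** Lists [A n] with tails at most [1 / (n + 1)] have Cauchy sums, since any two of them are
    compared through their union. *)
Lemma hasum_exists I (f : I -> C) M : asum f M -> exists s, hasum f s.
Proof.
move=> hM.
have hA : forall n : nat, exists A : seq I, uniq A /\ forall B, uniq B -> (forall i, i \in B -> i \notin A) ->
    \sum_(i <- B) nrm (f i) <= n.+1%:R^-1.
  move=> n; have n0 : (0 : R) < n.+1%:R^-1 by rewrite invr_gt0 ltr0Sn.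
  by have [A uA h] := asum_tail hM n0; exists A.
have [A hA'] := choice hA.
have hAB : forall n B, uniq B -> {subset A n <= B} ->
    nrm (\sum_(i <- B) f i - \sum_(i <- A n) f i) <= n.+1%:R^-1.
  move=> n B uB sB; have [uA hn] := hA' n.
  rewrite (big_uniq_split f uA uB sB) addrC addKr.
  apply: (le_trans (nrm_sum _ _ _)); apply: hn; rewrite ?filter_uniq // => i.
  by rewrite mem_filter => /andP[].
have [s hs] : exists s, cvC (fun n => \sum_(i <- A n) f i) s.
  apply: C_complete => e e0; have e2 : 0 < e / 2 by lra.
  have [N hN] := Rinv_small e2; exists N => n m hn hm.
  have uu := undup_uniq (A n ++ A m).
  have h1 := hAB n _ uu; have h2 := hAB m _ uu.
  have {}h1 : nrm (\sum_(i <- undup (A n ++ A m)) f i - \sum_(i <- A n) f i) <= e / 2.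
    by apply: (le_trans _ (hN _ hn)); apply: h1 => i iA; rewrite mem_undup mem_cat iA.
  have {}h2 : nrm (\sum_(i <- undup (A n ++ A m)) f i - \sum_(i <- A m) f i) <= e / 2.
    by apply: (le_trans _ (hN _ hm)); apply: h2 => i iA; rewrite mem_undup mem_cat iA orbT.
  set S := \sum_(i <- undup _) _ in h1 h2.
  have -> : \sum_(i <- A n) f i - \sum_(i <- A m) f i =
    (S - \sum_(i <- A m) f i) - (S - \sum_(i <- A n) f i) by ring.
  by apply: (le_trans (nrmB _ _)); lra.
exists s => e e0; have e2 : 0 < e / 2 by lra.
have [N hN] := Rinv_small e2; have [N' hN'] := hs _ e2.
exists (A (maxn N N')) => B uB sB.
have h1 := le_trans (hAB _ _ uB sB) (hN _ (leq_maxl N N')); have h3 := hN' _ (leq_maxr N N').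
have -> : \sum_(i <- B) f i - s = (\sum_(i <- B) f i - \sum_(i <- A (maxn N N')) f i) + (\sum_(i <- A (maxn N N')) f i - s) by ring.
apply: (le_trans (nrmD _ _)); lra.
Qed.

(** [get] yields an arbitrary value when the family is not summable; the value is meaningful only
    through [hasum_tsum] and [tsumE]. *)
Definition tsum I (f : I -> C) : C := get (hasum f).

Lemma hasum_tsum I (f : I -> C) M : asum f M -> hasum f (tsum f).
Proof. by move=> /hasum_exists[s hs]; apply: (@getPex _ (hasum f)); exists s. Qed.

Lemma tsumE I (f : I -> C) s : hasum f s -> tsum f = s.
Proof. by move=> h; exact: (hasum_uniq (getPex (ex_intro _ s h)) h). Qed.

Lemma hasum_nrm I (f : I -> C) s M : asum f M -> hasum f s -> nrm s <= M.
Proof.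
move=> hM hs; apply/ler_addgt0Pr => e e0; have [A hA] := hs _ e0.
have h1 : nrm (\sum_(i <- undup A) f i - s) <= e.
  by apply: hA (undup_uniq _) _ => i; rewrite mem_undup.
have h2 : nrm (\sum_(i <- undup A) f i) <= M.
  exact: (le_trans (nrm_sum _ _ _)) (hM _ (undup_uniq _)).
have -> : s = \sum_(i <- undup A) f i - (\sum_(i <- undup A) f i - s) by ring.
apply: (le_trans (nrmB _ _)); lra.
Qed.

Lemma hasumD I (f g : I -> C) s t : hasum f s -> hasum g t ->
  hasum (fun i => f i + g i) (s + t).
Proof.
move=> hs ht e e0; have e2 : 0 < e / 2 by lra.
have [A hA] := hs _ e2; have [B hB] := ht _ e2.
exists (A ++ B) => D uD sD; rewrite big_split /= opprD addrACA.
apply: (le_trans (nrmD _ _)).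
have h1 : nrm (\sum_(i <- D) f i - s) <= e / 2.
  by apply: hA => // i iA; apply: sD; rewrite mem_cat iA.
have h2 : nrm (\sum_(i <- D) g i - t) <= e / 2.
  by apply: hB => // i iA; apply: sD; rewrite mem_cat iA orbT.
lra.
Qed.

Lemma hasumZ I (f : I -> C) s c : hasum f s -> hasum (fun i => c * f i) (c * s).
Proof.
move=> hs e e0; have c0 : 0 < nrm c + 1 by rewrite ltr_wpDl ?nrm_ge0.
have [A hA] := hs _ (divr_gt0 e0 c0); exists A => B uB sB.
rewrite -mulr_sumr -mulrBr nrmM.
have := hA _ uB sB; rewrite ler_pdivlMr // => h; apply: le_trans h.
by rewrite mulrC ler_wpM2l ?nrm_ge0 // lerDl.
Qed.

Lemma hasumN I (f : I -> C) s : hasum f s -> hasum (fun i => - f i) (- s).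
Proof.
by move=> /(hasumZ (-1)); rewrite mulN1r; apply: hasum_ext => i; rewrite mulN1r.
Qed.

Lemma hasumB I (f g : I -> C) s t : hasum f s -> hasum g t ->
  hasum (fun i => f i - g i) (s - t).
Proof. by move=> h1 h2; apply: hasumD => //; exact: hasumN. Qed.

Lemma hasum0 I : hasum (fun _ : I => 0) 0.
Proof.
by move=> e e0; exists [::] => B _ _; rewrite big1 // subrr nrm0 ltW.
Qed.

Lemma hasum_sum I (K : Type) (r : seq K) (f : K -> I -> C) (s : K -> C) :
  (forall k, hasum (f k) (s k)) ->
  hasum (fun i => \sum_(k <- r) f k i) (\sum_(k <- r) s k).
Proof.
move=> h; elim: r => [|k r IH].
  by rewrite big_nil; apply: hasum_ext (hasum0 I) => i; rewrite big_nil.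
rewrite big_cons; apply: hasum_ext (hasumD (h k) IH) => i; rewrite big_cons //.
Qed.

Lemma hasum_fin (K : finType) (f : K -> C) : hasum f (\sum_k f k).
Proof.
move=> e e0; exists (index_enum K) => B uB sB.
have -> : \sum_(i <- B) f i = \sum_k f k.
  apply: perm_big; apply: uniq_perm => //; first exact: index_enum_uniq.
  by move=> k; rewrite mem_index_enum sB // mem_index_enum.
by rewrite subrr nrm0 ltW.
Qed.

Lemma hasum_bij I J (h : J -> I) (h' : I -> J) (f : I -> C) s :
  cancel h h' -> cancel h' h -> hasum f s -> hasum (fun j => f (h j)) s.
Proof.
move=> hK h'K hs e /hs[A hA]; exists (map h' A) => B uB sB.
have -> : \sum_(i <- B) f (h i) = \sum_(i <- map h B) f i by rewrite big_map.
apply: hA; first by rewrite map_inj_uniq //; exact: can_inj hK.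
by move=> i iA; rewrite -(h'K i); apply: map_f; apply: sB; exact: map_f.
Qed.

Lemma asum_le I (f g : I -> C) M : (forall i, nrm (f i) <= nrm (g i)) -> asum g M -> asum f M.
Proof. by move=> fg hM B uB; apply: le_trans (hM B uB); apply: ler_sum. Qed.

Lemma asumZ I (f : I -> C) M c : asum f M -> asum (fun i => c * f i) (nrm c * M).
Proof.
move=> hM B uB; under eq_bigr do rewrite nrmM.
by rewrite -mulr_sumr ler_wpM2l ?nrm_ge0 // hM.
Qed.

Lemma asumM I J (f : I -> C) (g : J -> C) M N : asum f M -> asum g N ->
  asum (fun ij : I * J => f ij.1 * g ij.2) (M * N).
Proof.
move=> hM hN B uB.
pose B1 := undup (map fst B); pose B2 := undup (map snd B).
apply: (@le_trans _ _ (\sum_(i <- [seq (i, j) | i <- B1, j <- B2]) nrm (f i.1 * g i.2))).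
  apply: ler_sum_sub => //; last by move=> i; exact: nrm_ge0.
    by apply: allpairs_uniq; rewrite ?undup_uniq // => -[a b] [c d].
  move=> [i j] ij; apply/allpairsP; exists (i, j) => /=.
  by rewrite !mem_undup; split=> //; apply/mapP; exists (i, j).
rewrite big_allpairs_dep /=.
under eq_bigr => i _ do (under eq_bigr => j _ do rewrite nrmM; rewrite -mulr_sumr).
rewrite -mulr_suml; apply: ler_pM; rewrite ?hM ?hN ?undup_uniq //.
  by apply: sumr_ge0 => i _; exact: nrm_ge0.
by apply: sumr_ge0 => i _; exact: nrm_ge0.
Qed.

(** Fubini in one direction: the double family is known to be summable beforehand, and summing the
    rows first gives the same value. *)
Lemma hasum_inner I J (f : I * J -> C) t (s : I -> C) : hasum f t ->
  (forall i, hasum (fun j => f (i, j)) (s i)) -> hasum s t.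
Proof.
move=> ht hs e e0; have e2 : 0 < e / 2 by lra.
have [E hE] := ht _ e2.
exists (map fst E) => B uB sB.
pose n := size B; have n0 : (0 : R) < n.+1%:R by rewrite ltr0Sn.
have hA : forall i, exists A : seq J, forall D, uniq D -> {subset A <= D} ->
    nrm (\sum_(j <- D) f (i, j) - s i) <= e / 2 / n.+1%:R.
  by move=> i; exact: hs (divr_gt0 e2 n0).
have [A hA'] := choice hA.
(* One list of second indices that serves every row in [B], each within a share [e / 2 / (n + 1)] of
   the error. *)
pose D := undup (map snd E ++ flatten (map A B)).
have h1 : nrm (\sum_(p <- [seq (i, j) | i <- B, j <- D]) f p - t) <= e / 2.
  apply: hE; first by apply: allpairs_uniq; rewrite ?undup_uniq // => -[a b] [c d].
  move=> [i j] ijE; apply/allpairsP; exists (i, j); split=> //=.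
    by apply: sB; apply/mapP; exists (i, j).
  by rewrite mem_undup mem_cat; apply/orP; left; apply/mapP; exists (i, j).
rewrite big_allpairs_dep /= in h1.
have h2 : nrm (\sum_(i <- B) (\sum_(j <- D) f (i, j) - s i)) <= e / 2.
  apply: (le_trans (nrm_sum _ _ _)).
  apply: (@le_trans _ _ (\sum_(i <- B) (e / 2 / n.+1%:R))).
    rewrite big_seq [leRHS]big_seq; apply: ler_sum => i iB; apply: hA'.
      exact: undup_uniq.
    move=> j jA; rewrite mem_undup mem_cat; apply/orP; right.
    by apply/flattenP; exists (A i) => //; exact: map_f.
  rewrite big_const_seq count_predT iter_addr_0 -/n -[_ *+ n]mulr_natl mulrCA.
  by rewrite ger_pMr // ler_pdivrMr // mul1r ler_nat leqnSn.
rewrite sumrB in h2.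
set X := \sum_(i <- B) \sum_(j <- D) _ in h1 h2.
have -> : \sum_(i <- B) s i - t = (X - t) - (X - \sum_(i <- B) s i) by ring.
apply: (le_trans (nrmB _ _)); lra.
Qed.

Lemma hasum_pair_swap I J (f : I * J -> C) t : hasum f t ->
  hasum (fun p : J * I => f (p.2, p.1)) t.
Proof.
by apply: (@hasum_bij _ _ (fun p : J * I => (p.2, p.1)) (fun p : I * J => (p.2, p.1))) => -[a b].
Qed.

Lemma asum_geom (r : R) : 0 <= r -> r < 1 ->
  asum (fun n : nat => (r ^+ n)%:C : C) (1 - r)^-1.
Proof.
move=> r0 r1 B uB.
apply: (@le_trans _ _ (\sum_(i <- iota 0 (\max_(i <- B) i).+1) nrm (r ^+ i)%:C)).
  apply: ler_sum_sub => //; [exact: iota_uniq| |by move=> i; exact: nrm_ge0].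
  by move=> i iB; rewrite mem_iota /= add0n ltnS; exact: leq_bigmax_seq.
move: (_.+1) => N.
have -> : \sum_(i <- iota 0 N) nrm (r ^+ i)%:C = (1 - r ^+ N) / (1 - r).
  have rn : 1 - r != 0 by rewrite gt_eqF // subr_gt0.
  elim: N => [|N IH]; first by rewrite big_nil expr0 subrr mul0r.
  rewrite -addn1 iotaD big_cat /= IH big_cons big_nil addr0 add0n nrm_real.
  by rewrite ger0_norm ?exprn_ge0 // addn1 exprS; field.
by rewrite ler_pdivrMr ?subr_gt0 // mulVf ?gt_eqF ?subr_gt0 // lerBlDr lerDl exprn_ge0.
Qed.

Lemma asum_sum_split (I : eqType) (f : I -> C) (P : pred I) M N :
  (forall B, uniq B -> all P B -> \sum_(i <- B) nrm (f i) <= M) ->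
  (forall B, uniq B -> all (predC P) B -> \sum_(i <- B) nrm (f i) <= N) ->
  asum f (M + N).
Proof.
move=> hM hN B uB; rewrite (bigID P) /= -big_filter -[X in _ + X]big_filter lerD //.
  by apply: hM; [exact: filter_uniq|exact: filter_all].
by apply: hN; [exact: filter_uniq|exact: filter_all].
Qed.

Lemma asum_geom_int (r : R) : 0 <= r -> r < 1 ->
  asum (fun n : int => (r ^+ `|n|%N)%:C : C) ((1 - r)^-1 + (1 - r)^-1).
Proof.
move=> r0 r1; have hg := asum_geom r0 r1.
apply: (@asum_sum_split _ _ (fun n : int => 0 <= n)) => B uB aB.
  have := hg (map absz B); rewrite big_map; apply; rewrite map_inj_in_uniq //.
  by move=> x y /(allP aB) hx /(allP aB) hy; move: hx hy; case: x => // x; case: y => //= y _ _ ->.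
have := hg (map absz B); rewrite big_map; apply; rewrite map_inj_in_uniq //.
by move=> x y /(allP aB) hx /(allP aB) hy; move: hx hy; case: x => // x; case: y => //= y _ _ [->].
Qed.

Lemma hasum_summability (I : choiceType) (f : I -> C) s : hasum f s ->
  @summability.sum I R[i] C f = s.
Proof.
move=> hs; apply: (@cvg_lim C); [exact: norm_hausdorff|exact: summability.totally_filter|].
move=> P /nbhsC[r r0 hr]; have [A hA] := hs (r / 2) (divr_gt0 r0 (ltr0Sn _ 1)).
exists [fset x in A]%fset => // B /= sB; apply: hr.
have -> : summability.partial_sum f B = \sum_(i <- B) f i by rewrite big_seq_fsetE.
have := hA B (fset_uniq B) => h; apply: (@le_lt_trans _ _ (r / 2)); last by lra.
by apply: h => i iA; apply: (fsubsetP sB); rewrite in_fset.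
Qed.

End Hasum.

(** * The function e(z) *)

Section Exponential.
Variable R : realType.
Local Notation C := (Cplx R).
Local Notation E := (@e2pi R).
Local Notation nrm := (@nrm R).

Definition tpi : R := 2%:R * pi.

Lemma tpi_gt0 : 0 < tpi.
Proof. by rewrite /tpi mulr_gt0 ?ltr0n // pi_gt0. Qed.

Lemma e2piE (x y : R) : E (x +i* y) =
  (expR (- (tpi * y)) * cos (tpi * x)) +i* (expR (- (tpi * y)) * sin (tpi * x)).
Proof.
rewrite /e2pi /cexp -/tpi.
have -> : ((0 +i* tpi) * (x +i* y) : C) = (- (tpi * y)) +i* (tpi * x).
  by apply/eqP; rewrite eq_complex /=; apply/andP; split; apply/eqP; ring.
by [].
Qed.

Lemma E0 : E 0 = 1.
Proof.
rewrite (_ : (0 : C) = 0 +i* 0) // e2piE !mulr0 oppr0 expR0 cos0 sin0 !mul1r.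
by [].
Qed.

Lemma ED (x y : C) : E (x + y) = E x * E y.
Proof.
case: x => a b; case: y => c d.
rewrite (_ : (a +i* b : C) + (c +i* d) = (a + c) +i* (b + d)) // !e2piE.
rewrite !mulrDr opprD expRD cosD sinD.
by apply/eqP; rewrite eq_complex /=; apply/andP; split; apply/eqP; ring.
Qed.

Lemma nrmE (z : C) : nrm (E z) = expR (- (tpi * complex.Im z)).
Proof.
case: z => x y; rewrite e2piE /nrm /= !exprMn -mulrDr cos2Dsin2 mulr1.
by rewrite sqrtr_sqr ger0_norm // expR_ge0.
Qed.

Lemma E_neq0 z : E z != 0.
Proof. by rewrite -nrm_gt0 nrmE expR_gt0. Qed.

Lemma EN x : E (- x) = (E x)^-1.
Proof.
by apply: (mulfI (E_neq0 x)); rewrite -ED subrr E0 mulfV ?E_neq0.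
Qed.

Lemma E1 : E 1 = 1.
Proof.
rewrite (_ : (1 : C) = 1 +i* 0) // e2piE mulr0 oppr0 expR0 mulr1 !mul1r.
rewrite (_ : tpi = pi *+ 2); last by rewrite /tpi mulr_natl.
by rewrite cos2pi sin2pi.
Qed.

Lemma Ehalf : E (2%:R^-1) = -1.
Proof.
have -> : (2%:R^-1 : C) = (2%:R^-1) +i* 0.
  by rewrite complexr0 fmorphV rmorph_nat.
rewrite e2piE mulr0 oppr0 expR0 !mul1r.
rewrite (_ : tpi * _ = pi); last by rewrite /tpi; field.
by rewrite cospi sinpi; apply/eqP; rewrite eq_complex /= oppr0 !eqxx.
Qed.

Lemma EMn x n : E (n%:R * x) = E x ^+ n.
Proof.
elim: n => [|n IH]; first by rewrite mul0r E0 expr0.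
by rewrite -addn1 natrD mulrDl mul1r ED IH addn1 exprSr.
Qed.

Lemma EMz x (n : int) : E (n%:~R * x) = E x ^ n.
Proof.
case: n => n; first by rewrite -pmulrn EMn.
by rewrite NegzE mulrNz mulNr EN -pmulrn EMn.
Qed.

Lemma Enat n : E n%:R = 1.
Proof. by rewrite -[n%:R]mulr1 EMn E1 expr1n. Qed.

Lemma Eint (n : int) : E n%:~R = 1.
Proof. by rewrite -[n%:~R]mulr1 EMz E1 exp1rz. Qed.

Lemma ED1 x : E (x + 1) = E x.
Proof. by rewrite ED E1 mulr1. Qed.

Lemma EDint x (n : int) : E (x + n%:~R) = E x.
Proof. by rewrite ED Eint mulr1. Qed.

Lemma real_deriv (f : R -> R) (x l : R) : is_derive x 1 f l ->
  forall e : R, 0 < e -> exists2 d : R, 0 < d & forall h, `|h| < d ->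
   `|f (x + h) - f x - l * h| <= e * `|h|.
Proof.
move=> [df dl] e e0.
have hl : (h^-1 *: ((f \o shift x) (h *: (1:R)) - f x)) @[h --> 0^'] --> l.
  by rewrite -dl; exact: df.
move/cvgrPdist_le: hl => /(_ _ e0) /nbhs_ballP[d /= d0 hd].
exists d => // h hh; have [->|h0] := eqVneq h 0.
  by rewrite addr0 subrr mulr0 subrr normr0 mulr0.
have := hd h; rewrite /ball /= sub0r normrN => /(_ hh h0).
have -> : f (x + h) - f x - l * h = - ((l - h^-1 *: (f (h *: (1:R) + x) - f x)) * h).
  by rewrite /GRing.scale /= mulr1 (addrC h); field.
by rewrite normrN normrM => H; rewrite ler_wpM2r.
Qed.

Definition tpii : C := 0 +i* tpi.

Lemma nrm_tpii : nrm tpii = tpi.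
Proof. by rewrite /nrm /= expr0n add0r sqrtr_sqr ger0_norm // ltW ?tpi_gt0. Qed.

Lemma tpii_neq0 : tpii != 0.
Proof. by rewrite -nrm_gt0 nrm_tpii tpi_gt0. Qed.

Lemma cdiff_E0 : cdiff E 0 tpii.
Proof.
move=> e e0; have t0 := tpi_gt0.
(* The real and imaginary parts below contribute 4 and 5 times [k * (N * tpi)], whence the 9. *)
pose k := Num.min 1 (e / (9 * tpi)).
have k0 : 0 < k by rewrite lt_min ltr01 divr_gt0 // mulr_gt0.
have k1 : k <= 1 by rewrite ge_min lexx.
have t8 : 0 < 9 * tpi by lra.
have ke : 9 * tpi * k <= e by rewrite mulrC -(ler_pdivlMr _ _ t8) /k ge_min lexx orbT.
clearbody k.
have [d1 d10 h1] := real_deriv (is_derive_expR (0 : R)) k0.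
have [d2 d20 h2] := real_deriv (is_derive_cos (0 : R)) k0.
have [d3 d30 h3] := real_deriv (is_derive_sin (0 : R)) k0.
exists (Num.min (Num.min d1 d2) (Num.min d3 k) / tpi).
  by rewrite divr_gt0 // !lt_min d10 d20 d30 k0.
move=> w; rewrite subr0 ltr_pdivlMr // E0 => hw.
have := hw; rewrite !lt_min => /andP[/andP[w1 w2] /andP[w3 w4]].
have hr := ler_Re_nrm w; have hi := ler_Im_nrm w.
have n0 := nrm_ge0 w.
case: w hw w1 w2 w3 w4 hr hi n0 => x y hw w1 w2 w3 w4 /= hr hi n0.
set N := nrm (x +i* y) in hw w1 w2 w3 w4 hr hi n0 *.
pose a := - (tpi * y); pose b := tpi * x.
have na : `|a| <= N * tpi.
  by rewrite normrN normrM (gtr0_norm t0) mulrC ler_wpM2r // ltW.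
have nb : `|b| <= N * tpi.
  by rewrite normrM (gtr0_norm t0) mulrC ler_wpM2r // ltW.
have := h1 a (le_lt_trans na w1); rewrite add0r expR0 mul1r => H1.
have := h2 b (le_lt_trans nb w2); rewrite add0r cos0 sin0 oppr0 mul0r subr0 => H2.
have := h3 b (le_lt_trans nb w3); rewrite add0r cos0 sin0 mul1r subr0 => H3.
rewrite e2piE -/a -/b.
apply: (le_trans (ler_nrm_ReIm _)) => /=.
rewrite (_ : _ - _ = expR a * cos b - 1 - a); last by rewrite /a; ring.
rewrite (_ : expR a * sin b - 0 - _ = expR a * sin b - b); last by rewrite /b; ring.
have A0 := normr_ge0 a; have B0 := normr_ge0 b.
have a1 : `|a| <= k by apply: (le_trans na); exact: ltW.
have kA : k * `|a| <= k * (N * tpi) by rewrite ler_wpM2l // ltW.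
have kB : k * `|b| <= k * (N * tpi) by rewrite ler_wpM2l // ltW.
have ea : `|expR a - 1| <= 2 * k.
  have -> : expR a - 1 = (expR a - 1 - a) + a by ring.
  apply: (le_trans (ler_normD _ _)); have : k * `|a| <= 1 * k by rewrite ler_pM // ltW.
  lra.
have ea3 : `|expR a| <= 3.
  have -> : expR a = (expR a - 1) + 1 by ring.
  apply: (le_trans (ler_normD _ _)); rewrite normr1; lra.
have R1 : `|expR a * cos b - 1 - a| <= 4 * (k * (N * tpi)).
  have -> : expR a * cos b - 1 - a = expR a * (cos b - 1) + (expR a - 1 - a) by ring.
  apply: (le_trans (ler_normD _ _)); rewrite normrM.
  have : `|expR a| * `|cos b - 1| <= 3 * (k * (N * tpi)).
    by apply: ler_pM => //; apply: (le_trans H2).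
  lra.
have R2 : `|expR a * sin b - b| <= 5 * (k * (N * tpi)).
  have -> : expR a * sin b - b = expR a * (sin b - b) + (expR a - 1) * b by ring.
  apply: (le_trans (ler_normD _ _)); rewrite normrM (normrM (expR a - 1)).
  have hh : `|expR a| * `|sin b - b| <= 3 * (k * (N * tpi)).
    by apply: ler_pM => //; apply: (le_trans H3).
  have hh2 : `|expR a - 1| * `|b| <= (2 * k) * (N * tpi) by apply: ler_pM.
  lra.
have : 9 * tpi * k * N <= e * N by rewrite ler_wpM2r.
lra.
Qed.

Lemma cdiff_E z : cdiff E z (tpii * E z).
Proof.
have H : cdiff (fun w => E z * E (w - z)) z (0 * E (z - z) + E z * (tpii * 1)).
  apply: cdiffM; first exact: cdiff_cst.
  apply: (@cdiff_comp _ (fun w => w - z)); last by rewrite subrr; exact: cdiff_E0.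
  rewrite -[X in cdiff _ _ X](addr0 1); apply: cdiffD; [exact: cdiff_id|exact: cdiff_cst].
rewrite mul0r add0r mulr1 mulrC in H.
by apply: (cdiff_ext (@ltr01 R) _ H) => w _; rewrite -ED addrC subrK.
Qed.

Lemma cdiffb_E f z : cdiffb f z -> cdiffb (fun w => E (f w)) z.
Proof. by move=> h; apply: (cdiffb_comp h); eexists; exact: cdiff_E. Qed.

Lemma E_real_neq1 (t : R) : 0 < t < 1 -> E t%:C != 1.
Proof.
move=> /andP[t0 t1]; apply/negP => /eqP.
rewrite -complexr0 e2piE mulr0 oppr0 expR0 !mul1r => -[hc _].
(* Since $\cos2\pi t=\cos^2\pi t-\sin^2\pi t$, the value 1 would force $\sin\pi t=0$. *)
have hs : 0 < sin (pi * t).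
  by apply: sin_gt0_pi; rewrite mulr_gt0 ?pi_gt0 //= gtr_pMr ?pi_gt0.
move: hc; rewrite (_ : tpi * t = pi * t + pi * t); last by rewrite /tpi; ring.
rewrite cosD; have := cos2Dsin2 (pi * t); rewrite !expr2 => h1 h2.
have : 0 < sin (pi * t) * sin (pi * t) by rewrite mulr_gt0.
lra.
Qed.

Lemma unit_circle (a b : R) : a ^+ 2 + b ^+ 2 = 1 -> exists t, cos t = a /\ sin t = b.
Proof.
move=> hab.
have a1 : -1 <= a <= 1.
  have h : a ^+ 2 <= 1 by rewrite -hab lerDl sqr_ge0.
  by rewrite -ler_norml -(@ler_pXn2r _ 2) ?nnegrE // real_normK ?num_real // expr1n.
have [h1 h2] := acos_def a1.
have hb : b ^+ 2 = sin (acos a) ^+ 2.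
  have := cos2Dsin2 (acos a); rewrite h2 -hab => /addrI; done.
have s0 : 0 <= sin (acos a) by exact: sin_ge0_pi.
have [b0|b0] := leP 0 b.
  exists (acos a); split=> //; apply/eqP; rewrite -(@eqrXn2 _ 2) // hb //.
exists (- acos a); rewrite cosN sinN h2; split=> //.
apply: oppr_inj; rewrite opprK; apply/eqP; rewrite -(@eqrXn2 _ 2) ?oppr_ge0 ?(ltW b0) //.
by rewrite sqrrN hb.
Qed.

Lemma E_surj (z : C) : z != 0 -> exists x, E x = z.
Proof.
rewrite -nrm_gt0 => z0; have t0 := tpi_gt0.
pose r := nrm z.
have h : (complex.Re z / r) ^+ 2 + (complex.Im z / r) ^+ 2 = 1.
  rewrite !expr_div_n -mulrDl /r /nrm sqr_sqrtr ?addr_ge0 ?sqr_ge0 // mulfV //.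
  by move: z0; rewrite /nrm sqrtr_gt0 => /gt_eqF ->.
have [t [hc hs]] := unit_circle h.
exists ((t / tpi) +i* (- (ln r / tpi))).
rewrite e2piE mulrN opprK ![tpi * _]mulrC !divfK ?gt_eqF // lnK // hc hs.
rewrite ![r * _]mulrC !divfK ?gt_eqF //; by case: (z).
Qed.

End Exponential.

(** * Dyadic averages and Goursat's lemma *)

Section Cousin.
Variable R : realType.

Definition dyad (n : nat) : R := (2^-1) ^+ n.

Lemma dy_gt0 n : 0 < dyad n.
Proof. by rewrite exprn_gt0 // invr_gt0 ltr0n. Qed.

Lemma dyS n : dyad n = dyad n.+1 + dyad n.+1.
Proof. by rewrite /dyad exprS; field. Qed.

Lemma dy0 : dyad 0 = 1.
Proof. exact: expr0. Qed.

Lemma dyh n : 2^-1 * dyad n = dyad n.+1.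
Proof. by rewrite /dyad exprS. Qed.

Lemma dy_small (e : R) : 0 < e -> exists N, forall n, (N <= n)%N -> dyad n <= e.
Proof. by move=> e0; apply: Rpow_small => //; lra. Qed.

Lemma dy_nat n : (2 ^ n)%:R * dyad n = 1.
Proof. by rewrite natrX -exprMn mulfV ?expr1n // pnatr_eq0. Qed.

(** Bisection (Cousin's lemma): [Q n a b] speaks of the square with corner [(a, b)] and side
    [dyad n]. If it failed on the unit square, it would fail on nested squares shrinking to a point,
    where the local hypothesis applies. *)
Lemma cousin2 (Q : nat -> R -> R -> Prop) :
  (forall n (a b : R), Q n.+1 a b -> Q n.+1 (a + dyad n.+1) b -> Q n.+1 a (b + dyad n.+1) ->
     Q n.+1 (a + dyad n.+1) (b + dyad n.+1) -> Q n a b) ->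
  (forall x y : R, 0 <= x <= 1 -> 0 <= y <= 1 -> exists N, forall n (a b : R), (N <= n)%N ->
     0 <= a -> a + dyad n <= 1 -> 0 <= b -> b + dyad n <= 1 ->
     a <= x <= a + dyad n -> b <= y <= b + dyad n -> Q n a b) ->
  Q 0%N 0 0.
Proof.
move=> hsub hloc; apply: contrapT => hQ.
pose T := (R * R)%type.
have step : forall (n : nat) (p : T), exists q : T,
   (~ Q n p.1 p.2 -> ~ Q n.+1 q.1 q.2) /\
   (q.1 = p.1 \/ q.1 = p.1 + dyad n.+1) /\ (q.2 = p.2 \/ q.2 = p.2 + dyad n.+1).
  move=> n [a b].
  have [h1|h1] := pselect (Q n.+1 a b); last by exists (a, b); split=> //; split; left.
  have [h2|h2] := pselect (Q n.+1 (a + dyad n.+1) b); last first.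
    by exists (a + dyad n.+1, b); split=> //; split; [right|left].
  have [h3|h3] := pselect (Q n.+1 a (b + dyad n.+1)); last first.
    by exists (a, b + dyad n.+1); split=> //; split; [left|right].
  have [h4|h4] := pselect (Q n.+1 (a + dyad n.+1) (b + dyad n.+1)); last first.
    by exists (a + dyad n.+1, b + dyad n.+1); split=> //; split; right.
  by exists (a, b); split; [move=> /=; have := hsub n a b; tauto|split; left].
have [F hF] : exists F : nat -> T -> T, forall n p,
   (~ Q n p.1 p.2 -> ~ Q n.+1 (F n p).1 (F n p).2) /\
   ((F n p).1 = p.1 \/ (F n p).1 = p.1 + dyad n.+1) /\ ((F n p).2 = p.2 \/ (F n p).2 = p.2 + dyad n.+1).
  have := choice (fun np : nat * T => step np.1 np.2) => -[G hG].
  by exists (fun n p => G (n, p)) => n p; exact: (hG (n, p)).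
pose p := fix p n : T := if n is m.+1 then F m (p m) else (0, 0).
have pQ n : ~ Q n (p n).1 (p n).2.
  by elim: n => //= n IH; apply: (hF n (p n)).1.
have lims : forall (u : nat -> R), u 0%N = 0 -> (forall n, u n.+1 = u n \/ u n.+1 = u n + dyad n.+1) ->
   (forall n, 0 <= u n) /\ (forall n, u n + dyad n <= 1) /\
   exists x : R, 0 <= x <= 1 /\ forall n, u n <= x <= u n + dyad n.
  move=> u u0 hu.
  have u_ge n : u n <= u n.+1 by have := dy_gt0 n.+1; case: (hu n) => ->; lra.
  have u_le n : u n.+1 + dyad n.+1 <= u n + dyad n.
    by have := dyS n; have := dy_gt0 n.+1; case: (hu n) => ->; lra.
  have um n m : (n <= m)%N -> u n <= u m.
    elim: m => [|m IH]; first by rewrite leqn0 => /eqP ->.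
    by rewrite leq_eqVlt => /orP[/eqP->//|/IH h]; apply: (le_trans h).
  have vm n m : (n <= m)%N -> u m + dyad m <= u n + dyad n.
    elim: m => [|m IH]; first by rewrite leqn0 => /eqP ->.
    by rewrite leq_eqVlt => /orP[/eqP->//|/IH h]; apply: (le_trans _ h).
  have p1 n : 0 <= u n by rewrite -u0; exact: um.
  have p2 n : u n + dyad n <= 1.
    by have := vm 0%N n (leq0n n); rewrite u0 add0r dy0.
  split=> //; split=> //.
  pose S := [set x | exists n, x = u n].
  have hS : has_sup S.
    split; first by exists (u 0%N); exists 0%N.
    by exists 1 => x [n ->]; have := p2 n; have := dy_gt0 n; lra.
  have key n : u n <= sup S <= u n + dyad n.
    apply/andP; split; first by apply: ub_le_sup; [exact: hS.2|exists n].
    apply: sup_le_ub; first exact: hS.1.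
    move=> x [m ->]; have [mn|nm] := leqP m n.
      by apply: (le_trans (um _ _ mn)); rewrite lerDl ltW ?dy_gt0.
    apply: le_trans (vm _ _ (ltnW nm)); by rewrite lerDl ltW ?dy_gt0.
  exists (sup S); split=> //.
  by have := key 0%N; rewrite u0 add0r dy0.
have [a1 [a2 [x [x01 hx]]]] := lims (fun n => (p n).1) erefl (fun n => (hF n (p n)).2.1).
have [b1 [b2 [y [y01 hy]]]] := lims (fun n => (p n).2) erefl (fun n => (hF n (p n)).2.2).
have [N hN] := hloc x y x01 y01.
by exact: (pQ N (hN _ _ _ (leqnn N) (a1 N) (a2 N) (b1 N) (b2 N) (hx N) (hy N))).
Qed.

End Cousin.

Section Average.
Variable R : realType.
Local Notation C := (Cplx R).
Local Notation nrm := (@nrm R).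
Local Notation dyad := (@dyad R).
Implicit Types f g : R -> C.

Definition avn f (n : nat) : C := (dyad n)%:C * \sum_(k < 2 ^ n) f (k%:R * dyad n).

(* [avg f] is the integral of [f] over [0, 1], as a limit of dyadic Riemann sums. *)
Definition avg f : C := get (cvC (avn f)).

Definition rcont f (a b : R) := forall x, a <= x <= b -> forall e : R, 0 < e ->
  exists2 d : R, 0 < d & forall y, a <= y <= b -> `|y - x| < d -> nrm (f y - f x) <= e.

(** By [cousin2], for a property of the first coordinate. Only [x] is confined to the dyadic
    interval, while [y] ranges over all of [[0, 1]], so that adjacent intervals can be joined. *)
Lemma ucont f : rcont f 0 1 -> forall e : R, 0 < e -> exists2 d : R, 0 < d &
  forall x y : R, 0 <= x <= 1 -> 0 <= y <= 1 -> `|x - y| < d -> nrm (f x - f y) <= e.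
Proof.
move=> hf e e0.
pose Q := fun (n : nat) (a b : R) => exists2 d : R, 0 < d &
  forall x y : R, a <= x <= a + dyad n -> 0 <= x <= 1 -> 0 <= y <= 1 -> `|x - y| < d -> nrm (f x - f y) <= e.
suff [d d0 hd] : Q 0%N 0 0.
  by exists d => // x y hx hy; apply: hd => //; rewrite add0r dy0.
apply: cousin2.
  move=> n a b [d1 d10 h1] [d2 d20 h2] _ _; exists (Num.min d1 d2); first by rewrite lt_min d10.
  move=> x y; rewrite dyS => /andP[x1 x2] x01 y01; rewrite lt_min => /andP[l1 l2].
  have [h|h] := leP x (a + dyad n.+1); first by apply: h1 => //; rewrite x1.
  by apply: h2 => //; rewrite (ltW h) /= -addrA.
move=> x y0 x01 _; have e2 : 0 < e / 2 by lra.
have [d d0 hd] := hf x x01 _ e2.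
have [N hN] := dy_small (divr_gt0 d0 (ltr0Sn _ 3) : 0 < d / 4); exists N => n a b /hN h _ _ _ _ ax _.
exists (d / 4); first lra.
move=> s t sa s01 t01 st.
have ht : `|t - x| < d.
  have -> : t - x = (s - x) - (s - t) by ring.
  have := ler_normB (s - x) (s - t).
  have : `|s - x| <= d / 4 by rewrite ler_norml; lra.
  lra.
have hs : `|s - x| < d by have : `|s - x| <= d / 4 by [rewrite ler_norml; lra]; lra.
have H1 := hd _ s01 hs; have H2 := hd _ t01 ht.
have -> : f s - f t = (f s - f x) - (f t - f x) by ring.
by apply: (le_trans (nrmB _ _)); lra.
Qed.

Lemma sum_dy (n : nat) (c : C) : (dyad n)%:C * \sum_(k < 2 ^ n) c = c.
Proof.
rewrite sumr_const card_ord -mulr_natl mulrA.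
have -> : (dyad n)%:C * ((2 ^ n)%:R : C) = ((2 ^ n)%:R * dyad n)%:C.
  by rewrite rmorphM rmorph_nat mulrC.
by rewrite dy_nat mul1r.
Qed.

Lemma avn_le f g n (e : R) : (forall x, 0 <= x < 1 -> nrm (f x - g x) <= e) ->
  nrm (avn f n - avn g n) <= e.
Proof.
move=> h; rewrite /avn -mulrBr -sumrB nrmM nrm_real gtr0_norm ?dy_gt0 //.
have -> : e = dyad n * \sum_(k < 2 ^ n) e.
  by rewrite sumr_const card_ord -mulr_natl mulrA [dyad n * _]mulrC dy_nat mul1r.
rewrite ler_wpM2l ?(ltW (dy_gt0 _ _)) // (le_trans (nrm_sum _ _ _)) // ler_sum // => k _.
apply: h; rewrite mulr_ge0 ?(ltW (dy_gt0 _ _)) //= -[ltRHS](dy_nat R n).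
by rewrite ltr_pM2r ?dy_gt0 // ltr_nat.
Qed.

Lemma avn_bound f n (e : R) : (forall x, 0 <= x < 1 -> nrm (f x) <= e) -> nrm (avn f n) <= e.
Proof.
move=> h; have := @avn_le f (fun=> 0) n e; rewrite {2}/avn big1 // mulr0 subr0; apply.
by move=> x /h; rewrite subr0.
Qed.

Lemma avnS f n : avn f n.+1 =
  2^-1%:C * (avn (fun t => f (t / 2)) n + avn (fun t => f (2^-1 + t / 2)) n).
Proof.
rewrite /avn -mulrDr mulrA.
have -> : (2^-1)%:C * (dyad n)%:C = (dyad n.+1)%:C :> C by rewrite -rmorphM dyh.
congr (_ * _).
have -> : (2 ^ n.+1 = 2 ^ n + 2 ^ n)%N by rewrite expnS mul2n addnn.
rewrite big_split_ord /=; congr (_ + _); apply: eq_bigr => k _; congr f.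
  by rewrite (dyS R n); field.
have h := dy_nat R n; rewrite dyS in h.
have e : (2 ^ n)%:R * dyad n.+1 = 2^-1 by lra.
by rewrite natrD mulrDl e (dyS R n); field.
Qed.

(** By [avnS] both halves of [f] are rescaled to the unit interval, where a modulus at [dyad n.+1]
    becomes one at [dyad n]; hence [f] stays general in the induction. *)
Lemma avn_modulus n : forall f j (e : R),
  (forall x y : R, 0 <= x <= 1 -> 0 <= y <= 1 -> `|x - y| <= dyad n -> nrm (f x - f y) <= e) ->
  nrm (avn f (n + j) - avn f n) <= e.
Proof.
elim: n => [|n IH] f j e h.
  have -> : avn f 0 = avn (fun=> f 0) (0 + j).
    by rewrite /avn sum_dy dy0 mul1r expn0 big_ord1 mul0r.
  by apply: avn_le => x x01; apply: h; rewrite ?subr0 ?dy0 ?ger0_norm; lra.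
rewrite addSn !avnS -mulrBr opprD addrACA nrmM nrm_real ger0_norm; last by rewrite invr_ge0.
have h1 : nrm (avn (fun t => f (t / 2)) (n + j) - avn (fun t => f (t / 2)) n) <= e.
  apply: IH => x y hx hy xy; apply: h; try lra.
  by rewrite -mulrBl normrM (@ger0_norm _ 2^-1) ?invr_ge0 //; have := dyS R n; lra.
have h2 : nrm (avn (fun t => f (2^-1 + t / 2)) (n + j) - avn (fun t => f (2^-1 + t / 2)) n) <= e.
  apply: IH => x y hx hy xy; apply: h; try lra.
  rewrite [_ + _ - _](_ : _ = (x - y) / 2); last by ring.
  by rewrite normrM (@ger0_norm _ 2^-1) ?invr_ge0 //; have := dyS R n; lra.
have := nrmD (avn (fun t => f (t / 2)) (n + j) - avn (fun t => f (t / 2)) n)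
 (avn (fun t => f (2^-1 + t / 2)) (n + j) - avn (fun t => f (2^-1 + t / 2)) n).
lra.
Qed.

Lemma avg_cvC f : rcont f 0 1 -> cvC (avn f) (avg f).
Proof.
move=> hf; suff : exists l, cvC (avn f) l by move=> h; exact: (getPex h).
apply: C_complete => e e0; have e2 : 0 < e / 2 by lra.
have [d d0 hd] := ucont hf e2; have [N hN] := dy_small (divr_gt0 d0 (ltr0Sn _ 1) : 0 < d / 2).
have key n : (N <= n)%N -> nrm (avn f n - avn f N) <= e / 2.
  move=> Nn; rewrite -(subnKC Nn); apply: avn_modulus => x y hx hy xy; apply: hd => //.
  by have := hN _ (leqnn N); lra.
exists N => n m /key h1 /key h2.
have -> : avn f n - avn f m = (avn f n - avn f N) - (avn f m - avn f N) by ring.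
by apply: (le_trans (nrmB _ _)); lra.
Qed.

Lemma avgE f l : cvC (avn f) l -> avg f = l.
Proof. by move=> h; exact: (cvC_uniq (getPex (ex_intro _ l h)) h). Qed.

Lemma avg_ext f g : (forall x, 0 <= x < 1 -> f x = g x) -> avg f = avg g.
Proof.
move=> fg; rewrite /avg; congr get; congr cvC; apply: funext => n.
rewrite /avn; congr (_ * _); apply: eq_bigr => k _; apply: fg.
rewrite mulr_ge0 ?(ltW (dy_gt0 _ _)) //= -[ltRHS](dy_nat R n).
by rewrite ltr_pM2r ?dy_gt0 // ltr_nat.
Qed.

Lemma avg_cst (c : C) : avg (fun=> c) = c.
Proof. by apply: avgE; apply: (cvC_ext _ (cvC_cst c)) => n; rewrite /avn sum_dy. Qed.

Lemma avgD f g : rcont f 0 1 -> rcont g 0 1 -> avg (fun t => f t + g t) = avg f + avg g.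
Proof.
move=> /avg_cvC hf /avg_cvC hg; apply: avgE.
apply: (cvC_ext _ (cvCD hf hg)) => n.
by rewrite /avn -mulrDr big_split.
Qed.

Lemma avgZ f c : rcont f 0 1 -> avg (fun t => c * f t) = c * avg f.
Proof.
move=> /avg_cvC hf; apply: avgE; apply: (cvC_ext _ (cvCZ c hf)) => n.
by rewrite /avn -mulr_sumr mulrCA.
Qed.

Lemma rcontZ f c a b : rcont f a b -> rcont (fun t => c * f t) a b.
Proof.
move=> hf x hx e e0; have c0 : 0 < nrm c + 1 by rewrite ltr_wpDl ?nrm_ge0.
have [d d0 hd] := hf x hx _ (divr_gt0 e0 c0); exists d => // y hy xy.
rewrite -mulrBr nrmM; have := hd _ hy xy; rewrite ler_pdivlMr // => h; apply: le_trans h.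
by rewrite mulrC ler_wpM2l ?nrm_ge0 // lerDl.
Qed.

Lemma rcontD f g a b : rcont f a b -> rcont g a b -> rcont (fun t => f t + g t) a b.
Proof.
move=> hf hg x hx e e0; have e2 : 0 < e / 2 by lra.
have [d d0 hd] := hf x hx _ e2; have [d' d'0 hd'] := hg x hx _ e2.
exists (Num.min d d'); first by rewrite lt_min d0.
move=> y hy; rewrite lt_min => /andP[/(hd _ hy) h1 /(hd' _ hy) h2].
by rewrite opprD addrACA (le_trans (nrmD _ _)) //; lra.
Qed.

Lemma rcontN f a b : rcont f a b -> rcont (fun t => - f t) a b.
Proof.
move=> hf x hx e e0; have [d d0 hd] := hf x hx _ e0; exists d => // y hy /(hd _ hy).
by rewrite -opprD nrmN.
Qed.

Lemma avgB f g : rcont f 0 1 -> rcont g 0 1 -> avg (fun t => f t - g t) = avg f - avg g.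
Proof.
move=> hf hg; rewrite avgD //; last exact: rcontN.
congr (_ + _); rewrite -mulN1r -avgZ //; congr avg; apply: funext => t; by rewrite mulN1r.
Qed.

Lemma avg_bound f (e : R) : rcont f 0 1 -> (forall x, 0 <= x < 1 -> nrm (f x) <= e) -> nrm (avg f) <= e.
Proof. by move=> /avg_cvC hf h; apply: (cvC_bound hf) => n; apply: avn_bound. Qed.

Lemma rcont_scale f c r : 0 <= c <= 1 -> 0 <= r <= 1 -> c + r <= 1 -> rcont f 0 1 ->
  rcont (fun t => f (c + t * r)) 0 1.
Proof.
move=> c01 r01 cr hf x hx e e0.
have in01 y : 0 <= y <= 1 -> 0 <= c + y * r <= 1.
  move=> /andP[y0 y1]; have h1 : 0 <= y * r by apply: mulr_ge0; lra.
  have h2 : y * r <= 1 * r by apply: ler_wpM2r; lra.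
  lra.
have [d d0 hd] := hf (c + x * r) (in01 _ hx) _ e0.
exists d => // y hy xy; apply: hd; first exact: in01.
rewrite [_ - _](_ : _ = (y - x) * r); last by ring.
rewrite normrM; apply: le_lt_trans xy; rewrite ler_piMr // ger0_norm; lra.
Qed.

Lemma avg_split f : rcont f 0 1 ->
  avg f = 2^-1%:C * (avg (fun t => f (t / 2)) + avg (fun t => f (2^-1 + t / 2))).
Proof.
move=> hf; apply: avgE.
have h1 : rcont (fun t => f (t / 2)) 0 1.
  have := @rcont_scale f 0 2^-1 _ _ _ hf.
  rewrite (_ : (fun t => f (0 + t / 2)) = (fun t => f (t / 2))); last by apply: funext => t; rewrite add0r.
  by apply; lra.
have h2 : rcont (fun t => f (2^-1 + t / 2)) 0 1 by apply: rcont_scale => //; lra.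
have := cvCZ (2^-1%:C) (cvCD (avg_cvC h1) (avg_cvC h2)) => h e /h[N hN].
by exists N.+1 => -[//|n] hn; rewrite avnS; apply: hN.
Qed.

Lemma avg_id : avg (fun t => t%:C) = 2^-1%:C.
Proof.
have hn n : \sum_(k < n) (k%:R : R) = n%:R * (n%:R - 1) / 2.
  elim: n => [|n IH]; first by rewrite big_ord0 !mul0r.
  by rewrite big_ord_recr /= IH -addn1 natrD; field.
apply: avgE => e e0; have [N hN] := dy_small e0; exists N => n /hN h.
have -> : avn (fun t => t%:C) n = ((1 - dyad n) / 2)%:C.
  rewrite /avn -rmorph_sum -rmorphM /= -mulr_suml hn; congr (_%:C).
  have := dy_nat R n; move: ((2 ^ n)%:R) (dyad n) => a b ab.
  rewrite (_ : b * _ = (a * b) * (a * b - b) / 2); last by field.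
  by rewrite ab mul1r.
rewrite -rmorphB nrm_real (_ : _ - _ = - (dyad n / 2)); last by field.
rewrite normrN ger0_norm; have := dy_gt0 R n; lra.
Qed.

End Average.

Section Goursat.
Variable R : realType.
Local Notation C := (Cplx R).
Local Notation nrm := (@nrm R).
Local Notation dyad := (@dyad R).

(** The integral of $f(z)\,dz$ along the segment from [p] to [p + u]. *)
Definition seg (f : C -> C) (p u : C) : C := u * avg (fun t => f (p + t%:C * u)).

Definition par (p u v : C) (z : C) :=
  exists s t : R, [/\ 0 <= s <= 1, 0 <= t <= 1 & z = p + s%:C * u + t%:C * v].

(** The integral around the boundary of the parallelogram with corner [p] and sides [u], [v]. *)
Definition loop (f : C -> C) (p u v : C) : C :=
  seg f p u + seg f (p + u) v - seg f (p + v) u - seg f p v.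

Lemma rcont_seg (f : C -> C) (p u : C) :
  (forall t : R, 0 <= t <= 1 -> ccont f (p + t%:C * u)) -> rcont (fun t => f (p + t%:C * u)) 0 1.
Proof.
move=> hf x hx e e0; have [d d0 hd] := hf x hx _ e0.
have u0 : 0 < nrm u + 1 by rewrite ltr_wpDl ?nrm_ge0.
exists (d / (nrm u + 1)); first by rewrite divr_gt0.
move=> y hy; rewrite ltr_pdivlMr // => h; apply/ltW/hd.
rewrite [_ - _](_ : _ = (y - x)%:C * u); last by rewrite rmorphB /=; ring.
rewrite nrmM nrm_real; apply: le_lt_trans h.
by rewrite ler_wpM2l // lerDl.
Qed.

Lemma seg_split (f : C -> C) (p u : C) :
  (forall t : R, 0 <= t <= 1 -> ccont f (p + t%:C * u)) ->
  seg f p u = seg f p (2^-1%:C * u) + seg f (p + 2^-1%:C * u) (2^-1%:C * u).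
Proof.
move=> /rcont_seg/avg_split h; rewrite /seg h.
have -> : (fun t : R => f (p + (t / 2)%:C * u)) = (fun t => f (p + t%:C * (2^-1%:C * u))).
  by apply: funext => t; congr f; rewrite rmorphM /=; ring.
have -> : (fun t : R => f (p + (2^-1 + t / 2)%:C * u)) =
    (fun t => f (p + 2^-1%:C * u + t%:C * (2^-1%:C * u))).
  by apply: funext => t; congr f; rewrite rmorphD rmorphM /=; ring.
ring.
Qed.

Lemma seg_affine (c l p u : C) : seg (fun z => c + l * z) p u = u * (c + l * (p + 2^-1%:C * u)).
Proof.
rewrite /seg; congr (_ * _).
have hc : rcont (fun t : R => t%:C : C) 0 1.
  by move=> x _ e e0; exists e => // y _ h; rewrite -rmorphB nrm_real ltW.
have -> : (fun t : R => c + l * (p + t%:C * u)) = (fun t : R => (c + l * p) + (l * u) * t%:C).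
  by apply: funext => t; ring.
rewrite avgD; [|by move=> x _ e e0; exists 1 => // y _ _; rewrite subrr nrm0 ltW|exact: rcontZ].
by rewrite avg_cst avgZ // avg_id; ring.
Qed.

Lemma loop_affine (c l p u v : C) : loop (fun z => c + l * z) p u v = 0.
Proof. by rewrite /loop !seg_affine; ring. Qed.

Lemma segB (f g : C -> C) (p u : C) :
  (forall t : R, 0 <= t <= 1 -> ccont f (p + t%:C * u)) ->
  (forall t : R, 0 <= t <= 1 -> ccont g (p + t%:C * u)) ->
  seg (fun z => f z - g z) p u = seg f p u - seg g p u.
Proof. by move=> /rcont_seg hf /rcont_seg hg; rewrite /seg avgB // mulrBr. Qed.

Lemma seg_bound (f : C -> C) (p u : C) (e : R) :
  (forall t : R, 0 <= t <= 1 -> ccont f (p + t%:C * u)) ->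
  (forall t : R, 0 <= t <= 1 -> nrm (f (p + t%:C * u)) <= e) ->
  nrm (seg f p u) <= nrm u * e.
Proof.
move=> /rcont_seg hf h; rewrite /seg nrmM ler_wpM2l ?nrm_ge0 //.
by apply: avg_bound => // x /andP[x0 x1]; apply: h; rewrite x0 ltW.
Qed.

Lemma par_bottom p u v t : 0 <= t <= 1 -> par p u v (p + t%:C * u).
Proof. by move=> ht; exists t, 0; rewrite mul0r addr0 lexx ler01. Qed.
Lemma par_right p u v t : 0 <= t <= 1 -> par p u v (p + u + t%:C * v).
Proof. by move=> ht; exists 1, t; rewrite mul1r lexx ler01. Qed.
Lemma par_top p u v t : 0 <= t <= 1 -> par p u v (p + v + t%:C * u).
Proof. by move=> ht; exists t, 1; rewrite mul1r lexx ler01; split=> //; ring. Qed.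
Lemma par_left p u v t : 0 <= t <= 1 -> par p u v (p + t%:C * v).
Proof. by move=> ht; exists 0, t; rewrite mul0r addr0 lexx ler01. Qed.

Lemma loop_bound (f : C -> C) (p u v : C) (e : R) :
  (forall z, par p u v z -> ccont f z) -> (forall z, par p u v z -> nrm (f z) <= e) ->
  nrm (loop f p u v) <= 2 * (nrm u + nrm v) * e.
Proof.
move=> hf h.
have h1 : nrm (seg f p u) <= nrm u * e.
  by apply: seg_bound => t ht; [apply: hf|apply: h]; exact: par_bottom.
have h2 : nrm (seg f (p + u) v) <= nrm v * e.
  by apply: seg_bound => t ht; [apply: hf|apply: h]; exact: par_right.
have h3 : nrm (seg f (p + v) u) <= nrm u * e.
  by apply: seg_bound => t ht; [apply: hf|apply: h]; exact: par_top.
have h4 : nrm (seg f p v) <= nrm v * e.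
  by apply: seg_bound => t ht; [apply: hf|apply: h]; exact: par_left.
rewrite /loop; apply: (le_trans (nrmB _ _)).
have := nrmB (seg f p u + seg f (p + u) v) (seg f (p + v) u).
have := nrmD (seg f p u) (seg f (p + u) v).
lra.
Qed.

Lemma loopB (f g : C -> C) (p u v : C) :
  (forall z, par p u v z -> ccont f z) -> (forall z, par p u v z -> ccont g z) ->
  loop (fun z => f z - g z) p u v = loop f p u v - loop g p u v.
Proof.
move=> hf hg; rewrite /loop !segB; first ring.
all: move=> t ht; (apply: hf || apply: hg);
  by [exact: par_bottom|exact: par_right|exact: par_top|exact: par_left].
Qed.

Lemma loop_split (f : C -> C) (p u v : C) : (forall z, par p u v z -> ccont f z) ->
  let h : C := 2^-1%:C in
  loop f p u v = loop f p (h * u) (h * v) + loop f (p + h * u) (h * u) (h * v)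
   + loop f (p + h * v) (h * u) (h * v) + loop f (p + h * u + h * v) (h * u) (h * v).
Proof.
move=> hf h.
have hh : h + h = 1.
  by rewrite /h -rmorphD /= (_ : 2^-1 + 2^-1 = 1) //; field.
rewrite /loop.
rewrite (seg_split (p := p) (u := u)); last by move=> t ht; apply: hf; exact: par_bottom.
rewrite (seg_split (p := p + u) (u := v)); last by move=> t ht; apply: hf; exact: par_right.
rewrite (seg_split (p := p + v) (u := u)); last by move=> t ht; apply: hf; exact: par_top.
rewrite (seg_split (p := p) (u := v)); last by move=> t ht; apply: hf; exact: par_left.
rewrite -/h.
have -> : p + h * u + h * u = p + u by rewrite -addrA -mulrDl hh mul1r.
have -> : p + h * v + h * v = p + v by rewrite -addrA -mulrDl hh mul1r.
have -> : p + h * u + h * v + h * u = p + u + h * v.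
  by rewrite -[in RHS](mul1r u) -hh; ring.
have -> : p + h * u + h * v + h * v = p + v + h * u.
  by rewrite -[in RHS](mul1r v) -hh; ring.
have -> : p + h * v + h * u = p + h * u + h * v by ring.
do ?[move: (seg _ _ _) => ?]; ring.
Qed.

Lemma ccont_affine (c l z : C) : ccont (fun z => c + l * z) z.
Proof.
apply: cdiffb_ccont; apply: cdiffbD; first exact: cdiffb_cst.
by apply: cdiffbM; [exact: cdiffb_cst|exact: cdiffb_id].
Qed.

Lemma ccontB (f g : C -> C) z : ccont f z -> ccont g z -> ccont (fun w => f w - g w) z.
Proof.
move=> hf hg e e0; have e2 : 0 < e / 2 by lra.
have [d d0 hd] := hf _ e2; have [d' d'0 hd'] := hg _ e2.
exists (Num.min d d'); first by rewrite lt_min d0.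
move=> w; rewrite lt_min => /andP[/hd h1 /hd' h2].
rewrite (_ : _ - _ = (f w - f z) - (g w - g z)); last by ring.
by apply: (le_lt_trans (nrmB _ _)); lra.
Qed.

(** Near a point [f] is affine up to [e] times the distance, and affine functions have loop integral
    0. A small parallelogram thus contributes at most a constant times its squared side, a bound
    that adds up under bisection. *)
Theorem goursat (f : C -> C) (p u v : C) : (forall z, par p u v z -> cdiffb f z) ->
  loop f p u v = 0.
Proof.
move=> hf; apply: eq_nrm => e0 e00; rewrite subr0.
pose K := nrm u + nrm v + 1.
have nu := nrm_ge0 u; have nv := nrm_ge0 v.
have K0 : 0 < K by rewrite /K; lra.
(* Makes [2 * (dyad n * K) * (e * (dyad n * K))] equal to [e0 * (dyad n * dyad n)]. *)
pose e := e0 / (2 * K * K).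
have e_gt0 : 0 < e by rewrite divr_gt0 // !mulr_gt0.
pose Q := fun n (a b : R) => 0 <= a -> a + dyad n <= 1 -> 0 <= b -> b + dyad n <= 1 ->
  nrm (loop f (p + a%:C * u + b%:C * v) ((dyad n)%:C * u) ((dyad n)%:C * v)) <= e0 * (dyad n * dyad n).
have sub n (a b : R) z : 0 <= a -> a + dyad n <= 1 -> 0 <= b -> b + dyad n <= 1 ->
    par (p + a%:C * u + b%:C * v) ((dyad n)%:C * u) ((dyad n)%:C * v) z ->
  exists s t : R, [/\ a <= s <= a + dyad n, b <= t <= b + dyad n & z = p + s%:C * u + t%:C * v].
  move=> a0 a1 b0 b1 [s [t [hs ht ->]]]; have d0 := dy_gt0 R n.
  have sd0 : 0 <= s * dyad n by apply: mulr_ge0; lra.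
  have sd1 : s * dyad n <= 1 * dyad n by apply: ler_wpM2r; lra.
  have td0 : 0 <= t * dyad n by apply: mulr_ge0; lra.
  have td1 : t * dyad n <= 1 * dyad n by apply: ler_wpM2r; lra.
  exists (a + s * dyad n), (b + t * dyad n); split; [lra|lra|].
  by rewrite !rmorphD !rmorphM /=; ring.
have sub' n (a b : R) z : 0 <= a -> a + dyad n <= 1 -> 0 <= b -> b + dyad n <= 1 ->
    par (p + a%:C * u + b%:C * v) ((dyad n)%:C * u) ((dyad n)%:C * v) z -> par p u v z.
  move=> a0 a1 b0 b1 /(sub _ _ _ _ a0 a1 b0 b1)[s [t [hs ht ->]]].
  by exists s, t; split=> //; lra.
suff : Q 0%N 0 0.
  rewrite /Q dy0 !add0r !mulr1 mul0r mul1r mul0r mul1r !addr0.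
  by apply.
apply: cousin2.
  move=> n a b q1 q2 q3 q4 a0 a1 b0 b1.
  have dS := dyS R n; have d0 := dy_gt0 R n.+1.
  have i1 : a + dyad n.+1 <= 1 by lra.
  have i2 : b + dyad n.+1 <= 1 by lra.
  have i3 : 0 <= a + dyad n.+1 by lra.
  have i4 : a + dyad n.+1 + dyad n.+1 <= 1 by lra.
  have i5 : 0 <= b + dyad n.+1 by lra.
  have i6 : b + dyad n.+1 + dyad n.+1 <= 1 by lra.
  rewrite loop_split; last by move=> z /(sub' _ _ _ _ a0 a1 b0 b1)/hf/cdiffb_ccont.
  have e1 (w : C) : (2^-1)%:C * ((dyad n)%:C * w) = (dyad n.+1)%:C * w.
    by rewrite mulrA -rmorphM dyh.
  rewrite /= !e1.
  have e2 : p + a%:C * u + b%:C * v + (dyad n.+1)%:C * u = p + (a + dyad n.+1)%:C * u + b%:C * v.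
    by rewrite rmorphD /=; ring.
  have e3 a' : p + a'%:C * u + b%:C * v + (dyad n.+1)%:C * v = p + a'%:C * u + (b + dyad n.+1)%:C * v.
    by rewrite rmorphD /=; ring.
  rewrite e2 !e3.
  have h1 := q1 a0 i1 b0 i2; have h2 := q2 i3 i4 b0 i2.
  have h3 := q3 a0 i1 i5 i6; have h4 := q4 i3 i4 i5 i6.
  have -> : e0 * (dyad n * dyad n) = e0 * (dyad n.+1 * dyad n.+1) + e0 * (dyad n.+1 * dyad n.+1)
     + e0 * (dyad n.+1 * dyad n.+1) + e0 * (dyad n.+1 * dyad n.+1) by rewrite dS; ring.
  apply: (le_trans (nrmD _ _)); apply: lerD h4.
  apply: (le_trans (nrmD _ _)); apply: lerD h3.
  exact: (le_trans (nrmD _ _)) (lerD h1 h2).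
move=> x y hx hy; pose z := p + x%:C * u + y%:C * v.
have [l hl] : cdiffb f z by apply: hf; exists x, y.
have [d d0 hd] := hl _ e_gt0.
have [N hN] := dy_small (divr_gt0 d0 (mulr_gt0 (ltr0Sn _ 1) K0) : 0 < d / (2 * K)).
exists N => n a b /hN hn _ _ _ _ ax bx a0 a1 b0 b1.
have dn := dy_gt0 R n.
set P := p + _ + _; set U := _ * u; set V := _ * v.
pose g := fun w => (f z - l * z) + l * w.
have gc w : ccont g w by exact: ccont_affine.
have fc w : par P U V w -> ccont f w by move=> /(sub' _ _ _ _ a0 a1 b0 b1)/hf/cdiffb_ccont.
have -> : loop f P U V = loop (fun w => f w - g w) P U V.
  by rewrite loopB // loop_affine subr0.
have key w : par P U V w -> nrm (f w - g w) <= e * (dyad n * K).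
  move=> /(sub _ _ _ _ a0 a1 b0 b1)[s [t [hs ht hw]]].
  have wz : nrm (w - z) <= dyad n * K.
    have -> : w - z = (s - x)%:C * u + (t - y)%:C * v.
      by rewrite hw /z !rmorphB /=; ring.
    apply: (le_trans (nrmD _ _)); rewrite !nrmM !nrm_real.
    have h1 : `|s - x| <= dyad n by rewrite ler_norml; lra.
    have h2 : `|t - y| <= dyad n by rewrite ler_norml; lra.
    have : `|s - x| * nrm u <= dyad n * nrm u by rewrite ler_wpM2r.
    have : `|t - y| * nrm v <= dyad n * nrm v by rewrite ler_wpM2r.
    rewrite /K; lra.
  have wd : nrm (w - z) < d.
    apply: (le_lt_trans wz); have := hn; rewrite ler_pdivlMr ?mulr_gt0 // => hh.
    have : 0 < dyad n * K by rewrite mulr_gt0.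
    lra.
  have -> : f w - g w = f w - f z - l * (w - z) by rewrite /g; ring.
  by apply: (le_trans (hd _ wd)); rewrite ler_wpM2l // ltW.
apply: (le_trans (loop_bound _ key)); first by move=> w /fc h; exact: ccontB.
rewrite /U /V !nrmM !nrm_real (gtr0_norm dn).
have -> : e0 * (dyad n * dyad n) = 2 * (dyad n * K) * (e * (dyad n * K)).
  by rewrite /e; field; rewrite gt_eqF.
have eK : 0 <= e * (dyad n * K).
  by apply: mulr_ge0; [exact: ltW|apply: mulr_ge0; exact: ltW].
apply: (ler_wpM2r eK).
have : 0 < dyad n * 1 by rewrite mulr1.
rewrite /K; lra.
Qed.

(* By Goursat, since the two sides parallel to [v] cancel. *)
Lemma avg_shift (f : C -> C) (p u v : C) : u != 0 ->
  (forall z, par p u v z -> cdiffb f z) ->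
  (forall t : R, 0 <= t < 1 -> f (p + u + t%:C * v) = f (p + t%:C * v)) ->
  avg (fun t => f (p + t%:C * u)) = avg (fun t => f (p + v + t%:C * u)).
Proof.
move=> u0 hf hper; have := goursat hf; rewrite /loop /seg.
rewrite (avg_ext hper) => h; apply: (mulfI u0); apply/eqP; rewrite -subr_eq0 -h.
apply/eqP; ring.
Qed.

End Goursat.

(** * Fourier expansions of periodic holomorphic functions *)

Section Shift.
Variable R : realType.
Local Notation C := (Cplx R).

Lemma sum_shift (V : zmodType) (a : nat -> V) N j : (forall i, a (i + N)%N = a i) ->
  \sum_(i < N) a (i + j)%N = \sum_(i < N) a i.
Proof.
move=> ha; elim: j => [|j IH]; first by apply: eq_bigr => i _; rewrite addn0.
have h1 : \sum_(i < N.+1) a (i + j)%N = a j + \sum_(i < N) a (i + j.+1)%N.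
  by rewrite big_ord_recl /= add0n; congr (_ + _); apply: eq_bigr => i _; rewrite /bump /= add1n addnS addSn.
have h2 : \sum_(i < N.+1) a (i + j)%N = \sum_(i < N) a (i + j)%N + a j.
  by rewrite big_ord_recr /= addnC ha.
by move: h1; rewrite h2 addrC IH => /addrI ->.
Qed.

(** A translation by [dyad R k] permutes, up to the period, the sample points of every finer Riemann
    sum; this is why only dyadic translations are treated. *)
Lemma avn_shift (F : R -> C) k n : (forall t, F (t + 1) = F t) -> (k <= n)%N ->
  avn (fun t => F (t + dyad R k)) n = avn F n.
Proof.
move=> hF kn; rewrite /avn; congr (_ * _).
have e : dyad R k = (2 ^ (n - k))%:R * dyad R n.
  by rewrite -{2}(subnK kn) /dyad exprD mulrA -/(dyad R (n - k)) dy_nat mul1r.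
under eq_bigr => i _ do rewrite e -mulrDl -natrD.
apply: (sum_shift (a := fun i => F (i%:R * dyad R n))) => i.
by rewrite natrD mulrDl dy_nat hF.
Qed.

Lemma avg_shift_dy (F : R -> C) k : (forall t, F (t + 1) = F t) ->
  rcont F 0 1 -> rcont (fun t => F (t + dyad R k)) 0 1 ->
  avg (fun t => F (t + dyad R k)) = avg F.
Proof.
move=> hF h1 h2; apply: avgE => e e0; have [N hN] := avg_cvC h1 e0.
exists (maxn N k) => n; rewrite geq_max => /andP[nN kn].
by rewrite avn_shift // hN.
Qed.

End Shift.

Section Fourier.
Variable R : realType.
Local Notation C := (Cplx R).
Local Notation E := (@e2pi R).
Local Notation nrm := (@nrm R).
Local Notation tpi := (@tpi R).
Local Notation tpii := (@tpii R).
Variables (h : C -> C) (Y : R).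
Hypothesis hol : forall z, Y < complex.Im z -> cdiffb h z.
Hypothesis per : forall z, Y < complex.Im z -> h (z + 1) = h z.

(* The [m]-th Fourier coefficient of [h] on the horizontal line through [p]. *)
Definition fcoef (m : int) (p : C) : C :=
  avg (fun t : R => h (p + t%:C) * E (- m%:~R * (p + t%:C))).

Lemma rcont_line (F : C -> C) (p : C) :
  (forall t : R, 0 <= t <= 1 -> ccont F (p + t%:C)) -> rcont (fun t => F (p + t%:C)) 0 1.
Proof.
move=> hF; have := @rcont_seg R F p 1.
rewrite (_ : (fun t : R => F (p + t%:C * 1)) = (fun t => F (p + t%:C))).
  by apply => t ht; rewrite mulr1; exact: hF.
by apply: funext => t; rewrite mulr1.
Qed.

Lemma Im_addr (p : C) (t : R) : complex.Im (p + t%:C) = complex.Im p.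
Proof. by case: p => a b /=; rewrite addr0. Qed.

Lemma cdiffb_Elin (c z : C) : cdiffb (fun w => E (c * w)) z.
Proof. by apply: cdiffb_E; apply: cdiffbM; [exact: cdiffb_cst|exact: cdiffb_id]. Qed.

Lemma cdiffb_hE (m : int) z : Y < complex.Im z -> cdiffb (fun w => h w * E (- m%:~R * w)) z.
Proof. by move=> hz; apply: cdiffbM; [exact: hol|exact: cdiffb_Elin]. Qed.

Lemma Eper (m : int) (z : C) : E (- m%:~R * (z + 1)) = E (- m%:~R * z).
Proof. by rewrite mulrDr mulr1 -mulrNz EDint. Qed.

(** Goursat on the parallelogram with sides [1] and [p' - p], whose other two edges cancel by
    periodicity. Coefficients can therefore be estimated at whatever height is convenient. *)
Lemma fcoef_indep m p p' : Y < complex.Im p -> Y < complex.Im p' -> fcoef m p = fcoef m p'.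
Proof.
move=> hp hp'; pose F := fun w => h w * E (- m%:~R * w).
have hpar (t : R) (z : C) : 0 <= t <= 1 -> z = p + t%:C * (p' - p) -> Y < complex.Im z.
  move=> ht ->; case: p hp => a b /= hp; case: p' hp' => c d /= hp'.
  have hm : Y < Num.min b d by rewrite lt_min hp.
  have m1 : Num.min b d <= b by rewrite ge_min lexx.
  have m2 : Num.min b d <= d by rewrite ge_min lexx orbT.
  move: (Num.min b d) hm m1 m2 => m' hm m1 m2.
  have q1 : 0 <= t * (d - m') by apply: mulr_ge0; lra.
  have q2 : 0 <= (1 - t) * (b - m') by apply: mulr_ge0; lra.
  lra.
have H : avg (fun t : R => F (p + t%:C * 1)) = avg (fun t : R => F (p + (p' - p) + t%:C * 1)).
  apply: avg_shift; first exact: oner_neq0.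
    move=> z [s [t [hs ht ->]]]; apply: cdiffb_hE.
    have -> : p + s%:C * 1 + t%:C * (p' - p) = (p + t%:C * (p' - p)) + s%:C by ring.
    by rewrite Im_addr; exact: (hpar t).
  move=> t /andP[t0 t1]; have -> : p + 1 + t%:C * (p' - p) = p + t%:C * (p' - p) + 1 by ring.
  rewrite /F Eper per //; apply: (hpar t) => //; by rewrite t0 ltW.
rewrite /fcoef; move: H.
rewrite (_ : (fun t : R => F (p + t%:C * 1)) = fun t => F (p + t%:C)); last first.
  by apply: funext => t; rewrite mulr1.
rewrite (_ : (fun t : R => F (p + (p' - p) + t%:C * 1)) = fun t => F (p' + t%:C)) //.
by apply: funext => t; rewrite mulr1; congr F; ring.
Qed.

Lemma fcoef_bound m p K : Y < complex.Im p ->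
  (forall t : R, 0 <= t < 1 -> nrm (h (p + t%:C)) <= K) ->
  nrm (fcoef m p) <= K * expR (tpi * (m%:~R * complex.Im p)).
Proof.
move=> hp hK; apply: avg_bound.
  apply: (rcont_line (F := fun w => h w * E (- m%:~R * w))) => t ht; apply: cdiffb_ccont; apply: cdiffb_hE.
  by rewrite Im_addr.
move=> t ht; rewrite nrmM nrmE.
have -> : complex.Im (- m%:~R * (p + t%:C)) = - (m%:~R * complex.Im p).
  have -> : (m%:~R : C) = (m%:~R : R)%:C by rewrite rmorph_int.
  by case: p hp hK => a b /= _ _; rewrite oppr0 mul0r !addr0 mulNr.
by rewrite mulrN opprK ler_wpM2r ?expR_ge0 // hK.
Qed.

Variables (z l : C).
Hypothesis hz : Y < complex.Im z.
Hypothesis hl : cdiff h z l.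

(* The difference quotient of [h] at [z] with respect to [E], extended by continuity. *)
Definition dquo (t : C) : C := if E t == 1 then l / tpii else (h (z + t) - h z) / (E t - 1).

Lemma dquo_ccont0 : ccont dquo 0.
Proof.
move=> e e0; have t0 := tpi_gt0 R; have ti := tpii_neq0 R.
pose L := nrm l + tpi; have L0 : 0 < L by rewrite /L ltr_wpDl ?nrm_ge0.
pose k := Num.min (tpi / 2) (e * tpi * tpi / (4 * L)).
have L4 : 0 < 4 * L by lra.
have k0 : 0 < k.
  rewrite lt_min; apply/andP; split; first lra.
  by apply: divr_gt0 => //; apply: mulr_gt0 => //; exact: mulr_gt0.
have k1 : k <= tpi / 2 by rewrite /k ge_min lexx.
have k2 : k * (4 * L) <= e * tpi * tpi.
  by rewrite -(ler_pdivlMr _ _ L4) /k ge_min lexx orbT.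
clearbody k.
have [d1 d10 h1] := hl k0; have [d2 d20 h2] := @cdiff_E0 R _ k0.
exists (Num.min d1 d2); first by rewrite lt_min d10.
have dq0 : dquo 0 = l / tpii by rewrite /dquo E0 eqxx.
move=> s; rewrite subr0 lt_min dq0 => /andP[s1 s2].
have [->|s0] := eqVneq s 0; first by rewrite dq0 subrr nrm0.
have ns : 0 < nrm s by rewrite nrm_gt0.
have := h1 (z + s); rewrite addrAC subrr add0r => /(_ s1) H1.
have := h2 s; rewrite subr0 E0 => /(_ s2) H2.
have big : tpi / 2 * nrm s <= nrm (E s - 1).
  have := ler_nrmBB (tpii * s) (tpii * s - (E s - 1)).
  rewrite (_ : tpii * s - (tpii * s - (E s - 1)) = E s - 1); last by ring.
  rewrite (nrmC (tpii * s)) nrmM nrm_tpii.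
  have : k * nrm s <= tpi / 2 * nrm s by rewrite ler_wpM2r // ltW.
  lra.
have bp : 0 < tpi / 2 * nrm s by rewrite mulr_gt0 ?divr_gt0.
have En : E s - 1 != 0 by rewrite -nrm_gt0 (lt_le_trans bp).
rewrite /dquo; case: eqP => [es|_]; first by rewrite es subrr eqxx in En.
have -> : (h (z + s) - h z) / (E s - 1) - l / tpii =
  ((h (z + s) - h z - l * s) * tpii - l * (E s - 1 - tpii * s)) / (tpii * (E s - 1)).
  by field; rewrite ti En.
rewrite nrmM nrmV nrmM nrm_tpii ltr_pdivrMr; last by rewrite mulr_gt0 // (lt_le_trans bp).
apply: (le_lt_trans (nrmB _ _)); rewrite !nrmM nrm_tpii.
have q1 : nrm (h (z + s) - h z - l * s) * tpi <= k * nrm s * tpi by rewrite ler_wpM2r // ltW.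
have q2 : nrm l * nrm (E s - 1 - tpii * s) <= nrm l * (k * nrm s) by rewrite ler_wpM2l ?nrm_ge0.
have q3 : e * (tpi * (tpi / 2 * nrm s)) <= e * (tpi * nrm (E s - 1)).
  by rewrite !ler_pM2l.
apply: lt_le_trans q3.
have q4 : k * (4 * L) * nrm s <= e * tpi * tpi * nrm s by rewrite ler_wpM2r // ltW.
have q5 : 0 < k * L * nrm s by rewrite !mulr_gt0.
rewrite /L in q4 q5; lra.
Qed.

Lemma dquo_ccont (t : C) : E t != 1 -> Y < complex.Im (z + t) -> ccont dquo t.
Proof.
move=> Et ht.
pose F := fun t : C => (h (z + t) - h z) / (E t - 1).
have cF : cdiffb F t.
  apply: cdiffb_div; first by rewrite subr_eq0.
    apply: cdiffbB; last exact: cdiffb_cst.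
    apply: (@cdiffb_comp R (fun t => z + t)); last exact: hol.
    by apply: cdiffbD; [exact: cdiffb_cst|exact: cdiffb_id].
  by apply: cdiffbB; [apply: cdiffb_E; exact: cdiffb_id|exact: cdiffb_cst].
have cE : ccont E t by apply: cdiffb_ccont; eexists; exact: cdiff_E.
have e0 : 0 < nrm (E t - 1) by rewrite nrm_gt0 subr_eq0.
have [d d0 hd] := cE _ e0.
move=> e /(cdiffb_ccont cF)[d' d'0 hd']; exists (Num.min d d'); first by rewrite lt_min d0.
move=> w; rewrite lt_min => /andP[/hd w1 /hd' w2].
have Ew : E w != 1.
  by apply/negP => /eqP ew; move: w1; rewrite ew nrmC ltxx.
by rewrite /dquo (negbTE Et) (negbTE Ew).
Qed.

Lemma dquo_per (t : R) : dquo (t + 1)%:C = dquo t%:C.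
Proof.
rewrite /dquo rmorphD /= ED1; case: eqP => // _; congr ((_ - _) / _).
by rewrite addrA per // Im_addr.
Qed.

(** At 0, 1, 2 continuity is carried over from 0 by periodicity; elsewhere the denominator does not
    vanish. The interval has length 2 to leave room for translates by at most 1. *)
Lemma dquo_real_cont (t : R) : 0 <= t <= 2 -> ccont dquo t%:C.
Proof.
have imz (s : R) : Y < complex.Im (z + s%:C) by rewrite Im_addr.
have perC (s : C) n : Y < complex.Im (z + s) -> dquo (s + n%:R) = dquo s.
  move=> hs; rewrite /dquo ED Enat mulr1; case: eqP => // _; congr ((_ - _) / _).
  elim: n => [|n IH]; first by rewrite addr0.
  rewrite -addn1 natrD !addrA per; first by rewrite -IH addrA.
  by rewrite -(rmorph_nat (real_complex R)) Im_addr.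
have atn n : ccont dquo n%:R.
  move=> e /dquo_ccont0[d d0 hd].
  exists (Num.min d (complex.Im z - Y)); first by rewrite lt_min d0 subr_gt0.
  move=> w; rewrite lt_min => /andP[w1 w2].
  have hw : Y < complex.Im (z + (w - n%:R)).
    have := le_lt_trans (ler_Im_nrm _) w2; rewrite ltr_norml.
    by move: (w - _) => [a b]; case: (z) => c d1 /=; lra.
  have -> : dquo w = dquo (w - n%:R) by rewrite -{1}(subrK n%:R w) perC.
  have -> : dquo n%:R = dquo 0 by rewrite -{1}[n%:R]add0r perC // addr0.
  by apply: hd; rewrite subr0.
move=> /andP[t0 t2].
have [->|tn0] := eqVneq t 0; first by have := atn 0%N.
have [->|tn1] := eqVneq t 1; first by have := atn 1%N.
have [->|tn2] := eqVneq t 2; first by have := atn 2%N; rewrite -(rmorph_nat (real_complex R)).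
apply: dquo_ccont => //; have [h1|h1] := ltP t 1.
  by apply: E_real_neq1; rewrite lt_def tn0 t0.
have -> : t%:C = (t - 1)%:C + 1 :> C by rewrite rmorphB /= subrK.
rewrite ED1; apply: E_real_neq1; rewrite subr_gt0 lt_def tn1 h1 /=.
by rewrite ltrBlDr lt_def eq_sym tn2.
Qed.

Definition bcoef (m : int) : C := avg (fun t : R => dquo t%:C * E (- m%:~R * t%:C)).

Lemma rcont_dquo (c : R) m : 0 <= c <= 1 ->
  rcont (fun t : R => dquo (t + c)%:C * E (- m%:~R * (t + c)%:C)) 0 1.
Proof.
move=> c01.
have H : rcont (fun t : R => (fun w => dquo w * E (- m%:~R * w)) (c%:C + t%:C)) 0 1.
  apply: (rcont_line (F := fun w => dquo w * E (- m%:~R * w))) => t t01.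
  have c1 : ccont dquo (c%:C + t%:C) by rewrite -rmorphD /=; apply: dquo_real_cont; lra.
  have c2 : ccont (fun w => E (- m%:~R * w)) (c%:C + t%:C) by apply: cdiffb_ccont; exact: cdiffb_Elin.
  move=> e e0.
  pose A := nrm (dquo (c%:C + t%:C)); pose B := nrm (E (- m%:~R * (c%:C + t%:C))).
  have A0 : 0 <= A := nrm_ge0 _; have B0 : 0 <= B := nrm_ge0 _.
  pose k := Num.min 1 (e / (A + B + 2)).
  have k0 : 0 < k by rewrite lt_min ltr01 divr_gt0 //; lra.
  have k1 : k <= 1 by rewrite /k ge_min lexx.
  have k2 : k * (A + B + 2) <= e.
    by rewrite -ler_pdivlMr /k ?ge_min ?lexx ?orbT //; lra.
  clearbody k.
  have [d1 d10 h1] := c1 _ k0; have [d2 d20 h2] := c2 _ k0.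
  exists (Num.min d1 d2); first by rewrite lt_min d10.
  move=> w; rewrite lt_min => /andP[/h1 H1 /h2 H2].
  set X := dquo w in H1 *; set X0 := dquo (_ + _) in H1 A A0 k2 *.
  set Z := E _ in H2 *; set Z0 := E (_ * (_ + _)) in H2 B B0 k2 *.
  have -> : X * Z - X0 * Z0 = (X - X0) * (Z - Z0) + ((X - X0) * Z0 + X0 * (Z - Z0)) by ring.
  apply: (le_lt_trans (nrmD _ _)); apply: (le_lt_trans (lerD (lexx _) (nrmD _ _))).
  rewrite !nrmM -/A -/B.
  have q1 : nrm (X - X0) * nrm (Z - Z0) <= k * 1.
    by apply: ler_pM; rewrite ?nrm_ge0 ?(ltW H1) ?(le_trans (ltW H2)).
  have q2 : nrm (X - X0) * B <= k * B by rewrite ler_wpM2r // ltW.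
  have q3 : A * nrm (Z - Z0) <= A * k by rewrite ler_wpM2l // ltW.
  lra.
move=> x hx e /(H x hx)[d d0 hd]; exists d => // y hy xy.
by have := hd y hy xy; rewrite /= -!rmorphD /= ![c + _]addrC.
Qed.

Lemma rcont_dquo0 m : rcont (fun t : R => dquo t%:C * E (- m%:~R * t%:C)) 0 1.
Proof.
have := @rcont_dquo 0 m; rewrite lexx ler01 => /(_ isT).
by rewrite (_ : (fun t : R => _) = (fun t : R => dquo t%:C * E (- m%:~R * t%:C))) //;
  apply: funext => t; rewrite addr0.
Qed.

(** Riemann-Lebesgue: translating by half a period of the exponential reverses its sign and so
    replaces [dquo] by half a difference of nearby values. The half period is dyadic for $|m|=2^k$,
    the indices that occur in [fourier_cvg]. *)
Lemma bcoef_small (e : R) : 0 < e -> exists N, forall k (m : int), (N <= k)%N -> `|m|%N = (2 ^ k)%N ->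
  nrm (bcoef m) <= e.
Proof.
move=> e0.
(* Rescaled so that uniform continuity on the unit interval covers [[0, 2]]. *)
have cg : rcont (fun t : R => dquo (t * 2)%:C) 0 1.
  have H : rcont (fun t : R => dquo (0 + t%:C * 2%:R)) 0 1.
    apply: rcont_seg => t t01; rewrite add0r.
    have -> : t%:C * 2%:R = (t * 2)%:C :> C by rewrite rmorphM /= rmorph_nat.
    by apply: dquo_real_cont; lra.
  move=> x hx e' e'0; have [d d0 hd] := H x hx e' e'0; exists d => // y hy xy.
  by have := hd y hy xy; rewrite !add0r !rmorphM /= !rmorph_nat.
have [d d0 hd] := ucont cg e0.
have [N hN] := dy_small (divr_gt0 d0 (ltr0Sn _ 1) : 0 < d / 2); exists N => k m Nk mk.
set s := dyad R k.+1.
have s0 : 0 < s by exact: dy_gt0.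
have s1 : s <= 2^-1.
  rewrite /s -dyh; have : dyad R k <= 1 by rewrite /dyad exprn_ile1 //; lra.
  lra.
have sd : s < d.
  have := hN _ Nk; have := dy_gt0 R k; rewrite /s -dyh; lra.
pose F := fun t : R => dquo t%:C * E (- m%:~R * t%:C).
have Fper t : F (t + 1) = F t.
  by rewrite /F dquo_per rmorphD /= Eper.
have Ems : E (- m%:~R * s%:C) = -1.
  have hs : (2 ^ k)%:R * s%:C = 2%:R^-1 :> C.
    rewrite -(rmorph_nat (real_complex R)) -rmorphM /= /s -dyh mulrCA dy_nat mulr1.
    by rewrite fmorphV rmorph_nat.
  have [->|->] : m = (2 ^ k)%N%:Z \/ m = - (2 ^ k)%N%:Z by lia.
    by rewrite -pmulrn mulNr hs EN Ehalf invrN1.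
  by rewrite mulrNz opprK -pmulrn hs Ehalf.
have r1 : rcont F 0 1 by exact: rcont_dquo0.
have r2 : rcont (fun t => F (t + s)) 0 1 by apply: rcont_dquo; lra.
have H : avg (fun t => F (t + s)) = avg F by exact: avg_shift_dy.
have -> : bcoef m = 2^-1%:C * avg (fun t => F t + F (t + s)).
  rewrite avgD // H -/(avg F) (_ : bcoef m = avg F) //.
  rewrite (_ : avg F + avg F = 2%:R * avg F); last by ring.
  by rewrite mulrA fmorphV rmorph_nat mulVf ?mul1r // pnatr_eq0.
have b2 : nrm (avg (fun t => F t + F (t + s))) <= e.
  apply: avg_bound; first exact: rcontD.
  move=> t t01.
  have -> : F t + F (t + s) = (dquo t%:C - dquo (t + s)%:C) * E (- m%:~R * t%:C).
    by rewrite /F rmorphD /= mulrDr ED Ems; ring.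
  rewrite nrmM nrmE.
  have -> : complex.Im (- m%:~R * t%:C : C) = 0.
    by rewrite -(rmorph_int (real_complex R)) /= mulr0 oppr0 mul0r addr0.
  rewrite mulr0 oppr0 expR0 mulr1.
  have := hd (t / 2) ((t + s) / 2); rewrite !divfK ?pnatr_eq0 //; apply.
  - lra.
  - lra.
  - by rewrite ltr_norml; lra.
rewrite nrmM nrm_real ger0_norm; last by rewrite invr_ge0.
lra.
Qed.

(** Raising the segment by ['i] leaves the integral unchanged but multiplies it by [E (m%:~R * 'i)],
    whose modulus is not 1. *)
Lemma avg_Eint (m : int) : m != 0 -> avg (fun t : R => E (m%:~R * t%:C)) = 0.
Proof.
move=> m0; pose F := fun w : C => E (m%:~R * w).
have H : avg (fun t : R => F (0 + t%:C * 1)) = avg (fun t : R => F (0 + 'i%C + t%:C * 1)).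
  apply: avg_shift; first exact: oner_neq0.
    by move=> w _; exact: cdiffb_Elin.
  by move=> t _; rewrite /F !add0r mulrDr mulr1 addrC EDint.
have rc : rcont (fun t : R => F (0 + t%:C * 1)) 0 1.
  by apply: rcont_seg => t _; apply: cdiffb_ccont; exact: cdiffb_Elin.
have H2 : avg (fun t : R => F (0 + 'i%C + t%:C * 1)) = E (m%:~R * 'i%C) * avg (fun t : R => F (0 + t%:C * 1)).
  by rewrite -avgZ //; congr avg; apply: funext => t; rewrite /F -ED; congr E; ring.
have e : (fun t : R => F (0 + t%:C * 1)) = (fun t : R => E (m%:~R * t%:C)).
  by apply: funext => t; rewrite add0r mulr1.
rewrite H2 e in H; apply/eqP; apply: contraT => a0.
have : E (m%:~R * 'i%C) = 1 by apply: (mulIf a0); rewrite -H mul1r.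
move=> /(congr1 nrm); rewrite nrm1 nrmE.
have -> : complex.Im (m%:~R * 'i%C : C) = m%:~R.
  by rewrite -(rmorph_int (real_complex R)) /= mulr1 mul0r addr0.
rewrite -[in RHS](@expR0 R) => /expR_inj/eqP.
by rewrite oppr_eq0 mulf_eq0 gt_eqF ?tpi_gt0 //= intr_eq0 (negbTE m0).
Qed.

(** From [h (z + t) = h z + (E t - 1) * dquo t]: the factor [E t - 1] turns the coefficients of
    [dquo] into differences of neighbours, so the partial sums of the Fourier series telescope. *)
Lemma fcoef_telescope (m : int) : fcoef m z * E (m%:~R * z) =
  (if m == 0 then h z else 0) + bcoef (m - 1) - bcoef m.
Proof.
have rE : rcont (fun t : R => E (- m%:~R * t%:C)) 0 1.
  have : rcont (fun t : R => (fun w => E (- m%:~R * w)) (0 + t%:C)) 0 1.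
    by apply: (rcont_line (F := fun w => E (- m%:~R * w))) => t _; apply: cdiffb_ccont; exact: cdiffb_Elin.
  by rewrite (_ : (fun t : R => _) = (fun t : R => E (- m%:~R * t%:C))) //; apply: funext => t; rewrite add0r.
have rh : rcont (fun t : R => h (z + t%:C) * E (- m%:~R * (z + t%:C))) 0 1.
  apply: (rcont_line (F := fun w => h w * E (- m%:~R * w))) => t ht; apply: cdiffb_ccont; apply: cdiffb_hE.
  by rewrite Im_addr.
have -> : fcoef m z * E (m%:~R * z) = avg (fun t : R => h (z + t%:C) * E (- m%:~R * t%:C)).
  rewrite mulrC -avgZ //; congr avg; apply: funext => t.
  by rewrite mulrCA -ED; congr (_ * E _); ring.
have -> : (if m == 0 then h z else 0) = avg (fun t : R => h z * E (- m%:~R * t%:C)).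
  rewrite avgZ //; have [->|m0] := eqVneq m 0.
    rewrite (_ : (fun t : R => _) = (fun=> 1)); first by rewrite avg_cst mulr1.
    by apply: funext => t; rewrite oppr0 mul0r E0.
  rewrite (_ : (fun t : R => _) = (fun t : R => E ((- m)%:~R * t%:C))); last first.
    by apply: funext => t; rewrite mulrNz.
  by rewrite avg_Eint ?oppr_eq0 // mulr0.
rewrite /bcoef -avgD; [|exact: rcontZ|exact: rcont_dquo0].
rewrite -avgB; [|by apply: rcontD; [exact: rcontZ|exact: rcont_dquo0]|exact: rcont_dquo0].
apply: avg_ext => t t01.
have -> : (m - 1)%:~R = m%:~R - 1 :> C by rewrite rmorphB.
have -> : E (- (m%:~R - 1) * t%:C) = E (- m%:~R * t%:C) * E t%:C.
  by rewrite -ED; congr E; ring.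
have key : h (z + t%:C) - h z = (E t%:C - 1) * dquo t%:C.
  rewrite /dquo; case: eqP => [et|/eqP et].
    have [->|t0] := eqVneq t 0; first by rewrite addr0 E0 !subrr mul0r.
    have := @E_real_neq1 R t; rewrite et eqxx => H.
    suff : false by []; apply: H; move: t01; rewrite [0 < t]lt_def t0; lra.
  by rewrite mulrC divfK // subr_eq0.
have -> : h (z + t%:C) = h z + (E t%:C - 1) * dquo t%:C by rewrite -key; ring.
ring.
Qed.

(** The frequency runs from [1 - M] to [n - M], and [h z] enters once frequency 0 has been reached,
    that is for [M <= n]. *)
Lemma fourier_sum M n : (0 < M)%N ->
  \sum_(i < n) fcoef (i%:Z - M%:Z + 1) z * E ((i%:Z - M%:Z + 1)%:~R * z) =
  (if (M <= n)%N then h z else 0) + bcoef (- M%:Z) - bcoef (n%:Z - M%:Z).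
Proof.
move=> M0; elim: n => [|n IH].
  by rewrite big_ord0 leqNgt M0 add0r sub0r subrr.
rewrite big_ord_recr /= IH fcoef_telescope addrK.
have -> : n%:Z - M%:Z + 1 = n.+1%:Z - M%:Z by lia.
have [e|ne] := eqVneq (n.+1%:Z - M%:Z) 0.
  have -> : M = n.+1 by lia.
  by rewrite ltnn leqnn; ring.
have -> : (M <= n.+1)%N = (M <= n)%N by lia.
by ring.
Qed.

Lemma fourier_cvg : cvC (fun k => \sum_(i < 2 * 2 ^ k)
   fcoef (i%:Z - (2 ^ k)%N%:Z + 1) z * E ((i%:Z - (2 ^ k)%N%:Z + 1)%:~R * z)) (h z).
Proof.
move=> e e0; have e2 : 0 < e / 2 by lra.
have [N hN] := bcoef_small e2; exists N => k Nk.
rewrite fourier_sum ?expn_gt0 //.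
have -> : (2 ^ k <= 2 * 2 ^ k)%N by lia.
have -> : (2 * 2 ^ k)%N%:Z - (2 ^ k)%N%:Z = (2 ^ k)%N%:Z by lia.
rewrite (_ : _ - h z = bcoef (- (2 ^ k)%N%:Z) - bcoef (2 ^ k)%N%:Z); last by ring.
apply: (le_trans (nrmB _ _)).
have h1 := hN k (- (2 ^ k)%N%:Z) Nk (abszN _).
have h2 := hN k ((2 ^ k)%N%:Z) Nk erefl.
lra.
Qed.

End Fourier.

(** * Expansions in nonnegative powers of e(z) *)

Section PosExpansion.
Variable R : realType.
Local Notation C := (Cplx R).
Local Notation E := (@e2pi R).
Local Notation nrm := (@nrm R).
Local Notation tpi := (@tpi R).

Lemma geom_bound (r : R) N K : 0 <= r -> r < 1 ->
  \sum_(N <= n < K) r ^+ n <= r ^+ N / (1 - r).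
Proof.
move=> r0 r1; have r1' : 0 < 1 - r by rewrite subr_gt0.
have [KN|NK] := leqP K N; first by rewrite big_geq // divr_ge0 ?exprn_ge0 // ltW.
rewrite ler_pdivlMr //.
have -> : (\sum_(N <= n < K) r ^+ n) * (1 - r) = r ^+ N - r ^+ K.
  transitivity (- \sum_(N <= n < K) (r ^+ n.+1 - r ^+ n)).
    by rewrite -sumrN mulr_suml; apply: eq_bigr => i _; rewrite exprS; ring.
  by rewrite telescope_sumr ?(ltnW NK) // opprB.
by rewrite lerBlDr lerDl exprn_ge0.
Qed.

Lemma expRN_le (x : R) : 0 <= x -> expR (- x) <= (1 + x)^-1.
Proof.
move=> x0; rewrite expRN lef_pV2 ?posrE ?expR_gt0 ?expR_ge1Dx //.
by rewrite ltr_wpDr.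
Qed.

Definition decay (y : R) : R := expR (- (tpi * y)).

(** Lets the height [d] above the boundary line tend to 0 by means of
    [1 - a * d <= expR (- (a * d))]. *)
Lemma ler_expR_lim (c K a : R) : 0 <= c -> 0 <= a ->
  (forall d : R, 0 < d -> c <= K * expR (a * d)) -> c <= K.
Proof.
move=> c0 a0 h; apply/ler_addgt0Pr => e e0.
pose d := e / (c * a + 1).
have ca0 : 0 <= c * a by exact: mulr_ge0.
have d0 : 0 < d by rewrite divr_gt0 // ltr_wpDl.
have ad0 : 0 <= a * d by rewrite mulr_ge0 // ltW.
have h1 : c * (1 - a * d) <= K.
  have h2 := h d d0.
  have h3 := expR_ge1Dx (- (a * d)); rewrite expRN in h3.
  have eg := expR_gt0 (a * d).
  apply: (@le_trans _ _ (c * (expR (a * d))^-1)).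
    by rewrite ler_wpM2l //; lra.
  by rewrite ler_pdivrMr.
have : c * a * d <= e.
  rewrite /d mulrA ler_pdivrMr ?ltr_wpDl // mulrC ler_wpM2l ?(ltW e0) //; lra.
lra.
Qed.

Variables (h : C -> C) (Y : R).
Hypothesis hol : forall z : C, Y < complex.Im z -> cdiffb h z.
Hypothesis per : forall z : C, Y < complex.Im z -> h (z + 1) = h z.

(** Raising the line of integration to height [y] multiplies the bound by $e^{2\pi my}$, which tends
    to 0 for negative [m]. The separate threshold [Y1] is for [schwarz], where the bound is
    available only near the cusp. *)
Lemma fcoef_neg (M Y1 : R) m p : (forall z : C, Y < complex.Im z -> Y1 < complex.Im z -> nrm (h z) <= M) ->
  m < 0 -> Y < complex.Im p -> fcoef h m p = 0.
Proof.
move=> bnd m0 hp; apply: eq_nrm => e e0; rewrite subr0.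
have t0 := tpi_gt0 R.
pose M1 : R := `|M| + 1; have M10 : 0 < M1 by rewrite ltr_wpDl.
pose y : R := `|Y| + `|Y1| + 1 + M1 / (e * tpi).
have q : 0 < M1 / (e * tpi) by rewrite divr_gt0 // mulr_gt0.
have y0 : Y < y by rewrite /y; have := ler_norm Y; have := normr_ge0 Y1; lra.
have y1 : Y1 < y by rewrite /y; have := ler_norm Y1; have := normr_ge0 Y; lra.
have yp : 0 <= y by rewrite /y; have := normr_ge0 Y; have := normr_ge0 Y1; lra.
have yq : M1 / (e * tpi) <= y by rewrite /y; have := normr_ge0 Y; have := normr_ge0 Y1; lra.
clearbody y.
rewrite (@fcoef_indep R h Y hol per m p (0 +i* y)) //.
apply: (le_trans (@fcoef_bound R h Y hol m (0 +i* y) M1 _ _)) => //=.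
  move=> t _; apply: (@le_trans _ _ M); last by rewrite /M1; have := ler_norm M; lra.
  by apply: bnd; rewrite Im_addr.
have m1 : (m%:~R : R) <= -1.
  have : m <= - 1%:Z by lia.
  by rewrite -(ler_int R) mulrNz.
have my : m%:~R * y <= - y by have := ler_wpM2r yp m1; lra.
apply: (@le_trans _ _ (M1 * expR (- (tpi * y)))).
  rewrite ler_wpM2l ?(ltW M10) // ler_expR -mulrN ler_wpM2l //; exact: ltW.
apply: (@le_trans _ _ (M1 * (1 + tpi * y)^-1)).
  by rewrite ler_wpM2l ?(ltW M10) // expRN_le // mulr_ge0 // ltW.
have ty : 0 < 1 + tpi * y by rewrite ltr_pwDl // mulr_ge0 // ltW.
rewrite ler_pdivrMr //.
have : M1 <= e * (tpi * y).
  have et : 0 < e * tpi by exact: mulr_gt0.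
  rewrite (_ : e * (tpi * y) = y * (e * tpi)); last by ring.
  by rewrite -(ler_pdivrMr _ _ et).
lra.
Qed.

Lemma fcoef_pos_bound (M : R) (n : nat) p : (forall z : C, Y < complex.Im z -> nrm (h z) <= M) ->
  Y < complex.Im p -> nrm (fcoef h n%:Z p) <= M * expR (tpi * (n%:R * Y)).
Proof.
move=> bnd hp; apply: (@ler_expR_lim _ _ (tpi * n%:R)); first exact: nrm_ge0.
  by rewrite mulr_ge0 // ltW ?tpi_gt0.
move=> d d0; have hy : Y < complex.Im (0 +i* (Y + d)) by rewrite /= ltrDl.
rewrite (@fcoef_indep R h Y hol per n p (0 +i* (Y + d))) //.
apply: (le_trans (@fcoef_bound R h Y hol n%:Z (0 +i* (Y + d)) M hy _)).
  by move=> t _; apply: bnd; rewrite Im_addr.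
rewrite -mulrA -expRD /= -pmulrn le_eqVlt; apply/orP; left; apply/eqP.
by congr (_ * expR _); ring.
Qed.

Lemma pos_expand (K : R) N z : 0 <= K ->
  (forall m, m < 0 -> fcoef h m z = 0) ->
  (forall n : nat, nrm (fcoef h n%:Z z) <= K * expR (tpi * (n%:R * Y))) ->
  Y < complex.Im z ->
  nrm (h z - \sum_(n < N) fcoef h n%:Z z * E (n%:R * z)) <=
    K * (decay (complex.Im z - Y) ^+ N / (1 - decay (complex.Im z - Y))).
Proof.
move=> K0 neg pos hz; set rho := decay _.
have rho0 : 0 <= rho by exact: expR_ge0.
have rho1 : rho < 1.
  by rewrite /rho /decay -[ltRHS](@expR0 R) ltr_expR oppr_lt0 mulr_gt0 ?tpi_gt0 // subr_gt0.
have [l hl] := hol hz.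
have hS := fourier_cvg hol per hz hl.
pose T := fun n : nat => fcoef h n%:Z z * E (n%:R * z).
have Tb n : nrm (T n) <= K * rho ^+ n.
  rewrite /T nrmM; apply: (@le_trans _ _ (K * expR (tpi * (n%:R * Y)) * nrm (E (n%:R * z)))).
    by rewrite ler_wpM2r ?nrm_ge0.
  rewrite EMn nrmX nrmE -mulrA ler_wpM2l // /rho /decay -!expRM_natr -expRD ler_expR.
  by rewrite le_eqVlt; apply/orP; left; apply/eqP; ring.
have hS2 : cvC (fun k => \sum_(n < (2 ^ k).+1) T n) (h z).
  apply: (cvC_ext _ hS) => k.
  (* Among the $2\cdot2^k$ terms the first $2^k-1$ have negative frequency and vanish. *)
  have -> : (2 * 2 ^ k = (2 ^ k).-1 + (2 ^ k).+1)%N by have := expn_gt0 2 k; lia.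
  rewrite big_split_ord /= big1 ?add0r.
    apply: eq_bigr => i _; rewrite /T.
    have -> : ((2 ^ k).-1 + i)%N%:Z - (2 ^ k)%N%:Z + 1 = i%:Z by have := expn_gt0 2 k; lia.
    by rewrite -pmulrn.
  by move=> i _; rewrite neg ?mul0r //; have := ltn_ord i; lia.
have [k0 hk0] : exists k0, forall k, (k0 <= k)%N -> (N <= (2 ^ k).+1)%N.
  exists N => k Nk; apply: leqW; apply: (leq_trans Nk); apply: ltnW; exact: ltn_expl.
have hS3 : cvC (fun k => \sum_(n < (2 ^ (k0 + k)).+1) T n - \sum_(n < N) T n) (h z - \sum_(n < N) T n).
  by apply: cvCB (cvC_cst _); apply: (cvC_sub hS2) => n; exact: leq_addl.
apply: (cvC_bound hS3) => k.
have hN := hk0 _ (leq_addr k k0).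
rewrite -(big_mkord xpredT T) (big_cat_nat (n := N)) //= big_mkord [X in nrm (X - _)]addrC addrK.
apply: (le_trans (nrm_sum _ _ _)).
apply: (@le_trans _ _ (\sum_(N <= n < (2 ^ (k0 + k)).+1) K * rho ^+ n)).
  by apply: ler_sum => n _; exact: Tb.
by rewrite -mulr_sumr ler_wpM2l // geom_bound.
Qed.

End PosExpansion.

(** * Consequences for holomorphic functions *)

Section Consequences.
Variable R : realType.
Local Notation C := (Cplx R).
Local Notation E := (@e2pi R).
Local Notation nrm := (@nrm R).
Local Notation tpi := (@tpi R).

Lemma bounded_expand (h : C -> C) (Y M : R) :
  (forall z : C, Y < complex.Im z -> cdiffb h z) ->
  (forall z : C, Y < complex.Im z -> h (z + 1) = h z) ->
  (forall z : C, Y < complex.Im z -> nrm (h z) <= M) ->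
  exists c : nat -> C, (forall n, nrm (c n) <= M * expR (tpi * (n%:R * Y))) /\
   forall (z : C) N, Y < complex.Im z ->
    nrm (h z - \sum_(n < N) c n * E (n%:R * z)) <=
      M * (decay (complex.Im z - Y) ^+ N / (1 - decay (complex.Im z - Y))).
Proof.
move=> hol per bnd; pose p : C := 0 +i* (Y + 1).
have hp : Y < complex.Im p by rewrite /= ltrDl.
have M0 : 0 <= M by apply: le_trans (bnd p hp); exact: nrm_ge0.
exists (fun n => fcoef h n%:Z p); split.
  by move=> n; exact: fcoef_pos_bound.
move=> z N hz.
have -> : \sum_(n < N) fcoef h n%:Z p * E (n%:R * z) = \sum_(n < N) fcoef h n%:Z z * E (n%:R * z).
  by apply: eq_bigr => n _; rewrite (@fcoef_indep R h Y hol per n p z).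
apply: pos_expand => //.
  by move=> m m0; apply: (@fcoef_neg R h Y hol per M Y) => // w hw _; exact: bnd.
by move=> n; exact: fcoef_pos_bound.
Qed.

(** If [b < a], the powers of [b / a] would fall below any positive bound. This removes the constant
    [K] from an estimate that holds for all powers. *)
Lemma ler_of_pow (a b K : R) : 0 <= a -> 0 <= b ->
  (forall n, a ^+ n <= b ^+ n * K) -> a <= b.
Proof.
move=> a0 b0 hn; rewrite leNgt; apply/negP => ba.
have a1 : 0 < a by exact: le_lt_trans ba.
have K0 : 0 < `|K| + 1 by rewrite ltr_wpDl.
have r0 : 0 <= b / a by rewrite divr_ge0.
have r1 : b / a < 1 by rewrite ltr_pdivrMr // mul1r.
have e0 : 0 < (2 * (`|K| + 1))^-1 by rewrite invr_gt0 mulr_gt0.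
have [N hN] := Rpow_small r0 r1 e0.
have h1 := hN _ (leqnn N); have h2 := hn N.
have aN : 0 < a ^+ N by rewrite exprn_gt0.
have h3 : 1 <= (b / a) ^+ N * K.
  by rewrite expr_div_n mulrAC ler_pdivlMr // mul1r.
have h4 : (b / a) ^+ N * K <= (2 * (`|K| + 1))^-1 * (`|K| + 1).
  apply: (@le_trans _ _ ((b / a) ^+ N * (`|K| + 1))).
    rewrite ler_wpM2l ?exprn_ge0 //; have := ler_norm K; lra.
  by rewrite ler_wpM2r // ltW.
have h5 : (2 * (`|K| + 1))^-1 * (`|K| + 1) = 2^-1 by field; rewrite gt_eqF.
lra.
Qed.

(* Schwarz lemma in the variable [q = E z]; the constant is recovered from the powers of [V / q]. *)
Lemma schwarz (V : C -> C) (M K Y1 : R) :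
  (forall z : C, 0 < complex.Im z -> cdiffb V z) ->
  (forall z : C, 0 < complex.Im z -> V (z + 1) = V z) ->
  (forall z : C, 0 < complex.Im z -> nrm (V z) <= M) ->
  (forall z : C, Y1 < complex.Im z -> nrm (V z) <= K * nrm (E z)) ->
  forall z : C, 0 < complex.Im z -> nrm (V z) <= M * nrm (E z).
Proof.
move=> hol per bnd dec z hz.
have M0 : 0 <= M by apply: le_trans (bnd z hz); exact: nrm_ge0.
pose W := fun z => V z * E (- 1 * z).
have Wz w : nrm (W w) = nrm (V w) / nrm (E w) by rewrite nrmM mulN1r EN nrmV.
have holW w : 0 < complex.Im w -> cdiffb W w.
  by move=> hw; apply: cdiffbM; [exact: hol|exact: cdiffb_Elin].
have perW w : 0 < complex.Im w -> W (w + 1) = W w.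
  by move=> hw; rewrite /W per // mulrDr mulr1 ED EN E1 invr1 mulr1.
suff: nrm (W z) <= M by rewrite Wz ler_pdivrMr // nrm_gt0 E_neq0.
have nE : nrm (E z) < 1.
  by rewrite nrmE -[ltRHS](@expR0 R) ltr_expR oppr_lt0 mulr_gt0 ?tpi_gt0.
apply: (@ler_of_pow _ _ (1 - nrm (E z))^-1) => //; first exact: nrm_ge0.
move=> n; pose h := fun w => W w ^+ n.
have holh w : 0 < complex.Im w -> cdiffb h w by move=> hw; apply: cdiffbX; exact: holW.
have perh w : 0 < complex.Im w -> h (w + 1) = h w by move=> hw; rewrite /h perW.
have neg m : m < 0 -> fcoef h m z = 0.
  move=> m0; apply: (@fcoef_neg R h 0 holh perh (K ^+ n) Y1) => // w _ hw.
  rewrite /h nrmX; apply: lerXn2r; rewrite ?nnegrE ?nrm_ge0 //.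
    by have := dec _ hw; rewrite -ler_pdivrMr ?nrm_gt0 ?E_neq0 // -Wz; apply: le_trans; exact: nrm_ge0.
  by rewrite Wz ler_pdivrMr ?nrm_gt0 ?E_neq0 // dec.
have pos (m : nat) : nrm (fcoef h m%:Z z) <= M ^+ n * expR (tpi * (m%:R * 0)).
  rewrite !mulr0 expR0 mulr1.
  apply: (@ler_expR_lim _ _ _ (tpi * (m%:R + n%:R))); first exact: nrm_ge0.
    by rewrite mulr_ge0 ?addr_ge0 // ltW ?tpi_gt0.
  move=> d d0; have hd : 0 < complex.Im (0 +i* d) by [].
  rewrite (@fcoef_indep R h 0 holh perh m z (0 +i* d)) //.
  apply: (le_trans (@fcoef_bound R h 0 holh m%:Z (0 +i* d) (M ^+ n * expR (tpi * (n%:R * d))) hd _)).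
    move=> t _; rewrite /h nrmX Wz expr_div_n -nrmX -nrmX -EMn [nrm (E _)]nrmE.
    have -> : complex.Im (n%:R * (0 +i* d + t%:C) : C) = n%:R * d.
      by rewrite -(rmorph_nat (real_complex R)) /= addr0 mul0r addr0.
    rewrite -expRN opprK ler_wpM2r ?expR_ge0 // nrmX lerXn2r ?nnegrE ?nrm_ge0 //.
    by apply: bnd; rewrite Im_addr.
  rewrite -[M ^+ n * _ * _]mulrA -expRD /= -pmulrn le_eqVlt; apply/orP; left; apply/eqP.
  by congr (_ * expR _); ring.
have := @pos_expand R h 0 holh perh (M ^+ n) 0 z (exprn_ge0 _ M0) neg pos hz.
by rewrite /decay big_ord0 !subr0 expr0 mul1r -nrmE /h nrmX.
Qed.

(** The map $x\mapsto z_0+re(x)$ sends the upper half-plane onto the punctured disc, so the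
    expansion in powers of $e(x)$ is a power series in $(z-z_0)/r$, cut here after two terms. *)
Lemma taylor_punctured (f : C -> C) (z0 : C) (r M : R) : 0 < r ->
  (forall z : C, z != z0 -> nrm (z - z0) < r -> cdiffb f z) ->
  (forall z : C, z != z0 -> nrm (z - z0) < r -> nrm (f z) <= M) ->
  exists c0 c1, [/\ nrm c0 <= M, nrm c1 <= M / r &
   forall z : C, z != z0 -> nrm (z - z0) <= r / 2 ->
    nrm (f z - c0 - c1 * (z - z0)) <= 2 * M * (nrm (z - z0) / r) ^+ 2].
Proof.
move=> r0 hol bnd; pose h := fun x => f (z0 + r%:C * E x).
have rC0 : r%:C != 0 :> C by rewrite -nrm_gt0 nrm_real gtr0_norm.
have inD x : 0 < complex.Im x -> z0 + r%:C * E x != z0 /\ nrm (z0 + r%:C * E x - z0) < r.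
  move=> hx; rewrite addrC -subr_eq0 addrK mulf_neq0 ?E_neq0 //; split=> //.
  rewrite nrmM nrm_real gtr0_norm // nrmE -[ltRHS]mulr1 ltr_pM2l //.
  by rewrite -[ltRHS](@expR0 R) ltr_expR oppr_lt0 mulr_gt0 ?tpi_gt0.
have holh x : 0 < complex.Im x -> cdiffb h x.
  move=> /inD[h1 h2]; apply: (@cdiffb_comp R (fun x => z0 + r%:C * E x) f); last exact: hol.
  apply: cdiffbD; first exact: cdiffb_cst.
  by apply: cdiffbM; [exact: cdiffb_cst|apply: cdiffb_E; exact: cdiffb_id].
have perh x : 0 < complex.Im x -> h (x + 1) = h x by move=> _; rewrite /h ED1.
have bndh x : 0 < complex.Im x -> nrm (h x) <= M by move=> /inD[h1 h2]; exact: bnd.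
have [c [cb hc]] := bounded_expand holh perh bndh.
have M0 : 0 <= M.
  by have := cb 0%N; rewrite mul0r mulr0 expR0 mulr1; apply: le_trans; exact: nrm_ge0.
exists (c 0%N), (c 1%N / r%:C); split.
- by have := cb 0%N; rewrite mul0r mulr0 expR0 mulr1.
- rewrite nrmM nrmV nrm_real gtr0_norm // ler_wpM2r ?invr_ge0 ?(ltW r0) //.
  by have := cb 1%N; rewrite mulr0 mulr0 expR0 mulr1.
move=> z zz hz.
have w0 : (z - z0) / r%:C != 0 by rewrite mulf_neq0 ?invr_eq0 // subr_eq0.
have [x hx] := E_surj w0.
have nx : nrm (E x) = nrm (z - z0) / r by rewrite hx nrmM nrmV nrm_real gtr0_norm.
have nx2 : nrm (E x) <= 2^-1 by rewrite nx ler_pdivrMr // mulrC.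
have imx : 0 < complex.Im x.
  rewrite ltNge; apply/negP => im0.
  have : 1 <= nrm (E x).
    by rewrite nrmE -[leLHS](@expR0 R) ler_expR oppr_ge0 mulr_ge0_le0 // ltW ?tpi_gt0.
  lra.
have := hc x 2%N imx; rewrite /decay subr0 -nrmE.
have zE : z0 + r%:C * E x = z by rewrite hx mulrC divfK // addrC subrK.
rewrite /h zE big_ord_recr /= big_ord1 mul0r E0 mulr1 mul1r hx opprD addrA -mulrA [r%:C^-1 * _]mulrC => H.
apply: (le_trans H); rewrite -hx -nx; move: (nrm (E x)) nx2 => X nx2.
rewrite (_ : 2 * M * X ^+ 2 = M * (2 * X ^+ 2)); last by ring.
apply: (ler_wpM2l M0); rewrite ler_pdivrMr; last lra.
have := sqr_ge0 X; nra.
Qed.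

Lemma removable (f : C -> C) (z0 : C) (r M : R) : 0 < r ->
  (forall z : C, z != z0 -> nrm (z - z0) < r -> cdiffb f z) ->
  (forall z : C, z != z0 -> nrm (z - z0) < r -> nrm (f z) <= M) ->
  exists2 g : C -> C, (forall z : C, z != z0 -> g z = f z) &
    forall z : C, nrm (z - z0) < r -> cdiffb g z.
Proof.
move=> r0 hol bnd; have [c0 [c1 [b0 b1 hc]]] := taylor_punctured r0 hol bnd.
pose g := fun z => if z == z0 then c0 else f z.
exists g; first by move=> z /negbTE zz; rewrite /g zz.
move=> z hz; have [->|zz] := eqVneq z z0; last first.
  have d0 : 0 < nrm (z - z0) by rewrite nrm_gt0 subr_eq0.
  apply: (@cdiffb_ext R f _ z (nrm (z - z0)) d0); last exact: hol.
  move=> w hw; rewrite /g; case: eqP => // wz.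
  by move: hw; rewrite wz nrmC ltxx.
have M0 : 0 <= M by apply: le_trans b0; exact: nrm_ge0.
exists c1 => e e0.
pose A := 2 * M / r ^+ 2 + 1.
have A0 : 0 < A by rewrite ltr_wpDl // divr_ge0 ?sqr_ge0 // mulr_ge0.
exists (Num.min (r / 2) (e / A)); first by rewrite lt_min !divr_gt0.
move=> w; rewrite lt_min => /andP[w1]; rewrite ltr_pdivlMr // => w2.
rewrite {2}/g eqxx /g; case: eqP => [->|/eqP wz].
  by rewrite !subrr mulr0 subrr nrm0 mulr0.
apply: (le_trans (hc w wz (ltW w1))).
set t := nrm (w - z0) in w1 w2 *; have t0 : 0 <= t := nrm_ge0 _.
have -> : 2 * M * (t / r) ^+ 2 = (2 * M / r ^+ 2 * t) * t by field; rewrite gt_eqF.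
rewrite ler_wpM2r //; rewrite /A in w2; lra.
Qed.

(** The quotient is bounded near [z0] because [f] is Lipschitz there, so its singularity is
    removable. *)
Lemma cdiffb_divX (f : C -> C) (z0 : C) (r : R) : 0 < r -> f z0 = 0 ->
  (forall z : C, nrm (z - z0) < r -> cdiffb f z) ->
  exists2 g : C -> C, (forall z, f z = (z - z0) * g z) &
    forall z : C, nrm (z - z0) < r -> cdiffb g z.
Proof.
move=> r0 f0 hol.
pose k := fun z => f z / (z - z0).
have [l hl] : cdiffb f z0 by apply: hol; rewrite subrr nrm0.
have [d d0 hd] := cdiff_lip hl.
have kd z : z != z0 -> nrm (z - z0) < r -> cdiffb k z.
  move=> zz hz; apply: cdiffb_div; [by rewrite subr_eq0|exact: hol|].
  by apply: cdiffbB; [exact: cdiffb_id|exact: cdiffb_cst].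
pose s := Num.min d r; have s0 : 0 < s by rewrite lt_min d0.
have [g gk gd] : exists2 g : C -> C, (forall z : C, z != z0 -> g z = k z) &
    forall z : C, nrm (z - z0) < s -> cdiffb g z.
  apply: (@removable k z0 s (nrm l + 1)) => // z zz; rewrite lt_min => /andP[z1 z2].
    exact: kd.
  have := hd _ z1; rewrite f0 subr0 /k nrmM nrmV ler_pdivrMr //.
  by rewrite nrm_gt0 subr_eq0.
exists g.
  move=> z; have [->|zz] := eqVneq z z0; first by rewrite subrr mul0r.
  by rewrite gk // mulrC divfK // subr_eq0.
move=> z hz; have [->|zz] := eqVneq z z0; first by apply: gd; rewrite subrr nrm0.
have n0 : 0 < nrm (z - z0) by rewrite nrm_gt0 subr_eq0.
apply: (@cdiffb_ext R k _ z (nrm (z - z0)) n0); last exact: kd.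
move=> w hw; rewrite gk //; apply/eqP => wz.
by move: hw; rewrite wz nrmC ltxx.
Qed.

(** Termwise differentiation: each term has a first-order expansion whose remainder is at most
    [nrm (m i)] times one common quadratic, and these remainders sum to a quadratic again. *)
Lemma hasum_cdiffb (I : eqType) (f : I -> C -> C) (S : C -> C) (z0 : C) (r : R) (m : I -> C) (M : R) :
  0 < r -> asum m M ->
  (forall i (z : C), nrm (z - z0) < r -> cdiffb (f i) z) ->
  (forall i (z : C), nrm (z - z0) < r -> nrm (f i z) <= nrm (m i)) ->
  (forall z : C, nrm (z - z0) < r -> hasum (fun i => f i z) (S z)) ->
  cdiffb S z0.
Proof.
move=> r0 hm hol bnd hS.
have M0 : 0 <= M by have := hm [::] isT; rewrite big_nil.
have n00 : nrm (z0 - z0) < r by rewrite subrr nrm0.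
have hb i : exists b : C, nrm b <= nrm (m i) / r /\ forall z : C, nrm (z - z0) <= r / 2 ->
    nrm (f i z - f i z0 - b * (z - z0)) <= 2 * nrm (m i) * (nrm (z - z0) / r) ^+ 2.
  have [c0 [c1 [h0 h1 hc]]] := taylor_punctured r0
    (fun z (_ : z != z0) => @hol i z) (fun z (_ : z != z0) => @bnd i z).
  exists c1; split=> //.
  (* [taylor_punctured] speaks of the punctured disc; continuity identifies the value at the centre
     with the constant coefficient. *)
  have fc : f i z0 = c0.
    apply: eq_nrm => e e0; have e3 : 0 < e / 3 by lra.
    have [d d0 hd] := cdiffb_ccont (hol i z0 n00) e3.
    have A0 : 0 < nrm c1 + 1 by rewrite ltr_wpDl ?nrm_ge0.
    pose B := 2 * nrm (m i) / r ^+ 2 + 1.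
    have B0 : 0 < B by rewrite ltr_wpDl // divr_ge0 ?sqr_ge0 // mulr_ge0 ?nrm_ge0.
    pose t := Num.min (Num.min (d / 2) (r / 2)) (Num.min 1 (Num.min (e / 3 / (nrm c1 + 1)) (e / 3 / B))).
    have t0 : 0 < t.
      have p4 : 0 < e / 3 / (nrm c1 + 1) by exact: divr_gt0.
      have p5 : 0 < e / 3 / B by exact: divr_gt0.
      by rewrite !lt_min ltr01 p4 p5 !andbT; apply/andP; split; lra.
    have t1 : t <= d / 2 by rewrite /t !ge_min lexx.
    have t2 : t <= r / 2 by rewrite /t !ge_min lexx orbT.
    have t3 : t <= 1 by rewrite /t !ge_min lexx !orbT.
    have t4 : t * (nrm c1 + 1) <= e / 3 by rewrite -ler_pdivlMr // /t !ge_min lexx !orbT.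
    have t5 : t * B <= e / 3 by rewrite -ler_pdivlMr // /t !ge_min lexx !orbT.
    clearbody t.
    pose z := z0 + t%:C.
    have zz : z - z0 = t%:C by rewrite /z; ring.
    have nz : nrm (z - z0) = t by rewrite zz nrm_real gtr0_norm.
    have zn : z != z0 by rewrite -subr_eq0 -nrm_gt0 nz.
    have H1 : nrm (f i z - f i z0) < e / 3 by apply: hd; rewrite nz; lra.
    have H2 := hc z zn; rewrite nz in H2; have {}H2 := H2 t2.
    have H3 : nrm (c1 * (z - z0)) <= e / 3.
      by rewrite nrmM nz mulrC; apply: le_trans t4; rewrite ler_wpM2l ?(ltW t0) // lerDl.
    have H4 : 2 * nrm (m i) * (t / r) ^+ 2 <= e / 3.
      apply: le_trans t5; rewrite (_ : 2 * nrm (m i) * (t / r) ^+ 2 = t * (2 * nrm (m i) / r ^+ 2 * t)); last by field; rewrite gt_eqF.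
      rewrite ler_wpM2l ?(ltW t0) //; apply: (@le_trans _ _ (2 * nrm (m i) / r ^+ 2 * 1)).
        by rewrite ler_wpM2l // divr_ge0 ?sqr_ge0 // mulr_ge0 ?nrm_ge0.
      by rewrite mulr1 /B lerDl.
    rewrite (_ : f i z0 - c0 = (f i z - c0 - c1 * (z - z0)) + (c1 * (z - z0) - (f i z - f i z0))); last by ring.
    apply: (le_trans (nrmD _ _)).
    have := nrmB (c1 * (z - z0)) (f i z - f i z0).
    lra.
  move=> z hz; have [->|zz] := eqVneq z z0.
    by rewrite !subrr mulr0 subr0 nrm0 mul0r expr0n mulr0.
  by rewrite fc; exact: hc.
have [b hb'] := choice hb.
have sb : asum b (M / r).
  move=> B uB; apply: (@le_trans _ _ (\sum_(i <- B) nrm (m i) / r)).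
    by apply: ler_sum => i _; exact: (hb' i).1.
  by rewrite -mulr_suml ler_wpM2r ?invr_ge0 ?(ltW r0) // hm.
exists (tsum b) => e e0.
pose A := 2 * M / r ^+ 2 + 1.
have A0 : 0 < A by rewrite ltr_wpDl // divr_ge0 ?sqr_ge0 // mulr_ge0.
exists (Num.min (r / 2) (e / A)); first by rewrite lt_min !divr_gt0.
move=> w; rewrite lt_min => /andP[w1]; rewrite ltr_pdivlMr // => w2.
have wr : nrm (w - z0) < r by lra.
have H : hasum (fun i => f i w - f i z0 - (w - z0) * b i) (S w - S z0 - (w - z0) * tsum b).
  apply: hasumB; first by apply: hasumB; exact: hS.
  by apply: hasumZ; exact: hasum_tsum sb.
rewrite (mulrC (tsum b)).
apply: (@le_trans _ _ (2 * M * (nrm (w - z0) / r) ^+ 2)).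
  apply: (hasum_nrm _ H) => B uB.
  apply: (@le_trans _ _ (\sum_(i <- B) (2 * (nrm (w - z0) / r) ^+ 2) * nrm (m i))).
    apply: ler_sum => i _; have := (hb' i).2 w (ltW w1).
    by rewrite (mulrC (b i)) mulrAC.
  rewrite -mulr_sumr [2 * M * _]mulrAC ler_wpM2l ?hm //.
  by rewrite mulr_ge0 ?sqr_ge0.
set t := nrm (w - z0) in w1 w2 *; have t0 : 0 <= t := nrm_ge0 _.
have -> : 2 * M * (t / r) ^+ 2 = (2 * M / r ^+ 2 * t) * t by field; rewrite gt_eqF.
rewrite ler_wpM2r //; rewrite /A in w2; lra.
Qed.

End Consequences.

(** * The theta function and its inversion formula *)

Section Residue.
Variable R : realType.
Local Notation C := (Cplx R).

(** Residue classes are represented by the multiples [c * k] rather than by [k], because [th_A] has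
    to sum over the classes of $-2Nk$ modulo $p$. *)
Lemma hasum_residue (M : nat) (c : int) (f : int -> C) S (s : 'I_M -> C) :
  (0 < M)%N -> coprimez c M -> hasum f S ->
  (forall k : 'I_M, hasum (fun m : int => f (M%:Z * m + c * k%:Z)) (s k)) ->
  S = \sum_k s k.
Proof.
move=> M0 cop hS hs.
pose h := fun p : 'I_M * int => M%:Z * p.2 + c * p.1%:Z.
(* [u] inverts [c] modulo [M], so the class of [r] is the one with [k = u * r] modulo [M]. *)
have [u [v uv]] : exists u v, u * c + v * M%:Z = 1.
  by have [u [v H]] := Bezoutz c M; exists u, v; rewrite H; apply/eqP.
have hsurj r : exists p, h p = r.
  have k0 : 0 <= ((u * r) %% M%:Z)%Z by rewrite modz_ge0 // gt_eqF // ltz_nat.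
  have k1 : ((u * r) %% M%:Z)%Z < M%:Z by rewrite ltz_mod // gt_eqF // ltz_nat.
  have kM : (`|((u * r) %% M%:Z)%Z| < M)%N by rewrite -ltz_nat gez0_abs.
  exists (Ordinal kM, r * v + c * ((u * r) %/ M%:Z)%Z); rewrite /h /= gez0_abs //.
  have := divz_eq (u * r) M%:Z; set q := (_ %/ _)%Z; set t := (_ %% _)%Z => H.
  have -> : t = u * r - q * M%:Z by rewrite H; ring.
  by rewrite -[in RHS](mul1r r) -uv; ring.
have hinj : injective h.
  move=> [k m] [k' m']; rewrite /h /= => H.
  have d : (M%:Z %| (k%:Z - k'%:Z))%Z.
    have : (M%:Z %| c * (k%:Z - k'%:Z))%Z.
      by apply/dvdzP; exists (m' - m); lia.
    by rewrite Gauss_dvdzr // coprimez_sym.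
  have kk : k%:Z = k'%:Z.
    move: d => /dvdzP[q hq]; have := ltn_ord k; have := ltn_ord k'.
    have : q = 0; last by lia.
    have := ltn_ord k; have := ltn_ord k'; nia.
  have e : k = k' by apply: val_inj; case: kk.
  subst k'; congr (_, _); move: H => /addIr /mulfI; apply.
  by rewrite gt_eqF // ltz_nat.
have [g hg] := choice hsurj.
have hf := @hasum_bij R _ _ h g f S (fun p => hinj _ _ (hg (h p))) hg hS.
have := hasum_inner hf hs => H; exact: hasum_uniq H (hasum_fin s).
Qed.

Lemma rcontC (f : R -> C) : (forall t : R, 0 <= t <= 1 -> exists2 F : C -> C, (forall s : R, f s = F s%:C) & ccont F t%:C) ->
  rcont f 0 1.
Proof.
move=> hf x hx e e0; have [F fF cF] := hf x hx; have [d d0 hd] := cF e e0.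
exists d => // y hy xy; rewrite !fF; apply/ltW/hd.
by rewrite -rmorphB nrm_real.
Qed.

Lemma avg_hasum (I : eqType) (f : I -> R -> C) (S : R -> C) (m : I -> C) (M : R) :
  asum m M -> (forall i t, 0 <= t <= 1 -> nrm (f i t) <= nrm (m i)) ->
  (forall i, rcont (f i) 0 1) -> rcont S 0 1 ->
  (forall t, 0 <= t <= 1 -> hasum (fun i => f i t) (S t)) ->
  hasum (fun i => avg (f i)) (avg S).
Proof.
move=> hm bnd cf cS hS e e0; have [A uA hA] := asum_tail hm e0.
exists A => B uB sB.
have sumc (D : seq I) : rcont (fun t => \sum_(i <- D) f i t) 0 1.
  elim: D => [|i D IH].
    by move=> x _ e' e'0; exists 1 => // y _ _; rewrite !big_nil subrr nrm0 ltW.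
  have := rcontD (cf i) IH; rewrite (_ : (fun t => f i t + _) = (fun t => \sum_(j <- i :: D) f j t)) //.
  by apply: funext => t; rewrite big_cons.
have -> : \sum_(i <- B) avg (f i) = avg (fun t => \sum_(i <- B) f i t).
  elim: (B) => [|i D IH].
    rewrite big_nil; apply/esym; rewrite (_ : (fun t => _) = (fun=> 0)) ?avg_cst //.
    by apply: funext => t; rewrite big_nil.
  rewrite big_cons IH -avgD //; congr avg; apply: funext => t; by rewrite big_cons.
rewrite -avgB //; apply: avg_bound.
  by apply: rcontD => //; exact: rcontN.
move=> t /andP[t0 t1]; have t01 : 0 <= t <= 1 by rewrite t0 ltW.
apply/ler_addgt0Pr => d d0; have [D hD] := hS t t01 _ d0.
pose D' := undup (B ++ D).
have sBD : {subset B <= D'} by move=> i iB; rewrite mem_undup mem_cat iB.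
have h1 : nrm (\sum_(i <- D') f i t - S t) <= d.
  by apply: hD; [exact: undup_uniq|move=> i iD; rewrite mem_undup mem_cat iD orbT].
rewrite (big_uniq_split (fun i => f i t) uB (undup_uniq _) sBD) in h1.
set X := \sum_(i <- [seq _ <- _ | _]) _ in h1.
have hX : nrm X <= e.
  apply: (le_trans (nrm_sum _ _ _)); apply: (@le_trans _ _ (\sum_(i <- [seq i <- D' | i \notin B]) nrm (m i))).
    by apply: ler_sum => i _; exact: bnd.
  apply: hA; first by rewrite filter_uniq // undup_uniq.
  by move=> i; rewrite mem_filter => /andP[iB _]; apply: contra iB => /sB.
have -> : \sum_(i <- B) f i t - S t = (\sum_(i <- B) f i t + X - S t) - X by ring.
by apply: (le_trans (nrmB _ _)); rewrite addrC lerD.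
Qed.

Lemma hasum_int_cvC (f : int -> C) s : hasum f s ->
  cvC (fun k => \sum_(i < 2 * 2 ^ k) f (i%:Z - (2 ^ k)%N%:Z + 1)) s.
Proof.
move=> hs e e0; have [A hA] := hs e e0.
exists (\max_(a <- A) `|a|%N) => k hk.
pose B := [seq i%:Z - (2 ^ k)%N%:Z + 1 | i <- iota 0 (2 * 2 ^ k)].
have -> : \sum_(i < 2 * 2 ^ k) f (i%:Z - (2 ^ k)%N%:Z + 1) = \sum_(i <- B) f i.
  by rewrite big_map -(big_mkord xpredT (fun i : nat => f (i%:Z - (2 ^ k)%N%:Z + 1))) /index_iota subn0.
apply: hA; first by rewrite map_inj_uniq ?iota_uniq // => i j; lia.
move=> a aA; have h1 : (`|a| <= k)%N by apply: leq_trans hk; exact: leq_bigmax_seq.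
have h2 : (k < 2 ^ k)%N by exact: ltn_expl.
apply/mapP; exists (absz ((a : int) + (2 ^ k)%N%:Z - 1)%R); last by move: (a : int) h1 => a'; lia.
by rewrite mem_iota; move: (a : int) h1 => a'; lia.
Qed.

(** A mean value inequality by bisection: the increment over a dyadic interval is at most [e] times
    its length, and increments add up. *)
Lemma cdiff0_const (f : C -> C) (p u : C) :
  (forall t : R, 0 <= t <= 1 -> cdiff f (p + t%:C * u) 0) -> f (p + u) = f p.
Proof.
move=> hf; apply: eq_nrm => e e0.
pose Q := fun (n : nat) (a b : R) => 0 <= a -> a + dyad R n <= 1 ->
   nrm (f (p + (a + dyad R n)%:C * u) - f (p + a%:C * u)) <= e * dyad R n.
suff : Q 0%N 0 0.
  by rewrite /Q dy0 add0r mul1r mul0r addr0 mulr1; apply.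
apply: cousin2.
  move=> n a b q1 q2 _ _ a0 a1; have dS := dyS R n; have d0 := dy_gt0 R n.+1.
  have i1 : a + dyad R n.+1 <= 1 by lra.
  have i2 : 0 <= a + dyad R n.+1 by lra.
  have i3 : a + dyad R n.+1 + dyad R n.+1 <= 1 by lra.
  have h1 := q1 a0 i1; have h2 := q2 i2 i3.
  rewrite dS addrA; set X := f _ in h2 *; set Z := f _ in h1 *.
  rewrite -(subrKA (f (p + (a + dyad R n.+1)%:C * u))).
  apply: (le_trans (nrmD _ _)); rewrite mulrDr addrC; exact: lerD.
move=> x y hx _.
have nu : 0 < nrm u + 1 by rewrite ltr_wpDl ?nrm_ge0.
have [d d0 hd] := hf x hx _ (divr_gt0 e0 nu).
have [N hN] := dy_small (divr_gt0 d0 nu); exists N => n a b /hN hn a0 a1 _ _ ax _ _ _.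
have dn := dy_gt0 R n.
have key (s : R) : `|s - x| <= dyad R n ->
   nrm (f (p + s%:C * u) - f (p + x%:C * u)) <= e / (nrm u + 1) * (`|s - x| * nrm u).
  move=> hs; have e1 : (p + s%:C * u) - (p + x%:C * u) = (s - x)%:C * u.
    by rewrite rmorphB /=; ring.
  have H := hd (p + s%:C * u); rewrite e1 mul0r subr0 nrmM nrm_real in H; apply: H.
  have : dyad R n * (nrm u + 1) <= d by move: hn; rewrite ler_pdivlMr.
  have : `|s - x| * nrm u <= dyad R n * nrm u by rewrite ler_wpM2r ?nrm_ge0.
  lra.
have k1 := key (a + dyad R n); have k2 := key a.
have e1 : `|a + dyad R n - x| = a + dyad R n - x by rewrite ger0_norm; lra.
have e2 : `|a - x| = x - a by rewrite ler0_norm; lra.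
rewrite e1 in k1; rewrite e2 in k2.
rewrite -(subrKA (f (p + x%:C * u))) -[X in nrm (_ + X)]opprB.
apply: (le_trans (nrmB _ _)).
apply: (@le_trans _ _ (e / (nrm u + 1) * ((a + dyad R n - x) * nrm u) + e / (nrm u + 1) * ((x - a) * nrm u))).
  by apply: lerD; [apply: k1|apply: k2]; lra.
rewrite -mulrDr -mulrDl (_ : a + dyad R n - x + (x - a) = dyad R n); last by ring.
have pp : 0 <= e * dyad R n by apply: mulr_ge0; exact: ltW.
rewrite mulrAC ler_pdivrMr //; lra.
Qed.

End Residue.

Section Theta.
Variable R : realType.
Local Notation C := (Cplx R).
Local Notation E := (@e2pi R).
Local Notation nrm := (@nrm R).
Local Notation tpi := (@tpi R).

Definition rhopi : R := expR (- (tpi / 2)).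

Lemma rhopi0 : 0 <= rhopi. Proof. exact: expR_ge0. Qed.
Lemma rhopi1 : rhopi < 1.
Proof. by rewrite -[ltRHS](@expR0 R) ltr_expR oppr_lt0 divr_gt0 ?tpi_gt0. Qed.

(** $e^{\pi iw(n+x)^2}$: keeping [x] inside the square makes the sum periodic in [x], hence
    accessible to Fourier expansion. *)
Definition thterm (w x : C) (n : int) : C := E (w * (n%:~R + x) ^+ 2 / 2%:R).

Definition domterm (K : R) (n : int) : C := (expR K)%:C * (rhopi ^+ `|n|%N)%:C.

Lemma asum_domterm K : exists M, asum (domterm K) M.
Proof. eexists; apply: asumZ; exact: asum_geom_int rhopi0 rhopi1. Qed.

(** Locally uniform domination by a multiple of $e^{-\pi|n|}$: the quadratic [b0 * t ^+ 2] exceeds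
    any given linear function of [|t|] up to a constant. *)
Lemma theta_dom (b0 B A X : R) : 0 < b0 -> 0 <= A -> 0 <= X -> exists K : R, forall (w x : C) (n : int),
  b0 <= complex.Im w -> complex.Im w <= B -> `|complex.Re w| <= A ->
  `|complex.Re x| <= X -> `|complex.Im x| <= X ->
  nrm (thterm w x n) <= nrm (domterm K n).
Proof.
move=> b00 A0 X0.
(* From completing the square in [b0 * s ^+ 2 - (2 * A * X + 1) * s]; the extra 1 in the slope
   yields the decay in [n]. *)
pose K1 := (2 * A * X + 1) ^+ 2 / (4 * b0).
pose K := X + K1 + B * X ^+ 2.
exists (tpi / 2 * K) => -[a b] [x1 x2] n /= hb1 hb2 ha hx1 hx2.
rewrite /thterm /domterm nrmM !nrm_real nrmE (gtr0_norm (expR_gt0 _)).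
rewrite ger0_norm ?exprn_ge0 ?rhopi0 // /rhopi -expRM_natr -expRD ler_expR.
have -> : (n%:~R + (x1 +i* x2) : C) = (n%:~R + x1) +i* x2.
  by rewrite -(rmorph_int (real_complex R)) /=; apply/eqP; rewrite eq_complex /= add0r !eqxx.
set t := n%:~R + x1.
have -> : complex.Im ((a +i* b) * (t +i* x2) ^+ 2 / 2%:R : C) = (b * (t ^+ 2 - x2 ^+ 2) + 2 * a * t * x2) / 2.
  have -> : (2%:R^-1 : C) = (2^-1)%:C by rewrite fmorphV rmorph_nat.
  by rewrite expr2 /=; field.
have nt : `|n|%N%:R <= `|t| + X.
  have -> : `|n|%N%:R = `|n%:~R| :> R by rewrite -intr_norm pmulrn.
  have -> : n%:~R = t - x1 by rewrite /t; ring.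
  by apply: (le_trans (ler_normB _ _)); rewrite lerD2l.
have q1 : b0 * t ^+ 2 <= b * t ^+ 2 by rewrite ler_wpM2r ?sqr_ge0.
have q2 : b * x2 ^+ 2 <= B * X ^+ 2.
  have h1 : x2 ^+ 2 <= X ^+ 2 by rewrite -real_normK ?num_real // lerXn2r ?nnegrE.
  have B0 : 0 <= B by lra.
  apply: (@le_trans _ _ (B * x2 ^+ 2)); first by rewrite ler_wpM2r ?sqr_ge0.
  by rewrite ler_wpM2l.
have q3 : - (2 * A * X * `|t|) <= 2 * a * t * x2.
  rewrite lerNl; apply: (le_trans (ler_norm _)); rewrite normrN !normrM.
  rewrite (@ger0_norm _ 2) // (_ : _ * `|x2| = (2 * (`|a| * `|x2|)) * `|t|); last by ring.
  by rewrite ler_wpM2r // -!mulrA ler_wpM2l // ler_pM.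
have q4 : `|t| * (2 * A * X + 1) - K1 <= b0 * t ^+ 2.
  rewrite -(real_normK (num_real t)) /K1; move: (`|t|) => s.
  rewrite -subr_ge0 (_ : _ - _ = (2 * b0 * s - (2 * A * X + 1)) ^+ 2 / (4 * b0)).
    by rewrite divr_ge0 ?sqr_ge0 // mulr_ge0 // ltW.
  by field; rewrite gt_eqF.
rewrite (_ : tpi / 2 * K + _ = tpi * ((K - `|n|%N%:R) / 2)); last by field.
rewrite -mulrN ler_wpM2l ?(ltW (tpi_gt0 _)) // /K; lra.
Qed.

Lemma asum_theta w x : 0 < complex.Im w -> exists M, asum (thterm w x) M.
Proof.
move=> hw; have X0 : 0 <= `|complex.Re x| + `|complex.Im x| by rewrite addr_ge0.
have [K hK] := @theta_dom (complex.Im w) (complex.Im w) `|complex.Re w| _ hw (normr_ge0 _) X0.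
have [M hM] := asum_domterm K; exists M; apply: asum_le hM => n.
by apply: hK => //; rewrite ?lerDl ?lerDr.
Qed.

Definition theta (w x : C) : C := tsum (thterm w x).

Lemma hasum_theta w x : 0 < complex.Im w -> hasum (thterm w x) (theta w x).
Proof. by move=> /(asum_theta x)[M hM]; exact: hasum_tsum hM. Qed.

Lemma theta_cdiff_x w x : 0 < complex.Im w -> cdiffb (theta w) x.
Proof.
move=> hw; pose X := `|complex.Re x| + `|complex.Im x| + 1.
have X0 : 0 <= X by rewrite !addr_ge0.
have [K hK] := @theta_dom (complex.Im w) (complex.Im w) `|complex.Re w| X hw (normr_ge0 _) X0.
have [M hM] := asum_domterm K.
apply: (@hasum_cdiffb R _ (fun n z => thterm w z n) (theta w) x 1 (domterm K) M) => //.
- move=> n z _; apply: cdiffb_E; apply: cdiffbM; last exact: cdiffb_cst.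
  apply: cdiffbM; first exact: cdiffb_cst.
  by apply: cdiffbX; apply: cdiffbD; [exact: cdiffb_cst|exact: cdiffb_id].
- move=> n z hz; apply: hK => //.
    have := le_lt_trans (ler_Re_nrm _) hz; rewrite raddfB /=.
    have := ler_normD (complex.Re z - complex.Re x) (complex.Re x); rewrite subrK /X.
    have := normr_ge0 (complex.Im x); lra.
  have := le_lt_trans (ler_Im_nrm _) hz; rewrite raddfB /=.
  have := ler_normD (complex.Im z - complex.Im x) (complex.Im x); rewrite subrK /X.
  have := normr_ge0 (complex.Re x); lra.
- by move=> z _; exact: hasum_theta.
Qed.

(** Stated for any family with the moduli of [thterm z x], so that it serves [theta] directly and
    [Dual] after the substitution [- w^-1]. *)
Lemma cdiffb_w_gen (f : int -> C -> C) (S : C -> C) (w x : C) : 0 < complex.Im w ->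
  (forall n z, cdiffb (f n) z) ->
  (forall n z, 0 < complex.Im z -> nrm (f n z) = nrm (thterm z x n)) ->
  (forall z, 0 < complex.Im z -> hasum (fun n => f n z) (S z)) -> cdiffb S w.
Proof.
move=> hw cf nf hS; pose X := `|complex.Re x| + `|complex.Im x|.
have X0 : 0 <= X by rewrite addr_ge0.
have b0 : 0 < complex.Im w / 2 by lra.
have A0 : 0 <= `|complex.Re w| + complex.Im w by rewrite addr_ge0 // ltW.
have [K hK] := @theta_dom (complex.Im w / 2) (2 * complex.Im w) _ X b0 A0 X0.
have [M hM] := asum_domterm K.
have imz (z : C) : nrm (z - w) < complex.Im w / 2 -> complex.Im w / 2 < complex.Im z /\
    complex.Im z <= 2 * complex.Im w /\ `|complex.Re z| <= `|complex.Re w| + complex.Im w.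
  move=> hz; have := le_lt_trans (ler_Im_nrm _) hz; have := le_lt_trans (ler_Re_nrm _) hz.
  rewrite !raddfB /= => h1; rewrite ltr_norml => h2.
  have := ler_normD (complex.Re z - complex.Re w) (complex.Re w); rewrite subrK.
  by move=> h3; split; [lra|split; lra].
apply: (@hasum_cdiffb R _ f S w (complex.Im w / 2) (domterm K) M) => //.
- move=> n z /imz[h1 [h2 h3]]; rewrite nf; last by lra.
  by apply: hK => //; rewrite ?(ltW h1) // /X ?lerDl ?lerDr.
- by move=> z /imz[h1 _]; apply: hS; lra.
Qed.

Lemma theta_cdiff_w w x : 0 < complex.Im w -> cdiffb (fun w => theta w x) w.
Proof.
move=> hw; apply: (@cdiffb_w_gen (fun n z => thterm z x n) _ w x) => //.
  move=> n z; apply: cdiffb_E; apply: cdiffbM; last exact: cdiffb_cst.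
  by apply: cdiffbM; [exact: cdiffb_id|exact: cdiffb_cst].
by move=> z hz; exact: hasum_theta.
Qed.

Lemma theta_per w x : 0 < complex.Im w -> theta w (x + 1) = theta w x.
Proof.
move=> hw; have h := hasum_theta x hw.
have h' := @hasum_bij R _ _ (fun n : int => n + 1) (fun n => n - 1) _ _ (fun n => addrK 1 n) (fun n => subrK 1 n) h.
apply: (hasum_eq _ (hasum_theta (x + 1) hw) h') => n.
by rewrite /thterm rmorphD /=; congr (E (_ * _ ^+ 2 / _)); ring.
Qed.

Lemma upper_neq0 (w : C) : 0 < complex.Im w -> w != 0.
Proof. by case: w => a b /=; apply: contraTneq => -[_ ->]; rewrite ltxx. Qed.

(** The second quasi-period. Together with the period 1 it gives a recursion that determines all
    Fourier coefficients from the single one called [J w]. *)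
Lemma theta_shift w x : 0 < complex.Im w ->
  theta w (x + w^-1) = E (x + (2%:R * w)^-1) * theta w x.
Proof.
move=> hw; have w0 := upper_neq0 hw.
have h := hasumZ (E (x + (2%:R * w)^-1)) (hasum_theta x hw).
apply: (hasum_eq _ (hasum_theta (x + w^-1) hw) h) => n.
rewrite /thterm -ED -[RHS](EDint _ n); congr E; field; exact: w0.
Qed.

(* The multiplier in [theta w x = J w * Dual w x]; up to normalisation [sqrt (i / w)],
   but only its behaviour under real scaling of [w] is needed. *)
Definition J (w : C) : C := fcoef (theta w) 0 0.

Lemma theta_fcoef w m p : 0 < complex.Im w -> fcoef (theta w) m p = fcoef (theta w) m 0.
Proof.
move=> hw; pose Y := - (`|complex.Im p| + 1).
apply: (@fcoef_indep R (theta w) Y) => //.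
- by move=> z _; exact: theta_cdiff_x.
- by move=> z _; exact: theta_per.
- by rewrite /Y ltrNl; have := ler_norm (- complex.Im p); rewrite normrN; lra.
- by rewrite /Y /= oppr_lt0 ltr_wpDl.
Qed.

Lemma theta_fcoef_rec w m : 0 < complex.Im w ->
  fcoef (theta w) m 0 = E ((1 - 2%:R * m%:~R) / (2%:R * w)) * fcoef (theta w) (m - 1) 0.
Proof.
move=> hw; have w0 := upper_neq0 hw.
rewrite -(theta_fcoef m (w^-1) hw) /fcoef -avgZ.
  congr avg; apply: funext => t; rewrite !add0r [w^-1 + _]addrC theta_shift //.
  rewrite rmorphB /= mulrCA [E _ * theta w _]mulrC -!mulrA; congr (_ * _).
  by rewrite -!ED; congr E; field; exact: w0.
apply: (rcont_line (F := fun z => theta w z * E (- (m - 1)%:~R * z))) => t _.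
apply: cdiffb_ccont; apply: cdiffbM; [exact: theta_cdiff_x|exact: cdiffb_Elin].
Qed.

Lemma theta_fcoefE w m : 0 < complex.Im w ->
  fcoef (theta w) m 0 = E (- m%:~R ^+ 2 / (2%:R * w)) * J w.
Proof.
move=> hw; have w0 := upper_neq0 hw.
have pos (n : nat) : fcoef (theta w) n%:Z 0 = E (- n%:~R ^+ 2 / (2%:R * w)) * J w.
  elim: n => [|n IH]; first by rewrite expr0n oppr0 mul0r E0 mul1r.
  rewrite theta_fcoef_rec // (_ : n.+1%:Z - 1 = n); last by lia.
  rewrite IH mulrA -ED; congr (E _ * _).
  by rewrite -!pmulrn -addn1 natrD; field; exact: w0.
case: m => [n|n]; first exact: pos.
elim: n => [|n IH].
  have := theta_fcoef_rec 0 hw; rewrite (pos 0%N) (_ : 0 - 1 = Negz 0) //.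
  rewrite expr0n oppr0 mul0r E0 mul1r mulr0 subr0 => H.
  apply: (mulfI (E_neq0 (1 / (2%:R * w)))); rewrite -H mulrA -ED.
  rewrite (_ : _ + _ = 0) ?E0 ?mul1r // NegzE mulrNz; field; exact: w0.
have := theta_fcoef_rec (Negz n) hw; rewrite IH.
rewrite (_ : Negz n - 1 = Negz n.+1); last by lia.
set e := E ((_ - _) / _) => H.
apply: (mulfI (E_neq0 ((1 - 2%:R * (Negz n)%:~R) / (2%:R * w)))); rewrite -/e -H mulrA /e -ED.
congr (E _ * _).
have -> : (Negz n.+1)%:~R = (Negz n)%:~R - 1 :> C.
  by rewrite (_ : Negz n.+1 = Negz n - 1) ?rmorphB //; lia.
by move: ((Negz n)%:~R : C) => a; field; exact: w0.
Qed.

(** The [m]-th Fourier term of [theta w] without the factor [J w]. *)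
Definition dual (w x : C) (m : int) : C := E (m%:~R * x - m%:~R ^+ 2 / (2%:R * w)).

Lemma Im_inv_upper (w : C) : 0 < complex.Im w -> 0 < complex.Im (- w^-1).
Proof.
case: w => a b /= hb; rewrite opprK divr_gt0 // ltr_wpDl ?sqr_ge0 // exprn_gt0 //.
Qed.

Lemma dualE w x m : 0 < complex.Im w ->
  dual w x m = E (w * x ^+ 2 / 2%:R) * thterm (- w^-1) (- (w * x)) m.
Proof.
move=> hw; have w0 := upper_neq0 hw.
by rewrite /dual /thterm -ED; congr E; field; exact: w0.
Qed.

Definition Dual (w x : C) : C := E (w * x ^+ 2 / 2%:R) * theta (- w^-1) (- (w * x)).

Lemma hasum_Dual w x : 0 < complex.Im w -> hasum (dual w x) (Dual w x).
Proof.
move=> hw; apply: hasum_ext (hasumZ _ (hasum_theta _ (Im_inv_upper hw))) => m.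
by rewrite dualE.
Qed.

Lemma theta_Dual w x : 0 < complex.Im w -> theta w x = J w * Dual w x.
Proof.
move=> hw; pose Y := - (`|complex.Im x| + 1).
have hx : Y < complex.Im x.
  by rewrite /Y ltrNl; have := ler_norm (- complex.Im x); rewrite normrN; lra.
have hol (z : C) : Y < complex.Im z -> cdiffb (theta w) z by move=> _; exact: theta_cdiff_x.
have per (z : C) : Y < complex.Im z -> theta w (z + 1) = theta w z by move=> _; exact: theta_per.
have [l hl] := hol x hx.
have h1 := fourier_cvg hol per hx hl.
have h2 := hasum_int_cvC (hasumZ (J w) (hasum_Dual x hw)).
apply: cvC_uniq h1 _; apply: (cvC_ext _ h2) => k; apply: eq_bigr => i _.
rewrite theta_fcoef // theta_fcoefE // /dual; move: (i%:Z - _ + 1) => m.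
have -> : E (m%:~R * x - m%:~R ^+ 2 / (2%:R * w)) = E (- m%:~R ^+ 2 / (2%:R * w)) * E (m%:~R * x).
  by rewrite -ED; congr E; ring.
ring.
Qed.

End Theta.

(** * The factor in the inversion formula *)

Section ThetaFactor.
Variable R : realType.
Local Notation C := (Cplx R).
Local Notation E := (@e2pi R).
Local Notation nrm := (@nrm R).
Local Notation tpi := (@tpi R).
Local Notation J := (@J R).
Local Notation theta := (@theta R).
Local Notation Dual := (@Dual R).

Lemma hasum_single (I : eqType) (i0 : I) (c : C) : hasum (fun i => if i == i0 then c else 0) c.
Proof.
move=> e e0; exists [:: i0] => B uB sB.
have i0B : i0 \in B by apply: sB; rewrite inE.
by rewrite (big_rem i0) //= eqxx big_seq big1 ?addr0 ?subrr ?nrm0 ?ltW // => i;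
  rewrite mem_rem_uniq // inE => /andP[/negbTE -> _].
Qed.

Lemma nrm_Ereal (t : R) : nrm (E t%:C) = 1.
Proof. by rewrite nrmE /= mulr0 oppr0 expR0. Qed.

Lemma nrm_dual_real (w : C) (t : R) (m : int) : 0 < complex.Im w ->
  nrm (dual w t%:C m) = nrm (thterm (- w^-1) 0 m).
Proof.
move=> hw; have w0 := upper_neq0 hw.
rewrite /dual ED nrmM; have -> : m%:~R * t%:C = (m%:~R * t)%:C :> C by rewrite rmorphM /= rmorph_int.
by rewrite nrm_Ereal mul1r /thterm addr0; congr (nrm (E _)); field; exact: w0.
Qed.

Lemma Dual_cdiff_x w x : 0 < complex.Im w -> cdiffb (Dual w) x.
Proof.
move=> hw; apply: cdiffbM.
  apply: cdiffb_E; apply: cdiffbM; last exact: cdiffb_cst.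
  by apply: cdiffbM; [exact: cdiffb_cst|apply: cdiffbX; exact: cdiffb_id].
apply: (@cdiffb_comp R (fun x => - (w * x)) (theta (- w^-1))).
  by apply: cdiffbN; apply: cdiffbM; [exact: cdiffb_cst|exact: cdiffb_id].
by apply: theta_cdiff_x; exact: Im_inv_upper.
Qed.

(** Averaging over a period retains only the term [m = 0]. The purpose is that [Dual w] cannot
    vanish on the whole real line. *)
Lemma avg_Dual w : 0 < complex.Im w -> avg (fun t : R => Dual w t%:C) = 1.
Proof.
move=> hw.
have [M hM] := asum_theta 0 (Im_inv_upper hw).
have H : hasum (fun m => avg (fun t : R => dual w t%:C m)) (avg (fun t : R => Dual w t%:C)).
  apply: (avg_hasum hM).
  - by move=> m t _; rewrite nrm_dual_real.
  - move=> m; apply: rcontC => t _; exists (fun x => dual w x m) => //.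
    apply: cdiffb_ccont; apply: cdiffb_E; apply: cdiffbB; last exact: cdiffb_cst.
    by apply: cdiffbM; [exact: cdiffb_cst|exact: cdiffb_id].
  - apply: rcontC => t _; exists (Dual w) => //.
    by apply: cdiffb_ccont; exact: Dual_cdiff_x.
  - by move=> t _; exact: hasum_Dual.
apply: (hasum_eq _ H (hasum_single 0 1)) => m.
have -> : (fun t : R => dual w t%:C m) = (fun t : R => E (- (m%:~R ^+ 2 / (2%:R * w))) * E (m%:~R * t%:C)).
  by apply: funext => t; rewrite /dual addrC ED.
rewrite avgZ; last first.
  apply: rcontC => t _; exists (fun x => E (m%:~R * x)) => //.
  by apply: cdiffb_ccont; exact: cdiffb_Elin.
case: eqP => [->|/eqP m0]; last by rewrite avg_Eint // mulr0.
rewrite expr0n mul0r oppr0 E0 mul1r (_ : (fun t => _) = (fun=> 1)) ?avg_cst //.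
by apply: funext => t; rewrite mul0r E0.
Qed.

Lemma Dual_neq0 w : 0 < complex.Im w -> exists t : R, Dual w t%:C != 0.
Proof.
move=> hw; apply: contrapT => h.
have := avg_Dual hw; rewrite (@avg_ext R _ (fun=> 0)); last first.
  by move=> t _; apply/eqP; apply: contrapT => /negP H; apply: h; exists t.
by rewrite avg_cst => /esym/eqP; rewrite oner_eq0.
Qed.

(** If [J w] were 0, [theta w] would vanish identically, and with it the dual series at [- w^-1],
    which is an exponential times [theta w]. *)
Lemma J_neq0 w : 0 < complex.Im w -> J w != 0.
Proof.
move=> hw; apply/negP => /eqP J0.
have [t] := Dual_neq0 (Im_inv_upper hw).
by rewrite /Dual invrN opprK invrK theta_Dual // J0 mul0r mulr0 eqxx.
Qed.

Lemma Dual_cdiff_w w (t : R) : 0 < complex.Im w -> cdiffb (fun w => Dual w t%:C) w.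
Proof.
move=> hw; have w0 := upper_neq0 hw.
pose f := fun (m : int) (u : C) => E (m%:~R * t%:C + u * m%:~R ^+ 2 / 2%:R).
have nf m (z : C) : nrm (f m z) = nrm (thterm z 0 m).
  rewrite /f ED nrmM; have -> : m%:~R * t%:C = (m%:~R * t)%:C :> C by rewrite rmorphM /= rmorph_int.
  by rewrite nrm_Ereal mul1r /thterm addr0.
have sf (u : C) : 0 < complex.Im u -> hasum (fun m => f m u) (tsum (fun m => f m u)).
  move=> hu; have [M hM] := asum_theta 0 hu.
  by apply: (@hasum_tsum R _ _ M); apply: asum_le hM => m; rewrite nf.
have cG (u : C) : 0 < complex.Im u -> cdiffb (fun u => tsum (fun m => f m u)) u.
  move=> hu; apply: (@cdiffb_w_gen R f _ u 0) => //.
  move=> m z; apply: cdiffb_E; apply: cdiffbD; first exact: cdiffb_cst.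
  apply: cdiffbM; last exact: cdiffb_cst.
  by apply: cdiffbM; [exact: cdiffb_id|exact: cdiffb_cst].
apply: (@cdiffb_ext R (fun w => tsum (fun m => f m (- w^-1))) _ w (complex.Im w) hw).
  move=> z hz; have hz0 : 0 < complex.Im z.
    have := le_lt_trans (ler_Im_nrm _) hz; rewrite raddfB /= ltr_norml; lra.
  have z0 := upper_neq0 hz0.
  apply: tsumE; apply: hasum_ext (hasum_Dual t%:C hz0) => m.
  by rewrite /dual /f; congr E; field; exact: z0.
apply: (@cdiffb_comp R (fun w => - w^-1) (fun u => tsum (fun m => f m u))).
  by apply: cdiffbN; apply: cdiffbV => //; exact: cdiffb_id.
by apply: cG; exact: Im_inv_upper.
Qed.

(** Near [w], [J] is the quotient of [theta] by [Dual] at one real point where the latter does not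
    vanish. *)
Lemma J_cdiffb w : 0 < complex.Im w -> cdiffb J w.
Proof.
move=> hw; have [t Dt] := Dual_neq0 hw.
have nD : 0 < nrm (Dual w t%:C) by rewrite nrm_gt0.
have [d d0 hd] := cdiffb_ccont (Dual_cdiff_w t hw) nD.
have r0 : 0 < Num.min d (complex.Im w) by rewrite lt_min d0.
apply: (@cdiffb_ext R (fun w => theta w t%:C / Dual w t%:C) _ w _ r0).
  move=> z; rewrite lt_min => /andP[/hd h1 h2].
  have hz0 : 0 < complex.Im z.
    have := le_lt_trans (ler_Im_nrm _) h2; rewrite raddfB /= ltr_norml; lra.
  have Dz : Dual z t%:C != 0.
    by apply: contraTneq h1 => ->; rewrite sub0r nrmN ltxx.
  by rewrite theta_Dual // mulfK.
by apply: cdiffb_div => //; [exact: theta_cdiff_w|exact: Dual_cdiff_w].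
Qed.

Lemma sum_roots (k : nat) (j : 'I_k) : \sum_(r < k) E (j%:R * r%:R / k%:R) = if j == 0%N :> nat then k%:R else 0.
Proof.
have k0 : (0 < k)%N by apply: leq_ltn_trans (ltn_ord j).
have kC : k%:R != 0 :> C by rewrite pnatr_eq0 -lt0n.
case: eqP => [->|/eqP j0].
  under eq_bigr do rewrite !mul0r E0.
  by rewrite sumr_const card_ord.
have z1 : E (j%:R / k%:R) != 1.
  have -> : (j%:R / k%:R : C) = (j%:R / k%:R)%:C by rewrite rmorphM /= fmorphV !rmorph_nat.
  apply: E_real_neq1; apply/andP; split; first by apply: divr_gt0; rewrite ltr0n // lt0n.
  by rewrite ltr_pdivrMr ?ltr0n // mul1r ltr_nat.
have -> : \sum_(r < k) E (j%:R * r%:R / k%:R) = \sum_(r < k) E (j%:R / k%:R) ^+ r.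
  by apply: eq_bigr => r _; rewrite -EMn; congr E; ring.
have := subrX1 (E (j%:R / k%:R)) k.
rewrite -EMn mulrCA mulfV // mulr1 Enat subrr => /esym/eqP.
by rewrite mulf_eq0 subr_eq0 (negbTE z1) /= => /eqP.
Qed.

Lemma Im_natM (k : nat) (w : C) : complex.Im (k%:R * w) = k%:R * complex.Im w.
Proof. by rewrite -(rmorph_nat (real_complex R)); case: w => a b /=; rewrite mul0r addr0. Qed.

Lemma theta_split (k : nat) w x : (0 < k)%N -> 0 < complex.Im w ->
  theta w x = \sum_(r < k) theta ((k ^ 2)%:R * w) ((x + r%:R) / k%:R).
Proof.
move=> k0 hw; have kC : k%:R != 0 :> C by rewrite pnatr_eq0 -lt0n.
have hkw : 0 < complex.Im ((k ^ 2)%:R * w) by rewrite Im_natM mulr_gt0 // ltr0n expn_gt0 k0.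
have cop : coprimez 1 k by rewrite /coprimez /gcdz gcd1n.
apply: (hasum_residue k0 cop (hasum_theta x hw)).
move=> r; apply: hasum_ext (hasum_theta _ hkw) => m.
rewrite /thterm natrX rmorphD !rmorphM /= -!pmulrn; congr E; field; exact: kC.
Qed.

Lemma Dual_split (k : nat) w x : (0 < k)%N -> 0 < complex.Im w ->
  \sum_(r < k) Dual ((k ^ 2)%:R * w) ((x + r%:R) / k%:R) = k%:R * Dual w x.
Proof.
move=> k0 hw; have kC : k%:R != 0 :> C by rewrite pnatr_eq0 -lt0n.
have w0 := upper_neq0 hw.
have hkw : 0 < complex.Im ((k ^ 2)%:R * w) by rewrite Im_natM mulr_gt0 // ltr0n expn_gt0 k0.
pose f := fun m : int => \sum_(r < k) dual ((k ^ 2)%:R * w) ((x + r%:R) / k%:R) m.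
have hf : hasum f (\sum_(r < k) Dual ((k ^ 2)%:R * w) ((x + r%:R) / k%:R)).
  by apply: hasum_sum => r; exact: hasum_Dual.
have cop : coprimez 1 k by rewrite /coprimez /gcdz gcd1n.
have hs (j : 'I_k) : hasum (fun m => f (k%:Z * m + 1 * j%:Z)) (if j == 0%N :> nat then k%:R * Dual w x else 0); last first.
  rewrite (hasum_residue k0 cop hf hs) (bigD1 (Ordinal k0)) //= big1 ?addr0 // => i /negbTE i0.
  by case: eqP => // h; move: i0; rewrite -val_eqE /= h eqxx.
have e m : f (k%:Z * m + 1 * j%:Z) = dual ((k ^ 2)%:R * w) (x / k%:R) (k%:Z * m + 1 * j%:Z) *
    (if j == 0%N :> nat then k%:R else 0).
  rewrite -sum_roots mulr_sumr; apply: eq_bigr => r _.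
  rewrite /dual -ED -[RHS](EDint _ (m * r%:Z)); congr E.
  rewrite natrX rmorphD !rmorphM /= -!pmulrn; field; by rewrite w0 kC.
case: eqP e => [j0|_] e; last first.
  by apply: (@hasum_ext R _ (fun=> 0)); [move=> m; rewrite e mulr0|exact: hasum0].
apply: hasum_ext (hasumZ k%:R (hasum_Dual x hw)) => m; rewrite e mulrC; congr (_ * _).
rewrite /dual j0; congr E; rewrite natrX rmorphD !rmorphM /= -!pmulrn; field; by rewrite w0 kC.
Qed.

(** Splitting [theta w] modulo [k] and inverting each part leaves, in the dual series, only the
    frequencies divisible by [k], each counted [k] times. *)
Lemma J_square (k : nat) w : (0 < k)%N -> 0 < complex.Im w -> J ((k ^ 2)%:R * w) * k%:R = J w.
Proof.
move=> k0 hw; have [t Dt] := Dual_neq0 hw.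
have hkw : 0 < complex.Im ((k ^ 2)%:R * w) by rewrite Im_natM mulr_gt0 // ltr0n expn_gt0 k0.
apply: (mulIf Dt).
have e1 : theta w t%:C = \sum_(r < k) J ((k ^ 2)%:R * w) * Dual ((k ^ 2)%:R * w) ((t%:C + r%:R) / k%:R).
  by rewrite (theta_split t%:C k0 hw); apply: eq_bigr => r _; exact: theta_Dual.
have e3 := theta_Dual t%:C hw; move: e1 e3; rewrite -mulr_sumr (Dual_split t%:C k0 hw).
by move: (J ((k ^ 2)%:R * w)) (J w) (Dual w t%:C) (theta w t%:C) => a b c d -> <-; rewrite mulrA.
Qed.

(* [J (k^2 w) = J w / k] gives the value of [J] at the points [((n + 1) / n)^2 w], which
   tend to [w] and hence determine the derivative. *)
Lemma J_deriv w : 0 < complex.Im w -> cdiff J w (- (J w) / (2%:R * w)).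
Proof.
move=> hw; have w0 := upper_neq0 hw; have [l hl] := J_cdiffb hw.
suff -> : - (J w) / (2%:R * w) = l by [].
have nw : 0 < nrm w by rewrite nrm_gt0.
suff h : l * w + J w / 2%:R = 0.
  have -> : l = (l * w + J w / 2%:R - J w / 2%:R) / w by field; exact: w0.
  by rewrite h; field; exact: w0.
apply: eq_nrm => e e0; rewrite subr0.
have e1 : 0 < e / (2 * nrm w) by rewrite divr_gt0 // mulr_gt0.
have [d d0 hd] := hl _ e1.
(* For [m] beyond [A] the step, at most [3 / m * nrm w], is shorter than [d], and the error
   [3 / m * nrm (J w)] is at most [e / 2]. *)
pose A := 6 * (nrm w / d) + 6 * (nrm (J w) / e) + 1.
have A0 : 0 < A by rewrite ltr_wpDl // addr_ge0 // mulr_ge0 // divr_ge0 ?nrm_ge0 // ltW.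
have [N hN] := Rinv_small (e := A^-1) ltac:(by rewrite invr_gt0).
have {hN} := hN N (leqnn N); rewrite lef_pV2 ?posrE ?ltr0Sn // => AN.
pose m : nat := N.+1; pose M : R := m%:R.
have M0 : 0 < M by rewrite ltr0Sn.
have M1 : 1 <= M by rewrite ler1n.
have AM : A <= M := AN.
have pA1 : 0 <= nrm w / d by rewrite divr_ge0 ?nrm_ge0 // ltW.
have pA2 : 0 <= nrm (J w) / e by rewrite divr_ge0 ?nrm_ge0 // ltW.
have MC : (m%:R : C) = M%:C by rewrite rmorph_nat.
have mC0 : (m%:R : C) != 0 by rewrite pnatr_eq0.
have m1C0 : (m%:R + 1 : C) != 0 by rewrite natr1 pnatr_eq0.
(* Both [w] and the nearby [w'] are square multiples of [u], so two uses of [J_square] give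
   [J w' = J w * m / (m + 1)]. *)
pose u := w / (m ^ 2)%:R.
have hu : 0 < complex.Im u.
  have : 0 < complex.Im ((m ^ 2)%:R * u) by rewrite /u mulrCA mulfV ?mulr1 // pnatr_eq0.
  by rewrite Im_natM pmulr_rgt0 // ltr0n.
have e2 : (m ^ 2)%:R * u = w by rewrite /u mulrCA mulfV ?mulr1 // pnatr_eq0.
have s1 := @J_square m u isT hu; have s2 := @J_square m.+1 u isT hu.
rewrite e2 in s1.
set w' := (m.+1 ^ 2)%:R * u in s2.
pose dl : R := (2 * M + 1) / M ^+ 2.
have dl0 : 0 < dl by rewrite divr_gt0 ?exprn_gt0 //; lra.
have w'w : w' - w = dl%:C * w.
  rewrite /w' /u /dl rmorphM fmorphV /= rmorphD rmorphM rmorphXn /= -MC !rmorph1 rmorph_nat.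
  rewrite !natrX -addn1 natrD; field; exact: mC0.
have jj : J w' - J w = - (J w / (m%:R + 1)).
  have h1 (a b c : C) : b * m%:R = c -> a * m.+1%:R = c -> a - b = - (b / (m%:R + 1)).
    move=> e4 e5; have -> : a = b * m%:R / (m%:R + 1) by rewrite e4 -e5 -natr1 mulfK.
    by field; exact: m1C0.
  exact: h1 s1 s2.
have dle : dl <= 3 / M.
  rewrite /dl ler_pdivrMr ?exprn_gt0 // (_ : 3 / M * M ^+ 2 = 3 * M); first lra.
  by field; rewrite gt_eqF.
have hdw : nrm (w' - w) < d.
  rewrite w'w nrmM nrm_real gtr0_norm //.
  apply: (@le_lt_trans _ _ (3 / M * nrm w)); first by rewrite ler_wpM2r ?nrm_ge0.
  rewrite mulrAC ltr_pdivrMr //.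
  have : 6 * (nrm w / d) <= M.
    by move: AM; rewrite /A; lra.
  rewrite mulrA ler_pdivrMr //; have := mulr_gt0 M0 d0; lra.
have := hd _ hdw; rewrite w'w jj nrmM nrm_real (gtr0_norm dl0) => H.
pose a : R := (M + 1)^-1 / dl.
have aE : a = M ^+ 2 / ((M + 1) * (2 * M + 1)).
  by rewrite /a /dl; field; rewrite !gt_eqF //; lra.
have H2 : nrm (l * w + a%:C * J w) <= e / 2.
  have -> : l * w + a%:C * J w = - ((- (J w / (m%:R + 1)) - l * (dl%:C * w)) / dl%:C).
    rewrite /a rmorphM !fmorphV /= rmorphD rmorph1 /= -MC; field.
    by rewrite m1C0 andbT -nrm_gt0 nrm_real gtr0_norm.
  rewrite nrmN nrmM nrmV nrm_real (gtr0_norm dl0) ler_pdivrMr //.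
  by apply: (le_trans H); rewrite le_eqVlt; apply/orP; left; apply/eqP; field; rewrite gt_eqF.
have H3 : nrm ((2^-1 - a)%:C * J w) <= e / 2.
  rewrite nrmM nrm_real.
  have h2 : 2^-1 - a = (3 * M + 1) / (2 * (M + 1) * (2 * M + 1)).
    by rewrite aE; field; rewrite !gt_eqF //; lra.
  have p2 : 0 < 2 * (M + 1) * (2 * M + 1) by rewrite !mulr_gt0 //; lra.
  have h3 : `|2^-1 - a| <= 3 / M.
    rewrite h2 ger0_norm; last by rewrite divr_ge0 ?(ltW p2) //; lra.
    rewrite ler_pdivrMr // mulrAC ler_pdivlMr //; nra.
  apply: (@le_trans _ _ (3 / M * nrm (J w))); first by rewrite ler_wpM2r ?nrm_ge0.
  rewrite mulrAC ler_pdivrMr //.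
  have : 6 * (nrm (J w) / e) <= M.
    by move: AM; rewrite /A; lra.
  rewrite mulrA ler_pdivrMr //; lra.
have -> : l * w + J w / 2%:R = (l * w + a%:C * J w) + (2^-1 - a)%:C * J w.
  by rewrite rmorphB /= fmorphV rmorph_nat; ring.
apply: (le_trans (nrmD _ _)); lra.
Qed.

Lemma const_upper (f : C -> C) : (forall w, 0 < complex.Im w -> cdiff f w 0) ->
  forall a b, 0 < complex.Im a -> 0 < complex.Im b -> f a = f b.
Proof.
move=> hf a b ha hb; rewrite -[a in LHS](subrK b) addrC; apply: cdiff0_const => t ht.
apply: hf; case: a ha => a1 a2 /= ha; case: b hb => b1 b2 /= hb.
have hm : 0 < Num.min a2 b2 by rewrite lt_min ha.
have m1 : Num.min a2 b2 <= a2 by rewrite ge_min lexx.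
have m2 : Num.min a2 b2 <= b2 by rewrite ge_min lexx orbT.
move: (Num.min a2 b2) hm m1 m2 => m' hm m1 m2.
have q1 : 0 <= t * (a2 - m') by apply: mulr_ge0; lra.
have q2 : 0 <= (1 - t) * (b2 - m') by apply: mulr_ge0; lra.
rewrite mul0r addr0; lra.
Qed.

Lemma hasum_pos (I : eqType) (i0 : I) (f : I -> C) s : hasum f s -> f i0 = 1 ->
  (forall i, 0 <= complex.Re (f i) /\ complex.Im (f i) = 0) -> 1 <= complex.Re s /\ complex.Im s = 0.
Proof.
move=> hs f0 hf.
have key (e : R) : 0 < e -> `|complex.Im s| <= e /\ 1 - e <= complex.Re s.
  move=> e0; have [A hA] := hs e e0.
  have uB := undup_uniq (i0 :: A).
  have : nrm (\sum_(i <- undup (i0 :: A)) f i - s) <= e.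
    by apply: hA => // i iA; rewrite mem_undup inE iA orbT.
  set B := undup _; set S := \sum_(i <- B) f i.
  have ImS : complex.Im S = 0.
    rewrite /S; elim: (B) => [|i D IH]; first by rewrite big_nil.
    by rewrite big_cons raddfD /= (hf i).2 IH addr0.
  have ReS : 1 <= complex.Re S.
    have iB : i0 \in B by rewrite mem_undup inE eqxx.
    rewrite /S (big_rem i0) //= f0 raddfD /= lerDl.
    elim: (rem _ _) => [|i D IH]; first by rewrite big_nil.
    by rewrite big_cons raddfD /= addr_ge0 //; exact: (hf i).1.
  move=> H; have := le_trans (ler_Im_nrm _) H; have := le_trans (ler_Re_nrm _) H.
  rewrite !raddfB /= ImS sub0r normrN => h1 h2; split=> //.
  by move: h1; rewrite ler_norml; lra.
split; first by apply/ler_addgt0Pr => e /key[]; lra.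
by apply/eqP; rewrite -normr_le0; apply/ler_addgt0Pr => e /key[]; rewrite add0r.
Qed.

(** On the imaginary axis the theta series on both sides of the inversion have positive terms; this
    sign settles the square root in [J_scale]. *)
Lemma J_imag (y : R) : 0 < y -> exists2 c : R, 0 < c & J (0 +i* y) = c%:C.
Proof.
move=> y0; have hw : 0 < complex.Im (0 +i* y) by [].
have e (a : R) : E (0 +i* a) = (expR (- (tpi * a)))%:C.
  by rewrite e2piE mulr0 cos0 sin0 mulr1 mulr0.
have t2 (a : R) : (0 +i* a) / 2%:R = 0 +i* (a / 2) :> C.
  have -> : (2%:R^-1 : C) = (2^-1)%:C by rewrite fmorphV rmorph_nat.
  by apply/eqP; rewrite eq_complex /= !mul0r mulr0 subr0 add0r !eqxx.
have hpos (a : R) (n : int) : thterm (0 +i* a) 0 n = (expR (- (tpi * (a * n%:~R ^+ 2 / 2))))%:C.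
  rewrite /thterm addr0 -e; congr E; rewrite -t2; congr (_ / _).
  by rewrite -(rmorph_int (real_complex R)) -rmorphXn; apply/eqP; rewrite eq_complex /= !mul0r mulr0 subr0 add0r !eqxx.
have h1 := hasum_theta 0 hw; have h2 := hasum_theta 0 (Im_inv_upper hw).
have inv : - (0 +i* y)^-1 = 0 +i* (y^-1) :> C.
  apply/eqP; rewrite eq_complex /= mul0r oppr0 eqxx /= opprK expr0n add0r expr2 invfM mulrA mulfV ?mul1r // gt_eqF //.
rewrite inv in h2.
have pz (a : R) : thterm (0 +i* a : C) 0 0 = 1 by rewrite hpos expr0n mulr0 mul0r mulr0 oppr0 expR0.
have pp (a : R) n : 0 <= complex.Re (thterm (0 +i* a : C) 0 n) /\ complex.Im (thterm (0 +i* a : C) 0 n) = 0.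
  by rewrite hpos /= expR_ge0.
have [r1 i1] := hasum_pos h1 (pz y) (pp y).
have [r2 i2] := hasum_pos h2 (pz y^-1) (pp y^-1).
have D : theta (0 +i* y) 0 = J (0 +i* y) * theta (0 +i* y^-1) 0.
  by rewrite theta_Dual // /Dual expr0n /= !(mulr0, mul0r) E0 mul1r oppr0 inv.
move: r1 i1 r2 i2 D; case: (theta (0 +i* y) 0) => a b /= a1 b0; case: (theta _ 0) => c d /= c1 d0 D.
subst b d; exists (a / c); first by rewrite divr_gt0; lra.
have c0 : (c +i* 0 : C) != 0 by rewrite eq_complex /= negb_and gt_eqF //; lra.
apply: (mulIf c0); rewrite -D complexr0 -rmorphM /= divfK // gt_eqF //; lra.
Qed.

(** The differential equation makes both $J(w)^2w$ and $J(\lambda w)/J(w)$ constant. At $w=i$ the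
    first gives the square of the second, and positivity on the imaginary axis picks the root. *)
Lemma J_scale (lam : R) w : 0 < lam -> 0 < complex.Im w ->
  J (lam%:C * w) * (Num.sqrt lam)%:C = J w.
Proof.
move=> l0 hw.
have lC : lam%:C != 0 :> C by rewrite -nrm_gt0 nrm_real gtr0_norm.
have imz (z : C) : 0 < complex.Im z -> 0 < complex.Im (lam%:C * z).
  by case: z => a b /= hb; rewrite mul0r addr0 mulr_gt0.
pose S := fun w => J w * J w * w.
have S0 (z : C) : 0 < complex.Im z -> cdiff S z 0.
  move=> hz; have z0 := upper_neq0 hz.
  have := cdiffM (cdiffM (J_deriv hz) (J_deriv hz)) (cdiff_id z).
  by congr (cdiff _ _ _); rewrite /=; field; exact: z0.
pose Q := fun w => J (lam%:C * w) / J w.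
have Q0 (z : C) : 0 < complex.Im z -> cdiff Q z 0.
  move=> hz; have z0 := upper_neq0 hz; have Jz := J_neq0 hz.
  have h1 : cdiff (fun z => lam%:C * z) z (0 * z + lam%:C * 1).
    by apply: cdiffM; [exact: cdiff_cst|exact: cdiff_id].
  have h2 := cdiff_comp h1 (J_deriv (imz z hz)).
  have h3 := cdiff_comp (J_deriv hz) (cdiff_inv Jz).
  have := cdiffM h2 h3; congr (cdiff _ _ _) => /=.
  move: (J (lam%:C * z)) (J z) Jz => A B B0; field; by rewrite B0 z0 lC.
have hi : 0 < complex.Im (0 +i* (1 : R)) by rewrite /= ltr01.
have e1 := const_upper Q0 hw hi.
have e2 := const_upper S0 (imz _ hi) hi.
have li : lam%:C * (0 +i* 1) = 0 +i* lam :> C.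
  by apply/eqP; rewrite eq_complex /= !mulr0 mul0r subr0 addr0 mulr1 !eqxx.
have [c c0 hc] := J_imag l0; have [b b0 hb] := J_imag ltr01.
rewrite /Q li hc hb in e1.
have lc : lam * (c * c) = b * b.
  have := e2; rewrite /S li hc hb -li mulrA => H.
  have {H} : c%:C * c%:C * lam%:C = b%:C * b%:C :> C.
    by apply: (mulIf (upper_neq0 hi)); rewrite -[_ * _ * 'i%C]mulrA.
  rewrite -!rmorphM /= => /complexI; lra.
have sq : Num.sqrt lam * c = b.
  apply/eqP; rewrite -(@eqrXn2 _ 2) // ?mulr_ge0 ?sqrtr_ge0 ?(ltW c0) ?(ltW b0) //.
  by rewrite exprMn sqr_sqrtr ?(ltW l0) // !expr2 lc.
have bC : b%:C != 0 :> C by rewrite -nrm_gt0 nrm_real gtr0_norm.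
have Jw := J_neq0 hw.
have -> : J (lam%:C * w) = c%:C / b%:C * J w by rewrite -e1 divfK.
rewrite -sq rmorphM /=; field.
apply/andP; split; first by rewrite -nrm_gt0 nrm_real gtr0_norm.
by rewrite -nrm_gt0 nrm_real gtr0_norm // sqrtr_gt0.
Qed.

End ThetaFactor.

(** * Theta functions of level N *)

Section LevelTheta.
Variable R : realType.
Local Notation C := (Cplx R).
Local Notation E := (@e2pi R).
Local Notation nrm := (@nrm R).
Local Notation J := (@J R).
Local Notation theta := (@theta R).

Lemma castZ (k : nat) : (k%:Z)%:~R = k%:R :> C.
Proof. by rewrite -pmulrn. Qed.

Lemma castR (k : nat) : (k%:R : int)%:~R = k%:R :> C.
Proof. exact: rmorph_nat. Qed.

Definition castE := (@expr2, castZ, castR, @intrD C, @intrM C, @mulrNz C 1, @mulr1z C 1, @natrM C, @natrD C).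

(* [th N r t] is the sum of [e(t s^2 / (4 N))] over [s = r] modulo [2 N]. *)
Definition th (N : nat) (r : int) (t : C) : C := theta ((2 * N)%:R * t) (r%:~R / (2 * N)%:R).

Lemma natC_neq0 n : (0 < n)%N -> n%:R != 0 :> C.
Proof. by move=> n0; rewrite pnatr_eq0 -lt0n. Qed.

Lemma Im_2N N (t : C) : (0 < N)%N -> 0 < complex.Im t -> 0 < complex.Im ((2 * N)%:R * t).
Proof. by move=> N0 ht; rewrite Im_natM mulr_gt0 // ltr0n muln_gt0. Qed.

Definition thN (N : nat) (t : C) (s : int) : C := E (t * s%:~R ^+ 2 / (4 * N)%:R).

Lemma hasum_th N r t : (0 < N)%N -> 0 < complex.Im t ->
  hasum (fun n : int => thN N t ((2 * N)%N%:Z * n + r)) (th N r t).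
Proof.
move=> N0 ht; have NC := natC_neq0 N0.
apply: hasum_ext (hasum_theta (r%:~R / (2 * N)%:R) (Im_2N N0 ht)) => n.
rewrite /thterm /thN !castE; congr E; field; exact: NC.
Qed.

Lemma th_per N r k t : (0 < N)%N -> 0 < complex.Im t -> th N (r + (2 * N)%N%:Z * k) t = th N r t.
Proof.
move=> N0 ht; have h := hasum_th r N0 ht.
have h' := @hasum_bij R _ _ (fun n : int => n + k) (fun n => n - k) _ _ (fun n => addrK k n) (fun n => subrK k n) h.
apply: (hasum_eq _ (hasum_th _ N0 ht) h') => n; congr thN; ring.
Qed.

Lemma th_even N r t : (0 < N)%N -> 0 < complex.Im t -> th N (- r) t = th N r t.
Proof.
move=> N0 ht; have h := hasum_th r N0 ht.
have h' := @hasum_bij R _ _ (fun n : int => - n) (fun n => - n) _ _ (@opprK _) (@opprK _) h.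
apply: (hasum_eq _ (hasum_th _ N0 ht) h') => n; rewrite /thN !castE; congr E; ring.
Qed.

Lemma th_T N r k t : (0 < N)%N -> 0 < complex.Im t ->
  th N r (t + (4 * N)%:R * k%:~R) = th N r t.
Proof.
move=> N0 ht; have NC := natC_neq0 N0.
have ht' : 0 < complex.Im (t + (4 * N)%:R * k%:~R).
  by rewrite -(rmorph_int (real_complex R)) -(rmorph_nat (real_complex R)) -rmorphM Im_addr.
apply: (hasum_eq _ (hasum_th _ N0 ht') (hasum_th r N0 ht)) => n.
rewrite /thN; set s := (_ + r : int).
rewrite -[RHS](EDint _ (k * s ^+ 2)); congr E.
rewrite !castE; field; exact: NC.
Qed.

Lemma asum_thN_twist N (t x : C) : (0 < N)%N -> 0 < complex.Im t ->
  (forall n : int, nrm (E (n%:~R * x)) = 1) ->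
  exists M, asum (fun n : int => E (n%:~R * x) * thN N t n) M.
Proof.
move=> N0 ht hx; have NC := natC_neq0 N0.
have ht2 : 0 < complex.Im (t / (2 * N)%:R).
  have : 0 < complex.Im ((2 * N)%:R * (t / (2 * N)%:R)).
    by rewrite mulrCA mulfV ?mulr1 // natC_neq0 // muln_gt0.
  by rewrite Im_natM pmulr_rgt0 // ltr0n muln_gt0.
have [M hM] := asum_theta 0 ht2; exists M; apply: asum_le hM => n.
rewrite nrmM hx mul1r /thN /thterm addr0 !natrM le_eqVlt; apply/orP; left; apply/eqP.
by congr (nrm (E _)); field; exact: NC.
Qed.

Lemma nrm_Erat (n r : int) (k : nat) : nrm (E (n%:~R * (r%:~R / k%:R))) = 1.
Proof.
have -> : n%:~R * (r%:~R / k%:R) = (n%:~R * (r%:~R / k%:R))%:C :> C.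
  by rewrite !rmorphM /= fmorphV !rmorph_int rmorph_nat.
exact: nrm_Ereal.
Qed.

Lemma coprimez1 k : coprimez 1 k.
Proof. by rewrite /coprimez /gcdz gcd1n. Qed.

Lemma th_twist N (r : int) (t : C) S : (0 < N)%N -> 0 < complex.Im t ->
  hasum (fun n : int => E (n%:~R * (r%:~R / (2 * N)%:R)) * thN N t n) S ->
  S = \sum_(s < 2 * N) E (s%:R * (r%:~R / (2 * N)%:R)) * th N s%:Z t.
Proof.
move=> N0 ht hS; have NN : (0 < 2 * N)%N by rewrite muln_gt0.
have NC := natC_neq0 NN.
apply: (hasum_residue NN (coprimez1 _) hS) => s.
apply: hasum_ext (hasumZ _ (hasum_th s%:Z N0 ht)) => m; rewrite mul1r; congr (_ * _).
rewrite -[LHS](EDint _ (m * r)); congr E; rewrite !castE; field.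
exact: natC_neq0.
Qed.

(** The dual series runs over all integers with an additive character modulo [2 * N]; sorting by
    residues gives a finite Fourier transform of the [th N s]. *)
Lemma th_S N r t : (0 < N)%N -> 0 < complex.Im t ->
  th N r t = J ((2 * N)%:R * t) * \sum_(s < 2 * N) E (s%:R * (r%:~R / (2 * N)%:R)) * th N s%:Z (- t^-1).
Proof.
move=> N0 ht; have NC := natC_neq0 N0; have t0 := upper_neq0 ht.
rewrite /th theta_Dual ?Im_2N // -/(th N _ _); congr (_ * _).
apply: (th_twist N0 (Im_inv_upper ht)).
apply: hasum_ext (hasum_Dual _ (Im_2N N0 ht)) => m.
rewrite /dual /thN -ED; congr E; rewrite !natrM; field; by rewrite NC t0.
Qed.

Definition gauss (p : nat) (mu : int) : C := \sum_(k < p) E (mu%:~R * k%:R ^+ 2 / p%:R).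

Lemma gauss_shift (p : nat) (mu u : int) : (0 < p)%N ->
  \sum_(k < p) E (mu%:~R * (k%:R + u%:~R) ^+ 2 / p%:R) = gauss p mu.
Proof.
move=> p0; have pC := natC_neq0 p0.
pose a := fun k : nat => E (mu%:~R * k%:R ^+ 2 / p%:R).
have ap i : a (i + p)%N = a i.
  rewrite /a -[RHS](EDint _ (mu * (2 * i%:Z + p%:Z))); congr E.
  rewrite !castE; field; exact: pC.
rewrite /gauss -(sum_shift `|(u %% p%:Z)%Z|%N ap); apply: eq_bigr => k _; rewrite /a.
have pz : p%:Z != 0 by rewrite gt_eqF // ltz_nat.
have := divz_eq u p%:Z; set q := (_ %/ _)%Z; set v := (_ %% _)%Z => ->.
have v0 : 0 <= v by exact: modz_ge0.
rewrite -[RHS](EDint _ (mu * q * (2 * (k%:Z + v) + q * p%:Z))); congr E.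
rewrite natrD (_ : (`|v|%N)%:R = v%:~R :> C); last by rewrite -[in RHS](gez0_abs v0) -pmulrn.
rewrite !castE; field; exact: pC.
Qed.

(** [ka] inverts [4 * mu] modulo [p], so replacing [k] by [k + 2 * ka * s] completes the square:
    $\mu(k+2\kappa s)^2\equiv\mu k^2+ks+\kappa s^2$. *)
Lemma gauss_fourier (p : nat) (mu ka j s : int) : (0 < p)%N -> 4 * ka * mu = 1 + p%:Z * j ->
  gauss p mu * E (- ka%:~R * s%:~R ^+ 2 / p%:R) =
  \sum_(k < p) E ((mu%:~R * k%:R ^+ 2 + k%:R * s%:~R) / p%:R).
Proof.
move=> p0 h; have pC := natC_neq0 p0.
rewrite -(gauss_shift mu (2 * ka * s) p0) mulr_suml; apply: eq_bigr => k _.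
rewrite -ED -[RHS](EDint _ (j * (k%:Z * s + ka * s ^+ 2))); congr E.
have hC : 4%:R * ka%:~R * mu%:~R = 1 + p%:R * j%:~R :> C.
  by move/(congr1 (fun z : int => z%:~R : C)): h; rewrite !castE.
rewrite !castE.
have -> : j%:~R = (4%:R * ka%:~R * mu%:~R - 1) / p%:R :> C by rewrite hC; field; exact: pC.
field; exact: pC.
Qed.

(* [t] and its image are [w] minus, and [- 1 / (p^2 w)] plus, a rational with denominator [p];
   splitting the summation modulo [p] produces the Gauss sum. *)
Lemma th_A (p N : nat) (r mu ka ka' ep j j' i : int) (w : C) : (0 < p)%N -> (0 < N)%N ->
  coprimez (- (2 * N)%N%:Z) p -> 4 * ka * mu = 1 + p%:Z * j ->
  4 * N%:Z ^+ 2 * ka' = mu + p%:Z * j' -> ep * p%:Z = 1 + (2 * N)%N%:Z * i ->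
  0 < complex.Im w ->
  let t := w - (4 * N)%:R * ka%:~R / p%:R in
  let t' := (4 * N)%:R * ka'%:~R / p%:R - (p%:R ^+ 2 * w)^-1 in
  gauss p mu * th N r t = J ((2 * N)%:R * w) *
    \sum_(s < 2 * N) E (s%:R * ((ep * r)%:~R / (2 * N)%:R)) * th N s%:Z t'.
Proof.
move=> p0 N0 cop hka hka' hep hw t t'.
have pC := natC_neq0 p0; have NC := natC_neq0 N0; have w0 := upper_neq0 hw.
have rat (k : int) (n m : nat) : exists a : R, n%:R * k%:~R / m%:R = a%:C :> C.
  by exists (n%:R * k%:~R / m%:R); rewrite !rmorphM /= fmorphV !rmorph_nat rmorph_int.
have ht : 0 < complex.Im t.
  by rewrite /t; have [a ->] := rat ka (4 * N)%N p; rewrite -rmorphN Im_addr.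
have ht' : 0 < complex.Im t'.
  rewrite /t'; have [a ->] := rat ka' (4 * N)%N p; rewrite addrC Im_addr.
  by apply: Im_inv_upper; rewrite -natrX Im_natM mulr_gt0 // ltr0n expn_gt0 p0.
pose phi := fun n : int => E (n%:~R * ((ep * r)%:~R / (2 * N)%:R)) * thN N t' n.
have [M hM] := @asum_thN_twist N t' _ N0 ht' (fun n => nrm_Erat n (ep * r) (2 * N)).
have hS := hasum_tsum hM; rewrite -/phi in hS.
rewrite -(th_twist N0 ht' hS).
have hcC : 4%:R * (N%:R * N%:R) * ka'%:~R = mu%:~R + p%:R * j'%:~R :> C.
  by move/(congr1 (fun z : int => z%:~R : C)): hka'; rewrite !castE.
have heC : ep%:~R * p%:R = 1 + 2%:R * N%:R * i%:~R :> C.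
  by move/(congr1 (fun z : int => z%:~R : C)): hep; rewrite !castE.
pose y := fun k : 'I_p => (r%:~R / (2 * N)%:R + k%:R / (p%:R * w) : C).
pose T := fun k : 'I_p => E (- (N%:R * k%:R ^+ 2 / (p%:R ^+ 2 * w))) * theta ((2 * N)%:R * w) (y k).
(* Sorting the dual side by the classes of $-2Nk$ modulo $p$ turns each class into a [dual] series
   at the point [y k]. *)
have e1 : J ((2 * N)%:R * w) * tsum phi = \sum_(k < p) E (mu%:~R * k%:R ^+ 2 / p%:R) * T k.
  pose sk := fun k : 'I_p => E (mu%:~R * k%:R ^+ 2 / p%:R) * (E (- (N%:R * k%:R ^+ 2 / (p%:R ^+ 2 * w))) * Dual ((2 * N)%:R * w) (y k)).
  rewrite (@hasum_residue R p (- (2 * N)%N%:Z) phi _ sk p0 cop hS).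
    rewrite mulr_sumr; apply: eq_bigr => k _.
    by rewrite /T /sk theta_Dual ?Im_2N //; ring.
  move=> k; rewrite /sk mulrA.
  apply: hasum_ext (hasumZ _ (hasum_Dual (y k) (Im_2N N0 hw))) => m.
  rewrite /phi /thN /dual -!ED.
  rewrite -[LHS](EDint _ (m * r * i - ep * r * k%:Z + ka' * (m * m * p%:Z - 4 * N%:Z * m * k%:Z) + j' * k%:Z ^+ 2)).
  congr E; rewrite /y /t'.
  have ej : j'%:~R = (4%:R * (N%:R * N%:R) * ka'%:~R - mu%:~R) / p%:R :> C by rewrite hcC; field; exact: pC.
  have ee : ep%:~R = (1 + 2%:R * N%:R * i%:~R) / p%:R :> C by rewrite -heC; field; exact: pC.
  rewrite !castE ej ee.
  by field; rewrite NC pC w0.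
rewrite e1.
(* [T k] is also the series at [w] twisted by $e(ks/p)$; summing over [k] first produces the Gauss
   sum by [gauss_fourier]. *)
have hT (k : 'I_p) : hasum (fun n : int => E (k%:R * (((2 * N)%N%:Z * n + r)%:~R / p%:R)) * thN N w ((2 * N)%N%:Z * n + r)) (T k).
  apply: hasum_ext (hasumZ _ (hasum_theta (y k) (Im_2N N0 hw))) => n.
  rewrite /thterm /thN -!ED; congr E; rewrite /y !castE; field.
  by rewrite NC pC w0.
have h2 : hasum (fun n : int => \sum_(k < p) E (mu%:~R * k%:R ^+ 2 / p%:R) *
    (E (k%:R * (((2 * N)%N%:Z * n + r)%:~R / p%:R)) * thN N w ((2 * N)%N%:Z * n + r)))
    (\sum_(k < p) E (mu%:~R * k%:R ^+ 2 / p%:R) * T k).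
  by apply: hasum_sum => k; apply: hasumZ.
apply: (hasum_eq _ (hasumZ (gauss p mu) (hasum_th r N0 ht)) h2) => n.
set s := (_ + r : int).
have -> : thN N t s = E (- ka%:~R * s%:~R ^+ 2 / p%:R) * thN N w s.
  rewrite /thN -ED /t !natrM; congr E; field; by rewrite NC pC.
rewrite mulrA (gauss_fourier s p0 hka) mulr_suml; apply: eq_bigr => k _.
by rewrite mulrA -ED; congr (E _ * _); field; exact: pC.
Qed.

End LevelTheta.

(** * The Fricke involution and the matrices with lower left entry 31 *)

Section Pairings.
Variable R : realType.
Local Notation C := (Cplx R).
Local Notation E := (@e2pi R).
Local Notation J := (@J R).
Local Notation th := (@th R).
Local Notation gauss := (@gauss R).

(* The character of the pentagonal number theorem: [eta12 = 2 eta]. *)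
Definition chi12 (r : nat) : C :=
  if r \in [:: 1; 11]%N then 1 else if r \in [:: 5; 7]%N then -1 else 0.

Definition eta12 (t : C) : C := \sum_(r < 12) chi12 r * th 6 r%:Z t.

Local Notation z := (E (12%:R^-1)).

(** The Gauss sum of the character modulo 12, that is $2\sqrt3$; it cancels between the two eta
    factors. *)
Definition s12 : C := 2%:R * (z - z ^+ 5).

Lemma z6 a b : z ^+ (6 * a + b) = (-1) ^+ a * z ^+ b.
Proof.
rewrite exprD exprM; congr (_ ^+ a * _).
rewrite -EMn -[RHS](Ehalf R); by congr E; field.
Qed.

Lemma chi12_gaussX (s : nat) : \sum_(r < 12) chi12 r * z ^+ (s * r) =
  (1 - (-1) ^+ s) * (z ^+ s - z ^+ (5 * s)).
Proof.
rewrite !big_ord_recl big_ord0 /= /bump /= /chi12 /= !mul0r !mul1r !mulN1r !add0r !addr0 muln1.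
have -> : z ^+ (s * 7) = (-1) ^+ s * z ^+ s by rewrite -z6; congr (_ ^+ _); lia.
have -> : z ^+ (s * 11) = (-1) ^+ s * z ^+ (5 * s) by rewrite -z6; congr (_ ^+ _); lia.
rewrite (mulnC s 5); ring.
Qed.

Lemma chi12_gauss (s : nat) : (s < 12)%N ->
  \sum_(r < 12) chi12 r * z ^+ (s * r) = chi12 s * s12.
Proof.
move=> s12'; rewrite chi12_gaussX /s12.
have e3 := z6 2 3; have e5 := z6 4 1; have e7 := z6 1 1; have e7' := z6 5 5.
have e9 := z6 1 3; have e9' := z6 7 3; have e11 := z6 1 5; have e11' := z6 9 1.
move: s s12'; do 12?[case => [_|] /=]; rewrite ?expr0 ?expr1 /chi12 /= ?subrr ?mul0r //.
- by rewrite muln1; ring.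
- by ring.
- by rewrite (e3 : z ^+ (5 * 3) = _); ring.
- by ring.
- by rewrite (e5 : z ^+ (5 * 5) = _); ring.
- by ring.
- by rewrite (e7 : z ^+ 7 = _) (e7' : z ^+ (5 * 7) = _); ring.
- by ring.
- by rewrite (e9 : z ^+ 9 = _) (e9' : z ^+ (5 * 9) = _); ring.
- by ring.
- by rewrite (e11 : z ^+ 11 = _) (e11' : z ^+ (5 * 11) = _); ring.
Qed.

(** The residue 7 enters as the inverse of 31 modulo 12, and the sign is the value of the character
    there. *)
Lemma chi12_gauss7 (s : nat) : (s < 12)%N ->
  \sum_(r < 12) chi12 r * z ^+ (s * (7 * r)) = - (chi12 s * s12).
Proof.
move=> hs; rewrite -(chi12_gauss hs) chi12_gaussX.
transitivity (- \sum_(r < 12) chi12 r * z ^+ (s * r)); last by rewrite chi12_gaussX.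
transitivity (\sum_(r < 12) chi12 r * z ^+ (7 * s * r)).
  by apply: eq_bigr => r _; congr (_ * _ ^+ _); lia.
rewrite !chi12_gaussX.
have m5 : (-1) ^+ 5 = -1 :> C by ring.
have -> : z ^+ (7 * s) = (-1) ^+ s * z ^+ s by rewrite -z6; congr (_ ^+ _); lia.
have -> : z ^+ (5 * (7 * s)) = (-1) ^+ s * z ^+ (5 * s).
  by rewrite -{1}m5 -exprM -z6; congr (_ ^+ _); lia.
have -> : (-1) ^+ (7 * s) = (-1) ^+ s :> C by rewrite exprM; congr (_ ^+ _); ring.
have ee : (-1) ^+ s * (-1) ^+ s = 1 :> C by rewrite -exprMn mulrNN mulr1 expr1n.
rewrite -mulrBr mulrA mulrBl ee; ring.
Qed.

Lemma Ez (s r : nat) : E (s%:R * (r%:Z%:~R / (2 * 6)%:R)) = z ^+ (s * r).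
Proof. by rewrite -EMn castZ natrM; congr E; field. Qed.

Lemma Ez7 (s r : nat) : E (s%:R * ((7 * r%:Z)%:~R / (2 * 6)%:R)) = z ^+ (s * (7 * r)).
Proof. by rewrite -EMn !castE; congr E; field. Qed.

Lemma eta12_S (t : C) : 0 < complex.Im t -> eta12 t = s12 * J (12%:R * t) * eta12 (- t^-1).
Proof.
move=> ht; rewrite /eta12.
under eq_bigr => r _ do rewrite (@th_S R 6 r%:Z t isT ht) mulrCA mulr_sumr.
rewrite -mulr_sumr exchange_big /= [s12 * _]mulrC -mulrA; congr (_ * _); rewrite mulr_sumr.
apply: eq_bigr => s _; rewrite mulrA [s12 * _]mulrC -chi12_gauss // mulr_suml.
by apply: eq_bigr => r _; rewrite Ez mulrA.
Qed.

Lemma th_Th (N : nat) (r : int) (t : C) (k : int) : (0 < N)%N -> 0 < complex.Im t ->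
  th N r (31%:R * (t - (4 * N)%:R * k%:~R / 31%:R)) = th N r (31%:R * t).
Proof.
move=> N0 ht; have ht31 : 0 < complex.Im (31%:R * t) by rewrite Im_natM mulr_gt0.
rewrite -(@th_T R N r (- k) (31%:R * t) N0 ht31) mulrNz; by congr th; field.
Qed.

(* [Th 1] and [Th 2] are the theta series of [u^2 + u v + 8 v^2] and [2 u^2 + u v + 4 v^2]:
   [4 N] times the form is [(2 N u + v)^2 + 31 v^2]. *)
Definition Th (N : nat) (t : C) : C := \sum_(r < 2 * N) th N r%:Z t * th N r%:Z (31%:R * t).

Lemma upper31 (w : C) : 0 < complex.Im w -> 0 < complex.Im (31%:R * w) /\ 0 < complex.Im (- (31%:R * w)^-1).
Proof.
move=> hw; have h : 0 < complex.Im (31%:R * w) by rewrite Im_natM mulr_gt0.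
by split=> //; exact: Im_inv_upper.
Qed.

Lemma th_S31 N r (w : C) : (0 < N)%N -> 0 < complex.Im w ->
  th N r (- (31%:R * w)^-1) = J ((2 * N)%:R * - (31%:R * w)^-1) *
    \sum_(s < 2 * N) E (s%:R * (r%:~R / (2 * N)%:R)) * th N s%:Z (31%:R * w).
Proof.
move=> N0 /upper31[h1 h2]; rewrite (th_S r N0 h2); congr (_ * _).
by rewrite invrN opprK invrK.
Qed.

Lemma eta12_S31 (w : C) : 0 < complex.Im w ->
  eta12 (- (31%:R * w)^-1) = s12 * J (12%:R * - (31%:R * w)^-1) * eta12 (31%:R * w).
Proof. by move=> /upper31[h1 h2]; rewrite (eta12_S h2) invrN opprK invrK. Qed.

Lemma th_dual_sum (N : nat) (ep s : int) (w : C) : (0 < N)%N -> 0 < complex.Im w -> ep = 1 \/ ep = -1 ->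
  J ((2 * N)%:R * - (31%:R * w)^-1) *
   (\sum_(r < 2 * N) E (s%:~R * ((ep * r%:Z)%:~R / (2 * N)%:R)) * th N r%:Z (31%:R * w)) =
  th N s (- (31%:R * w)^-1).
Proof.
move=> N0 hw hep; have [h1 h2] := upper31 hw.
have -> : th N s (- (31%:R * w)^-1) = th N (ep * s) (- (31%:R * w)^-1).
  by case: hep => ->; rewrite ?mul1r // mulN1r th_even.
rewrite th_S31 //; congr (_ * _); apply: eq_bigr => r _; congr (E _ * _).
by rewrite !castE; ring.
Qed.

Definition Jratio (w : C) : C := J w / J (- (31%:R * w)^-1).

Lemma Jratio_neq0 (w : C) : 0 < complex.Im w -> Jratio w != 0.
Proof. by move=> hw; have [h1 h2] := upper31 hw; rewrite mulf_neq0 ?invr_eq0 ?J_neq0. Qed.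

(** Both arguments are scaled by the same [k], so the factors $\sqrt k$ of [J_scale] cancel and one
    ratio serves for $k=2,4,12$. *)
Lemma JratioE (k : nat) (w : C) : (0 < k)%N -> 0 < complex.Im w ->
  J (k%:R * w) = Jratio w * J (k%:R * - (31%:R * w)^-1).
Proof.
move=> k0 hw; have [h1 h2] := upper31 hw.
have kR : 0 < (k%:R : R) by rewrite ltr0n.
have kE : k%:R = (k%:R : R)%:C :> C by rewrite rmorph_nat.
have e1 := J_scale kR hw; have e2 := J_scale kR h2.
have sk : (Num.sqrt (k%:R : R))%:C != 0 :> C by rewrite -nrm_gt0 nrm_real gtr0_norm sqrtr_gt0.
have J0 := J_neq0 h2.
have alg (a b c d s : C) : s != 0 -> d != 0 -> a * s = b -> c * s = d -> a = b / d * c.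
  move=> s0 d0 <- e; have c0 : c != 0 by apply: contraNneq d0 => c0; rewrite -e c0 mul0r.
  by rewrite -e; field; rewrite s0 c0.
by rewrite -kE in e1 e2; exact: alg sk J0 e1 e2.
Qed.

(** Here [ep] is the inverse of 31 modulo [2 * N]; being 1 or -1 it is absorbed by the evenness of
    [th]. *)
Lemma Th_A (N : nat) (mu ka ka' ep j j' i : int) (w : C) : (0 < N)%N ->
  coprimez (- (2 * N)%N%:Z) 31 -> 4 * ka * mu = 1 + 31%:Z * j ->
  4 * N%:Z ^+ 2 * ka' = mu + 31%:Z * j' -> ep * 31%:Z = 1 + (2 * N)%N%:Z * i ->
  ep = 1 \/ ep = -1 -> 0 < complex.Im w ->
  let t := w - (4 * N)%:R * ka%:~R / 31%:R in
  let t' := (4 * N)%:R * ka'%:~R / 31%:R - (31%:R ^+ 2 * w)^-1 in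
  gauss 31 mu * Th N t = Jratio w * Th N t'.
Proof.
move=> N0 cop hka hka' hep1 hep hw t t'; have [h1 h2] := upper31 hw.
have w0 := upper_neq0 hw.
have N20 : (0 < 2 * N)%N by rewrite muln_gt0.
have e31 r : th N r (31%:R * t') = th N r (- (31%:R * w)^-1).
  rewrite -[RHS](@th_T R N r ka' _ N0 h2); congr th; rewrite /t'; field; exact: w0.
rewrite /Th mulr_sumr.
under eq_bigr => r _ do rewrite mulrA (@th_A R 31 N r%:Z mu ka ka' ep j j' i w) // th_Th // -mulrA mulr_suml.
rewrite -mulr_sumr exchange_big /= (JratioE N20 hw) -mulrA; congr (_ * _).
rewrite mulr_sumr; apply: eq_bigr => s _; rewrite e31 -(@th_dual_sum N ep s%:Z w N0 hw hep).
rewrite mulrCA; congr (_ * _); rewrite mulr_sumr; apply: eq_bigr => r _.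
by rewrite castZ; ring.
Qed.

Lemma eta12_A (mu ka ka' j j' : int) (w : C) :
  4 * ka * mu = 1 + 31%:Z * j -> 144 * ka' = mu + 31%:Z * j' -> 0 < complex.Im w ->
  let t := w - 24%:R * ka%:~R / 31%:R in
  let t' := 24%:R * ka'%:~R / 31%:R - (31%:R ^+ 2 * w)^-1 in
  gauss 31 mu * (eta12 t * eta12 (31%:R * t)) = - (Jratio w * (eta12 t' * eta12 (31%:R * t'))).
Proof.
move=> hka hka' hw t t'; have [h1 h2] := upper31 hw; have w0 := upper_neq0 hw.
have a1 : eta12 (31%:R * t') = eta12 (- (31%:R * w)^-1).
  apply: eq_bigr => r _; congr (_ * _); rewrite -[RHS](@th_T R 6 _ ka' _ isT h2).
  by congr th; rewrite /t'; field; exact: w0.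
have a2 : eta12 (31%:R * t) = eta12 (31%:R * w).
  by apply: eq_bigr => r _; congr (_ * _); exact: (@th_Th 6).
have a3 : gauss 31 mu * eta12 t = - (s12 * J (12%:R * w) * eta12 t').
  rewrite /eta12 mulr_sumr.
  have hk2 : 4 * 6%:Z ^+ 2 * ka' = mu + 31%:Z * j' by rewrite -hka'; ring.
  have cop : coprimez (- (2 * 6)%N%:Z) 31 by [].
  have hep : 7 * 31%:Z = 1 + (2 * 6)%N%:Z * 18 by [].
  under eq_bigr => r _ do rewrite mulrCA (@th_A R 31 6 r%:Z mu ka ka' 7 j j' 18 w isT isT cop hka hk2 hep hw) mulrCA mulr_sumr.
  rewrite -mulr_sumr exchange_big /=.
  have -> : - (s12 * J (12%:R * w) * eta12 t') = J (12%:R * w) * (- s12 * eta12 t') by ring.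
  congr (_ * _); rewrite /eta12 mulr_sumr; apply: eq_bigr => s _.
  rewrite mulrA [- s12 * _]mulrC mulrN -chi12_gauss7 // mulr_suml.
  by apply: eq_bigr => r _; rewrite Ez7 mulrA.
rewrite mulrA a3 a1 a2 eta12_S31 // (@JratioE 12) //; ring.
Qed.

(** Inverting the first factor of each product produces a finite Fourier transform over [r], which
    is exactly the inversion formula for the second factor read backwards. *)
Lemma Th_fricke (N : nat) (w : C) : (0 < N)%N -> 0 < complex.Im w ->
  Th N w = Jratio w * Th N (- (31%:R * w)^-1).
Proof.
move=> N0 hw; have [h1 h2] := upper31 hw; have w0 := upper_neq0 hw.
have N20 : (0 < 2 * N)%N by rewrite muln_gt0.
have e : 31%:R * - (31%:R * w)^-1 = - w^-1 by field; exact: w0.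
rewrite /Th e.
under eq_bigr => r _ do rewrite (th_S r%:Z N0 hw) -mulrA mulr_suml.
rewrite -mulr_sumr exchange_big /= (JratioE N20 hw) -mulrA; congr (_ * _).
rewrite mulr_sumr; apply: eq_bigr => s _; rewrite -(@th_dual_sum N 1 s%:Z w N0 hw) ?mulrA; last by left.
rewrite -!mulrA; congr (_ * _); rewrite mulr_suml; apply: eq_bigr => r _.
by rewrite mul1r castZ; ring.
Qed.

Lemma eta12_fricke (w : C) : 0 < complex.Im w ->
  eta12 w * eta12 (31%:R * w) =
  Jratio w * (eta12 (- (31%:R * w)^-1) * eta12 (31%:R * - (31%:R * w)^-1)).
Proof.
move=> hw; have [h1 h2] := upper31 hw; have w0 := upper_neq0 hw.
have -> : 31%:R * - (31%:R * w)^-1 = - w^-1 by field; exact: w0.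
rewrite eta12_S // eta12_S31 // (@JratioE 12) //; ring.
Qed.

(* The hypothesis on lists says that the squares, and [c] times the squares, together cover
   each residue modulo 31 twice. *)
Lemma gauss_nonresidue (c mu v j : int) : v * mu = 1 + 31%:Z * j ->
  perm_eq ([seq ((k * k) %% 31)%N | k <- iota 0 31] ++ [seq ((`|c| * ((k * k) %% 31)) %% 31)%N | k <- iota 0 31])
    (iota 0 31 ++ iota 0 31) -> 0 <= c ->
  gauss 31 (c * mu) = - gauss 31 mu.
Proof.
move=> hv hp c0; have pC : 31%:R != 0 :> C by rewrite pnatr_eq0.
pose f := fun x : nat => E (mu%:~R * x%:R / 31%:R).
have fmod x : f (x %% 31)%N = f x.
  rewrite /f {2}(divn_eq x 31) -[LHS](EDint _ (mu * (x %/ 31)%N%:Z)); congr E.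
  by rewrite !castE; field.
have g1 : gauss 31 mu = \sum_(x <- [seq ((k * k) %% 31)%N | k <- iota 0 31]) f x.
  rewrite big_map /gauss -(big_mkord xpredT (fun k : nat => E (mu%:~R * k%:R ^+ 2 / 31%:R))) /index_iota subn0.
  by apply: eq_bigr => k _; rewrite fmod /f !castE.
have g2 : gauss 31 (c * mu) = \sum_(x <- [seq ((`|c| * ((k * k) %% 31)) %% 31)%N | k <- iota 0 31]) f x.
  rewrite big_map /gauss -(big_mkord xpredT (fun k : nat => E ((c * mu)%:~R * k%:R ^+ 2 / 31%:R))) /index_iota subn0.
  apply: eq_bigr => k _; rewrite modnMmr fmod /f !castE.
  have -> : (`|c|%N)%:R = c%:~R :> C by rewrite -[in RHS](gez0_abs c0) castZ.
  by congr E; ring.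
have s0 : \sum_(x <- iota 0 31) f x = 0.
  have z1 : E (mu%:~R / 31%:R) != 1.
    apply/negP => /eqP h.
    have : E (31%:R^-1) = 1.
      transitivity (E (mu%:~R / 31%:R) ^ v); last by rewrite h exp1rz.
      rewrite -EMz -(EDint _ j); congr E.
      have := congr1 (fun x : int => x%:~R : C) hv; rewrite !castE => hvC.
      by rewrite mulrA hvC; field.
    have -> : 31%:R^-1 = (31%:R^-1)%:C :> C by rewrite fmorphV rmorph_nat.
    by apply/eqP; apply: E_real_neq1; lra.
  have -> : \sum_(x <- iota 0 31) f x = \sum_(i < 31) E (mu%:~R / 31%:R) ^+ i.
    rewrite -(big_mkord xpredT (fun i => E (mu%:~R / 31%:R) ^+ i)) /index_iota subn0.
    by apply: eq_bigr => k _; rewrite /f -EMn; congr E; ring.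
  have := subrX1 (E (mu%:~R / 31%:R)) 31.
  rewrite -EMn mulrCA mulfV // mulr1 Eint subrr => /esym/eqP.
  by rewrite mulf_eq0 subr_eq0 (negbTE z1) /= => /eqP.
apply/eqP; rewrite -addr_eq0 addrC g1 g2 -big_cat (perm_big _ hp) big_cat /= s0 addr0 //.
Qed.

Definition thPhi (t : C) : C := (Th 1 t - Th 2 t) / (eta12 t * eta12 (31%:R * t)).

Lemma thPhi_fricke (w : C) : 0 < complex.Im w ->
  thPhi (- (31%:R * w)^-1) = thPhi w.
Proof.
move=> hw; rewrite /thPhi (eta12_fricke hw) (@Th_fricke 1 w isT hw) (@Th_fricke 2 w isT hw).
have X0 := Jratio_neq0 hw.
rewrite -mulrBr; move: (eta12 _ * eta12 _) => D; move: (_ - _) => A.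
have [->|D0] := eqVneq D 0; first by rewrite mulr0 !invr0 !mulr0.
by field; rewrite X0 D0.
Qed.

(** Put $A=24a$ and $D=24d$, so that $AD\equiv1$ modulo 31. Then $w=t+D/31$ and
    $t'=(At+(AD-1)/31)/(31t+D)$, the action of a matrix with lower left entry 31. *)
Lemma thPhi_A (a d j : int) (w : C) : 576 * a * d = 1 + 31%:Z * j -> 0 < complex.Im w ->
  let t := w - 24%:R * d%:~R / 31%:R in
  let t' := 24%:R * a%:~R / 31%:R - (31%:R ^+ 2 * w)^-1 in
  eta12 t' * eta12 (31%:R * t') != 0 -> thPhi t = thPhi t'.
Proof.
move=> h hw t t' D0; have X0 := Jratio_neq0 hw; have [h1 h2] := upper31 hw.
have w0 := upper_neq0 hw.
pose mu := 144 * a.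
have k6 : 4 * d * mu = 1 + 31%:Z * j by rewrite -h /mu; ring.
have n6 : 144 * a = mu + 31%:Z * 0 by rewrite /mu; ring.
have H6 : gauss 31 mu * (eta12 t * eta12 (31%:R * t)) =
  - (Jratio w * (eta12 t' * eta12 (31%:R * t'))) by exact: (eta12_A k6 n6 hw).
(* As $24=4\cdot6=8\cdot3$, the translation by $24d/31$ has [ka] equal to [6 * d] for $N=1$ and
   [3 * d] for $N=2$. The Gauss parameters are then $24a$ and $48a$ modulo 31, where
   $24\equiv26\cdot144$ and $48\equiv21\cdot144$. *)
have q1 : (4 * 1)%:R * (6 * d)%:~R = 24%:R * d%:~R :> C by rewrite !castE; ring.
have q1' : (4 * 1)%:R * (6 * a)%:~R = 24%:R * a%:~R :> C by rewrite !castE; ring.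
have q2 : (4 * 2)%:R * (3 * d)%:~R = 24%:R * d%:~R :> C by rewrite !castE; ring.
have q2' : (4 * 2)%:R * (3 * a)%:~R = 24%:R * a%:~R :> C by rewrite !castE; ring.
have k1 : 4 * (6 * d) * (26 * mu) = 1 + 31%:Z * (5 + 156 * j).
  rewrite (_ : 4 * (6 * d) * (26 * mu) = 156 * (576 * a * d)); last by rewrite /mu; ring.
  by rewrite h; ring.
have n1 : 4 * 1%:Z ^+ 2 * (6 * a) = 26 * mu + 31%:Z * (- (120 * a)) by rewrite /mu; ring.
have k2 : 4 * (3 * d) * (21 * mu) = 1 + 31%:Z * (2 + 63 * j).
  rewrite (_ : 4 * (3 * d) * (21 * mu) = 63 * (576 * a * d)); last by rewrite /mu; ring.
  by rewrite h; ring.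
have n2 : 4 * 2%:Z ^+ 2 * (3 * a) = 21 * mu + 31%:Z * (- (96 * a)) by rewrite /mu; ring.
have H1 : gauss 31 (26 * mu) * Th 1 t = Jratio w * Th 1 t'.
  have := @Th_A 1 _ _ _ 1 _ _ 15 w isT isT k1 n1 (erefl _) (or_introl erefl) hw.
  by rewrite q1 q1'.
have H2 : gauss 31 (21 * mu) * Th 2 t = Jratio w * Th 2 t'.
  have := @Th_A 2 _ _ _ (-1) _ _ (-8) w isT isT k2 n2 (erefl _) (or_intror erefl) hw.
  by rewrite q2 q2'.
have g1 : gauss 31 (26 * mu) = - gauss 31 mu by apply: (@gauss_nonresidue 26 mu (4 * d) j k6).
have g2 : gauss 31 (21 * mu) = - gauss 31 mu by apply: (@gauss_nonresidue 21 mu (4 * d) j k6).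
rewrite g1 in H1; rewrite g2 in H2; rewrite /thPhi.
move: H1 H2 H6 D0; move: (gauss 31 mu) (Jratio w) X0 (Th 1 t) (Th 1 t') (Th 2 t) (Th 2 t').
move: (eta12 t * _) (eta12 t' * _) => D D' g X X0 a1 b1 a2 b2 H1 H2 H6 D0.
(* The Gauss sum inherits nonvanishing from the eta product. *)
have g0 : g != 0.
  apply/negP => /eqP g0; move/eqP: H6; rewrite g0 mul0r eq_sym oppr_eq0.
  by rewrite !mulf_eq0 (negbTE X0) (negbTE D0).
have D1 : D != 0.
  apply/negP => /eqP D1; move/eqP: H6; rewrite D1 mulr0 eq_sym oppr_eq0.
  by rewrite !mulf_eq0 (negbTE X0) (negbTE D0).
have e1 : b1 = - g * a1 / X by rewrite H1; field.
have e2 : b2 = - g * a2 / X by rewrite H2; field.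
have e3 : D' = - g * D / X by rewrite mulNr H6; field.
rewrite e1 e2 e3; field; by rewrite D1 X0 g0.
Qed.

End Pairings.

(** * Expansions in q *)

Section QSeries.
Variable R : realType.
Local Notation C := (Cplx R).
Local Notation nrm := (@nrm R).

Definition qdom (I : eqType) (e : I -> nat) : Prop := forall rho : R, 0 <= rho -> rho < 1 ->
  exists M, asum (fun i => (rho ^+ e i)%:C : C) M.

Definition qser (I : eqType) (e : I -> nat) (c : I -> C) (q : C) : C :=
  tsum (fun i => c i * q ^+ e i).

Lemma hasum_supp (I : eqType) (A : seq I) (f : I -> C) : uniq A ->
  (forall i, i \notin A -> f i = 0) -> hasum f (\sum_(i <- A) f i).
Proof.
move=> uA hf e e0; exists A => B uB AB.
rewrite (big_uniq_split f uA uB AB) addrAC subrr add0r big_filter big1 ?nrm0 ?ltW //.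
Qed.

Variables (I : eqType) (e : I -> nat) (c : I -> C).
Hypotheses (edom : qdom e) (c1 : forall i, nrm (c i) <= 1).

Lemma nrm_rX (rho : R) n : 0 <= rho -> nrm (rho ^+ n)%:C = rho ^+ n.
Proof. by move=> r0; rewrite nrm_real ger0_norm // exprn_ge0. Qed.

Lemma hasum_qser (q : C) : nrm q < 1 -> hasum (fun i => c i * q ^+ e i) (qser e c q).
Proof.
move=> q1; have [M hM] := edom (nrm_ge0 q) q1; apply: (@hasum_tsum _ _ _ M).
apply: asum_le hM => i; rewrite nrmM nrmX (nrm_rX _ (nrm_ge0 q)).
by rewrite -[leRHS]mul1r ler_wpM2r ?exprn_ge0 ?nrm_ge0.
Qed.

(** [A] contains every index of exponent below [N], so the remaining terms are divisible by $q^N$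
    with a holomorphic cofactor. All truncated expansions come from here. *)
Lemma qser_tail (N : nat) (A : seq I) : uniq A -> (forall i, i \notin A -> (N <= e i)%N) ->
  exists2 g : C -> C, (forall q : C, nrm q < 1 -> cdiffb g q) &
    forall q : C, nrm q < 1 -> qser e c q = \sum_(i <- A) c i * q ^+ e i + q ^+ N * g q.
Proof.
move=> uA hA; pose f i (q : C) := (if i \in A then 0 else c i) * q ^+ (e i - N).
have dom (rho : R) : 0 < rho -> rho < 1 ->
    exists M, asum (fun i => (rho ^- N * rho ^+ e i)%:C : C) M.
  move=> r0 r1; have [M hM] := edom (ltW r0) r1; exists (nrm (rho ^- N)%:C * M).
  by apply: asum_le (asumZ _ hM) => i; rewrite rmorphM.
have bnd (rho : R) i (q : C) : 0 < rho -> nrm q <= rho ->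
    nrm (f i q) <= nrm ((rho ^- N * rho ^+ e i)%:C : C).
  move=> r0 qr; have rw := ltW r0; rewrite nrm_real ger0_norm ?mulr_ge0 ?invr_ge0 ?exprn_ge0 //.
  rewrite /f; case: ifPn => iA; first by rewrite mul0r nrm0 mulr_ge0 ?invr_ge0 ?exprn_ge0.
  rewrite -(subnKC (hA _ iA)) exprD mulKf ?expf_neq0 ?gt_eqF // addnC addnK nrmM nrmX.
  by rewrite -[leRHS]mul1r ler_pM ?exprn_ge0 ?nrm_ge0 // lerXn2r ?nnegrE ?nrm_ge0.
have hg (q : C) : nrm q < 1 -> hasum (fun i => f i q) (tsum (fun i => f i q)).
  move=> q1; pose rho := (1 + nrm q) / 2; have q0 := nrm_ge0 q.
  have r0 : 0 < rho by rewrite /rho; lra.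
  have r1 : rho < 1 by rewrite /rho; lra.
  have [M hM] := dom _ r0 r1; apply: (@hasum_tsum _ _ _ M); apply: asum_le hM => i.
  by apply: bnd => //; rewrite /rho; lra.
exists (fun q => tsum (fun i => f i q)) => q q1; last first.
  have h1 := hasumZ (q ^+ N) (hg q q1).
  have h2 : hasum (fun i => (if i \in A then c i else 0) * q ^+ e i) (\sum_(i <- A) c i * q ^+ e i).
    rewrite (eq_big_seq (fun i => (if i \in A then c i else 0) * q ^+ e i)); last by move=> i ->.
    by apply: hasum_supp => // i /negbTE ->; rewrite mul0r.
  apply: (hasum_eq _ (hasum_qser q1) (hasumD h2 h1)) => i.
  rewrite /f; case: ifPn => iA; first by rewrite mul0r mulr0 addr0.
  by rewrite mul0r add0r mulrCA -exprD subnKC // hA.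
(* Halfway between [nrm q] and 1, so that a disc around [q] stays within radius [rho], where one
   majorant applies. *)
pose rho := (1 + nrm q) / 2; have q0 := nrm_ge0 q.
have r0 : 0 < rho by rewrite /rho; lra.
have r1 : rho < 1 by rewrite /rho; lra.
have [M hM] := dom _ r0 r1.
have near (w : C) : nrm (w - q) < rho - nrm q -> nrm w <= rho.
  by move=> h; have := nrmD (w - q) q; rewrite subrK; lra.
apply: (@hasum_cdiffb R _ f _ q (rho - nrm q) _ M _ hM).
- by rewrite /rho; lra.
- move=> i z _; apply: cdiffbM; first exact: cdiffb_cst.
  exact: cdiffbX (cdiffb_id _).
- by move=> i z /near; exact: bnd.
- by move=> z /near zr; apply: hg; exact: le_lt_trans zr r1.
Qed.

Lemma qser_cdiffb (q : C) : nrm q < 1 -> cdiffb (qser e c) q.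
Proof.
move=> q1; have [g hg ge] := @qser_tail 0 [::] isT (fun _ _ => isT).
apply: (@cdiffb_ext _ g _ _ (1 - nrm q)) (hg _ q1) => [|w hw]; first by lra.
have w1 : nrm w < 1 by have := nrmD (w - q) q; rewrite subrK; lra.
by rewrite ge // big_nil add0r expr0 mul1r.
Qed.

End QSeries.

(** * Binary quadratic forms and their theta series *)

Section Forms.
Variable R : realType.
Local Notation C := (Cplx R).
Local Notation E := (@e2pi R).
Local Notation nrm := (@nrm R).
Local Notation th := (@th R).

(** Passing from [rho] to its square root absorbs the factor 2 in the comparison of exponents. *)
Lemma qdom_geom (I : eqType) (e s : I -> nat) : (forall i, (s i <= 2 * e i)%N) ->
  (forall r : R, 0 <= r -> r < 1 -> exists M, asum (fun i => (r ^+ s i)%:C : C) M) ->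
  qdom R e.
Proof.
move=> se hs rho r0 r1; pose r := Num.sqrt rho.
have s0 : 0 <= r by exact: sqrtr_ge0.
have s1 : r < 1 by rewrite -[ltRHS]sqrtr1 ltr_sqrt.
have [M hM] := hs _ s0 s1; exists M; apply: asum_le hM => i.
rewrite !nrm_real !ger0_norm ?exprn_ge0 // -{1}(sqr_sqrtr r0) -/r -exprM.
by apply: ler_wiXn2l => //; exact: ltW.
Qed.

(** The factor [1] is the middle coefficient of [Theta a 1 c], kept so that the exponents agree
    syntactically; [absz] makes it a natural number. *)
Definition qform (a c : int) (p : int * int) : nat :=
  absz (a * p.1 ^+ 2 + 1 * p.1 * p.2 + c * p.2 ^+ 2).

Lemma qform_dom (a c : int) : 1 <= a -> 4 <= c -> qdom R (qform a c).
Proof.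
move=> a1 c4; apply: (@qdom_geom _ _ (fun p : int * int => `|p.1| + `|p.2|)%N) => [[u v]|r r0 r1].
  rewrite /qform /=; have h : 4 * (u ^+ 2 + u * v + 4 * v ^+ 2) = (2 * u + v) ^+ 2 + 15 * v ^+ 2 by ring.
  have u1 : (`|u|%N : int) <= u ^+ 2 by nia.
  have v1 : (`|v|%N : int) <= v ^+ 2 by nia.
  have : 0 <= (a - 1) * u ^+ 2 by nia.
  have : 0 <= (c - 4) * v ^+ 2 by nia.
  have : 0 <= (u + v) ^+ 2 by nia.
  have : 0 <= (a - 1) * u ^+ 2 by nia.
  nia.
have [M hM] := (ex_intro (fun M => asum _ M) _ (asum_geom_int r0 r1)).
exists (M * M); apply: asum_le (asumM hM hM) => -[u v] /=.
by rewrite exprD rmorphM.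
Qed.

Definition qTheta (a c : int) (q : C) : C := qser (qform a c) (fun=> 1) q.

Lemma nomeE (t : C) : nome t = E t. Proof. by []. Qed.

Lemma nome_lt1 (t : C) : 0 < complex.Im t -> nrm (E t) < 1.
Proof.
move=> ht; rewrite nrmE -[ltRHS]expR0 ltr_expR oppr_lt0 mulr_gt0 //; exact: tpi_gt0.
Qed.

Lemma qform_pos (a c : int) p : 1 <= a -> 4 <= c ->
  a * p.1 ^+ 2 + 1 * p.1 * p.2 + c * p.2 ^+ 2 = (qform a c p)%:Z.
Proof.
move=> a1 c4; rewrite /qform gez0_abs //; case: p => u v /=.
have : 0 <= (a - 1) * u ^+ 2 by nia.
have : 0 <= (c - 4) * v ^+ 2 by nia.
have : 0 <= (2 * u + v) ^+ 2 by nia.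
nia.
Qed.

Lemma hasum_qTheta (a c : int) (t : C) : 1 <= a -> 4 <= c -> 0 < complex.Im t ->
  hasum (fun p : int * int => E t ^ (a * p.1 ^+ 2 + 1 * p.1 * p.2 + c * p.2 ^+ 2)) (qTheta a c (E t)).
Proof.
move=> a1 c4 ht.
have n1 : forall i : int * int, nrm ((fun=> 1) i : C) <= 1 by move=> ?; rewrite nrm1.
apply: hasum_ext (hasum_qser (qform_dom a1 c4) n1 (nome_lt1 ht)) => p.
by rewrite qform_pos // mul1r.
Qed.

Lemma ThetaE (a c : int) (t : C) : 1 <= a -> 4 <= c -> 0 < complex.Im t ->
  Theta a 1 c t = qTheta a c (E t).
Proof. by move=> a1 c4 ht; apply: hasum_summability; exact: hasum_qTheta. Qed.

(** The hypothesis on [c] says that the discriminant $1-4Nc$ is -31. For fixed [v] the sum over [u]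
    is a multiple of [th N v t], and that function depends on [v] modulo [2 * N] only. *)
Lemma qTheta_Th (N : nat) (c : int) (t : C) : (0 < N)%N -> 4 <= c -> 4 * N%:Z * c = 32 ->
  0 < complex.Im t -> qTheta N c (E t) = Th N t.
Proof.
move=> N0 c4 hc ht.
have N1 : 1 <= (N%:Z) by lia.
have ht31 : 0 < complex.Im (31%:R * t) by rewrite Im_natM mulr_gt0.
have h := hasum_pair_swap (hasum_qTheta N1 c4 ht).
have hin v : hasum (fun u : int => (fun p : int * int => E t ^ (N%:Z * p.2 ^+ 2 + 1 * p.2 * p.1 + c * p.1 ^+ 2)) (v, u))
    (thN N (31%:R * t) v * th N v t).
  apply: hasum_ext (hasumZ (thN N (31%:R * t) v) (hasum_th v N0 ht)) => u /=.
  rewrite -EMz /thN -ED; congr E.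
  have hC : 4%:R * N%:R * c%:~R = 32%:R :> C by have := congr1 (fun x : int => x%:~R : C) hc; rewrite !castE.
  have cE : c%:~R = 32%:R / (4%:R * N%:R) :> C.
    by rewrite -hC; field; exact: natC_neq0.
  rewrite !castE cE; field; exact: natC_neq0.
have h2 := hasum_inner h hin.
have NN : (0 < 2 * N)%N by rewrite muln_gt0.
apply: (hasum_residue NN (coprimez1 _) h2) => s.
apply: hasum_ext (hasumZ (th N s%:Z t) (hasum_th s%:Z N0 ht31)) => m.
by rewrite mul1r mulrC [(2 * N)%N%:Z * m + _]addrC th_per.
Qed.

End Forms.

(** * The pentagonal number theorem *)

Section Pentagonal.
Variable R : realType.
Local Notation C := (Cplx R).
Local Notation E := (@e2pi R).
Local Notation nrm := (@nrm R).

(** The generalised pentagonal numbers $i(3i-1)/2$ (see [pentE]), in the shape in which Shanks'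
    identity produces them. *)
Definition pent (i : int) : nat :=
  match i with
  | Posz n => n * n + 'C(n, 2)
  | Negz n => n.+1 * n.+1 + 'C(n.+2, 2)
  end.

Lemma bin2E (n : nat) : (2 * 'C(n.+1, 2) = n * n.+1)%N.
Proof. by elim: n => // n IH; rewrite binS bin1 mulnDr IH; lia. Qed.

Lemma pentE (i : int) : 2 * (pent i)%:Z = i * (3 * i - 1).
Proof.
case: i => n /=; last by have := bin2E n.+1; rewrite NegzE; lia.
by case: n => [|n] //; have := bin2E n; lia.
Qed.

Lemma pent_ge (i : int) : (`|i| <= pent i)%N.
Proof.
by case: i => n /=; [case: n => //= n; nia|nia].
Qed.

Lemma pent_dom : qdom R pent.
Proof.
apply: (@qdom_geom R _ _ (fun i : int => absz i)) => [i|r r0 r1].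
  by apply: leq_trans (pent_ge i) _; rewrite mul2n -addnn leq_addr.
by exists ((1 - r)^-1 + (1 - r)^-1); exact: asum_geom_int.
Qed.

Fixpoint zrange (n : nat) : seq int :=
  if n is m.+1 then m.+1%:Z :: - m.+1%:Z :: zrange m else [:: 0].

Lemma mem_zrange n i : (i \in zrange n) = (`|i| <= n)%N.
Proof.
elim: n => [|n IH]; first by rewrite inE; lia.
rewrite !inE IH; lia.
Qed.

Lemma uniq_zrange n : uniq (zrange n).
Proof. elim: n => //= n IH; rewrite inE !mem_zrange IH; lia. Qed.

Lemma hasum_cvC (I : eqType) (A : nat -> seq I) (f : I -> C) s : hasum f s ->
  (forall n, uniq (A n)) -> (forall n m, (n <= m)%N -> {subset A n <= A m}) ->
  (forall i, exists n, i \in A n) -> cvC (fun n => \sum_(i <- A n) f i) s.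
Proof.
move=> hf uA mA eA e e0; have [B hB] := hf _ e0.
suff [N hN] : exists N, {subset B <= A N}.
  by exists N => n Nn; apply: hB => // i /hN; exact: mA.
elim: B {hB} => [|b B [N hN]]; first by exists 0%N.
have [M hM] := eA b; exists (maxn M N) => i; rewrite inE => /orP[/eqP ->|/hN].
  by apply: (mA M) hM; exact: leq_maxl.
by apply: mA; exact: leq_maxr.
Qed.

Lemma nrm_sign (i : int) : nrm ((-1) ^ i) = 1.
Proof.
case: i => n; first by rewrite -exprnP nrmX nrmN nrm1 expr1n.
by rewrite NegzE -exprnN nrmV nrmX nrmN nrm1 expr1n invr1.
Qed.

Lemma nrm_sign_le (i : int) : nrm ((-1) ^ i) <= 1.
Proof. by rewrite nrm_sign. Qed.

Lemma sign2 (m k : int) : (-1) ^ (2 * m + k) = (-1) ^ k :> C.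
Proof.
by rewrite expfzDr ?oppr_eq0 ?oner_eq0 // -exprz_exp -exprnP sqrrN expr1n exp1rz mul1r.
Qed.

Section Product.
Variable q : C.
Hypothesis q1 : nrm q < 1.
Local Notation r := (nrm q).

Definition eprod (n : nat) : C := \prod_(1 <= j < n.+1) (1 - q ^+ j).

Lemma eprodS n : eprod n.+1 = eprod n * (1 - q ^+ n.+1).
Proof. by rewrite /eprod big_nat_recr. Qed.

Lemma eprod0 : eprod 0 = 1.
Proof. by rewrite /eprod big_geq. Qed.

Lemma qX_neq1 n : 1 - q ^+ n.+1 != 0.
Proof.
rewrite subr_eq0; apply: contraTneq q1 => h; rewrite -leNgt -(@expr_ge1 _ n.+1) //.
- by rewrite -nrmX -h nrm1.
- exact: nrm_ge0.
Qed.

Lemma eprod_neq0 n : eprod n != 0.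
Proof. by elim: n => [|n IH]; rewrite ?eprod0 ?oner_neq0 // eprodS mulf_neq0 ?qX_neq1. Qed.

(* Shanks' finite form of the pentagonal number theorem. *)
Lemma shanks n : \sum_(s < n.+1) (-1) ^+ s * (eprod n / eprod s) * q ^+ (s * n + 'C(s.+1, 2)) =
  \sum_(i <- zrange n) (-1) ^ i * q ^+ pent i.
Proof.
elim: n => [|n IH].
  by rewrite big_ord1 big_seq1 eprod0 divr1 /= expr0 expr0z mulr1.
rewrite [RHS]/= !big_cons -IH big_ord_recr /= divff ?eprod_neq0 // mulr1.
(* Cut after [m], the sum for [n + 1] differs from that for [n] by one boundary term; at [m = n]
   this term and the summand [s = n + 1] are the two new pentagonal terms. *)
have tel m : (m <= n)%N ->
  \sum_(s < m.+1) (-1) ^+ s * (eprod n.+1 / eprod s) * q ^+ (s * n.+1 + 'C(s.+1, 2)) =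
  \sum_(s < m.+1) (-1) ^+ s * (eprod n / eprod s) * q ^+ (s * n + 'C(s.+1, 2))
  - (-1) ^+ m * (eprod n / eprod m) * q ^+ ('C(m.+1, 2) + m * n.+1 + n.+1).
  elim: m => [_|m IHm mn].
    rewrite !big_ord1 eprod0 !divr1 eprodS !mul0n !add0n bin_small // !expr0; ring.
  rewrite big_ord_recr /= IHm ?(ltnW mn) // [in RHS]big_ord_recr /= -!addrA; congr (_ + _).
  have em := eprod_neq0 m; have qm := qX_neq1 m.
  pose K := (n + ('C(m.+1, 2) + m * n))%N.
  have bS : 'C(m.+2, 2) = ('C(m.+1, 2) + m.+1)%N by rewrite binS bin1.
  have -> : ('C(m.+1, 2) + m * n.+1 + n.+1 = K + m.+1)%N by rewrite /K; lia.
  have -> : (m.+1 * n.+1 + 'C(m.+2, 2) = K + m.+1 + m.+1)%N by rewrite bS /K; lia.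
  have -> : (m.+1 * n + 'C(m.+2, 2) = K + m.+1)%N by rewrite bS /K; lia.
  have -> : ('C(m.+2, 2) + m.+1 * n.+1 + n.+1 = K + m.+1 + m.+1 + n.+1)%N by rewrite bS /K; lia.
  rewrite !eprodS !exprD [(-1) ^+ m.+1]exprS.
  move: (q ^+ m.+1) (q ^+ n.+1) (q ^+ K) qm => x y z qm.
  by field; rewrite em qm.
rewrite tel // divff ?eprod_neq0 // mulr1 -invr_expz -!exprnP -exprVn invrN1.
have -> : ('C(n.+1, 2) + n * n.+1 + n.+1 = n.+1 * n.+1 + 'C(n.+1, 2))%N by lia.
rewrite [(-1) ^+ n.+1]exprS.
by do ?[move: (q ^+ _) => ?]; move: (\sum_(s < n.+1) _) ((-1) ^+ n) => ? ?; ring.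
Qed.

Lemma sum_rX n : \sum_(1 <= j < n.+1) r ^+ j <= (1 - r)^-1.
Proof.
have := asum_geom (nrm_ge0 q) q1 (iota_uniq 1 n).
rewrite /index_iota subn1; under eq_bigr do rewrite nrm_rX ?nrm_ge0 //.
by [].
Qed.

(** For $0\le x\le r<1$ one has $1-x\ge e^{-x/(1-r)}$, and the exponents sum to a geometric
    series. *)
Lemma eprod_lower : exists2 c : R, 0 < c & forall n, c <= nrm (eprod n).
Proof.
exists (expR (- ((1 - r)^-1 / (1 - r)))) => [|n]; first exact: expR_gt0.
have r0 := nrm_ge0 q.
apply: (@le_trans _ _ (expR (- ((\sum_(1 <= j < n.+1) r ^+ j) / (1 - r))))).
  by rewrite ler_expR lerN2 ler_pM2r ?invr_gt0 ?subr_gt0 // sum_rX.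
elim: n => [|n IH]; first by rewrite big_geq // mul0r oppr0 expR0 eprod0 nrm1.
rewrite big_nat_recr //= mulrDl opprD expRD eprodS nrmM.
apply: ler_pM => //; rewrite ?expR_ge0 //.
apply: (@le_trans _ _ (1 - r ^+ n.+1)); last first.
  by have := ler_nrmBB (1 : C) (q ^+ n.+1); rewrite nrm1 nrmX.
have x0 : 0 <= r ^+ n.+1 by exact: exprn_ge0.
have xr : r ^+ n.+1 <= r by rewrite exprS ler_piMr // exprn_ile1 // ltW.
move: (r ^+ n.+1) x0 xr => x x0 xr.
have a0 : 0 < 1 - r by rewrite subr_gt0.
rewrite expRN -[leRHS]invrK lef_pV2 ?posrE ?expR_gt0 ?invr_gt0 ?subr_gt0 ?(le_lt_trans xr) //.
apply: le_trans (expR_ge1Dx _).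
rewrite -(ler_pM2r (_ : 0 < 1 - x)); last lra.
rewrite mulVf; last by rewrite gt_eqF //; lra.
rewrite mulrDl mul1r -lerBlDl opprB addrCA subrr addr0 -mulrA ler_peMr //.
rewrite -(ler_pM2l a0) mulr1 mulrA divff ?gt_eqF // mul1r; lra.
Qed.

Lemma eprod_upper : exists2 B : R, 0 < B & forall n, nrm (eprod n) <= B.
Proof.
exists (expR ((1 - r)^-1)) => [|n]; first exact: expR_gt0.
have r0 := nrm_ge0 q.
apply: (@le_trans _ _ (expR (\sum_(1 <= j < n.+1) r ^+ j))); last by rewrite ler_expR sum_rX.
elim: n => [|n IH]; first by rewrite big_geq // expR0 eprod0 nrm1.
rewrite big_nat_recr //= expRD eprodS nrmM; apply: ler_pM; rewrite ?nrm_ge0 //.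
apply: le_trans (expR_ge1Dx _); apply: le_trans (nrmB _ _) _.
by rewrite nrm1 nrmX.
Qed.

(** Defined by the pentagonal series, so that holomorphy in [q] and truncation come from [qser];
    [cvC_eprod] identifies it with the infinite product. *)
Definition euler : C := qser pent (fun i => (-1) ^ i) q.

(** The summand [s = 0] of Shanks' sum is [eprod n] itself. In the others [eprod n / eprod s] is
    bounded and the exponent is at least [n], so they add up to $O(r^n)$. *)
Lemma cvC_eprod : cvC eprod euler.
Proof.
have h1 := hasum_cvC (hasum_qser pent_dom nrm_sign_le q1) uniq_zrange.
have {}h1 : cvC (fun n => \sum_(i <- zrange n) (-1) ^ i * q ^+ pent i) euler.
  apply: h1 => [n m nm i|i]; first by rewrite !mem_zrange => /leq_trans; exact.
  by exists `|i|%N; rewrite mem_zrange.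
have [c c0 hc] := eprod_lower; have [B B0 hB] := eprod_upper.
have r0 := nrm_ge0 q.
suff h2 : cvC (fun n => eprod n - \sum_(i <- zrange n) (-1) ^ i * q ^+ pent i) 0.
  rewrite -[euler]add0r; apply: cvC_ext (cvCD h2 h1) => n; exact: subrK.
have sg k : nrm ((-1 : C) ^+ k) = 1 by rewrite nrmX nrmN nrm1 expr1n.
have bd n : nrm (eprod n - \sum_(i <- zrange n) (-1) ^ i * q ^+ pent i) <= B / c / (1 - r) * r ^+ n.
  rewrite -shanks big_ord_recl /= eprod0 divr1 expr0 mul1r bin_small // mul0n expr0 mulr1.
  rewrite opprD addrA subrr add0r nrmN.
  apply: le_trans (nrm_sum _ _ _) _.
  apply: (@le_trans _ _ (\sum_(i < n) B / c * r ^+ n * r ^+ i)).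
    apply: ler_sum => i _; rewrite /bump /= add1n !nrmM sg mul1r nrmV nrmX -[leRHS]mulrA -exprD.
    apply: ler_pM; rewrite ?mulr_ge0 ?invr_ge0 ?nrm_ge0 ?exprn_ge0 //.
      by apply: ler_pM; rewrite ?invr_ge0 ?nrm_ge0 // lef_pV2 ?posrE // nrm_gt0 eprod_neq0.
    by apply: ler_wiXn2l; rewrite ?(ltW q1) //; have := ltn_ord i; nia.
  rewrite -mulr_sumr -!mulrA ler_pM2l // ler_pM2l ?invr_gt0 // mulrC ler_wpM2r ?exprn_ge0 //.
  have := asum_geom (nrm_ge0 q) q1 (iota_uniq 0 n).
  under eq_bigr do rewrite nrm_rX ?nrm_ge0 //.
  by rewrite -(big_mkord xpredT (fun i => r ^+ i)) /index_iota subn0.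
apply: (cvC0_le bd) => e e0.
have K0 : 0 < B / c / (1 - r) by rewrite !divr_gt0 ?subr_gt0.
have [N hN] := Rpow_small r0 q1 (divr_gt0 e0 K0).
by exists N => n /hN; rewrite ler_pdivlMr // mulrC.
Qed.

Lemma euler_neq0 : euler != 0.
Proof.
have [c c0 hc] := eprod_lower; apply/negP => /eqP P0.
have c2 : 0 < c / 2 by lra.
have [N hN] := cvC_eprod c2; have := hN N (leqnn _); rewrite P0 subr0.
by have := hc N; lra.
Qed.

End Product.

Lemma etaE (t : C) : 0 < complex.Im t -> eta t = E (t / 24%:R) * euler (E t).
Proof. by move=> ht; rewrite /eta (cvC_lim (cvC_eprod (nome_lt1 ht))). Qed.

Lemma eta_neq0 (t : C) : 0 < complex.Im t -> eta t != 0.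
Proof. by move=> ht; rewrite etaE // mulf_neq0 ?E_neq0 ?euler_neq0 ?nome_lt1. Qed.

Lemma chi12_sum (f : nat -> C) : \sum_(r < 12) chi12 R r * f r = f 1%N - f 5%N - f 7%N + f 11%N.
Proof. rewrite !big_ord_recl big_ord0 /= /bump /= /chi12 /=; ring. Qed.

(** Because $12n(3n-1)+1=(6n-1)^2$, the parity of [n] sorts the pentagonal series into the residues
    -1 and 5 modulo 12. In [eta12] the residues 11 and 7 repeat 1 and 5 by evenness, whence the
    factor 2. *)
Lemma eta12E (t : C) : 0 < complex.Im t -> eta12 t = 2%:R * eta t.
Proof.
move=> ht; have e7 : th 6 7 t = th 6 5 t.
  transitivity (th 6 (- 5 + (2 * 6)%N%:Z * 1) t); first by congr th.
  exact: etrans (@th_per R 6 (- 5) 1 t isT ht) (@th_even R 6 5 t isT ht).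
have e11 : th 6 11 t = th 6 1 t.
  transitivity (th 6 (- 1 + (2 * 6)%N%:Z * 1) t); first by congr th.
  exact: etrans (@th_per R 6 (- 1) 1 t isT ht) (@th_even R 6 1 t isT ht).
have -> : eta t = th 6 1 t - th 6 5 t.
  have hP := hasumZ (E (t / 24%:R)) (hasum_qser pent_dom nrm_sign_le (nome_lt1 ht)).
  rewrite etaE //; pose s (k : 'I_2) : C := if nat_of_ord k is 0%N then th 6 (-1) t else - th 6 5 t.
  have sE : \sum_k s k = th 6 1 t - th 6 5 t by rewrite !big_ord_recl big_ord0 /s /= addr0 th_even.
  rewrite -sE; apply: (@hasum_residue R 2 1 _ _ s isT (coprimez1 _) hP) => k.
  have tE (n : int) : E (t / 24%:R) * ((-1) ^ n * E t ^+ pent n) = (-1) ^ n * thN 6 t (6 * n - 1).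
    rewrite mulrCA; congr (_ * _); rewrite -EMn -ED /thN; congr E.
    have /(congr1 (fun x : int => x%:~R : C)) := pentE n; rewrite !castE => pC.
    have -> : (pent n)%:R = n%:~R * (3%:R * n%:~R - 1) / 2%:R :> C by rewrite -pC; field.
    by field.
  case: k => -[|[|//]] k2.
    rewrite /s /=; apply: hasum_ext (@hasum_th R 6 (-1) t isT ht) => m; rewrite tE mul1r.
    by rewrite sign2 expr0z mul1r; congr thN; ring.
  rewrite /s /=; apply: hasum_ext (hasumN (@hasum_th R 6 5 t isT ht)) => m; rewrite tE mul1r.
  by rewrite sign2 expr1z mulN1r; congr (- thN _ _ _); ring.
rewrite /eta12; have := chi12_sum (fun r => th 6 r%:Z t); rewrite /= => ->; rewrite e7 e11; ring.
Qed.

(** The two factors [eta12 = 2 eta] give 4, against the 2 in [f31]. *)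
Lemma PhiE (t : C) : 0 < complex.Im t -> Phi t = 2%:R * thPhi t.
Proof.
move=> ht; have ht31 : 0 < complex.Im (31%:R * t) by rewrite Im_natM mulr_gt0.
rewrite /Phi /f31 !ThetaE // (@qTheta_Th R 1 8 t) // (@qTheta_Th R 2 4 t) // /thPhi !eta12E //.
have := eta_neq0 ht; have := eta_neq0 ht31.
move: (eta t) (eta _) (Th 1 t) (Th 2 t) => a b x y b0 a0.
by field; rewrite a0 b0.
Qed.

Lemma thPhi_den (t : C) : 0 < complex.Im t -> eta12 t * eta12 (31%:R * t) != 0.
Proof.
move=> ht; have ht31 : 0 < complex.Im (31%:R * t) by rewrite Im_natM mulr_gt0.
have two : 2%:R != 0 :> C by rewrite pnatr_eq0.
by rewrite (eta12E ht) (eta12E ht31) (mulf_neq0 (mulf_neq0 two (eta_neq0 ht)) (mulf_neq0 two (eta_neq0 ht31))).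
Qed.

Lemma Phi_fricke (t : C) : 0 < complex.Im t -> Phi (- (31%:R * t)^-1) = Phi t.
Proof.
by move=> ht; have [h1 h2] := upper31 ht; rewrite (PhiE h2) (PhiE ht) thPhi_fricke.
Qed.

Lemma Phi_A (a d j : int) (w : C) : 576 * a * d = 1 + 31%:Z * j -> 0 < complex.Im w ->
  Phi (w - 24%:R * d%:~R / 31%:R) = Phi (24%:R * a%:~R / 31%:R - (31%:R ^+ 2 * w)^-1).
Proof.
move=> h hw.
have real_add (x : C) (y : R) : complex.Im (x + y%:C) = complex.Im x.
  by case: x => x1 x2 /=; rewrite addr0.
have rat (k : int) : 24%:R * k%:~R / 31%:R = (24%:R * k%:~R / 31%:R)%:C :> C.
  by rewrite !rmorphM /= fmorphV !rmorph_nat rmorph_int.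
have h1 : 0 < complex.Im (w - 24%:R * d%:~R / 31%:R).
  by rewrite rat -rmorphN real_add.
have h2 : 0 < complex.Im (24%:R * a%:~R / 31%:R - (31%:R ^+ 2 * w)^-1).
  by rewrite addrC rat real_add; apply: Im_inv_upper; rewrite -natrX Im_natM mulr_gt0 // ltr0n.
rewrite (PhiE h1) (PhiE h2); congr (_ * _); apply: (thPhi_A h hw); exact: thPhi_den.
Qed.

End Pentagonal.

(** * The cube of Phi as a function of q *)

Section QSide.
Variable R : realType.
Local Notation C := (Cplx R).
Local Notation E := (@e2pi R).
Local Notation nrm := (@nrm R).

Definition dhol (g : C -> C) : Prop := forall q : C, nrm q < 1 -> cdiffb g q.

(** Congruence modulo $q^N$ with a cofactor holomorphic on the disc, as [q_expansion] asks for a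
    convergent remainder. *)
Definition qcong (N : nat) (a b : C -> C) : Prop :=
  exists2 g : C -> C, dhol g & forall q : C, nrm q < 1 -> a q = b q + q ^+ N * g q.

Lemma dholM f g : dhol f -> dhol g -> dhol (fun q => f q * g q).
Proof. by move=> hf hg q q1; exact: cdiffbM (hf q q1) (hg q q1). Qed.

Lemma dholX f n : dhol f -> dhol (fun q => f q ^+ n).
Proof. by move=> hf q q1; exact: cdiffbX (hf q q1). Qed.

Lemma qcongM N a b a' b' : dhol a' -> dhol b -> qcong N a b -> qcong N a' b' ->
  qcong N (fun q => a q * a' q) (fun q => b q * b' q).
Proof.
move=> ha' hb [g hg eg] [g' hg' eg'].
exists (fun q => b q * g' q + g q * a' q) => q q1.
  by apply: cdiffbD; apply: cdiffbM; [exact: hb|exact: hg'|exact: hg|exact: ha'].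
by rewrite eg // mulrDl {1}eg' //; ring.
Qed.

Lemma qcong_sub N a b c : qcong N a b -> qcong N c b -> qcong N a c.
Proof.
move=> [g hg eg] [h hh eh]; exists (fun q => g q - h q) => q q1.
  by apply: cdiffbB; [exact: hg|exact: hh].
by rewrite eg // eh //; ring.
Qed.

Definition polyhol (p : {poly C}) : dhol (fun q => p.[q]) := fun q _ => cdiffb_horner p (cdiffb_id q).

Lemma qTheta18_tail : exists2 g, dhol g & forall q : C, nrm q < 1 ->
  qTheta 1 8 q = 1 + 2%:R * q + 2%:R * q ^+ 4 + q ^+ 8 * g q.
Proof.
have n1 : forall i : int * int, nrm ((fun=> 1) i : C) <= 1 by move=> ?; rewrite nrm1.
have d18 : qdom R (qform 1 8) by exact: qform_dom.
(* By $4(u^2+uv+8v^2)=(2u+v)^2+31v^2$, a value below 8 forces $v=0$ and $|u|\le2$. *)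
pose A : seq (int * int) := [:: (0, 0); (1, 0); (-1, 0); (2, 0); (-2, 0)].
have hA p : p \notin A -> (8 <= qform 1 8 p)%N.
  apply: contraR; rewrite -ltnNge => h.
  have hp := @qform_pos 1 8 p isT isT.
  case: p h hp => u v /=; move: (qform _ _ _) => k h hp.
  have h4 : (2 * u + v) ^+ 2 + 31 * v ^+ 2 = 4 * k%:Z by rewrite -hp; ring.
  have v0 : v = 0 by nia.
  rewrite v0 in h4 *; have u3 : -3 < u < 3 by nia.
  have : u \in [:: -2; -1; 0; 1; 2 : int] by rewrite !inE; lia.
  by rewrite !inE => /or4P[|||/orP[]] /eqP ->.
have [g hg eg] := qser_tail d18 n1 (isT : uniq A) hA.
exists g => // q q1; rewrite /qTheta eg // /A !big_cons big_nil /= !mul1r.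
congr (_ + _); rewrite /qform /=; ring.
Qed.

Lemma qTheta24_tail : exists2 g, dhol g & forall q : C, nrm q < 1 ->
  qTheta 2 4 q = 1 + 2%:R * q ^+ 2 + 2%:R * q ^+ 4 + 2%:R * q ^+ 5 + 2%:R * q ^+ 7 + q ^+ 8 * g q.
Proof.
have n1 : forall i : int * int, nrm ((fun=> 1) i : C) <= 1 by move=> ?; rewrite nrm1.
have d24 : qdom R (qform 2 4) by exact: qform_dom.
(* By $8(2u^2+uv+4v^2)=(4u+v)^2+31v^2$, a value below 8 forces $|u|,|v|\le1$. *)
pose A : seq (int * int) := [:: (0, 0); (1, 0); (-1, 0); (0, 1); (0, -1); (1, 1); (1, -1); (-1, 1); (-1, -1)].
have hA p : p \notin A -> (8 <= qform 2 4 p)%N.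
  apply: contraR; rewrite -ltnNge => h.
  have hp := @qform_pos 2 4 p isT isT.
  case: p h hp => u v /=; move: (qform _ _ _) => k h hp.
  have h8 : (4 * u + v) ^+ 2 + 31 * v ^+ 2 = 8 * k%:Z by rewrite -hp; ring.
  have v1 : -2 < v < 2 by nia.
  have : v \in [:: -1; 0; 1 : int] by rewrite !inE; lia.
  rewrite !inE => /or3P[] /eqP v0; rewrite v0 in h8 *.
  - have u3 : -2 < u < 2 by nia.
    have : u \in [:: -1; 0; 1 : int] by rewrite !inE; lia.
    by rewrite !inE => /or3P[] /eqP ->.
  - have u3 : -2 < u < 2 by nia.
    have : u \in [:: -1; 0; 1 : int] by rewrite !inE; lia.
    by rewrite !inE => /or3P[] /eqP ->.
  - have u3 : -2 < u < 2 by nia.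
    have : u \in [:: -1; 0; 1 : int] by rewrite !inE; lia.
    by rewrite !inE => /or3P[] /eqP ->.
have [g hg eg] := qser_tail d24 n1 (isT : uniq A) hA.
exists g => // q q1; rewrite /qTheta eg // /A !big_cons big_nil /= !mul1r.
congr (_ + _); rewrite /qform /=; ring.
Qed.

Lemma euler_tail : exists2 g, dhol g & forall q : C, nrm q < 1 ->
  euler q = 1 - q - q ^+ 2 + q ^+ 5 + q ^+ 7 * g q.
Proof.
(* A pentagonal number below 7 has $(6i-1)^2<169$, which leaves these four indices. *)
pose A : seq int := [:: 0; 1; -1; 2].
have hA (i : int) : i \notin A -> (7 <= pent i)%N.
  apply: contraR; rewrite -ltnNge => h; have := pentE i; move: (pent i) h => k h hk.
  have h36 : (6 * i - 1) ^+ 2 = 24 * k%:Z + 1 by rewrite (_ : 24 * k%:Z = 12 * (2 * k%:Z)); [rewrite hk; ring|ring].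
  by rewrite !inE; nia.
have [g hg eg] := qser_tail (@pent_dom R) (@nrm_sign_le R) (isT : uniq A) hA.
have m1 : (-1) ^ (-1 : int) = -1 :> C by rewrite -invr_expz expr1z invrN1.
have m2 : (-1) ^ (2 : int) = 1 :> C by rewrite -exprnP sqrrN expr1n.
exists g => // q q1; rewrite /euler eg // /A !big_cons big_nil expr0z expr1z m1 m2.
by congr (_ + _); rewrite /=; ring.
Qed.

Lemma euler_tail1 : exists2 g, dhol g & forall q : C, nrm q < 1 -> euler q = 1 + q * g q.
Proof.
have hA i : i \notin [:: 0 : int] -> (1 <= pent i)%N.
  by rewrite inE => i0; apply: leq_trans (pent_ge i); rewrite absz_gt0.
have [g hg eg] := qser_tail (@pent_dom R) (@nrm_sign_le R) (isT : uniq [:: 0 : int]) hA.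
by exists g => // q q1; rewrite /euler eg // big_seq1 expr0z mulr1.
Qed.

Lemma dhol_euler : dhol (@euler R).
Proof. by move=> q q1; exact: qser_cdiffb (@pent_dom R) (@nrm_sign_le R) q q1. Qed.

Lemma nrmX_lt1 (q : C) n : nrm q < 1 -> nrm (q ^+ n.+1) < 1.
Proof. by move=> q1; rewrite nrmX exprn_ilt1 // nrm_ge0. Qed.

Lemma dhol_euler31 : dhol (fun q : C => euler (q ^+ 31)).
Proof.
move=> q q1; apply: (@cdiffb_comp _ (fun q => q ^+ 31) (@euler R)); first exact: cdiffbX (cdiffb_id _).
by apply: dhol_euler; exact: nrmX_lt1.
Qed.

(** [q] times the asserted expansion of the cube; the entry 0 is its vanishing constant term. *)
Definition w0 : {poly C} := Poly [:: 1; 0; 3%:R; 3%:R; 6%:R; 9%:R; 13%:R].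

(* [Phi ^+ 3 = q^-1 * W q] as a function of [q] on the unit disc. *)
Lemma q_side : exists2 W : C -> C,
  dhol W /\ qcong 7 W (fun q => w0.[q]) &
  forall t : C, 0 < complex.Im t -> Phi t ^+ 3 = (E t)^-1 * W (E t).
Proof.
have [g1 hg1 e1] := qTheta18_tail; have [g2 hg2 e2] := qTheta24_tail.
have [gP hgP eP] := euler_tail; have [gQ hgQ eQ] := euler_tail1.
(* The numerator is $q-q^2-q^5-q^7+O(q^8)$ and the Euler product is $1-q-q^2+q^5+O(q^7)$; [F0] and
   [P0] record them, the former divided by [q]. *)
pose F0 : {poly C} := Poly [:: 1; -1; 0; 0; -1; 0; -1].
pose P0 : {poly C} := Poly [:: 1; -1; -1; 0; 0; 1].
pose F := fun q : C => F0.[q] + q ^+ 7 * ((g1 q - g2 q) / 2%:R).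
have hF : dhol F.
  move=> q q1; apply: cdiffbD; first exact: polyhol.
  apply: cdiffbM; first exact: cdiffbX (cdiffb_id _).
  apply: cdiffbM; last exact: cdiffb_cst.
  by apply: cdiffbB; [exact: hg1|exact: hg2].
have F_q : forall q : C, nrm q < 1 -> (qTheta 1 8 q - qTheta 2 4 q) / 2%:R = q * F q.
  move=> q q1; rewrite e1 // e2 // /F /F0 horner_Poly /=; by field.
pose D := fun q : C => (euler q * euler (q ^+ 31)) ^+ 3.
have hD : dhol D by apply: dholX; apply: dholM; [exact: dhol_euler|exact: dhol_euler31].
have D0 q : nrm q < 1 -> D q != 0.
  by move=> q1; rewrite expf_neq0 // mulf_neq0 // euler_neq0 // nrmX_lt1.
pose W := fun q => F q ^+ 3 / D q.
have hW : dhol W by move=> q q1; apply: cdiffb_div; [exact: D0|exact: cdiffbX (hF _ q1)|exact: hD].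
have cF : qcong 7 F (fun q => F0.[q]).
  exists (fun q => (g1 q - g2 q) / 2%:R) => // q q1.
  apply: cdiffbM; last exact: cdiffb_cst.
  by apply: cdiffbB; [exact: hg1|exact: hg2].
have cP : qcong 7 (@euler R) (fun q => P0.[q]).
  exists gP => // q q1; rewrite eP // /P0 horner_Poly /=; ring.
have cP31 : qcong 7 (fun q => euler (q ^+ 31)) (fun=> 1).
  exists (fun q => q ^+ 24 * gQ (q ^+ 31)) => q q1; last first.
    by rewrite eQ ?nrmX_lt1 // mulrA -exprD.
  apply: cdiffbM; first exact: cdiffbX (cdiffb_id _).
  apply: (@cdiffb_comp _ (fun q => q ^+ 31) gQ); first exact: cdiffbX (cdiffb_id _).
  by apply: hgQ; exact: nrmX_lt1.
have cst1 : dhol (fun=> 1) by move=> q _; exact: cdiffb_cst.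
have cube a b : dhol a -> dhol b -> qcong 7 a b -> qcong 7 (fun q => a q ^+ 3) (fun q => b q ^+ 3).
  move=> ha hb hab; have h2 := qcongM ha hb hab hab.
  have h3 := qcongM (dholM ha ha) hb hab h2.
  by case: h3 => g hg eg; exists g => // q q1; rewrite !exprS !expr0 !mulr1 eg.
have cF3 := cube _ _ hF (polyhol F0) cF.
have cPP := qcongM dhol_euler31 (polyhol P0) cP cP31.
have cD := cube _ _ (dholM dhol_euler dhol_euler31) (dholM (polyhol P0) cst1) cPP.
have cw : qcong 7 (fun q => w0.[q]) (fun q => w0.[q]).
  by exists (fun=> 0) => q q1; [exact: cdiffb_cst|rewrite mulr0 addr0].
have hP03 : dhol (fun q : C => (P0.[q] * 1) ^+ 3) by apply: dholX; apply: dholM => //; exact: polyhol.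
have cwD := qcongM hD (polyhol w0) cw cD.
(* The exact quotient of $F_0^3-w_0P_0^3$ by $q^7$, which reduces the expansion to a polynomial
   identity. *)
pose Q0 : {poly C} := Poly [:: 18%:R; -30%:R; -41%:R; 36%:R; 51%:R; 69%:R; -36%:R; -108%:R; -40%:R; 3%:R; 63%:R; 35%:R; -6%:R; -9%:R; -13%:R].
have c0 : qcong 7 (fun q => F0.[q] ^+ 3) (fun q => w0.[q] * (P0.[q] * 1) ^+ 3).
  exists (fun q => Q0.[q]) => [|q q1]; first exact: polyhol.
  rewrite /F0 /P0 /w0 /Q0 !horner_Poly /=; ring.
have cFw : qcong 7 (fun q => F q ^+ 3) (fun q => w0.[q] * D q).
  apply: qcong_sub cwD; case: cF3 c0 => [g hg eg] [h hh eh].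
  exists (fun q => h q + g q) => q q1; first by apply: cdiffbD; [exact: hh|exact: hg].
  by rewrite eg // eh // mulrDr addrA.
exists W; first split=> //.
  have [g hg eg] := cFw; exists (fun q => g q / D q) => q q1.
    by apply: cdiffb_div; [exact: D0|exact: hg|exact: hD].
  by rewrite /W eg // mulrDl mulfK ?D0 // mulrA.
move=> t ht; have q1 := nome_lt1 ht; have ht31 : 0 < complex.Im (31%:R * t) by rewrite Im_natM mulr_gt0.
(* The eta factors contribute $q^{32/24}$, whose cube is the integral power $q^4$; against $q^3$
   from the numerator this leaves the simple pole. *)
have E43 : (E (t / 24%:R) * E (31%:R * t / 24%:R)) ^+ 3 = E t ^+ 4.
  by rewrite -ED -!EMn; congr E; field.
rewrite /Phi /f31 !ThetaE // !etaE // EMn F_q // /W.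
have P1 := euler_neq0 q1; have P31 := euler_neq0 (nrmX_lt1 30 q1).
have Et := E_neq0 t.
rewrite expr_div_n mulrACA [X in _ / X]exprMn E43 -/(D (E t)).
have := D0 _ q1; move: (D (E t)) (F (E t)) (E t) Et => d f x x0 d0.
by field; rewrite x0 d0.
Qed.

End QSide.

(** * Modular transformations *)

Section Matrices.
Variable S : comNzRingType.

Definition mx2 (a b c d : S) : 'M[S]_2 :=
  \matrix_(i, j) (if i == 0 then if j == 0 then a else b else if j == 0 then c else d).

Lemma mx2E a b c d : (mx2 a b c d 0 0 = a) * (mx2 a b c d 0 1 = b) *
  (mx2 a b c d 1 0 = c) * (mx2 a b c d 1 1 = d).
Proof. by do !split; rewrite !mxE. Qed.

Lemma ord2P (i : 'I_2) : i = 0 \/ i = 1.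
Proof. by case: i => -[|[|//]] hi; [left|right]; apply: val_inj. Qed.

Lemma eq_mx2 (A B : 'M[S]_2) : A 0 0 = B 0 0 -> A 0 1 = B 0 1 -> A 1 0 = B 1 0 ->
  A 1 1 = B 1 1 -> A = B.
Proof.
by move=> h1 h2 h3 h4; apply/matrixP => i j; case: (ord2P i) => ->; case: (ord2P j) => ->.
Qed.

Lemma mul2E (A B : 'M[S]_2) i j : (A *m B) i j = A i 0 * B 0 j + A i 1 * B 1 j.
Proof. by rewrite !mxE !big_ord_recl big_ord0 addr0; congr (_ + A i _ * B _ j); apply: val_inj. Qed.

Lemma det2 (A : 'M[S]_2) : \det A = A 0 0 * A 1 1 - A 0 1 * A 1 0.
Proof.
rewrite (expand_det_row _ 0) !big_ord_recl big_ord0 addr0 /cofactor !det_mx11 !mxE /=.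
rewrite !expr0 mul1r /bump /= addn0 expr1 mulN1r mulrN.
by do ![congr (_ + _)|congr (- _)|congr (_ * _)|congr (A _ _)]; apply: val_inj.
Qed.

End Matrices.

Section Moebius.
Variable R : realType.
Local Notation C := (Cplx R).
Local Notation nrm := (@nrm R).

Lemma mob_num (a b : R) (z : C) : a%:C * z + b%:C = (a * complex.Re z + b) +i* (a * complex.Im z).
Proof. by case: z => x y; apply/eqP; rewrite eq_complex /=; apply/andP; split; apply/eqP; ring. Qed.

Lemma mob_den (A : 'M[R]_2) (z : C) : 0 < \det A -> 0 < complex.Im z ->
  (A 1 0)%:C * z + (A 1 1)%:C != 0.
Proof.
rewrite det2 mob_num => hA hz; apply/negP => /eqP [h1 h2].
have c0 : A 1 0 = 0 by move/eqP: h2; rewrite mulf_eq0 (gt_eqF hz) orbF => /eqP.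
have d0 : A 1 1 = 0 by move: h1; rewrite c0 mul0r add0r.
by move: hA; rewrite c0 d0 !mulr0 subrr ltxx.
Qed.

Lemma mobius_upper (A : 'M[R]_2) (z : C) : 0 < \det A -> 0 < complex.Im z ->
  0 < complex.Im (mobius A z).
Proof.
move=> hA hz; have := mob_den hA hz; rewrite /mobius !mob_num; move: hA; rewrite det2.
case: z hz => x y /= y0.
move: (A 0 0) (A 0 1) (A 1 0) (A 1 1) => a b c d hA hd.
have n0 : 0 < (c * x + d) ^+ 2 + (c * y) ^+ 2.
  by move: hd; rewrite -nrm_gt0 /nrm /= sqrtr_gt0.
have -> : (a * x + b) * (- (c * y / ((c * x + d) ^+ 2 + (c * y) ^+ 2))) +
   a * y * ((c * x + d) / ((c * x + d) ^+ 2 + (c * y) ^+ 2)) =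
   (a * d - b * c) * y / ((c * x + d) ^+ 2 + (c * y) ^+ 2).
  by field; rewrite gt_eqF.
by rewrite divr_gt0 ?mulr_gt0.
Qed.

Lemma mobiusM (A B : 'M[R]_2) (z : C) : 0 < \det A -> 0 < \det B -> 0 < complex.Im z ->
  mobius (A *m B) z = mobius A (mobius B z).
Proof.
move=> hA hB hz; have h1 := mob_den hB hz.
have hAB : 0 < \det (A *m B) by rewrite det_mulmx mulr_gt0.
have h2 := mob_den hAB hz; move: h1 h2; rewrite /mobius !mul2E.
move: (A 0 0) (A 0 1) (A 1 0) (A 1 1) (B 0 0) (B 0 1) (B 1 0) (B 1 1) => a b c d a' b' c' d'.
rewrite !(rmorphD (real_complex R)) !(rmorphM (real_complex R)) /=.
move: (a%:C) (b%:C) (c%:C) (d%:C) (a'%:C) (b'%:C) (c'%:C) (d'%:C) => {}a {}b {}c {}d {}a' {}b' {}c' {}d'.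
move=> h1 h2; field; rewrite h1 /=.
have -> : c * (a' * z + b') + d * (c' * z + d') = (c * a' + d * c') * z + (c * b' + d * d') by ring.
by rewrite h2.
Qed.

Lemma mobius1 (z : C) : mobius 1%:M z = z.
Proof. by rewrite /mobius !mxE /= mul1r mul0r addr0 add0r divr1. Qed.

Definition mobz (A : 'M[int]_2) : C -> C := mobius (map_mx intr A).

Lemma det_intr (A : 'M[int]_2) : \det (map_mx intr A : 'M[R]_2) = (\det A)%:~R.
Proof. by rewrite det_map_mx. Qed.

Lemma det_intr_gt0 (A : 'M[int]_2) : \det A = 1 -> 0 < \det (map_mx intr A : 'M[R]_2).
Proof. by rewrite det_intr => ->; rewrite ltr01. Qed.

Lemma mobzE (A : 'M[int]_2) (z : C) :
  mobz A z = ((A 0 0)%:~R * z + (A 0 1)%:~R) / ((A 1 0)%:~R * z + (A 1 1)%:~R).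
Proof. by rewrite /mobz /mobius !mxE !rmorph_int. Qed.

Lemma mobz_upper A (z : C) : \det A = 1 -> 0 < complex.Im z -> 0 < complex.Im (mobz A z).
Proof. by move=> hA; apply: mobius_upper; exact: det_intr_gt0. Qed.

Lemma mobz_den (A : 'M[int]_2) (z : C) : \det A = 1 -> 0 < complex.Im z -> (A 1 0)%:~R * z + (A 1 1)%:~R != 0.
Proof. by move=> /det_intr_gt0 hA hz; have := mob_den hA hz; rewrite !mxE !rmorph_int. Qed.

Lemma mobzM A B (z : C) : \det A = 1 -> \det B = 1 -> 0 < complex.Im z ->
  mobz (A *m B) z = mobz A (mobz B z).
Proof.
by move=> /det_intr_gt0 hA /det_intr_gt0 hB hz; rewrite /mobz map_mxM mobiusM.
Qed.

Lemma mobz1 (z : C) : mobz 1%:M z = z.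
Proof. by rewrite /mobz map_mx1 mobius1. Qed.

End Moebius.

(** * Invariance of the cube and reduction to a half-plane *)

Section Invariance.
Variable R : realType.
Local Notation C := (Cplx R).

Definition Phi3 (t : C) : C := Phi t ^+ 3.

Lemma Im_addint (z : C) (k : int) : complex.Im (z + k%:~R) = complex.Im z.
Proof. by rewrite -(rmorph_int (real_complex R)) Im_addr. Qed.

Lemma Im_div31 (z : C) : complex.Im (z / 31%:R) = complex.Im z / 31%:R.
Proof.
have := Im_natM 31 (z / 31%:R); rewrite mulrCA divff ?pnatr_eq0 // mulr1 => ->.
by rewrite mulrAC divff ?mul1r // pnatr_eq0.
Qed.

Lemma Phi3_T (z : C) (k : int) : 0 < complex.Im z -> Phi3 (z + k%:~R) = Phi3 z.
Proof.
move=> hz; have [W _ hW] := q_side R.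
have hz' : 0 < complex.Im (z + k%:~R) by rewrite Im_addint.
have e1 := hW _ hz'; have e2 := hW _ hz; rewrite EDint in e1.
exact: etrans e1 (esym e2).
Qed.

Lemma Phi3_S (z : C) : 0 < complex.Im z -> Phi3 (- (31%:R * z)^-1) = Phi3 z.
Proof. by move=> hz; rewrite /Phi3 Phi_fricke. Qed.

(* Every unit modulo 31 is the upper left entry of a matrix of lower left entry 31
   obtained from those of [Phi_A] by translation. *)
Lemma Phi3_gen (al : int) : coprimez al 31 -> exists be de : int,
  al * de - be * 31 = 1 /\ forall z : C, 0 < complex.Im z -> Phi3 (mobz (mx2 al be 31 de) z) = Phi3 z.
Proof.
move=> /coprimezP cop; have [u [v uv]] : exists u v : int, u * al + v * 31 = 1.
  by case: cop => -[u v] /= uv; exists u, v.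
(* 22 inverts 24 modulo 31, as $24\cdot22=1+17\cdot31$. The upper left entry obtained is
   [al + 31 * m], and a translation by [- m] brings it back to [al]. *)
pose m : int := 17 * al; pose D : int := 24 * (22 * u).
pose j : int := (17 * 17 * 31 + 34) * (1 - v * 31) - v.
have ua : u * al = 1 - v * 31 by rewrite -[LHS](addrK (v * 31)) uv.
have h : 576 * (22 * al) * (22 * u) = 1 + 31%:Z * j.
  transitivity ((1 + 17 * 31) * (1 + 17 * 31) * (u * al)); first by ring.
  by rewrite ua /j; ring.
have hD : (al + 31%:Z * m) * D = 1 + 31%:Z * j by rewrite -h /m /D; ring.
have eD : 24%:R * (22 * u)%:~R = D%:~R :> C by rewrite /D [RHS]intrM castR.
have eA : 24%:R * (22 * al)%:~R = (al + 31%:Z * m)%:~R :> C.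
  by rewrite (_ : al + 31%:Z * m = 24%:R * (22 * al)); [rewrite [RHS]intrM castR|rewrite /m; ring].
move: m D j hD eD eA h => m D j hD eD eA h; clear ua uv.
exists (j - m * D), D; split.
  rewrite (_ : al * D - (j - m * D) * 31 = (al + 31%:Z * m) * D - 31%:Z * j); last by ring.
  by rewrite hD addrK.
move=> z hz; pose w : C := z + D%:~R / 31%:R.
have p31 : 31%:R != 0 :> C by rewrite pnatr_eq0.
have hw : 0 < complex.Im w.
  have -> : w = z + (D%:~R / 31%:R)%:C by rewrite !rmorphM /= fmorphV rmorph_nat rmorph_int.
  by rewrite Im_addr.
have den : 31%:R * z + D%:~R != 0.
  have := upper_neq0 hw; apply: contraNneq => e0; rewrite /w.
  have -> : z + D%:~R / 31%:R = (31%:R * z + D%:~R) / 31%:R by field.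
  by rewrite e0 mul0r.
have hA := Phi_A h hw; rewrite eD eA {1}/w addrK in hA.
have wE : 31%:R ^+ 2 * w = 31%:R * (31%:R * z + D%:~R) by rewrite /w; field.
have hj : (al%:~R + 31%:R * m%:~R) * D%:~R = 1 + 31%:R * j%:~R :> C.
  by have := congr1 (fun x : int => x%:~R : C) hD; rewrite /= !intrM !intrD !intrM castZ.
rewrite [in RHS]/Phi3 hA -/(Phi3 _) mobzE !mx2E.
set w1 := (_ - _ : C).
have hw1 : 0 < complex.Im w1.
  have -> : w1 = - (31%:R ^+ 2 * w)^-1 + ((al + 31%:Z * m)%:~R / 31%:R)%:C.
    by rewrite /w1 addrC !rmorphM /= fmorphV rmorph_nat rmorph_int.
  by rewrite Im_addr; apply: Im_inv_upper; rewrite -natrX Im_natM mulr_gt0 // ltr0n.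
rewrite -(Phi3_T (- m) hw1); congr Phi3.
have -> : w1 = (al%:~R + 31%:R * m%:~R) / 31%:R - (31%:R * (31%:R * z + D%:~R))^-1.
  by rewrite /w1 wE intrD intrM castZ.
have -> : (j - m * D)%:~R = ((al%:~R + 31%:R * m%:~R) * D%:~R - 1) / 31%:R - m%:~R * D%:~R :> C.
  by rewrite intrB intrM hj; field.
have -> : (31 : int)%:~R = 31%:R :> C by exact: castR.
by rewrite mulrNz; field; exact: den.
Qed.

Lemma coprimez31 (x : int) : ~~ (31 %| x)%Z -> coprimez x 31.
Proof.
move=> h; have : coprime 31 (absz x) by rewrite prime_coprime.
by rewrite coprimez_sym /coprimez /gcdz -[1]/(Posz 1) eqz_nat.
Qed.

(* Descent on the lower left entry [c] of [A]: of two consecutive candidates for [al], one is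
   prime to 31, and [A] times the matrix [al, be; 31, de] has a smaller lower left entry. *)
Lemma Phi3_Gamma0_rec (n : nat) (A : 'M[int]_2) (z : C) : (absz (A 1 0)%R <= n)%N -> \det A = 1 ->
  (31 %| A 1%R 0%R)%Z -> 0 < complex.Im z -> Phi3 (mobz A z) = Phi3 z.
Proof.
elim: n A z => [|n IH] A z hn hA h31 hz.
  have c0 : A 1 0 = 0 by apply/eqP; rewrite -absz_eq0 -leqn0.
  have := hA; rewrite det2 c0 mulr0 subr0 => ad.
  rewrite mobzE c0 mul0r add0r.
  have [[a1 d1]|[a1 d1]] : (A 0 0 = 1 /\ A 1 1 = 1) \/ (A 0 0 = -1 /\ A 1 1 = -1).
  - have : A 0 0 \is a GRing.unit by apply/unitrP; exists (A 1 1); rewrite ad mulrC ad.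
    by rewrite /in_mem /= /GRing.unit /= => /orP[]/eqP h; rewrite h ?mul1r ?mulN1r in ad *; [left|right]; split=> //; rewrite -[LHS]opprK ad.
  - by rewrite a1 d1 mul1r divr1 Phi3_T.
  - rewrite a1 d1 (_ : _ / _ = z + (- A 0 1)%:~R) ?Phi3_T //.
    by rewrite !mulrNz mulr1z; field.
have [/IH|cn] := leqP (absz (A 1 0)) n; first by apply.
have {hn cn} cn : absz (A 1 0) = n.+1 by apply/eqP; rewrite eqn_leq hn.
have [c' hc] := dvdzP h31; have := hA; rewrite det2 hc => det1.
have [al [cop hal]] : exists al : int, coprimez al 31 /\ (absz (A 1 0 * al + A 1 1 * 31)%R <= n)%N.
  have c'0 : c' != 0 by apply: contraPneq cn => c0; rewrite hc c0 mul0r.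
  rewrite hc in cn *; move: (A 0 0) (A 0 1) (A 1 1) det1 => a b d det1.
  have dE := divz_eq d c'; have r0 := modz_ge0 d c'0; have r1 := ltz_mod d c'0.
  move: (d %/ c')%Z (d %% c')%Z dE r0 r1 => q r dE r0 r1.
  (* If 31 divides the quotient [q], then [- q] is not prime to 31 and a neighbour is taken. The
     remainder [r] is then nonzero, since otherwise 31 would divide both lower entries of [A]. *)
  have [q31|q31] := boolP (31 %| q)%Z; last first.
    exists (- q); split; first by apply: coprimez31; rewrite dvdzE abszN -dvdzE.
    rewrite (_ : _ + _ = r * 31); last by rewrite dE; ring.
    by lia.
  have [q' hq] := dvdzP q31.
  have r_neq0 : r != 0.
    apply: contraPneq det1 => re.
    by rewrite dE re hq addr0 (_ : _ - _ = 31 * (a * q' * c' - b * c')); [lia|ring].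
  have [cp|cn'] := ltP 0 c'.
    exists (- q - 1); split.
      by apply: coprimez31; apply/negP => /dvdzP[k hk]; lia.
    rewrite (_ : _ + _ = (r - c') * 31); last by rewrite dE; ring.
    by lia.
  exists (- q + 1); split.
    by apply: coprimez31; apply/negP => /dvdzP[k hk]; lia.
  rewrite (_ : _ + _ = (r + c') * 31); last by rewrite dE; ring.
  by lia.
have [be [de [detN hN]]] := Phi3_gen cop.
pose N := mx2 al be 31 de; pose N' := mx2 de (- be) (-31) al.
have dN : \det N = 1 by rewrite det2 !mx2E.
have dN' : \det N' = 1 by rewrite det2 !mx2E -[RHS]detN; ring.
have NN' : N *m N' = 1%:M.
  by apply: eq_mx2; rewrite mul2E !mx2E !mxE /= -?[RHS]/1 -?[RHS]detN; ring.
have hw := mobz_upper dN' hz.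
have zE : z = mobz N (mobz N' z) by rewrite -mobzM // NN' mobz1.
move: (mobz N' z) hw zE => w hw zE.
transitivity (Phi3 (mobz (A *m N) w)); first by rewrite (mobzM hA dN hw) -zE.
transitivity (Phi3 w); last by rewrite zE (hN w hw).
have c10 : (A *m N) 1 0 = A 1 0 * al + A 1 1 * 31 by rewrite mul2E !mx2E.
apply: IH => //.
- by rewrite c10.
- by rewrite det_mulmx hA dN mulr1.
- by apply/dvdzP; exists (c' * al + A 1 1); rewrite c10 hc; ring.
Qed.

Lemma Phi3_Gamma0 (A : 'M[R]_2) (z : C) : Gamma0 31 A -> upper z -> Phi3 (mobius A z) = Phi3 z.
Proof. by move=> [B [dB h31] <-] hz; exact: Phi3_Gamma0_rec (leqnn _) dB h31 hz. Qed.

Lemma fricke_det : \det (fricke_mx R 31) = 31%:R.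
Proof. rewrite det2 /fricke_mx !mxE /=; ring. Qed.

Lemma fricke_mobius (z : C) : 0 < complex.Im z -> mobius (fricke_mx R 31) z = - (31%:R * z)^-1.
Proof.
move=> /upper_neq0 z0; rewrite /mobius /fricke_mx !mxE /=.
rewrite !(mulr0, mulr1, subr0, add0r, sub0r) !rmorph0 mul0r add0r rmorphN rmorph1 rmorph_nat addr0.
by rewrite mulN1r.
Qed.

Definition invariant31 (f : C -> C) : Prop :=
  forall (A : 'M[R]_2) (z : C), Gamma0plus 31 A -> upper z -> f (mobius A z) = f z.

(** The matrices of positive determinant that preserve [f] form a subgroup, so the generators of
    [Gamma0plus 31] suffice. *)
Lemma invariant31_gen (f : C -> C) :
  (forall (A : 'M[R]_2) (z : C), Gamma0 31 A -> upper z -> f (mobius A z) = f z) ->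
  (forall z : C, upper z -> f (- (31%:R * z)^-1) = f z) -> invariant31 f.
Proof.
move=> f0 fS A z.
pose S := [set A : 'M[R]_2 | 0 < \det A /\ forall z : C, upper z -> f (mobius A z) = f z].
have SG : GL2pos_subgroup S.
  split.
  - by move=> B [].
  - by split=> [|w _]; rewrite ?det1 ?mobius1.
  - move=> A1 A2 [d1 h1] [d2 h2]; split=> [|w hw]; first by rewrite det_mulmx mulr_gt0.
    by rewrite (mobiusM d1 d2 hw) (h1 _ (mobius_upper d2 hw)) (h2 _ hw).
  - move=> B [dB hB]; have uB : B \in unitmx by rewrite unitmxE unitfE gt_eqF.
    have dV : 0 < \det (invmx B) by rewrite det_inv invr_gt0.
    split=> [|w hw]; first exact: dV.
    have h := hB _ (mobius_upper dV hw).
    rewrite -(mobiusM dB dV hw) (mulmxV uB) mobius1 in h.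
    exact: esym h.
have sub : Gamma0plus 31 `<=` S.
  rewrite /Gamma0plus; apply: (smallest_sub SG) => B [hB|->].
    split=> [|w hw]; last exact: f0.
    by case: hB => B' [dB' _] <-; exact: det_intr_gt0.
  by split=> [|w hw]; rewrite ?fricke_det ?ltr0n // (fricke_mobius hw) (fS _ hw).
by move=> /sub [_ h] hz; exact: h.
Qed.

Lemma Phi3_Gamma0plus : invariant31 Phi3.
Proof. exact: invariant31_gen Phi3_Gamma0 Phi3_S. Qed.

(** The codomain is arbitrary because [reduce] is also applied to the set-valued function of
    [regv_inv31]. *)
Definition inv31 (T : Type) (f : C -> T) : Prop :=
  (forall (B : 'M[int]_2) (z : C), \det B = 1 -> (31 %| B 1%R 0%R)%Z -> 0 < complex.Im z ->
    f (mobz B z) = f z) /\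
  forall z : C, 0 < complex.Im z -> f (- (31%:R * z)^-1) = f z.

Lemma invariant31_inv31 (f : C -> C) : invariant31 f -> inv31 f.
Proof.
move=> finv; split=> [B z dB hB hz|z hz].
  by apply: finv => //; apply: sub_gen_smallest; left; exists B.
by rewrite -fricke_mobius // finv //; apply: sub_gen_smallest; right.
Qed.

Lemma Phi3_inv31 : inv31 Phi3.
Proof. exact: invariant31_inv31 Phi3_Gamma0plus. Qed.

Variables (T : Type) (f : C -> T).
Hypothesis finv : inv31 f.

Lemma inv_T (z : C) (k : int) : 0 < complex.Im z -> f (z + k%:~R) = f z.
Proof.
move=> hz; have := finv.1 (mx2 1 k 0 1) z.
by rewrite mobzE det2 !mx2E !mul0r !mul1r add0r divr1 mulr0 subr0 => -> //; rewrite dvdz0.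
Qed.

(* Cosets of Gamma0(31) in SL2(Z): either A is in Gamma0(31), or A = B S T^j with B in
   Gamma0(31), and - 1 / (z + j) is the Fricke image of (z + j) / 31. *)
Lemma inv_cusp (A : 'M[int]_2) : \det A = 1 ->
  (forall z : C, 0 < complex.Im z -> f (mobz A z) = f z) \/
  exists j : int, forall z : C, 0 < complex.Im z -> f (mobz A z) = f ((z + j%:~R) / 31%:R).
Proof.
move=> dA; have [h31|/coprimez31/coprimezP cop] := boolP (31 %| A 1%R 0%R)%Z.
  by left=> z hz; exact: finv.1.
have [u [v uv]] : exists u v : int, u * A 1 0 + v * 31 = 1.
  by case: cop => -[u v] /= uv; exists u, v.
(* With [u] inverse to the entry [A 1 0] modulo 31, this [j] makes [A 1 0 * j - A 1 1], the lower
   left entry of [B], divisible by 31. *)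
right; pose j : int := A 1 1 * u; exists j => z hz.
pose B := A *m mx2 j 1 (-1) 0; pose ST := mx2 0 (-1) 1 j.
have dST : \det ST = 1 by rewrite det2 !mx2E; ring.
have dB : \det B = 1 by rewrite det_mulmx dA det2 !mx2E; ring.
have AB : A = B *m ST.
  rewrite /B -mulmxA (_ : _ *m ST = 1%:M) ?mulmx1 //.
  by apply: eq_mx2; rewrite mul2E !mx2E !mxE /=; ring.
have B31 : (31 %| B 1%R 0%R)%Z.
  apply/dvdzP; exists (- (v * A 1 1)); rewrite mul2E !mx2E /j.
  have -> : A 1 0 * (A 1 1 * u) + A 1 1 * -1 = A 1 1 * (u * A 1 0 - 1) by ring.
  by rewrite -[in X in _ - X]uv; ring.
have hz' := mobz_upper dST hz.
rewrite AB (mobzM dB dST hz) (finv.1 _ _ dB B31 hz').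
have hw : 0 < complex.Im ((z + j%:~R) / 31%:R).
  by rewrite Im_div31 divr_gt0 // Im_addint.
rewrite -(finv.2 _ hw) mobzE !mx2E mul0r add0r mul1r mulrCA divff ?pnatr_eq0 // mulr1.
by rewrite mulN1r.
Qed.

Lemma shift_half (x : R) : exists k : int, `|x + k%:~R| <= 2^-1.
Proof.
exists (- Num.floor (x + 2^-1)); have := floor_itv (x + 2^-1).
move=> /andP[h1 h2]; rewrite mulrNz ler_norml; apply/andP; split.
  by move: h1; lra.
by move: h2; rewrite intrD mulr1z; lra.
Qed.

Lemma Im_Ninv (z : C) : complex.Im (- z^-1) = complex.Im z / (complex.Re z ^+ 2 + complex.Im z ^+ 2).
Proof. by case: z => x y /=; rewrite opprK. Qed.

(** If $|x|\le1/2$ and $y<1/2$, then $x^2+y^2\le1/2$, so inversion at least doubles the height; [n]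
    counts the doublings still required. *)
Lemma SL2_up (n : nat) (z : C) : 0 < complex.Im z -> (2^-1) ^+ n.+1 <= complex.Im z ->
  exists2 B : 'M[int]_2, \det B = 1 & 2^-1 <= complex.Im (mobz B z).
Proof.
elim: n z => [|n IH] z hz hn; first by exists 1%:M; rewrite ?det1 // mobz1.
have [k hk] := shift_half (complex.Re z).
have [h2|h2] := leP 2^-1 (complex.Im z); first by exists 1%:M; rewrite ?det1 // mobz1.
pose ST := mx2 0 (-1) 1 k.
have dST : \det ST = 1 by rewrite det2 !mx2E; ring.
have hz' := mobz_upper dST hz.
have [|B dB hB] := IH (mobz ST z) hz'; last first.
  by exists (B *m ST); rewrite ?det_mulmx ?dB ?dST ?mulr1 // (mobzM dB dST hz).
have -> : mobz ST z = - (z + k%:~R)^-1 by rewrite mobzE !mx2E mul0r add0r mul1r mulN1r.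
rewrite Im_Ninv Im_addint.
have -> : complex.Re (z + k%:~R) = complex.Re z + k%:~R.
  by rewrite -(rmorph_int (real_complex R)); case: (z).
move: (complex.Re z + k%:~R) hk => x hk; move: (complex.Im z) hz h2 hn => y y0 y2 hn.
have x2 : x ^+ 2 <= 4^-1.
  by have := hk; rewrite ler_norml => /andP[x1 x2]; nra.
have hy2 : y ^+ 2 <= 4^-1 by nra.
have s0 : 0 < x ^+ 2 + y ^+ 2 by have : 0 < y ^+ 2 by [exact: exprn_gt0]; have := sqr_ge0 x; lra.
rewrite ler_pdivlMr //; move: hn; rewrite exprS; have := exprn_gt0 n.+1 (_ : 0 < 2^-1 :> R).
move: ((2^-1) ^+ n.+1) => e e0 hn.
have {}e0 : 0 < e by apply: e0; lra.
by nra.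
Qed.

(** Here $62=2\cdot31$: height 1/2 is reached under SL2(Z), and the second kind of coset in
    [inv_cusp] divides it by 31. *)
Lemma reduce (z : C) : 0 < complex.Im z -> exists z' : C,
  [/\ `|complex.Re z'| <= 2^-1, 62%:R^-1 <= complex.Im z' & f z = f z'].
Proof.
move=> hz.
have shift (w : C) : 62%:R^-1 <= complex.Im w -> f z = f w -> exists z' : C,
    [/\ `|complex.Re z'| <= 2^-1, 62%:R^-1 <= complex.Im z' & f z = f z'].
  move=> hw e; have [k hk] := shift_half (complex.Re w); exists (w + k%:~R); split.
  - by rewrite (_ : complex.Re _ = complex.Re w + k%:~R) // -(rmorph_int (real_complex R)); case: (w).
  - by rewrite Im_addint.
  - by rewrite inv_T //; apply: lt_le_trans hw; rewrite invr_gt0 ltr0n.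
have [n hn] : exists n, (2^-1) ^+ n.+1 <= complex.Im z.
  have [N hN] := @Rpow_small R 2^-1 (ltac:(lra)) (ltac:(lra)) _ hz.
  by exists N; apply: hN; exact: leqnSn.
have [B dB hB] := SL2_up hz hn.
pose B' := mx2 (B 1 1) (- B 0 1) (- B 1 0) (B 0 0).
have dB' : \det B' = 1 by rewrite det2 !mx2E -[RHS]dB det2; ring.
have BB : B' *m B = 1%:M.
  by move: dB; rewrite det2 => dB; apply: eq_mx2; rewrite mul2E !mx2E !mxE /= -?[RHS]/1 -?[RHS]dB; ring.
have hw : 0 < complex.Im (mobz B z) by apply: lt_le_trans hB; lra.
have zE : z = mobz B' (mobz B z) by rewrite -mobzM // BB mobz1.
have [h|[j h]] := inv_cusp dB'.
  by apply: (shift (mobz B z)); [apply: le_trans hB; lra|rewrite {1}zE; exact: h].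
apply: (shift ((mobz B z + j%:~R) / 31%:R)); last by rewrite {1}zE; exact: h.
rewrite Im_div31 Im_addint; apply: le_trans (_ : 2^-1 / 31%:R <= _); first by lra.
by rewrite ler_pM2r // invr_gt0 ltr0n.
Qed.

End Invariance.

(** * Removal of singularities *)

Section Regular.
Variable R : realType.
Local Notation C := (Cplx R).
Local Notation nrm := (@nrm R).

Lemma holomorphic_atP (f : C -> C) (z0 : C) : holomorphic_at f z0 <->
  exists2 r : R, 0 < r & forall z : C, nrm (z - z0) < r -> cdiffb f z.
Proof.
rewrite /holomorphic_at; split=> [/nbhsC[r r0 h]|[r r0 h]].
  by exists r => // z /h /derivable_cdiff.
by apply/nbhsC; exists r => // z /h /derivable_cdiff.
Qed.

Lemma meromorphic_atP (f : C -> C) (z0 : C) : meromorphic_at f z0 <->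
  exists n (g : C -> C) (r : R), [/\ 0 < r, forall z : C, nrm (z - z0) < r -> cdiffb g z &
    forall z : C, z != z0 -> nrm (z - z0) < r -> f z = g z / (z - z0) ^+ n].
Proof.
split=> [[n [g [/holomorphic_atP[r r0 hg] /dnbhsC[r' r'0 hf]]]]|[n [g [r [r0 hg hf]]]]].
  exists n, g, (Num.min r r'); split=> [|z|z zz].
  - by rewrite lt_min r0.
  - by rewrite lt_min => /andP[/hg].
  - by rewrite lt_min => /andP[_ /(hf _ zz)].
exists n, g; split; first by apply/holomorphic_atP; exists r.
by apply/dnbhsC; exists r.
Qed.

(* [v] is the value at [w] of the function obtained from [U] by removing the singularity at [w];
   the value [U w] itself is irrelevant. *)
Definition regv (U : C -> C) (w v : C) : Prop := exists (r : R) (G : C -> C),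
  [/\ 0 < r, forall z : C, nrm (z - w) < r -> cdiffb G z,
    forall z : C, z != w -> nrm (z - w) < r -> U z = G z & G w = v].

Lemma ccont_uniq (f g : C -> C) (w : C) (r : R) : 0 < r -> ccont f w -> ccont g w ->
  (forall z : C, z != w -> nrm (z - w) < r -> f z = g z) -> f w = g w.
Proof.
move=> r0 hf hg h; apply: eq_nrm => e e0.
have e2 : 0 < e / 2 by lra.
have [d d0 hd] := hf _ e2; have [d' d'0 hd'] := hg _ e2.
pose m := Num.min r (Num.min d d') / 2.
have m0 : 0 < Num.min r (Num.min d d') by rewrite !lt_min r0 d0.
have mn : nrm (w + m%:C - w) = m by rewrite addrAC subrr add0r nrm_real gtr0_norm // divr_gt0.
have ml : m < Num.min r (Num.min d d') by rewrite /m; lra.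
move: ml; rewrite !lt_min => /and3P[m1 m2 m3].
have wm : w + m%:C != w.
  by rewrite -subr_eq0 -nrm_eq0 mn gt_eqF // divr_gt0.
have hw := h _ wm; rewrite mn in hw.
have q1 := hd (w + m%:C); have q2 := hd' (w + m%:C); rewrite mn in q1 q2.
have := nrmD (f w - f (w + m%:C)) (g (w + m%:C) - g w).
rewrite -(hw m1) addrA subrK [nrm (f w - f _)]nrmC => q3.
have := q1 m2; have := q2 m3; rewrite -(hw m1); lra.
Qed.

Lemma regv_uniq U w v v' : regv U w v -> regv U w v' -> v = v'.
Proof.
move=> [r [G [r0 hG UG <-]]] [r' [G' [r'0 hG' UG' <-]]].
have ww : nrm (w - w) = 0 by rewrite subrr nrm0.
apply: (@ccont_uniq _ _ w (Num.min r r')).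
- by rewrite lt_min r0.
- by apply: cdiffb_ccont; apply: hG; rewrite ww.
- by apply: cdiffb_ccont; apply: hG'; rewrite ww.
- by move=> z zw; rewrite lt_min => /andP[z1 z2]; rewrite -UG // -UG'.
Qed.

(** One [G] computes the regular values at all nearby points; this is what makes the function of
    regular values holomorphic. *)
Lemma regv_near U w v : regv U w v -> exists (r : R) (G : C -> C),
  [/\ 0 < r, forall z : C, nrm (z - w) < r -> cdiffb G z,
    forall z : C, z != w -> nrm (z - w) < r -> U z = G z &
    forall z : C, nrm (z - w) < r -> regv U z (G z)].
Proof.
move=> [r [G [r0 hG UG Gw]]]; exists r, G; split=> // z zr.
have [->|zw] := eqVneq z w; first by exists r, G.
exists (Num.min (r - nrm (z - w)) (nrm (z - w))), G; split=> //.
- by rewrite lt_min subr_gt0 zr nrm_gt0 subr_eq0.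
- move=> y; rewrite lt_min => /andP[h1 h2]; apply: hG.
  by have := nrmD (y - z) (z - w); rewrite addrA subrK; lra.
- move=> y yz; rewrite lt_min => /andP[h1 h2]; apply: UG.
    by apply: contraTneq h2 => ->; rewrite nrmC ltxx.
  by have := nrmD (y - z) (z - w); rewrite addrA subrK; lra.
Qed.

Lemma regv_hol U w (r : R) : 0 < r -> (forall z : C, nrm (z - w) < r -> cdiffb U z) -> regv U w (U w).
Proof. by move=> r0 h; exists r, U; split. Qed.

Lemma regvM U V w v (r : R) : 0 < r -> (forall z : C, nrm (z - w) < r -> cdiffb V z) ->
  regv U w v -> regv (fun z => U z * V z) w (v * V w).
Proof.
move=> r0 hV [r' [G [r'0 hG UG Gw]]].
exists (Num.min r r'), (fun z => G z * V z); split=> [|z|z zw|].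
- by rewrite lt_min r0.
- by rewrite lt_min => /andP[h1 h2]; apply: cdiffbM; [exact: hG|exact: hV].
- by rewrite lt_min => /andP[h1 h2]; rewrite UG.
- by rewrite Gw.
Qed.

Lemma regv_ext (U V : C -> C) w v (r : R) : 0 < r -> (forall z : C, nrm (z - w) < r -> U z = V z) ->
  regv U w v -> regv V w v.
Proof.
move=> r0 UV [r' [G [r'0 hG UG Gw]]]; exists (Num.min r r'), G; split=> // [|z|z zw].
- by rewrite lt_min r0.
- by rewrite lt_min => /andP[h1 h2]; exact: hG.
- by rewrite lt_min => /andP[h1 h2]; rewrite -UV // UG.
Qed.

Lemma regv_comp (U phi : C -> C) (w v : C) (r0 : R) : 0 < r0 ->
  (forall z : C, nrm (z - w) < r0 -> cdiffb phi z) ->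
  (forall z : C, z != w -> nrm (z - w) < r0 -> phi z != phi w) ->
  (forall z : C, nrm (z - w) < r0 -> U (phi z) = U z) ->
  regv U (phi w) v -> regv U w v.
Proof.
move=> r00 hphi inj Uphi [r [G [rp hG UG Gw]]].
have ww : nrm (w - w) < r0 by rewrite subrr nrm0.
have [d d0 hd] := cdiffb_ccont (hphi w ww) rp.
exists (Num.min r0 d), (fun z => G (phi z)); split=> // [|z|z zw].
- by rewrite lt_min r00.
- rewrite lt_min => /andP[h1 h2]; apply: (@cdiffb_comp _ phi G); first exact: hphi.
  by apply: hG; exact: hd.
- by rewrite lt_min => /andP[h1 h2]; rewrite -Uphi // UG ?inj // hd.
Qed.

Lemma upper_disc (z w : C) : nrm (z - w) < complex.Im w -> 0 < complex.Im z.
Proof.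
move=> h; have := ler_Im_nrm (z - w); rewrite ler_norml => /andP[+ _].
by rewrite (_ : complex.Im (z - w) = complex.Im z - complex.Im w); [lra|case: (z); case: (w)].
Qed.

Lemma cdiffb_mobz (B : 'M[int]_2) (z : C) : \det B = 1 -> 0 < complex.Im z -> cdiffb (mobz B) z.
Proof.
move=> dB hz; have d0 := mobz_den dB hz.
have aff (a b : C) : cdiffb (fun w => a * w + b) z.
  by apply: cdiffbD (cdiffb_cst _ _); apply: cdiffbM (cdiffb_id _); exact: cdiffb_cst.
have -> : @mobz R B = fun z => ((B 0 0)%:~R * z + (B 0 1)%:~R) / ((B 1 0)%:~R * z + (B 1 1)%:~R).
  by apply: funext => w; exact: mobzE.
exact: cdiffb_div.
Qed.

Definition adj2 (B : 'M[int]_2) := mx2 (B 1 1) (- B 0 1) (- B 1 0) (B 0 0).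

Lemma det_adj2 B : \det B = 1 -> \det (adj2 B) = 1.
Proof. by move=> <-; rewrite !det2 !mx2E; ring. Qed.

Lemma mobz_adj2 B (z : C) : \det B = 1 -> 0 < complex.Im z -> mobz (adj2 B) (mobz B z) = z.
Proof.
move=> dB hz; rewrite -mobzM ?det_adj2 //.
have -> : adj2 B *m B = 1%:M; last exact: mobz1.
by move: dB; rewrite det2 => dB; apply: eq_mx2; rewrite mul2E !mx2E !mxE /= -?[RHS]/1 -?[RHS]dB; ring.
Qed.

(** Lets [reduce] carry regularity from the strip to the whole half-plane. The transformations are
    injective and holomorphic, hence transport removable singularities. *)
Lemma regv_inv31 (U : C -> C) : inv31 U -> inv31 (fun w => [set v | regv U w v]).
Proof.
move=> [UB US]; have step (B : 'M[int]_2) (w v : C) : \det B = 1 -> (31 %| B 1%R 0%R)%Z ->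
    0 < complex.Im w -> regv U (mobz B w) v -> regv U w v.
  move=> dB hB hw; apply: (@regv_comp U (mobz B) w v (complex.Im w)) => // [z|z zw|z] /upper_disc hz.
  - exact: cdiffb_mobz.
  - by apply: contra_neq zw => e; rewrite -(mobz_adj2 dB hz) e mobz_adj2.
  - exact: UB.
have stepS (w v : C) : 0 < complex.Im w -> regv U (- (31%:R * w)^-1) v -> regv U w v.
  move=> hw; apply: (@regv_comp U (fun w => - (31%:R * w)^-1) w v (complex.Im w)) => // [z|z zw|z] /upper_disc hz.
  - apply: cdiffbN; apply: cdiffbV; first by rewrite mulf_neq0 ?pnatr_eq0 ?upper_neq0.
    by apply: cdiffbM (cdiffb_id _); exact: cdiffb_cst.
  - apply: contra_neq zw => /oppr_inj/invr_inj; apply: mulfI; by rewrite pnatr_eq0.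
  - exact: US.
split=> [B w dB hB hw|w hw]; apply/seteqP; split=> v /=.
- exact: step.
- have hw' := mobz_upper dB hw; rewrite -{1}(mobz_adj2 dB hw); apply: step => //; first exact: det_adj2.
  by rewrite !mx2E dvdzE abszN -dvdzE.
- exact: stepS.
- have [h1 h2] := upper31 hw.
  rewrite -{1}[w](_ : - (31%:R * - (31%:R * w)^-1)^-1 = w); last first.
    by field; exact: upper_neq0.
  exact: stepS.
Qed.

End Regular.

(** * Isolated zeros of holomorphic functions *)

Section Zeros.
Variable R : realType.
Local Notation C := (Cplx R).
Local Notation E := (@e2pi R).
Local Notation nrm := (@nrm R).

Lemma expand1 (h : C -> C) (Y M : R) :
  (forall z : C, Y < complex.Im z -> cdiffb h z) ->
  (forall z : C, Y < complex.Im z -> h (z + 1) = h z) ->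
  (forall z : C, Y < complex.Im z -> nrm (h z) <= M) ->
  exists (c : C) (K : R), forall z : C, Y + 1 < complex.Im z -> nrm (h z - c) <= K * nrm (E z).
Proof.
move=> h1 h2 h3; have [c [_ hc]] := bounded_expand h1 h2 h3.
exists (c 0%N), (M / (1 - decay 1) * expR (tpi R * Y)) => z hz.
have hz' : Y < complex.Im z by lra.
have M0 : 0 <= M by apply: le_trans (h3 _ hz'); exact: nrm_ge0.
have := hc z 1%N hz'; rewrite big_ord1 mul0r E0 mulr1 expr1 => /le_trans; apply.
have d1 : decay 1 < 1 :> R by rewrite /decay mulr1 -[ltRHS]expR0 ltr_expR oppr_lt0 tpi_gt0.
have dz : decay (complex.Im z - Y) <= decay 1.
  by rewrite /decay ler_expR lerN2 ler_pM2l ?tpi_gt0 //; lra.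
have -> : nrm (E z) = decay (complex.Im z - Y) / expR (tpi R * Y).
  by rewrite nrmE /decay -expRN -expRD; congr expR; ring.
rewrite -!mulrA ler_wpM2l //.
rewrite [expR _ * _]mulrCA mulfV ?gt_eqF ?expR_gt0 // mulr1 mulrC ler_wpM2r ?expR_ge0 //.
by rewrite lef_pV2 ?posrE ?subr_gt0 //; lra.
Qed.

(* Pull [u] back by [x |-> z0 + s e(x)] and look at the first nonzero Fourier coefficient. *)
Lemma zero_dichotomy (u : C -> C) (z0 : C) (r : R) : 0 < r ->
  (forall z : C, nrm (z - z0) < r -> cdiffb u z) ->
  (exists2 d : R, 0 < d & forall z : C, z != z0 -> nrm (z - z0) < d -> u z != 0) \/
  (exists2 d : R, 0 < d & forall z : C, nrm (z - z0) < d -> u z = 0).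
Proof.
move=> r0 hu; have z00 : nrm (z0 - z0) < r by rewrite subrr nrm0.
have [d d0 hd] := cdiffb_ccont (hu _ z00) (ltr01 : 0 < 1 :> R).
pose s := Num.min r d; have s0 : 0 < s by rewrite lt_min r0.
have bnd (z : C) : nrm (z - z0) < s -> nrm (u z) <= nrm (u z0) + 1.
  by rewrite lt_min => /andP[_ /hd h]; have := nrmD (u z - u z0) (u z0); rewrite subrK; lra.
pose h (x : C) := u (z0 + s%:C * E x).
have nE (x : C) : nrm (z0 + s%:C * E x - z0) = s * nrm (E x).
  by rewrite addrAC subrr add0r nrmM nrm_real gtr0_norm.
have near0 (x : C) : 0 < complex.Im x -> nrm (z0 + s%:C * E x - z0) < s.
  by move=> hx; rewrite nE -[ltRHS]mulr1 ltr_pM2l // nome_lt1.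
have h1 (x : C) : 0 < complex.Im x -> cdiffb h x.
  move=> hx; apply: (@cdiffb_comp _ (fun x => z0 + s%:C * E x) u).
    apply: cdiffbD (cdiffb_cst _ _) _; apply: cdiffbM (cdiffb_cst _ _) _.
    exact: (cdiffb_E (cdiffb_id x)).
  by apply: hu; apply: lt_le_trans (near0 x hx) _; rewrite ge_min lexx.
have h2 (x : C) : 0 < complex.Im x -> h (x + 1) = h x by move=> _; rewrite /h ED1.
have h3 (x : C) : 0 < complex.Im x -> nrm (h x) <= nrm (u z0) + 1 by move=> /near0; exact: bnd.
have [c [_ hc]] := bounded_expand h1 h2 h3.
move: (nrm (u z0) + 1) h3 hc => M h3 hc.
have surj (z : C) : z != z0 -> exists x, z = z0 + s%:C * E x.
  move=> zz; have sC : s%:C != 0 :> C by rewrite -nrm_gt0 nrm_real gtr0_norm.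
  have [|x hx] := @E_surj R ((z - z0) / s%:C); first by rewrite mulf_neq0 ?invr_eq0 // subr_eq0.
  by exists x; rewrite hx mulrCA divff // mulr1 addrCA subrr addr0.
have ImE (x : C) : nrm (E x) < 1 -> 0 < complex.Im x.
  by rewrite nrmE -[ltRHS]expR0 ltr_expR oppr_lt0 pmulr_rgt0 // tpi_gt0.
have decE (x : C) : decay (complex.Im x) = nrm (E x) by rewrite nrmE.
have M0 : 0 <= M.
  have hi : 0 < complex.Im ('i : C) by rewrite /= ltr01.
  by apply: le_trans (h3 _ hi); exact: nrm_ge0.
have [call|[n cn nmin]] : (forall n, c n = 0) \/ exists2 n, c n != 0 & forall m, (m < n)%N -> c m = 0.
  have [call|/existsNP[m /eqP cm]] := pselect (forall n, c n = 0); first by left.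
  right; have [n hn nm] := ex_minnP (ex_intro (fun n => c n != 0) m cm).
  by exists n => // k kn; apply/eqP; apply: contraTT kn => /nm; rewrite leqNgt.
- right; exists s => // z zs.
  have hz (w : C) : w != z0 -> nrm (w - z0) < s -> u w = 0.
    move=> wz ws; have [x xE] := surj w wz; rewrite xE nE -[ltRHS]mulr1 ltr_pM2l // in ws.
    have hx := ImE _ ws; rewrite xE -/(h x); apply: eq_nrm => e e0; rewrite subr0.
    have q0 := nrm_ge0 (E x).
    have K0 : 0 < M / (1 - nrm (E x)) + 1 by rewrite ltr_wpDl // divr_ge0 // subr_ge0 ltW.
    have [N hN] := Rpow_small q0 ws (divr_gt0 e0 K0).
    have := hc x N hx; rewrite big1 ?subr0 => [|i _]; last by rewrite call mul0r.
    rewrite decE => /le_trans; apply; have := hN N (leqnn _).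
    rewrite ler_pdivlMr // => /(le_trans _); apply.
    by rewrite mulrCA ler_wpM2l ?exprn_ge0 //; lra.
  have [->|zz] := eqVneq z z0; last exact: hz.
  apply: (@ccont_uniq R u (fun=> 0) z0 s) => //.
  - by apply: cdiffb_ccont; exact: hu.
  - by apply: cdiffb_ccont; exact: cdiffb_cst.
- left; have c0 : 0 < nrm (c n) by rewrite nrm_gt0.
  (* For $|e(x)|<q$ the first nonzero term, of size $|c_n||e(x)|^n$, exceeds the tail, which is at
     most $2M|e(x)|^{n+1}$. *)
  pose q := nrm (c n) / (2 * (M + nrm (c n) + 1)).
  have den0 : 0 < 2 * (M + nrm (c n) + 1) by lra.
  have q0 : 0 < q by exact: divr_gt0.
  have q1 : q < 2^-1 by rewrite /q ltr_pdivrMr //; lra.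
  exists (s * q) => [|z zz zs]; first exact: mulr_gt0.
  have [x xE] := surj z zz; rewrite xE nE ltr_pM2l // in zs.
  have hx : 0 < complex.Im x by apply: ImE; lra.
  rewrite xE -/(h x); apply/negP => /eqP hx0.
  have := hc x n.+1 hx; rewrite hx0 big_ord_recr /= big1 ?add0r => [|i _]; last first.
    by rewrite nmin ?mul0r.
  rewrite nrmN nrmM EMn nrmX subr0 decE exprS.
  have e0 : 0 < nrm (E x) by rewrite nrm_gt0 E_neq0.
  have en0 : 0 < nrm (E x) ^+ n by exact: exprn_gt0.
  rewrite /q in zs q0 q1; clear q; move: zs e0 en0 c0 den0 q0 q1.
  move: (nrm (E x)) (nrm (E x) ^+ n) (nrm (c n)) => a y b zs a0 y0 b0 den0 q0 q1 hle.
  have i2 : (1 - a)^-1 <= 2 by rewrite -[leRHS]invrK lef_pV2 ?posrE; lra.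
  have : b * y <= M * (a * 2) * y.
    apply: le_trans hle _; rewrite -!mulrA ler_wpM2l // ler_pM2l // mulrC ler_wpM2r //; lra.
  rewrite ler_pM2r // => {}hle.
  have h4 : b <= M * (b / (2 * (M + b + 1)) * 2) by apply: le_trans hle _; rewrite ler_wpM2l //; lra.
  move: h4; rewrite (_ : M * (b / (2 * (M + b + 1)) * 2) = b * (M / (M + b + 1))); last first.
    by field; apply/negP => /eqP; lra.
  by rewrite -[leLHS]mulr1 ler_pM2l // ler_pdivlMr; lra.
Qed.

End Zeros.

(** * The Hauptmodul property *)

Section Hauptmodul.
Variable R : realType.
Local Notation C := (Cplx R).
Local Notation E := (@e2pi R).
Local Notation nrm := (@nrm R).
Local Notation Phi3 := (@Phi3 R).

Lemma E_small (d : R) : 0 < d -> exists2 Y : R, 0 < Y &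
  forall t : C, Y < complex.Im t -> nrm (E t) < d.
Proof.
move=> d0; exists (d * tpi R)^-1 => [|t ht]; first by rewrite invr_gt0 mulr_gt0 ?tpi_gt0.
rewrite nrmE expRN -[ltRHS]invrK ltf_pV2 ?posrE ?expR_gt0 ?invr_gt0 //.
apply: lt_le_trans (expR_ge1Dx _); apply: ltr_wpDl => //.
by rewrite -ltr_pdivrMl ?tpi_gt0 // mulrC -invfM.
Qed.

Lemma Phi3_cusp : exists W : C -> C, [/\ dhol W, W 0 = 1 &
  forall t : C, 0 < complex.Im t -> Phi3 t = (E t)^-1 * W (E t)].
Proof.
have [W [hW [g hg eW]] hF] := q_side R; exists W; split=> //.
by rewrite eW ?nrm0 // /w0 horner_Poly /= expr0n /=; ring.
Qed.

Lemma Phi3_hol (t : C) : 0 < complex.Im t -> cdiffb Phi3 t.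
Proof.
move=> ht; have [W [hW _ FW]] := Phi3_cusp.
apply: (@cdiffb_ext _ (fun t => (E t)^-1 * W (E t)) _ _ (complex.Im t)) => // [w /upper_disc hw|].
  exact: esym (FW w hw).
have hE : cdiffb E t by exact: (cdiffb_E (cdiffb_id t)).
apply: cdiffbM; first by apply: cdiffbV => //; exact: E_neq0.
by apply: (@cdiffb_comp _ E W) => //; apply: hW; exact: nome_lt1.
Qed.

Lemma Phi3_large : exists2 Y : R, 0 < Y & forall t : C, Y < complex.Im t ->
  nrm (Phi3 t) * nrm (E t) <= 2 /\ 1 <= 2 * (nrm (Phi3 t) * nrm (E t)).
Proof.
have [W [hW W0 FW]] := Phi3_cusp.
have z1 : nrm (0 : C) < 1 by rewrite nrm0.
have [d d0 hd] := cdiffb_ccont (hW _ z1) (ltac:(lra) : 0 < 2^-1 :> R).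
have [Y Y0 hY] := E_small d0; exists Y => // t ht.
have h0 : 0 < complex.Im t by lra.
rewrite -nrmM FW // mulrAC mulVf ?E_neq0 // mul1r.
have := hd (E t); rewrite subr0 W0 => /(_ (hY _ ht)) h.
have := nrmD (W (E t) - 1) 1; rewrite subrK nrm1.
by have := ler_nrmBB 1 (W (E t)); rewrite nrm1 nrmC; lra.
Qed.

Lemma Phi3_avoid (c : C) : exists2 Y : R, 0 < Y & forall t : C, Y < complex.Im t -> Phi3 t != c.
Proof.
have [Y Y0 hY] := Phi3_large; have c0 := nrm_ge0 c.
have d0 : 0 < (2 * (nrm c + 1))^-1 by rewrite invr_gt0; lra.
have [Y' Y'0 hY'] := E_small d0; exists (Num.max Y Y') => [|t]; first by rewrite lt_max Y0.
rewrite gt_max => /andP[/hY[_ h1] /hY' h2]; apply: contraTneq h1 => ->.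
rewrite -ltNge.
have : nrm c * nrm (E t) <= nrm c * (2 * (nrm c + 1))^-1 by rewrite ler_wpM2l // ltW.
have : nrm c * (2 * (nrm c + 1))^-1 < 2^-1.
  by rewrite ltr_pdivrMr; lra.
lra.
Qed.

(** Otherwise [Phi3] would equal [c] on a disc. Climbing the vertical line from [z0], the supremum
    of the heights up to which it equals [c] is finite by [Phi3_avoid], yet the dichotomy at that
    point allows going further. *)
Lemma Phi3_isolated (z0 c : C) : 0 < complex.Im z0 ->
  exists2 d : R, 0 < d & forall z : C, z != z0 -> nrm (z - z0) < d -> Phi3 z != c.
Proof.
move=> h0; pose u z := Phi3 z - c.
have dich (z : C) : 0 < complex.Im z ->
  (exists2 d : R, 0 < d & forall w : C, w != z -> nrm (w - z) < d -> u w != 0) \/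
  (exists2 d : R, 0 < d & forall w : C, nrm (w - z) < d -> u w = 0).
  move=> hz; apply: (zero_dichotomy hz) => w /upper_disc hw.
  by apply: cdiffbB (cdiffb_cst _ _); exact: Phi3_hol.
have [[d d0 hd]|[d d0 hd]] := dich _ h0.
  by exists d => // z zz zd; rewrite -subr_eq0; exact: hd.
exfalso; pose l (s : R) : C := z0 + (0 +i* s).
have nl (s s' : R) : nrm (l s - l s') = `|s - s'|.
  rewrite /l opprD addrACA subrr add0r (_ : _ - _ = (0 +i* (s - s')) :> C); last first.
    by apply/eqP; rewrite eq_complex /= subrr !eqxx.
  by rewrite /nrm /= expr0n /= add0r sqrtr_sqr.
have Iml (s : R) : complex.Im (l s) = complex.Im z0 + s by rewrite /l; case: (z0).
have l0 : l 0 = z0 by rewrite /l (_ : (0 +i* 0) = 0 :> C) ?addr0.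
pose A := [set s : R | 0 <= s /\ forall s', 0 <= s' <= s -> u (l s') = 0].
have [Y Y0 hY] := Phi3_avoid c.
have Aub : ubound A Y.
  move=> s [s0 hs]; rewrite leNgt; apply/negP => Ys.
  have : u (l s) = 0 by apply: hs; rewrite s0 lexx.
  move=> /eqP; rewrite subr_eq0; apply/negP; apply: hY; rewrite Iml; lra.
have Ad : A (d / 2).
  split=> [|s' /andP[s0 s1]]; first by lra.
  by apply: hd; rewrite -[X in _ - X]l0 nl subr0 ger0_norm //; lra.
have Asup : has_sup A by split; [exists (d / 2)|exists Y].
have sg0 : d / 2 <= sup A by apply: ub_le_sup => //; exists Y.
have below (s : R) : 0 <= s -> s < sup A -> u (l s) = 0.
  move=> s0 ss; have e0 : 0 < sup A - s by lra.
  have [a [a0 ha] aa] := sup_adherent e0 Asup; apply: ha; rewrite s0 /=; lra.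
have hp : 0 < complex.Im (l (sup A)) by rewrite Iml; lra.
have [[e e0 he]|[e e0 he]] := dich _ hp.
  pose s := sup A - Num.min (d / 2) e / 2.
  have m0 : 0 < Num.min (d / 2) e by rewrite lt_min e0; lra.
  have m1 : Num.min (d / 2) e <= d / 2 by rewrite ge_min lexx.
  have m2 : Num.min (d / 2) e <= e by rewrite ge_min lexx orbT.
  have ns : nrm (l s - l (sup A)) = Num.min (d / 2) e / 2.
    by rewrite nl /s addrAC subrr sub0r normrN gtr0_norm //; lra.
  have us : u (l s) = 0 by apply: below; rewrite /s; lra.
  have : u (l s) != 0.
    apply: he; last by rewrite ns; lra.
    by rewrite -subr_eq0 -nrm_eq0 ns gt_eqF //; lra.
  by rewrite us eqxx.
have : sup A + e / 2 <= sup A.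
  apply: ub_le_sup; first by exists Y.
  split=> [|s' /andP[s0 s1]]; first by lra.
  have [hs|hs] := ltP s' (sup A); first exact: below.
  by apply: he; rewrite nl ger0_norm; lra.
lra.
Qed.

(** Compactness of the truncated strip as an induction over sets, from [cousin2] after rescaling to
    the unit square. It yields a uniform bound in [liouville31] and a finite list in
    [clear_poles]. *)
Lemma region_ind (L : R) (P : set C -> Prop) : 0 < L ->
  (forall A B, A `<=` B -> P B -> P A) -> (forall A B, P A -> P B -> P (A `|` B)) ->
  (forall z0 : C, 62%:R^-1 <= complex.Im z0 -> exists2 r : R, 0 < r & P [set z | nrm (z - z0) < r]) ->
  P [set z : C | `|complex.Re z| <= 2^-1 /\ 62%:R^-1 <= complex.Im z <= 62%:R^-1 + L].
Proof.
move=> L0 sub uni loc.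
pose Q n (a b : R) := P [set z : C | a <= complex.Re z + 2^-1 <= a + dyad R n /\
  b * L <= complex.Im z - 62%:R^-1 <= (b + dyad R n) * L].
have : Q 0%N 0 0.
  apply: cousin2 => [n a b h1 h2 h3 h4|x y hx hy].
    have := uni _ _ (uni _ _ h1 h2) (uni _ _ h3 h4); apply: sub => z [].
    rewrite dyS /=; move: (dyad R n.+1) => e /andP[p1 p2] /andP[p3 p4].
    have [p5|p5] := leP (complex.Re z + 2^-1) (a + e); have [p6|p6] := leP (complex.Im z - 62%:R^-1) ((b + e) * L).
    - by left; left; split; apply/andP; split.
    - right; left; split; apply/andP; split=> //; first exact: ltW.
      by rewrite -addrA.
    - left; right; split; apply/andP; split=> //; first exact: ltW.
      by rewrite -addrA.
    - by right; right; split; apply/andP; split; rewrite -?addrA //; exact: ltW.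
  pose z0 : C := (x - 2^-1) +i* (62%:R^-1 + y * L).
  have [|r r0 hr] := loc z0.
    by rewrite /= lerDl mulr_ge0 //; [case/andP: hy|exact: ltW].
  have e0 : 0 < r / (2 * (1 + L)) by rewrite divr_gt0 // mulr_gt0 //; lra.
  have [N hN] := dy_small e0; exists N => n a b nN _ _ _ _ ha hb.
  apply: sub hr => z [] /andP[p1 p2] /andP[p3 p4] /=.
  apply: le_lt_trans (ler_nrm_ReIm _) _.
  have -> : complex.Re (z - z0) = complex.Re z - (x - 2^-1) by case: (z).
  have -> : complex.Im (z - z0) = complex.Im z - (62%:R^-1 + y * L) by case: (z).
  have hd := hN n nN; have d0 := dy_gt0 R n.
  case/andP: ha => a1 a2; case/andP: hb => b1 b2.
  have q1 : `|complex.Re z - (x - 2^-1)| <= dyad R n by rewrite ler_norml; apply/andP; split; lra.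
  have b1' : b * L <= y * L by rewrite ler_pM2r.
  have b2' : y * L <= (b + dyad R n) * L by rewrite ler_pM2r.
  rewrite mulrDl in p4 b2'.
  have q2 : `|complex.Im z - (62%:R^-1 + y * L)| <= dyad R n * L.
    by rewrite ler_norml; apply/andP; split; lra.
  apply: le_lt_trans (lerD q1 q2) _; rewrite -[X in X + _]mulr1 -mulrDr.
  have L1 : 0 < 1 + L by lra.
  apply: le_lt_trans (_ : r / (2 * (1 + L)) * (1 + L) < _); first by rewrite ler_pM2r.
  rewrite invfM mulrA -mulrA mulVf ?gt_eqF // mulr1; lra.
apply: sub => z [p1 p2] /=; rewrite dy0 !add0r mul0r mul1r.
move: p1; rewrite ler_norml => /andP[p3 p4]; move/andP: p2 => [p5 p6].
split; apply/andP; split; lra.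
Qed.

(* Every value of [V] is taken where [1/62 <= Im z]; there the Schwarz lemma improves a bound
   [M] to [M e^(- 2 pi / 62)]. *)
Lemma liouville31 (V : C -> C) (K Y : R) : inv31 V ->
  (forall z : C, 0 < complex.Im z -> cdiffb V z) ->
  (forall z : C, Y < complex.Im z -> nrm (V z) <= K * nrm (E z)) ->
  forall z : C, 0 < complex.Im z -> V z = 0.
Proof.
move=> Vinv Vhol VK.
have L0 : 0 < `|Y| + 1 by rewrite ltr_wpDl.
have i62 : 0 < 62%:R^-1 :> R by rewrite invr_gt0 ltr0n.
have [M1 hM1] : exists M, forall z : C, `|complex.Re z| <= 2^-1 /\
    62%:R^-1 <= complex.Im z <= 62%:R^-1 + (`|Y| + 1) -> nrm (V z) <= M.
  apply: (@region_ind _ (fun A => exists M, forall z, A z -> nrm (V z) <= M) L0).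
  - by move=> A B AB [M hM]; exists M => z /AB; exact: hM.
  - move=> A B [M hM] [N hN]; exists (Num.max M N) => z [/hM|/hN] h.
      by rewrite le_max h.
    by rewrite le_max h orbT.
  - move=> z0 hz; have hz0 : 0 < complex.Im z0 by lra.
    have [d d0 hd] := cdiffb_ccont (Vhol _ hz0) (ltr01 : 0 < 1 :> R).
    exists d => //; exists (nrm (V z0) + 1) => z /hd.
    by have := nrmD (V z - V z0) (V z0); rewrite subrK; lra.
pose M := Num.max M1 `|K|.
have bndK (z : C) : 0 < complex.Im z -> Y < complex.Im z -> nrm (V z) <= `|K|.
  move=> h0 /VK /le_trans; apply; have e1 := nome_lt1 h0; have e0 := nrm_ge0 (E z).
  apply: le_trans (_ : `|K| * nrm (E z) <= _); first by rewrite ler_wpM2r // ler_norm.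
  by rewrite ler_piMr // ltW.
have Mbnd (z : C) : 0 < complex.Im z -> nrm (V z) <= M.
  move=> hz; have [z' [h1 h2 ->]] := reduce Vinv hz; rewrite le_max.
  have [h3|h3] := leP (complex.Im z') (62%:R^-1 + (`|Y| + 1)).
    by rewrite hM1 // h2.
  rewrite bndK ?orbT //; first by lra.
  by have := ler_norm Y; lra.
pose rho : R := expR (- (tpi R * 62%:R^-1)).
have r0 : 0 <= rho by exact: expR_ge0.
have r1 : rho < 1 by rewrite -[ltRHS]expR0 ltr_expR oppr_lt0 mulr_gt0 ?tpi_gt0.
have iter n (z : C) : 0 < complex.Im z -> nrm (V z) <= M * rho ^+ n.
  elim: n z => [|n IH] z hz; first by rewrite expr0 mulr1; exact: Mbnd.
  have [z' [h1 h2 ->]] := reduce Vinv hz; have hz' : 0 < complex.Im z' by lra.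
  have per (w : C) : 0 < complex.Im w -> V (w + 1) = V w.
    by move=> hw; rewrite -(inv_T Vinv 1 hw).
  have sch := schwarz Vhol per IH VK hz'.
  rewrite exprSr mulrA; apply: le_trans sch _; apply: ler_wpM2l.
    by apply: le_trans (IH _ hz'); exact: nrm_ge0.
  by rewrite nrmE ler_expR lerN2 ler_pM2l ?tpi_gt0.
move=> z hz; apply: eq_nrm => e e0; rewrite subr0.
have M0 : 0 <= M by apply: le_trans (Mbnd _ hz); exact: nrm_ge0.
have M1' : 0 < M + 1 by lra.
have [N hN] := Rpow_small r0 r1 (divr_gt0 e0 M1').
apply: le_trans (iter N z hz) _; have := hN N (leqnn _).
rewrite ler_pdivlMr // mulrC => /(le_trans _); apply.
by rewrite ler_wpM2r ?exprn_ge0 //; lra.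
Qed.

Lemma inv31B (U V : C -> C) : inv31 U -> inv31 V -> inv31 (fun z => U z - V z).
Proof. by move=> [u1 u2] [v1 v2]; split=> [B z dB hB hz|z hz]; rewrite ?u1 ?v1 ?u2 ?v2. Qed.

Lemma inv31_poly (p : C -> C) (U : C -> C) : inv31 U -> inv31 (fun z => p (U z)).
Proof. by move=> [u1 u2]; split=> [B z dB hB hz|z hz]; rewrite ?u1 ?u2. Qed.

(** At the cusp $U(z)e(z)^{n+1}\to c$ and $\Phi(z)^3e(z)\to1$, so subtracting $c\,\Phi^{3(n+1)}$
    lowers the growth by one order; in the bounded case [liouville31] applies to $U-c$. *)
Lemma poly_of_F (n : nat) (U : C -> C) (K Y : R) : inv31 U ->
  (forall z : C, 0 < complex.Im z -> cdiffb U z) ->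
  (forall z : C, 0 < complex.Im z -> Y < complex.Im z -> nrm (U z) * nrm (E z) ^+ n <= K) ->
  exists p : {poly C}, forall z : C, 0 < complex.Im z -> U z = p.[Phi3 z].
Proof.
elim: n U K Y => [|n IH] U K Y Uinv Uhol UK.
all: pose Y1 := Num.max 0 Y.
all: have Y1P (z : C) : Y1 < complex.Im z -> 0 < complex.Im z /\ Y < complex.Im z
  by rewrite gt_max => /andP[].
- have [c [K' hc]] : exists (c : C) (K : R), forall z : C, Y1 + 1 < complex.Im z ->
      nrm (U z - c) <= K * nrm (E z).
    apply: (@expand1 _ U Y1 K) => z /Y1P[h1 h2]; first exact: Uhol.
      by rewrite -(inv_T Uinv 1 h1).
    by have := UK z h1 h2; rewrite expr0 mulr1.
  exists c%:P => z hz; rewrite hornerC; apply/eqP; rewrite -subr_eq0; apply/eqP.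
  apply: (@liouville31 (fun z => U z - c) K' (Y1 + 1)) => //.
    by case: Uinv => u1 u2; split=> [B w dB hB hw|w hw]; rewrite ?u1 ?u2.
  by move=> w hw; apply: cdiffbB (cdiffb_cst _ _); exact: Uhol.
have [c [K' hc]] : exists (c : C) (K : R), forall z : C, Y1 + 1 < complex.Im z ->
    nrm (U z * E z ^+ n.+1 - c) <= K * nrm (E z).
  apply: (@expand1 _ (fun z => U z * E z ^+ n.+1) Y1 K) => z /Y1P[h1 h2].
  - apply: cdiffbM; first exact: Uhol.
    by apply: cdiffbX; exact: (cdiffb_E (cdiffb_id z)).
  - by rewrite ED1 -(inv_T Uinv 1 h1).
  - by rewrite nrmM nrmX; exact: UK.
have [W [hW W0 FW]] := Phi3_cusp.
have z1 : nrm (0 : C) < 1 by rewrite nrm0.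
(* The Lipschitz bound for $W^{n+1}$ at 0 makes its difference from 1 an $O(q)$, which is the order
   gained. *)
have [m hm] := cdiffbX n.+1 (hW _ z1).
have [d d0 hd] := cdiff_lip hm; have [Y2 Y20 hY2] := E_small d0.
have Y10 : 0 <= Y1 by rewrite le_max lexx.
have [|||p hp] := IH (fun z => U z - c * Phi3 z ^+ n.+1) (K' + nrm c * (nrm m + 1)) (Num.max (Y1 + 1) Y2).
- exact: (inv31B Uinv (@inv31_poly (fun x => c * x ^+ n.+1) Phi3 (@Phi3_inv31 R))).
- move=> z hz; apply: cdiffbB; first exact: Uhol.
  by apply: cdiffbM (cdiffb_cst _ _) _; apply: cdiffbX; exact: Phi3_hol.
- move=> z hz; rewrite gt_max => /andP[h1 h2].
  have e0 : 0 < nrm (E z) by rewrite nrm_gt0 E_neq0.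
  rewrite -(ler_pM2r e0) -mulrA -exprSr -nrmX -nrmM mulrBl -mulrA -exprMn FW //.
  rewrite mulrAC mulVf ?E_neq0 // mul1r.
  have q1 := hc z h1; have := hd (E z); rewrite !subr0 W0 expr1n => /(_ (hY2 _ h2)) q2.
  have -> : U z * E z ^+ n.+1 - c * W (E z) ^+ n.+1 =
    (U z * E z ^+ n.+1 - c) - c * (W (E z) ^+ n.+1 - 1) by ring.
  apply: le_trans (nrmB _ _) _; rewrite nrmM mulrDl; apply: lerD => //.
  by rewrite -mulrA ler_wpM2l ?nrm_ge0.
exists (p + c *: 'X^(n.+1)) => z hz.
by rewrite hornerD hornerZ hornerXn -hp // subrK.
Qed.

Lemma SL2Z1 : SL2Z (1%:M : 'M[R]_2).
Proof. by exists 1%:M; [exact: det1|rewrite map_mx1]. Qed.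

Definition Phi3prod (s : seq C) (z : C) : C := \prod_(c <- s) (Phi3 z - c).

Lemma Phi3prod_hol s (z : C) : 0 < complex.Im z -> cdiffb (Phi3prod s) z.
Proof.
move=> hz; rewrite /Phi3prod; elim: s => [|c s IH].
  by apply: (@cdiffb_ext _ (fun=> 1) _ _ 1) (cdiffb_cst _ _) => // w _; rewrite big_nil.
apply: (@cdiffb_ext _ (fun w => (Phi3 w - c) * \prod_(c <- s) (Phi3 w - c)) _ _ 1) => // [w _|].
  by rewrite big_cons.
by apply: cdiffbM IH; apply: cdiffbB (cdiffb_cst _ _); exact: Phi3_hol.
Qed.

Lemma Phi3prod_inv31 s : inv31 (Phi3prod s).
Proof. exact: (@inv31_poly (fun x => \prod_(c <- s) (x - c)) Phi3 (@Phi3_inv31 R)). Qed.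

Lemma Phi3prod_horner s z : Phi3prod s z = (\prod_(c <- s) ('X - c%:P)).[Phi3 z].
Proof.
rewrite horner_prod; apply: eq_bigr => c _; by rewrite hornerXsubC.
Qed.

Lemma Phi3prod_isolated s (z0 : C) : 0 < complex.Im z0 ->
  exists2 d : R, 0 < d & forall z : C, z != z0 -> nrm (z - z0) < d -> Phi3prod s z != 0.
Proof.
move=> hz; rewrite /Phi3prod; elim: s => [|c s [d d0 IH]].
  by exists 1 => // z _ _; rewrite big_nil oner_neq0.
have [e e0 he] := Phi3_isolated c hz; exists (Num.min d e) => [|z zz]; first by rewrite lt_min d0.
by rewrite lt_min big_cons => /andP[h1 h2]; rewrite mulf_neq0 ?subr_eq0 ?he ?IH.
Qed.

Lemma Phi3prod_growth s : exists K Y : R, forall z : C, Y < complex.Im z ->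
  nrm (Phi3prod s z) * nrm (E z) ^+ size s <= K.
Proof.
have [Y0 Y00 hY] := Phi3_large; rewrite /Phi3prod; elim: s => [|c s [K [Y IH]]].
  by exists 1, 0 => z _; rewrite big_nil nrm1 expr0 mulr1.
exists ((2 + nrm c) * K), (Num.max Y0 Y) => z; rewrite gt_max => /andP[h1 h2].
rewrite big_cons nrmM exprS mulrACA; apply: ler_pM; rewrite ?mulr_ge0 ?exprn_ge0 ?nrm_ge0 ?IH //.
have e1 : nrm (E z) < 1 by apply: nome_lt1; lra.
apply: le_trans (_ : (nrm (Phi3 z) + nrm c) * nrm (E z) <= _).
  by rewrite ler_wpM2r ?nrm_ge0 ?nrmB.
rewrite mulrDl lerD ?(hY z h1).1 //.
by rewrite ler_piMr ?nrm_ge0 // ltW.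
Qed.

(** The expansion at infinity may come in $e(z/h)$ with $h>1$; since $|e(z)|\le|e(z/h)|<1$, the same
    exponent [n] bounds the growth in $e(z)$. *)
Lemma cusp_growth (f : C -> C) : meromorphic_at_cusps f ->
  exists (n : nat) (K Y : R), forall z : C, 0 < complex.Im z -> Y < complex.Im z ->
    cdiffb f z /\ nrm (f z) * nrm (E z) ^+ n <= K.
Proof.
move=> /(_ _ SL2Z1)[h [g [y [h0 /meromorphic_atP[n [k [r [r0 hk gk]]]] fg]]]].
have k00 : nrm (0 - 0 : C) < r by rewrite subrr nrm0.
have [d d0 hd] := cdiffb_ccont (hk _ k00) (ltr01 : 0 < 1 :> R).
have m0 : 0 < Num.min r d by rewrite lt_min r0.
have [Y Y0 hY] := E_small m0; have hC : h%:R != 0 :> C := natC_neq0 R h0.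
have hR : 0 < h%:R :> R by rewrite ltr0n.
have ImV (z : C) : complex.Im (z / h%:R) = complex.Im z / h%:R.
  have := Im_natM h (z / h%:R); rewrite mulrCA divff // mulr1 => ->.
  by rewrite mulrAC divff ?mul1r // gt_eqF.
have near (z : C) : h%:R * Y < complex.Im z -> nrm (E (z / h%:R)) < r /\ nrm (E (z / h%:R)) < d.
  by move=> hz; apply/andP; rewrite -lt_min; apply: hY; rewrite ImV ltr_pdivlMr // mulrC.
have fE (z : C) : 0 < complex.Im z -> y < complex.Im z -> h%:R * Y < complex.Im z ->
    f z = k (E (z / h%:R)) / E (z / h%:R) ^+ n.
  move=> z0 zy zY; have [z1 z2] := near z zY; have := fg z z0 zy; rewrite mobius1 => ->.
  by rewrite gk ?E_neq0 ?subr0.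
exists n, (nrm (k 0) + 1), (Num.max y (h%:R * Y)) => z z0; rewrite gt_max => /andP[zy zY].
split.
  pose e := Num.min (complex.Im z) (Num.min (complex.Im z - y) (complex.Im z - h%:R * Y)).
  have e0 : 0 < e by rewrite !lt_min z0 !subr_gt0 zy.
  apply: (@cdiffb_ext _ (fun z => k (E (z / h%:R)) / E (z / h%:R) ^+ n) _ _ e) => // [w|].
    rewrite !lt_min => /and3P[w1 w2 w3]; have := ler_Im_nrm (w - z).
    rewrite (_ : complex.Im (w - z) = complex.Im w - complex.Im z); last by case: (w); case: (z).
    by rewrite ler_norml => /andP[w4 _]; rewrite fE //; lra.
  have cE : cdiffb (fun z => E (z / h%:R)) z.
    by apply: cdiffb_E; apply: cdiffbM (cdiffb_id _) (cdiffb_cst _ _).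
  apply: cdiffb_div; first by rewrite expf_neq0 // E_neq0.
    by apply: (@cdiffb_comp _ (fun z => E (z / h%:R)) k) => //; apply: hk; rewrite subr0; exact: (near z zY).1.
  exact: cdiffbX.
have hz' : 0 < complex.Im (z / h%:R) by rewrite ImV divr_gt0.
have e1 := nome_lt1 hz'; have e0 : 0 < nrm (E (z / h%:R)) by rewrite nrm_gt0 E_neq0.
rewrite fE // nrmM nrmV nrmX.
have le : nrm (E z) <= nrm (E (z / h%:R)).
  rewrite {1}(_ : z = h%:R * (z / h%:R)); last by rewrite mulrCA divff // mulr1.
  by rewrite EMn nrmX -{2}[nrm _]expr1; apply: ler_wiXn2l; rewrite ?ltW.
apply: le_trans (_ : nrm (k (E (z / h%:R))) <= _).
  rewrite -mulrA ler_piMr ?nrm_ge0 // mulrC ler_pdivrMr ?exprn_gt0 // mul1r.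
  by rewrite lerXn2r ?nnegrE ?nrm_ge0.
have := hd (E (z / h%:R)); rewrite subr0 => /(_ (near z zY).2).
by have := nrmD (k (E (z / h%:R)) - k 0) (k 0); rewrite subrK; lra.
Qed.

Lemma clear_poles (f : C -> C) (L : R) : 0 < L -> (forall z, upper z -> meromorphic_at f z) ->
  exists s : seq C, forall z : C, `|complex.Re z| <= 2^-1 /\
    62%:R^-1 <= complex.Im z <= 62%:R^-1 + L -> exists v, regv (fun z => f z * Phi3prod s z) z v.
Proof.
move=> L0 fm.
(* Positivity of the imaginary part is built in because the discs of [region_ind] may leave the
   half-plane. *)
pose P (A : set C) := exists s : seq C, forall z : C, A z /\ 0 < complex.Im z ->
  exists v, regv (fun z => f z * Phi3prod s z) z v.
suff [s hs] : P [set z : C | `|complex.Re z| <= 2^-1 /\ 62%:R^-1 <= complex.Im z <= 62%:R^-1 + L].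
  exists s => z hz; apply: hs; split=> //; case: hz => _ /andP[+ _].
  by apply: lt_le_trans; rewrite invr_gt0 ltr0n.
apply: (region_ind L0) => [A B AB [s hs]|A B [s hs] [s' hs']|z0 hz].
- by exists s => z [/AB zB hz]; exact: hs.
- exists (s ++ s') => z [zAB hz].
  have disc (w : C) : nrm (w - z) < complex.Im z -> 0 < complex.Im w by exact: upper_disc.
  case: zAB => [zA|zB].
  + have [v hv] := hs z (conj zA hz); exists (v * Phi3prod s' z).
    apply: regv_ext (regvM hz (fun w hw => Phi3prod_hol s' (disc w hw)) hv) => // w _.
    by rewrite /Phi3prod big_cat mulrA.
  + have [v hv] := hs' z (conj zB hz); exists (v * Phi3prod s z).
    apply: regv_ext (regvM hz (fun w hw => Phi3prod_hol s (disc w hw)) hv) => // w _.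
    by rewrite /Phi3prod big_cat /= -mulrA [X in _ * X]mulrC.
- have hz0 : 0 < complex.Im z0 by apply: lt_le_trans hz; rewrite invr_gt0 ltr0n.
  have /meromorphic_atP[n [g [r [r0 hg fg]]]] := fm z0 hz0.
  have m0 : 0 < Num.min r (complex.Im z0) by rewrite lt_min r0.
  (* [Phi3 - Phi3 z0] vanishes at [z0], so its [n]-th power clears a pole of order at most [n]. *)
  have [|k Fk hk] := @cdiffb_divX R (fun z => Phi3 z - Phi3 z0) z0 _ m0 (subrr _).
    move=> z; rewrite lt_min => /andP[_ /upper_disc hz'].
    by apply: cdiffbB (cdiffb_cst _ _); exact: Phi3_hol.
  have prodE z : Phi3prod (nseq n (Phi3 z0)) z = (Phi3 z - Phi3 z0) ^+ n.
    by rewrite /Phi3prod big_nseq -Monoid.iteropE.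
  have reg0 : regv (fun z => f z * Phi3prod (nseq n (Phi3 z0)) z) z0 (g z0 * k z0 ^+ n).
    exists (Num.min r (complex.Im z0)), (fun z => g z * k z ^+ n); split=> // [w|w ww wr].
      move=> wr; apply: cdiffbM; last by apply: cdiffbX; exact: hk.
      by apply: hg; move: wr; rewrite lt_min => /andP[].
    move: wr; rewrite lt_min => /andP[wr _]; rewrite fg // prodE Fk exprMn.
    have w0 : (w - z0) ^+ n != 0 by rewrite expf_neq0 // subr_eq0.
    by rewrite mulrA -mulrAC [_ / _ * _]mulrAC divfK // mulrC.
  have [r1 [G [r10 _ _ hG]]] := regv_near reg0.
  by exists r1 => //; exists (nseq n (Phi3 z0)) => z [/= zr _]; exists (G z); exact: hG.
Qed.

Lemma Phi3_generates (f : C -> C) : modular_function (Gamma0plus 31) f -> rational_function_of Phi3 f.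
Proof.
move=> [fm fG /cusp_growth[n [K [Y hY]]]].
have finv : inv31 f by exact: invariant31_inv31.
have L0 : 0 < `|Y| + 1 by rewrite ltr_wpDl.
have [s hs] := clear_poles L0 fm.
pose U z := f z * Phi3prod s z.
have Uinv : inv31 U.
  case: finv => f1 f2; case: (Phi3prod_inv31 s) => p1 p2; rewrite /U.
  by split=> [B z dB hB hz|z hz]; rewrite ?f1 ?p1 ?f2 ?p2.
have i62 : 0 < 62%:R^-1 :> R by rewrite invr_gt0 ltr0n.
(* Above [Y] the function [f] is holomorphic, so [s] has to clear the poles in a bounded part of the
   strip only. *)
have Yreg (z : C) : 0 < complex.Im z -> Y < complex.Im z -> regv U z (U z).
  move=> hz zY; have e0 : 0 < Num.min (complex.Im z) (complex.Im z - Y).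
    by rewrite lt_min hz subr_gt0.
  apply: (regv_hol e0) => w; rewrite lt_min => /andP[w1 w2].
  have w0 := upper_disc w1; apply: cdiffbM; last exact: Phi3prod_hol.
  have := ler_Im_nrm (w - z).
  rewrite (_ : complex.Im (w - z) = complex.Im w - complex.Im z); last by case: (w); case: (z).
  by rewrite ler_norml => /andP[w4 _]; apply: (hY w w0 _).1; lra.
have Ureg (z : C) : 0 < complex.Im z -> exists v, regv U z v.
  move=> hz; have [z' [h1 h2 e]] := reduce (regv_inv31 Uinv) hz.
  have [v hv] : exists v, regv U z' v.
    have [h3|h3] := leP (complex.Im z') (62%:R^-1 + (`|Y| + 1)); first by apply: hs; rewrite h2.
    exists (U z'); apply: Yreg; first by lra.
    by have := ler_norm Y; lra.
  by exists v; have : [set v | regv U z v] v by rewrite e.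
(* [U] is arbitrary at the former poles; [V] takes the regular values instead and is holomorphic
   throughout. *)
pose V z : C := get [set v | regv U z v].
have VP (z : C) : 0 < complex.Im z -> regv U z (V z).
  by move=> hz; have [v hv] := Ureg z hz; exact: (@getI _ [set v | regv U z v] v hv).
have Vuniq (z v : C) : regv U z v -> V z = v.
  by move=> hv; exact: regv_uniq (@getI _ [set v | regv U z v] v hv) hv.
have Vinv : inv31 V.
  case: (regv_inv31 Uinv) => r1 r2.
  by split=> [B z dB hB hz|z hz]; rewrite /V; congr get; [exact: r1|exact: r2].
have Vhol (z : C) : 0 < complex.Im z -> cdiffb V z.
  move=> hz; have [r [G [r0 hG _ hGv]]] := regv_near (VP z hz).
  apply: (@cdiffb_ext _ G _ _ r) => // [w wr|]; first by apply/esym/Vuniq; exact: hGv.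
  by apply: hG; rewrite subrr nrm0.
have [K' [Y' hY']] := Phi3prod_growth s.
have [p hp] : exists p : {poly C}, forall z : C, 0 < complex.Im z -> V z = p.[Phi3 z].
  apply: (@poly_of_F (n + size s) V (K * K') (Num.max Y Y')) => // z hz.
  rewrite gt_max => /andP[z1 z2]; rewrite (Vuniq _ _ (Yreg z hz z1)) /U nrmM exprD mulrACA.
  apply: ler_pM; rewrite ?mulr_ge0 ?exprn_ge0 ?nrm_ge0 //; first exact: (hY z hz z1).2.
  exact: hY'.
exists p, (\prod_(c <- s) ('X - c%:P)); split.
  by apply: monic_neq0; exact: monic_prod_XsubC.
move=> z0 hz0; apply/dnbhsC.
have [r [G [r0 hG UG hGv]]] := regv_near (VP z0 hz0).
have [d d0 hd] := Phi3prod_isolated s hz0.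
exists (Num.min (complex.Im z0) (Num.min r d)) => [|z zz]; first by rewrite !lt_min hz0 r0.
rewrite !lt_min => /and3P[/upper_disc hz zr zd].
rewrite -Phi3prod_horner -hp // (Vuniq _ _ (hGv z zr)) -(UG _ zz zr) /U mulfK //.
exact: hd.
Qed.

End Hauptmodul.

(** * Behaviour at the cusps and the conclusion *)

Section Cusps.
Variable R : realType.
Local Notation C := (Cplx R).
Local Notation E := (@e2pi R).
Local Notation nrm := (@nrm R).
Local Notation Phi3 := (@Phi3 R).

Lemma Phi3_meromorphic (z : C) : upper z -> meromorphic_at Phi3 z.
Proof.
move=> hz; apply/meromorphic_atP; exists 0%N, Phi3, (complex.Im z); split=> // [w|w _ _].
  by move=> /upper_disc; exact: Phi3_hol.
by rewrite expr0 divr1.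
Qed.

(** By [inv_cusp] the local parameter is $q$ itself, or $e(t/31)$ with $e(j/31)e(t/31)$ in place of
    $q$. Both cases are covered by [mer], with $|a|=1$. *)
Lemma Phi3_meromorphic_at_cusps : meromorphic_at_cusps Phi3.
Proof.
have [W [hW _ FW]] := Phi3_cusp R.
have mer (a : C) : nrm a = 1 -> meromorphic_at (fun x => (a * x)^-1 * W (a * x)) 0.
  move=> a1; apply/meromorphic_atP; exists 1%N, (fun x => a^-1 * W (a * x)), 1.
  have aff (x : C) : cdiffb (fun x => a * x) x by apply: cdiffbM (cdiffb_id _); exact: cdiffb_cst.
  split=> // [x|x _ _]; last by rewrite subr0 expr1 invfM mulrAC.
  rewrite subr0 => x1; apply: cdiffbM; first exact: cdiffb_cst.
  by apply: (@cdiffb_comp _ (fun x => a * x) W) => //; apply: hW; rewrite nrmM a1 mul1r.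
move=> al [A dA <-]; have [h|[j h]] := inv_cusp (@Phi3_inv31 R) dA.
  exists 1%N, (fun x => (1 * x)^-1 * W (1 * x)), 0; split=> // [|t t0 _].
    by apply: mer; exact: nrm1.
  by rewrite -/(mobz A t) h // FW // divr1 mul1r.
exists 31%N, (fun x => (E (j%:~R / 31%:R) * x)^-1 * W (E (j%:~R / 31%:R) * x)), 0.
split=> // [|t t0 _].
  by apply: mer; have := nrm_Erat R j 1 31; rewrite !mulr1z mul1r.
rewrite -/(mobz A t) h // -ED addrC -mulrDl FW //.
by rewrite Im_div31 divr_gt0 // addrC Im_addint.
Qed.

Lemma Phi3_q_expansion : q_expansion Phi3
  (fun q => q^-1 + 3%:R * q + 3%:R * q ^+ 2 + 6%:R * q ^+ 3 + 9%:R * q ^+ 4 + 13%:R * q ^+ 5) 6.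
Proof.
have [W [hW [g hg eW]] hF] := q_side R; exists g, 0; split=> [|t t0 _].
  by apply/holomorphic_atP; exists 1 => // z; rewrite subr0; exact: hg.
rewrite /Phi3 hF // nomeE eW ?nome_lt1 // /w0 horner_Poly /=.
by have := E_neq0 t; move: (E t) (g _) => x y x0; field.
Qed.

Lemma Phi3_q_expansion1 : q_expansion Phi3 (fun q => q^-1) 1.
Proof.
have [g [y [/holomorphic_atP[r r0 hg] hF]]] := Phi3_q_expansion.
(* The constant term of the expansion is 0, so one factor [q] comes out of everything after the
   pole. *)
pose p : {poly C} := Poly [:: 3%:R; 3%:R; 6%:R; 9%:R; 13%:R].
exists (fun q => p.[q] + q ^+ 5 * g q), y; split=> [|t t0 ty]; last first.
  by rewrite hF // /p horner_Poly /=; ring.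
apply/holomorphic_atP; exists r => // z /hg gz; apply: cdiffbD.
  exact: (cdiffb_horner p (cdiffb_id z)).
by apply: cdiffbM gz; exact: cdiffbX (cdiffb_id _).
Qed.

End Cusps.

Theorem proposition3p2 (R : realType) :
  [/\ forall tau : Cplx R, upper tau ->
        Phi (- 1 / (31%:R * tau)) = Phi tau,
      modular_function (Gamma0 31) (fun tau : Cplx R => Phi tau ^+ 3),
      normalized_hauptmodul (Gamma0plus 31)
        (fun tau : Cplx R => Phi tau ^+ 3) &
      q_expansion (fun tau : Cplx R => Phi tau ^+ 3)
        (fun q => q^-1 + 3%:R * q + 3%:R * q ^+ 2 + 6%:R * q ^+ 3
                  + 9%:R * q ^+ 4 + 13%:R * q ^+ 5) 6].
Proof.
have mer := @Phi3_meromorphic R; have cusps := @Phi3_meromorphic_at_cusps R.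
split.
- by move=> t ht; rewrite mulN1r Phi_fricke.
- split; [exact: mer|exact: Phi3_Gamma0|exact: cusps].
- split.
  + split; [exact: mer|exact: Phi3_Gamma0plus|exact: cusps].
  + exact: Phi3_generates.
  + move=> z hz; apply/holomorphic_atP; exists (complex.Im z) => // w /upper_disc; exact: Phi3_hol.
  + exact: Phi3_q_expansion1.
- exact: Phi3_q_expansion.
Qed.
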